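(* Let $(\mathcal T_{h_k})_{k\in\mathbb N_0}\subset\mathbb T$ be a sequence of meshes starting with the initial mesh $\mathcal T_{h_0}$ in which each $\mathcal T_{h_{k+1}}$ is a refinement of $\mathcal T_{h_k}$, and let $(y,p)$ be the optimal state and adjoint state. Provided the initial mesh size $h_0$ is sufficiently small, there exist a constant $C>0$ independent of the meshes and a constant $C_{orth}>0$ depending on $\Omega$, $d$, $\alpha$ and the shape regularity of the initial mesh $\mathcal T_{h_0}$ such that for all $l,N\in\mathbb N_0$, $$\sum_{k=l}^{N}\Big\{\|r_k\|_\Omega^2-2C\,\Theta^2(h_0)\Big(\|y-y_{\mathcal T_{h_k}}\|^2_{\widetilde H^{\frac\alpha2}(\Omega)}+\|p-p_{\mathcal T_{h_k}}\|^2_{\widetilde H^{\frac\alpha2}(\Omega)}\Big)\Big\}\le C_{orth}\,\mathcal E_{ocp}^2(y_{\mathcal T_{h_l}},p_{\mathcal T_{h_l}},\mathcal T_{h_l}),$$ where $$\|r_k\|_\Omega^2=\|y_{\mathcal T_{h_k}}-y_{\mathcal T_{h_{k+1}}}\|^2_{\widetilde H^{\frac\alpha2}(\Omega)}+\|p_{\mathcal T_{h_k}}-p_{\mathcal T_{h_{k+1}}}\|^2_{\widetilde H^{\frac\alpha2}(\Omega)}.$$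
   Context: $\Omega\subset\mathbb R^d$ is a bounded Lipschitz domain, $\Omega^c=\mathbb R^d\setminus\overline\Omega$, $0<\alpha<2$, $\gamma>0$, $\beta>0$, $a,b\in\mathbb R$ with $a<0<b$, and $f,y_d\in L^2(\Omega)$ (all fixed). $(\cdot,\cdot)$ and $\|\cdot\|$ denote the inner product and norm of $L^2(\Omega)$. $\widetilde H^{\frac{\alpha}{2}}(\Omega)=\{v\in H^{\frac{\alpha}{2}}(\mathbb R^d): v=0 \text{ in }\Omega^c\}$, with bilinear form $$a(y,v)=\frac{C(d,\alpha)}{2}\iint_{\mathbb R^d\times\mathbb R^d}\frac{(y(x)-y(w))(v(x)-v(w))}{|x-w|^{d+\alpha}}\,dx\,dw,\qquad C(d,\alpha)=\frac{2^\alpha\Gamma(\frac{\alpha}{2}+\frac d2)}{\pi^{d/2}|\Gamma(-\frac\alpha2)|},$$ and norm $\|y\|_{\widetilde H^{\frac{\alpha}{2}}(\Omega)}=a(y,y)^{1/2}$. $(-\Delta)^{\frac\alpha2}y(x)=C(d,\alpha)\,\mathrm{p.v.}\int_{\mathbb R^d}\frac{y(x)-y(w)}{|x-w|^{d+\alpha}}dw$. $\mathcal S:L^2(\Omega)\to\widetilde H^{\frac\alpha2}(\Omega)$ is given by $a(\mathcal S g,v)=(g,v)$ for all $v\in\widetilde H^{\frac\alpha2}(\Omega)$. $U_{ad}=\{v\in L^2(\Omega): a\le v\le b\text{ a.e.}\}$; $j_2(u)=\|u\|_{L^1(\Omega)}$; $\partial j_2(u)=\{\lambda\in L^2(\Omega):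 j_2(w)-j_2(u)\ge(\lambda,w-u)\ \forall w\in L^2(\Omega)\}$. Continuous optimality system: $y,p\in\widetilde H^{\frac{\alpha}{2}}(\Omega)$, $u\in U_{ad}$, $\lambda\in\partial j_2(u)$ with $a(y,v)=(f+u,v)$ and $a(w,p)=(y-y_d,w)$ for all $v,w\in\widetilde H^{\frac{\alpha}{2}}(\Omega)$, and $(p+\gamma u+\beta\lambda,v-u)\ge0$ for all $v\in U_{ad}$. $\mathbb T$ is the collection of conforming, uniformly shape-regular simplicial meshes of $\Omega$ that are refinements (by newest-vertex bisection) of an initial mesh $\mathcal T_{h_0}$ with mesh size $h_0=\max_{K\in\mathcal T_{h_0}}h_K$, $h_K=|K|^{1/d}$. For $\mathcal T\in\mathbb T$: $\mathbb V_{\mathcal T}=\{v\in C(\overline\Omega)\cap H^1_0(\Omega): v|_K\in\mathbb P_1(K)\ \forall K\in\mathcal T\}$ (extended by zero), and $(y_{\mathcal T},p_{\mathcal T},u_{\mathcal T},\lambda_{\mathcal T})$ is the solution of the discrete optimality system on $\mathcal T$: $y_{\mathcal T},p_{\mathcal T}\in\mathbb V_{\mathcal T}$, $u_{\mathcal T}\in U_{ad}$, $\lambda_{\mathcal T}\in\partial j_2(u_{\mathcal T})$ with $a(y_{\mathcal T},v)=(f+u_{\mathcal T},v)$ and $a(w,p_{\mathcal T})=(y_{\mathcal T}-y_d,w)$ for all $v,w\in\mathbb V_{\mathcal T}$, and $(p_{\mathcal T}+\gamma u_{\mathcal T}+\beta\lambda_{\mathcal T},v-u_{\mathcal T})\ge0$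 for all $v\in U_{ad}$. $\Theta(h_0)=\sup_{g\in L^2(\Omega),\|g\|=1}\inf_{\chi\in\mathbb V_{\mathcal T_{h_0}}}\|\mathcal S g-\chi\|_{\widetilde H^{\frac\alpha2}(\Omega)}$. Estimator: with $\omega_{\mathcal T}(x)=\inf_{K\in\mathcal T}\inf_{z\in\partial K}|x-z|$ and, on $K$, $\widetilde h_K^{\frac\alpha2}=h_K^{\frac\alpha2}$ if $\alpha\in(0,1]$, $\widetilde h_K^{\frac\alpha2}=h_K^{\frac\alpha2-\sigma}\omega_{\mathcal T}^\sigma$ with $\sigma=\frac\alpha2-\frac12$ if $\alpha\in(1,2)$, set for $K\in\mathcal T$ $$E_y^2(y_{\mathcal T},K)=\|\widetilde h_K^{\frac\alpha2}(f+u_{\mathcal T}-(-\Delta)^{\frac\alpha2}y_{\mathcal T})\|^2_{L^2(K)},\qquad E_p^2(p_{\mathcal T},K)=\|\widetilde h_K^{\frac\alpha2}(y_{\mathcal T}-y_d-(-\Delta)^{\frac\alpha2}p_{\mathcal T})\|^2_{L^2(K)},$$ and $\mathcal E_{ocp}^2(y_{\mathcal T},p_{\mathcal T},\mathcal T)=\sum_{K\in\mathcal T}(C_{st}E_y^2(y_{\mathcal T},K)+C_{ad}E_p^2(p_{\mathcal T},K))$ with fixed mesh-independent constants $C_{st},C_{ad}>0$. *)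

(* Defs.v *)
From HB Require Import structures.
From mathcomp Require Import all_boot all_order all_algebra.
From mathcomp Require Import all_classical all_reals all_analysis.

Set Implicit Arguments.
Unset Strict Implicit.
Unset Printing Implicit Defensive.

Import Order.TTheory GRing.Theory Num.Theory.
Import numFieldNormedType.Exports.

Local Open Scope classical_set_scope.
Local Open Scope ring_scope.

(** The points of R^n are row vectors.  Their sigma-algebra is the product
    sigma-algebra, generated by the coordinates (as for [n.-tuple]); it is the
    Borel sigma-algebra.  The Lebesgue measure is the n-fold product of the
    one-dimensional one. *)

Definition measure_rV_display : measure_display -> measure_display.
Proof. exact. Qed.

Section measurable_rV.
Context {R : realType} (n : nat).

Let coord (i : 'I_n) (x : 'rV[R]_n) : R := x 0 i.

Let rV_set0 : g_sigma_preimage coord set0.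
Proof. exact: sigma_algebra0. Qed.

Let rV_setC A : g_sigma_preimage coord A -> g_sigma_preimage coord (~` A).
Proof. exact: sigma_algebraC. Qed.

Let rV_bigcup (F : _^nat) : (forall i, g_sigma_preimage coord (F i)) ->
  g_sigma_preimage coord (\bigcup_i (F i)).
Proof. exact: sigma_algebra_bigcup. Qed.

HB.instance Definition _ :=
  @isMeasurable.Build (measure_rV_display default_measure_display)
  'rV[R]_n (g_sigma_preimage coord) rV_set0 rV_setC rV_bigcup.

Lemma measurable_coord (i : 'I_n) :
  measurable_fun [set: 'rV[R]_n] (fun x => x 0 i).
Proof.
move=> _ Y mY; rewrite setTI; apply: sub_sigma_algebra => /=.
rewrite -bigcup_seq/=; exists i => /=; first by rewrite mem_index_enum.
by exists Y => //; rewrite setTI.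
Qed.

Lemma measurable_fun_rV d (T : measurableType d) (f : T -> 'rV[R]_n) :
  (forall i, measurable_fun [set: T] (fun x => f x 0 i)) ->
  measurable_fun [set: T] f.
Proof.
move=> mf.
have sub : g_sigma_preimage (fun i => coord i \o f) `<=` measurable.
  apply: smallest_sub; first exact: sigma_algebra_measurable.
  rewrite -bigcup_seq/=; apply: bigcup_sub => i _ A [B mB <-].
  exact: mf.
move=> _ A mA; apply: sub.
by rewrite g_sigma_preimage_comp; exists A.
Qed.

End measurable_rV.

Section lebesgue_rV.
Context {R : realType}.

Definition rVcons n (p : R * 'rV[R]_n) : 'rV[R]_n.+1 := row_mx p.1%:M p.2.

Lemma measurable_rVcons n : measurable_fun [set: R * 'rV[R]_n] (@rVcons n).
Proof.
apply: measurable_fun_rV => i.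
have [j ->|j ->] := @split_ordP 1 n i.
- apply: (eq_measurable_fun fst) => [p _|]; last exact: measurable_fst.
  by rewrite [RHS](row_mxEl p.1%:M p.2) ord1 mxE.
- apply: (eq_measurable_fun ((fun v : 'rV[R]_n => v 0 j) \o snd)) => [p _|].
    by rewrite [RHS](row_mxEr p.1%:M p.2).
  by apply: measurableT_comp => //; exact: measurable_coord.
Qed.

Definition rVuncons n (x : 'rV[R]_n.+1) : R * 'rV[R]_n :=
  (@lsubmx R 1 1 n x 0 0, @rsubmx R 1 1 n x).

Lemma rVconsK n : cancel (@rVcons n) (@rVuncons n).
Proof.
by case=> a v; rewrite /rVuncons /rVcons row_mxKl row_mxKr mxE eqxx mulr1n.
Qed.

Lemma measurable_rVuncons n : measurable_fun [set: 'rV[R]_n.+1] (@rVuncons n).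
Proof.
apply/measurable_fun_pairP; split.
  apply: (eq_measurable_fun (fun x : 'rV[R]_n.+1 => x 0 (@lshift 1 n 0))).
    by move=> x _ /=; rewrite mxE.
  exact: measurable_coord.
apply: measurable_fun_rV => i.
apply: (eq_measurable_fun (fun x : 'rV[R]_n.+1 => x 0 (@rshift 1 n i))).
  by move=> x _ /=; rewrite mxE.
exact: measurable_coord.
Qed.

Section step.
Variables (n : nat) (mu : {sigma_finite_measure set 'rV[R]_n -> \bar R}).

Definition rVstep : set 'rV[R]_n.+1 -> \bar R :=
  pushforward (@lebesgue_measure R \x mu)%E (@rVcons n).

Let rVstep0 : rVstep set0 = 0%E.
Proof. by rewrite /rVstep /pushforward preimage_set0 measure0. Qed.

Let rVstep_ge0 A : (0 <= rVstep A)%E.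
Proof. exact: (measure_ge0 (@lebesgue_measure R \x mu)%E). Qed.

Let rVstep_sigma_additive : semi_sigma_additive rVstep.
Proof.
move=> F mF tF mUF; rewrite /rVstep /pushforward preimage_bigcup.
have mpre B : measurable B -> measurable (@rVcons n @^-1` B).
  by move=> mB; rewrite -[X in measurable X]setTI; exact: measurable_rVcons.
apply: measure_semi_sigma_additive.
- by move=> k; exact: mpre.
- apply/trivIsetP => /= i j _ _ ij; rewrite -preimage_setI.
  by move/trivIsetP : tF => /(_ _ _ _ _ ij) ->//; rewrite preimage_set0.
- by rewrite -preimage_bigcup; exact: mpre.
Qed.

HB.instance Definition _ := isMeasure.Build _ _ _ rVstep
  rVstep0 rVstep_ge0 rVstep_sigma_additive.

Let rVstep_sigma_finite : sigma_finite setT rVstep.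
Proof.
have /sigma_finiteP[F [TF ndF Foo]] := sigma_finiteT (@lebesgue_measure R).
have /sigma_finiteP[G [TG ndG Goo]] := sigma_finiteT mu.
exists (fun k => @rVuncons n @^-1` (F k `*` G k)).
  rewrite -preimage_bigcup (_ : \bigcup_i _ = setT) ?preimage_setT//.
  apply/seteqP; split=> // -[x y] _.
  have [i _ Fx] : (\bigcup_i F i) x by rewrite -TF.
  have [j _ Gy] : (\bigcup_i G i) y by rewrite -TG.
  exists (maxn i j) => //; split.
  - by move: x Fx; exact/subsetPset/ndF/leq_maxl.
  - by move: y Gy; exact/subsetPset/ndG/leq_maxr.
move=> k; have [mF Fk] := Foo k; have [mG Gk] := Goo k; split.
  by rewrite -[X in measurable X]setTI; apply: measurable_rVuncons => //;
    exact: measurableX.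
rewrite /rVstep /pushforward (_ : _ @^-1` _ = F k `*` G k).
  by rewrite product_measure1E// lte_mul_pinfty// ge0_fin_numE.
by apply/funext => z; rewrite /preimage /mkset rVconsK.
Qed.

HB.instance Definition _ := Measure_isSigmaFinite.Build _ _ _ rVstep
  rVstep_sigma_finite.

End step.

Fixpoint lebesgue_rV n : {sigma_finite_measure set 'rV[R]_n -> \bar R} :=
  match n with
  | 0 => \d_(0 : 'rV[R]_0)
  | m.+1 => @rVstep m (lebesgue_rV m)
  end.

End lebesgue_rV.

Section euclid.
Context {R : realType} {d : nat}.
Implicit Types (x z : 'rV[R]_d) (Omega : set 'rV[R]_d).

Definition dotp x z : R := \sum_(i < d) x 0 i * z 0 i.

(* The norm [`|x|] of the library is the sup norm. *)
Definition enorm x : R := Num.sqrt (dotp x x).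

Definition boundary (A : set 'rV[R]_d) : set 'rV[R]_d := closure A `\` A°.

(* Near a boundary point, Omega is the part above the graph of a Lipschitz
   function in a rotated frame whose last axis is the unit vector e.  A
   function of the d-1 other coordinates is a function on R^d that is invariant
   under translations along e. *)
Definition lipschitz_boundary Omega :=
  forall x, boundary Omega x ->
  exists (r : R) (e : 'rV[R]_d) (phi : 'rV[R]_d -> R) (L : R),
  [/\ 0 < r, enorm e = 1,
      forall z t, phi (z + t *: e) = phi z,
      forall z w, `|phi z - phi w| <= L * enorm (z - w) &
      forall z, enorm (z - x) < r -> (Omega z <-> phi z < dotp z e)].

Definition bounded_lipschitz_domain Omega :=
  [/\ Omega !=set0, open Omega, connected Omega, bounded_set Omega &
      lipschitz_boundary Omega].

End euclid.

(** Elements of function spaces are represented by everywhere defined Borel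
    functions on R^d; for an element of L^2(Omega), the values outside Omega are
    irrelevant. *)

Section spaces.
Context {R : realType} {d : nat}.
Variable Omega : set 'rV[R]_d.
Implicit Types f g u v y : 'rV[R]_d -> R.

Local Notation mu := (@lebesgue_rV R d).

Definition L2 : set ('rV[R]_d -> R) := [set f : 'rV[R]_d -> R |
  measurable_fun Omega f /\ (\int[mu]_(x in Omega) ((f x) ^+ 2)%:E < +oo)%E].

Definition inner f g : R := \int[mu]_(x in Omega) (f x * g x).

Definition normL2 f : R := Num.sqrt (inner f f).

Definition j2 u : R := \int[mu]_(x in Omega) `|u x|.

Definition subdiff_j2 u : set ('rV[R]_d -> R) := [set lambda : 'rV[R]_d -> R |
  L2 lambda /\
  forall w, L2 w -> inner lambda (w \- u) <= j2 w - j2 u].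

Definition Uad (ua ub : R) : set ('rV[R]_d -> R) := [set v : 'rV[R]_d -> R |
  L2 v /\
  {ae mu, forall x, Omega x -> ua <= v x <= ub}].

(* 'e_i is the i-th vector of the canonical basis. *)
Definition partial (i : 'I_d) f : 'rV[R]_d -> R := fun x => 'D_'e_i f x.

Definition smooth f :=
  forall (s : seq 'I_d) (x : 'rV[R]_d), differentiable (foldr partial f s) x.

Definition test_function f := smooth f /\
  exists K, [/\ compact K, K `<=` Omega & forall x, ~ K x -> f x = 0].

(* H^1_0(Omega) is the closure of the test functions for the H^1 norm: the
   limits g i are then the weak partial derivatives of v. *)
Definition H10 : set ('rV[R]_d -> R) := [set v : 'rV[R]_d -> R |
  L2 v /\
  exists (g : 'I_d -> 'rV[R]_d -> R) (phi : nat -> 'rV[R]_d -> R),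
  [/\ forall i, L2 (g i), forall n, test_function (phi n),
      (fun n => normL2 (phi n \- v)) @ \oo --> (0 : R) &
      forall i,
        (fun n => normL2 (partial i (phi n) \- g i)) @ \oo --> (0 : R)]].

End spaces.

Section Gamma_function.
Context {R : realType}.

Definition Gamma_pos (s : R) : R :=
  \int[lebesgue_measure]_(t in `]0, +oo[) (t `^ (s - 1) * expR (- t)).

(* For s < 0 not an integer, Gamma s is given by the functional equation
   Gamma (s + n) = s (s + 1) ... (s + n - 1) Gamma s, with s + n > 0. *)
Definition Gamma (s : R) : R :=
  let n := if 0 < s then 0%N else `|Num.floor s|%N in
  Gamma_pos (s + n%:R) / \prod_(i < n) (s + i%:R).

End Gamma_function.

Section fractional.
Context {R : realType} {d : nat}.
Variable alpha : R.
Implicit Types (y v p g : 'rV[R]_d -> R) (Omega : set 'rV[R]_d).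

Local Notation mu := (@lebesgue_rV R d).

Definition Cda : R :=
  2 `^ alpha * Gamma (alpha / 2 + d%:R / 2)
  / (pi `^ (d%:R / 2) * `|Gamma (- (alpha / 2))|).

Definition frac_kernel (x w : 'rV[R]_d) : R := enorm (x - w) `^ (d%:R + alpha).

Definition aform y v : R :=
  Cda / 2 * \int[(mu \x mu)%E]_z
    ((y z.1 - y z.2) * (v z.1 - v z.2) / frac_kernel z.1 z.2).

Definition Hnorm y : R := Num.sqrt (aform y y).

Definition Hspace : set ('rV[R]_d -> R) := [set v : 'rV[R]_d -> R |
  L2 setT v /\
  (\int[(mu \x mu)%E]_z ((v z.1 - v z.2) ^+ 2 / frac_kernel z.1 z.2)%:E < +oo)%E].

Definition Htilde Omega : set ('rV[R]_d -> R) := [set v : 'rV[R]_d -> R |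
  Hspace v /\
  {ae mu, forall x, ~ closure Omega x -> v x = 0}].

(* The principal value is the limit, as eps tends to 0 from above, of the
   integrals over the complements of the balls of radius eps around x. *)
Definition fraclap y (x : 'rV[R]_d) : R :=
  Cda * lim ((fun eps : R => \int[mu]_(w in [set w | eps < enorm (x - w)])
                ((y x - y w) / frac_kernel x w)) @ 0^'+).

(* Every g in L^2(Omega) has an image, which is unique as an element of
   [Htilde Omega], that is, up to a null set. *)
Definition Sop Omega g : 'rV[R]_d -> R := xget (fun=> 0)
  [set s : 'rV[R]_d -> R | Htilde Omega s /\
           forall v, Htilde Omega v -> aform s v = inner Omega g v].

(* The optimality systems: [V] is [Htilde Omega] for the continuous one, and
   the finite element space for the discrete one. *)
Definition optimality_system Omega (gamma beta ua ub : R) f yd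
    (V : set ('rV[R]_d -> R)) y p u lambda :=
  [/\ V y /\ V p,
      Uad Omega ua ub u /\ subdiff_j2 Omega u lambda,
      forall v, V v -> aform y v = inner Omega (f \+ u) v,
      forall w, V w -> aform w p = inner Omega (y \- yd) w &
      forall v, Uad Omega ua ub v ->
        0 <= inner Omega (fun x => p x + gamma * u x + beta * lambda x)
                         (v \- u)].

End fractional.

Section meshes.
Context {R : realType} {d : nat}.
Implicit Types (Omega : set 'rV[R]_d).

(* A tagged simplex (z_0, ..., z_d)_g of Maubach, Traxler and Stevenson: the
   rows of the matrix are the vertices z_i; the order of the vertices and the
   tag g in {0, ..., d-1} determine how it is bisected. *)
Definition tsimplex : Type := ('M[R]_(d.+1, d) * nat)%type.
Definition mesh : Type := seq tsimplex.
Implicit Types (K : tsimplex) (T : mesh).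

Definition vert K (i : nat) : 'rV[R]_d := row (inord i) K.1.

Definition face K (I : {set 'I_d.+1}) : set 'rV[R]_d := [set x |
  exists t : 'I_d.+1 -> R,
  [/\ forall i, 0 <= t i, forall i, i \notin I -> t i = 0, \sum_i t i = 1 &
      x = \sum_i t i *: row i K.1]].

Definition simplex K : set 'rV[R]_d := face K [set: 'I_d.+1]%SET.

Definition nondegenerate_simplex K : Prop :=
  (\matrix_(i < d) (vert K i.+1 - vert K 0)) \in unitmx.

Definition hK K : R := fine (lebesgue_rV d (simplex K)) `^ (d%:R^-1).

Definition meshsize T : R := \big[Num.max/0]_(K <- T) hK K.

Definition conforming_mesh Omega T :=
  [/\ uniq T,
      forall K, K \in T -> nondegenerate_simplex K /\ (K.2 < d)%N,
      closure Omega = [set x | exists2 K, K \in T & simplex K x],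
      forall K K', K \in T -> K' \in T -> K != K' ->
        (simplex K)° `&` (simplex K')° = set0 &
      forall K K', K \in T -> K' \in T -> K != K' ->
        simplex K `&` simplex K' =
        face K [set i | [exists j, row i K.1 == row j K'.1]]%SET].

(* The edge z_0 z_d is bisected at its midpoint m; the children of
   (z_0, ..., z_d)_g are, with tag g + 1 mod d,
   (z_0, m, z_1, ..., z_(d-1)) and
   (z_d, m, z_1, ..., z_g, z_(d-1), ..., z_(g+1)). *)
Definition midpt K : 'rV[R]_d := 2^-1 *: (vert K 0 + vert K d).

Definition child1 K : tsimplex :=
  (\matrix_(i < d.+1)
     (if i == 0%N :> nat then vert K 0
      else if i == 1%N :> nat then midpt K
      else vert K i.-1),
   (K.2.+1 %% d)%N).

Definition child2 K : tsimplex :=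
  (\matrix_(i < d.+1)
     (if i == 0%N :> nat then vert K d
      else if i == 1%N :> nat then midpt K
      else if (i.-1 <= K.2)%N then vert K i.-1
      else vert K (d + K.2 - i.-1)),
   (K.2.+1 %% d)%N).

Inductive refinement T : mesh -> Prop :=
| refinement_refl : refinement T T
| refinement_step T1 K T2 :
    refinement T (T1 ++ K :: T2) ->
    refinement T (T1 ++ child1 K :: child2 K :: T2).

Definition shape_regular (kappa : R) T :=
  forall K, K \in T -> forall x z, simplex K x -> simplex K z ->
  enorm (x - z) <= kappa * hK K.

Definition locally_quasi_uniform (kappa : R) T :=
  forall K K', K \in T -> K' \in T -> simplex K `&` simplex K' !=set0 ->
  hK K <= kappa * hK K'.

(* The class of meshes generated from an initial mesh T0 with shape-regularity
   constant kappa.  If d >= 2, the simplices generated from a given one by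
   bisection fall into finitely many similarity classes, so that all these
   meshes are uniformly shape-regular, with a constant depending only on kappa
   and d, and conformity implies that neighbouring simplices have comparable
   sizes.  If d = 1 conformity and [shape_regular] are void, and uniform shape
   regularity means, as usual, that the ratio of the lengths of neighbouring
   intervals is uniformly bounded. *)
Definition mesh_class Omega (kappa : R) (T0 : mesh) : set mesh := [set T |
  [/\ conforming_mesh Omega T, shape_regular kappa T0, refinement T0 T &
      d = 1%N -> locally_quasi_uniform kappa T]].

Definition P1_on (A : set 'rV[R]_d) (v : 'rV[R]_d -> R) :=
  exists (c : R) (g : 'rV[R]_d), forall x, A x -> v x = c + dotp g x.

Definition VT Omega T : set ('rV[R]_d -> R) := [set v : 'rV[R]_d -> R |
  [/\ {within closure Omega, continuous v}, H10 Omega v,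
      forall K, K \in T -> P1_on (simplex K) v &
      forall x, ~ closure Omega x -> v x = 0]].

End meshes.

Arguments tsimplex : clear implicits.
Arguments mesh : clear implicits.

Section estimator.
Context {R : realType} {d : nat}.
Variables (alpha : R) (Omega : set 'rV[R]_d).
Implicit Types (K : tsimplex R d) (T : mesh R d).

Local Notation mu := (@lebesgue_rV R d).

Definition Theta T : R := sup [set r | exists g : 'rV[R]_d -> R,
  [/\ L2 Omega g, normL2 Omega g = 1 &
      r = inf [set Hnorm alpha (Sop alpha Omega g \- chi)
              | chi in VT Omega T]]].

Definition omegaT T (x : 'rV[R]_d) : R :=
  inf [set inf [set enorm (x - z) | z in boundary (simplex K)]
      | K in [set K | K \in T]].

(* This is the weight written h~_K^(alpha/2), exponent included. *)
Definition htilde T K (x : 'rV[R]_d) : R :=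
  if alpha <= 1 then hK K `^ (alpha / 2)
  else let sigma := alpha / 2 - 2^-1 in
       hK K `^ (alpha / 2 - sigma) * omegaT T x `^ sigma.

(* The boundary of K is a null set; the residual involves [fraclap] of a
   function that is affine near the interior points of K only. *)
Definition weighted_residual T K (r : 'rV[R]_d -> R) : \bar R :=
  \int[mu]_(x in (simplex K)°) ((htilde T K x * r x) ^+ 2)%:E.

Definition estimator_sq (Cst Cad : R) (f yd u y p : 'rV[R]_d -> R) T
    : \bar R :=
  (\sum_(K <- T)
     (Cst%:E * weighted_residual T K
                 (fun x => f x + u x - fraclap alpha y x)%R +
      Cad%:E * weighted_residual T K
                 (fun x => y x - yd x - fraclap alpha p x)%R))%E.

End estimator.

(* Main.v *)
(** Let [e_k] be the squared energy error of state and adjoint on the mesh [T k]. The differences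
    [y - y_k - S (u - u_k)] and [p - p_k - S (y - y_k)] are Galerkin orthogonal to the initial space,
    so by duality their L^2 norms are at most [Theta] times their energy norms. Testing the continuous
    and the discrete variational inequality against each other (the subgradients are monotone) then
    gives [|u - u_k|^2 + |y - y_k|^2 <= c Theta^2 e_k]. Hence the Pythagoras identity between nested
    spaces survives up to a small term, [|r_k|^2 <= 2 (e_k - e_(k+1)) + 2 A Theta^2 e_(k+1)].
    If [2 A Theta^2 <= 1] the sum telescopes to at most [2 e_l], and [e_l] is bounded by the estimator.
    If [2 A Theta^2 > 1], quasi-optimality [e_(k+1) <= Q e_k] makes every summand nonpositive for
    [C = A (2 + 2 Q)]; so any bound on the initial mesh size will do.

    Reliability: the residual of a discrete [v] is tested with [w - chi], where the quasi-interpolant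
    [chi] has vertex averages of [w] as nodal values, and 0 at the vertices whose star leaves [Omega].
    The energy norm controls [w - chi] on [K] by a Poincare inequality on the star, whose simplices are
    of comparable size, and near the faces of [K] by a Hardy inequality; the latter makes [w - chi]
    integrable against [fraclap alpha v], which is only bounded by a power of the distance to the
    element boundaries, and this legitimates Green's formula. Newest-vertex bisection keeps the meshes
    uniformly shape regular because a simplex stays spanned by a chain of [d] steps of comparable
    length, of which each bisection halves one more, while its volume is halved. *)
From HB Require Import structures.
Require Import Defs.
From mathcomp Require Import all_boot all_order all_algebra.
From mathcomp Require Import all_classical all_reals all_analysis.
From mathcomp Require Import measurable_realfun real_interval ring lra zify.

Set Implicit Arguments.
Unset Strict Implicit.
Unset Printing Implicit Defensive.

Import Order.TTheory GRing.Theory Num.Theory.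
Import numFieldNormedType.Exports.

Local Open Scope classical_set_scope.
Local Open Scope ring_scope.

(** [Corth] is fixed before [gamma], [beta] and the data, so it may see the initial shape regularity
    only. Every constant depending on [gamma], whether from duality or from quasi-optimality, must
    therefore enter [C], in front of [Theta]. This is why reliability is invoked only for
    [2 * A * Theta ^ 2 <= 1]: there the L^2 coupling terms are absorbed into half of the error, and
    a purely geometric constant remains.

    Membership in H^1_0 means being a limit of test functions, and two facts are derived from it:
    continuous H^1_0 functions vanish on the boundary, which gives global Lipschitz bounds for
    discrete functions; and piecewise affine functions vanishing outside the domain are such limits,
    which puts the quasi-interpolant into the discrete space.

    Comparable sizes in a vertex star are a topological matter when [d >= 2]. Simplices sharing an
    edge are comparable; and as a Lipschitz domain is not pinched at a point, the star cannot split
    into small and large simplices meeting only at the vertex. *)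

Lemma eq_lew (disp : Order.disp_t) (T : porderType disp) (x y : T) : x = y -> (x <= y)%O.
Proof. by move->. Qed.

(** The integral of a nonnegative function is the supremum of the integrals of the simple functions
    below it, hence monotone for arbitrary functions. *)
Lemma nonneg_le_integral (dd : measure_display) (X : measurableType dd) (R : realType) (m : {measure set X -> \bar R})
  (D : set X) (f g : X -> \bar R) : (forall x, D x -> 0 <= f x)%E -> (forall x, D x -> f x <= g x)%E ->
  (\int[m]_(x in D) f x <= \int[m]_(x in D) g x)%E.
Proof.
move=> f0 fg; have g0 x : D x -> (0 <= g x)%E by move=> Dx; exact: le_trans (f0 x Dx) (fg x Dx).
rewrite !ge0_integralE//; apply: ereal_sup_le => _ [h hf <-]; exists h => //= x.
apply: (le_trans (hf x)); rewrite !patchE; case: ifPn => // Dx; apply: fg; by rewrite inE in Dx.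
Qed.

(** * Borel sets and Lebesgue measure on row vectors *)

Section rV_topology_measure.
Context {R : realType}.

Lemma rV_ballE n (x y : 'rV[R]_n) e : 0 < e ->
  ball x e y <-> forall i, `|x 0 i - y 0 i| < e.
Proof.
move=> e0; split=> [[_ H] i|H]; first exact: H.
by split=> // i j; rewrite ord1; exact: H.
Qed.

Lemma measurable_rV_ball n (x : 'rV[R]_n) e : 0 < e -> measurable (ball x e).
Proof.
move=> e0.
have -> : ball x e = \bigcap_(i in [set: 'I_n]) [set y : 'rV[R]_n | `|x 0 i - y 0 i| < e].
  by apply/seteqP; split=> y /=; [move/rV_ballE => H i _; exact: H|
    move=> H; apply/rV_ballE => // i; exact: H].
apply: fin_bigcap_measurable => // i _; rewrite -[X in measurable X]setTI.
have -> : [set y : 'rV[R]_n | `|x 0 i - y 0 i| < e] =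
    (fun y : 'rV[R]_n => `|x 0 i - y 0 i|) @^-1` `]-oo, e[%classic.
  by apply/seteqP; split=> y; rewrite /= in_itv.
suff : measurable_fun setT (fun y : 'rV[R]_n => `|x 0 i - y 0 i|) by apply.
apply: measurableT_comp => //; apply: measurable_funB => //.
exact: measurable_coord.
Qed.

(** Balls are sup-norm balls, that is, boxes, hence measurable for the product sigma-algebra; an
    open set is the countable union of the balls with rational centre and radius that it
    contains. *)
Lemma open_measurable_rV n (A : set 'rV[R]_n) : open A -> measurable A.
Proof.
move=> oA.
pose qv (q : 'rV[rat]_n) : 'rV[R]_n := map_mx ratr q.
pose F (q : 'rV[rat]_n * rat) : set 'rV[R]_n :=
  if (0 < q.2) && `[< ball (qv q.1) (ratr q.2) `<=` A >]
  then ball (qv q.1) (ratr q.2) else set0.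
have -> : A = \bigcup_q F q.
  apply/seteqP; split=> [x Ax|x [q _]]; last first.
    by rewrite /F; case: ifPn => // /andP[_ /asboolP H]; exact: H.
  have /nbhs_ballP[e /= e0 He] := open_nbhs_nbhs (conj oA Ax).
  have [r] := @rat_in_itvoo R 0 (e / 2) (divr_gt0 e0 (ltr0Sn _ 1)).
  rewrite in_itv/= => /andP[r0 re].
  have r0' : (0 < r)%R by move: r0; rewrite ltr0q.
  have Hq i : exists q : rat, `|ratr q - x 0 i| < ratr r.
    have : x 0 i - ratr r < x 0 i + ratr r by lra.
    move=> /rat_in_itvoo[q]; rewrite in_itv/= => /andP[q1 q2]; exists q.
    by rewrite ltr_norml; apply/andP; split; lra.
  have [q Hq'] := choice Hq.
  exists (\row_i q i, r) => //.
  rewrite /F/= r0'/=.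
  have xb : ball (qv (\row_i q i)) (ratr r) x.
    by apply/rV_ballE => // i; rewrite !mxE; exact: Hq'.
  case: asboolP => // -[] y yb; apply: He.
  apply: (@le_ball _ _ x (ratr r + ratr r)); first lra.
  by apply: ball_triangle yb; exact/ball_sym.
apply: countable_bigcupT_measurable; first exact: countableP.
move=> q; rewrite /F; case: ifPn => // /andP[q0 _].
by apply: measurable_rV_ball; rewrite ltr0q.
Qed.

Lemma closed_measurable_rV n (A : set 'rV[R]_n) : closed A -> measurable A.
Proof. by move/closed_openC/open_measurable_rV/measurableC; rewrite setCK. Qed.

Lemma within_continuous_measurable_rV n (D : set 'rV[R]_n) (f : 'rV[R]_n -> R) :
  measurable D -> {within D, continuous f} -> measurable_fun D f.
Proof.
move=> mD /continuousP cf; apply: (measurability _ (RGenOpens.measurableE R)).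
move=> _ [_ [a [b ->] <-]].
have /open_subspaceP [V oV VD] := cf _ (@interval_open _ (BRight a) (BLeft b) isT isT).
by rewrite setIC -VD; apply: measurableI => //; exact: open_measurable_rV.
Qed.

Lemma continuous_measurable_rV n (f : 'rV[R]_n -> R) :
  continuous f -> measurable_fun setT f.
Proof.
move=> cf; apply: within_continuous_measurable_rV => //.
exact: continuous_subspaceT.
Qed.

Lemma measurable_mulmx n m (M : 'M[R]_(n, m)) :
  measurable_fun setT (fun x : 'rV[R]_n => x *m M).
Proof.
apply: measurable_fun_rV => i.
under eq_fun do rewrite mxE.
apply: measurable_sum => j; apply: measurable_funM => //.
exact: measurable_coord.
Qed.

Lemma measurable_addrV d (T : measurableType d) n (f g : T -> 'rV[R]_n) :
  measurable_fun setT f -> measurable_fun setT g ->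
  measurable_fun setT (fun x => f x + g x).
Proof.
move=> mf mg; apply: measurable_fun_rV => i.
under eq_fun do rewrite mxE.
apply: measurable_funD.
  by apply: (measurableT_comp (measurable_coord i)).
by apply: (measurableT_comp (measurable_coord i)).
Qed.

Lemma measurable_scalerV d (T : measurableType d) n (a : R) (f : T -> 'rV[R]_n) :
  measurable_fun setT f -> measurable_fun setT (fun x => a *: f x).
Proof.
move=> mf; apply: measurable_fun_rV => i.
under eq_fun do rewrite mxE.
apply: measurable_funM => //.
by apply: (measurableT_comp (measurable_coord i)).
Qed.

Lemma measurable_opprV d (T : measurableType d) n (f : T -> 'rV[R]_n) :
  measurable_fun setT f -> measurable_fun setT (fun x => - f x).
Proof.
move=> mf; under eq_fun do rewrite -scaleN1r.
exact: measurable_scalerV.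
Qed.

Lemma measurable_subrV d (T : measurableType d) n (f g : T -> 'rV[R]_n) :
  measurable_fun setT f -> measurable_fun setT g ->
  measurable_fun setT (fun x => f x - g x).
Proof.
by move=> mf mg; apply: measurable_addrV => //; exact: measurable_opprV.
Qed.

Lemma measurable_preimageT d1 d2 (T1 : measurableType d1) (T2 : measurableType d2)
   (f : T1 -> T2) A :
  measurable_fun setT f -> measurable A -> measurable (f @^-1` A).
Proof. by move=> mf mA; rewrite -[X in measurable X]setTI; exact: mf. Qed.

Lemma lebesgue_shift (a : R) (A : set R) : measurable A ->
  lebesgue_measure ((fun x => x + a) @^-1` A) = lebesgue_measure A.
Proof.
move=> mA.
have mf : measurable_fun (setT : set (measurableTypeR R))
   ((fun x => x + a) : measurableTypeR R -> measurableTypeR R).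
  exact: measurable_funD.
apply/esym.
pose nu : {measure set (measurableTypeR R) -> \bar R} :=
  measure_function_pushforward__canonical__measure_function_Measure lebesgue_measure mf.
apply: (@lebesgue_measure_unique R nu) => // X /ocitvP[->|[[x y]/= xy ->]].
  by rewrite !measure0.
rewrite /nu/= /pushforward.
have -> : (fun x => x + a) @^-1` `]x, y]%classic = `](x - a), (y - a)]%classic.
  by apply/seteqP; split => z; rewrite /= !in_itv/= => /andP[h1 h2]; apply/andP; split; lra.
rewrite !lebesgue_measure_itv/= !lte_fin ltrD2r xy -!EFinB; congr (_%:E); lra.
Qed.

Local Notation mu := (@lebesgue_rV R _).

Lemma rVunconsK n : cancel (@rVuncons R n) (@rVcons R n).
Proof. by move=> x; rewrite /rVcons /rVuncons/= -mx11_scalar hsubmxK. Qed.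

Lemma rVconsD n (p q : R * 'rV[R]_n) :
  rVcons p + rVcons q = rVcons (p.1 + q.1, p.2 + q.2).
Proof. by rewrite /rVcons/= raddfD/= -add_row_mx. Qed.

(** Induction on the dimension: a translation acts separately on the first coordinate and on the
    others, so the translated measure agrees with the product measure on rectangles, and uniqueness
    of product measures concludes. *)
Lemma lebesgue_rV_shift n (v : 'rV[R]_n) A : measurable A ->
  mu ((fun x => x + v) @^-1` A) = mu A.
Proof.
elim: n v A => [|n IH] v A mA.
  by congr (mu _); apply/seteqP; split=> x /=; rewrite (_ : x + v = x)//; apply/rowP => -[].
rewrite /= /rVstep /pushforward.
set B := @rVcons R n @^-1` A.
have mB : measurable B by apply: measurable_preimageT => //; exact: measurable_rVcons.
pose a := (rVuncons v).1; pose w := (rVuncons v).2.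
pose f (p : R * 'rV[R]_n) := (p.1 + a, p.2 + w).
have mf : measurable_fun setT f.
  apply/measurable_fun_pairP; split.
    by apply: measurable_funD.
  apply: measurable_addrV => //.
have -> : @rVcons R n @^-1` ((fun x => x + v) @^-1` A) = f @^-1` B.
  have E x y : rVcons (x + a, y + w) = rVcons (x, y) + v.
    by rewrite -[v in RHS]rVunconsK rVconsD.
  by apply/seteqP; split=> -[x y]; rewrite /B /f /= E.
have mf' : measurable_fun (setT : set (measurableTypeR R * 'rV[R]_n)) (f : _ -> measurableTypeR R * 'rV[R]_n).
  exact: mf.
pose nu : {measure set (measurableTypeR R * 'rV[R]_n) -> \bar R} :=
  measure_function_pushforward__canonical__measure_function_Measure (@lebesgue_measure R \x @lebesgue_rV R n)%E mf'.
rewrite -[LHS]/(nu B); apply/esym.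
have := @product_measure_unique _ _ _ _ R (@lebesgue_measure R) (@lebesgue_rV R n) nu.
apply => // C D mC mD.
rewrite /nu/= /pushforward.
have -> : f @^-1` (C `*` D) = ((fun x => x + a) @^-1` C) `*` ((fun x => x + w) @^-1` D) by [].
rewrite product_measure1E; first by rewrite [X in (X * _)%E]lebesgue_shift// IH.
by apply: measurable_preimageT => //; exact: measurable_funD.
by apply: measurable_preimageT => //; exact: measurable_addrV.
Qed.

Lemma ge0_integral_shift n (v : 'rV[R]_n) (f : 'rV[R]_n -> \bar R) :
  measurable_fun setT f -> (forall x, 0 <= f x)%E ->
  (\int[mu]_x f (x + v)%R = \int[mu]_x f x)%E.
Proof.
move=> mf f0.
have ms : measurable_fun setT (fun x : 'rV[R]_n => x + v) by exact: measurable_addrV.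
have := @ge0_integral_pushforward _ _ _ _ R _ ms mu setT f measurableT mf (fun x _ => f0 x).
rewrite preimage_setT => <-.
apply: eq_measure_integral => A mA _; exact: lebesgue_rV_shift.
Qed.

Lemma lebesgue_rV_ball n (c : 'rV[R]_n) r : 0 < r -> mu (ball c r) = ((2 * r) ^+ n)%:E.
Proof.
move=> r0; elim: n c => [|n IH] c.
  rewrite /= diracE mem_set ?expr0//.
  by apply/rV_ballE => // -[].
rewrite /= /rVstep /pushforward.
have -> : @rVcons R n @^-1` (ball c r) =
    (`](rVuncons c).1 - r, (rVuncons c).1 + r[%classic) `*` ball (rVuncons c).2 r.
  apply/seteqP; split=> [[x y]|[x y]] /=.
    move/(rV_ballE _ _ r0) => H; split => /=.
      by have := H (@lshift 1 n 0); rewrite [rVcons _ _ _](row_mxEl x%:M y) !mxE eqxx mulr1n in_itv/= ltr_norml => /andP[? ?]; apply/andP; split; lra.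
    by apply/rV_ballE => // i; have := H (@rshift 1 n i); rewrite [rVcons _ _ _](row_mxEr x%:M y) !mxE.
  rewrite in_itv/= => -[/andP[h1 h2] /(rV_ballE _ _ r0) H]; apply/rV_ballE => // i.
  have [j ->|j ->] := @split_ordP 1 n i.
    rewrite [rVcons _ _ _](row_mxEl x%:M y) ord1; move: h1 h2; rewrite !mxE eqxx mulr1n ltr_norml => ? ?; apply/andP; split; lra.
  by have := H j; rewrite [rVcons _ _ _](row_mxEr x%:M y) !mxE.
rewrite product_measure1E//; last exact: measurable_rV_ball.
rewrite IH [X in (X * _)%E](lebesgue_measure_itv `]_, _[)/= lte_fin ltrD2l gtrN// -EFinB -EFinM exprS; congr (_%:E).
by ring.
Qed.

Lemma coord_le_norm n (z : 'rV[R]_n) j : `|z 0 j| <= `|z|.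
Proof.
rewrite {2}/Num.norm /= mx_normrE.
by have := @le_bigmax_cond _ _ _ 0 (0, j) xpredT (fun i : 'I_1 * 'I_n => `|z i.1 i.2|) isT.
Qed.

Lemma norm_le_coord n (z : 'rV[R]_n) r : 0 <= r -> (forall j, `|z 0 j| <= r) -> `|z| <= r.
Proof.
move=> r0 H; rewrite {1}/Num.norm /= mx_normrE.
by apply: bigmax_le => // -[i j] _ /=; rewrite ord1.
Qed.

Lemma mulmx_norm_le n m (M : 'M[R]_(n, m)) :
  exists2 C : R, 0 < C & forall z : 'rV[R]_n, `|z *m M| <= C * `|z|.
Proof.
exists (1 + \sum_i \sum_j `|M i j|).
  by rewrite ltr_pwDl// sumr_ge0// => i _; rewrite sumr_ge0.
move=> z; apply: norm_le_coord.
  by rewrite mulr_ge0// addr_ge0// sumr_ge0// => i _; rewrite sumr_ge0.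
move=> j; rewrite mxE (le_trans (ler_norm_sum _ _ _))//.
apply: (@le_trans _ _ (\sum_i `|M i j| * `|z|)).
  by apply: ler_sum => i _; rewrite normrM mulrC ler_wpM2l// coord_le_norm.
rewrite -mulr_suml ler_wpM2r// ler_wpDl//.
apply: ler_sum => i _; rewrite (bigD1 j)//= lerDl sumr_ge0//.
Qed.

Lemma lebesgue_rV_lty n (A : set 'rV[R]_n) r : measurable A ->
  (forall x, A x -> `|x| <= r) -> (mu A < +oo)%E.
Proof.
move=> mA H; have r0 : 0 < `|r| + 1 by rewrite ltr_wpDl.
apply: (@le_lt_trans _ _ (mu (ball (0 : 'rV[R]_n) (`|r| + 1)))).
  apply: le_measure; rewrite ?inE//; first exact: measurable_rV_ball.
  move=> x /H xr; rewrite -ball_normE/= sub0r normrN (le_lt_trans xr)//.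
  by rewrite (le_lt_trans (ler_norm r))// ltrDl.
by rewrite lebesgue_rV_ball// ltry.
Qed.

Lemma ge0_fubini_indic n (h : 'rV[R]_n -> 'rV[R]_n -> R) :
  measurable_fun setT (fun p : 'rV[R]_n * 'rV[R]_n => h p.1 p.2) ->
  (forall x y, 0 <= h x y) ->
  (\int[mu]_x \int[mu]_y (h x y)%:E = \int[mu]_y \int[mu]_x (h x y)%:E)%E.
Proof.
move=> mh h0.
rewrite -[LHS](@fubini_tonelli1 _ _ _ _ R mu mu (fun p => (h p.1 p.2)%:E)).
- rewrite -[RHS](@fubini_tonelli2 _ _ _ _ R mu mu (fun p => (h p.1 p.2)%:E))//.
  + exact: measurableT_comp.
  + by move=> x; rewrite lee_fin.
- exact: measurableT_comp.
- by move=> x; rewrite lee_fin.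
Qed.

(** Uniqueness of translation-invariant measures: with [nu] the measure transported by [M],
    integrating [\1_A x * \1_Q (z *m M - x)] in both orders gives [nu Q * mu A = mu Q * nu A] for a
    cube [Q]. The constant is obtained as [nu Q / mu Q] rather than as a determinant. *)
Lemma lebesgue_rV_linear n (M : 'M[R]_n) : M \in unitmx ->
  exists2 c : R, 0 < c & forall A, measurable A ->
    mu ((fun x => x *m M) @^-1` A) = (c%:E * mu A)%E.
Proof.
move=> uM.
pose nu (A : set 'rV[R]_n) := mu ((fun x => x *m M) @^-1` A).
pose Q : set 'rV[R]_n := ball 0 1.
have mQ : measurable Q by exact: measurable_rV_ball.
have mM A : measurable A -> measurable ((fun x : 'rV[R]_n => x *m M) @^-1` A).
  by move=> mA; apply: measurable_preimageT => //; exact: measurable_mulmx.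
have intM (B : set 'rV[R]_n) v : measurable B ->
    (\int[mu]_z (\1_B (z *m M + v))%:E = nu B)%E.
  move=> mB.
  transitivity (\int[mu]_z (\1_((fun x : 'rV[R]_n => x *m M) @^-1` B) (z + v *m invmx M))%:E)%E.
    by apply: eq_integral => z _; rewrite !indicE; congr ((_%:R)%:E); congr (nat_of_bool (asbool _));
       rewrite /= mulmxDl mulmxKV.
  rewrite (ge0_integral_shift _ (f := fun z => (\1_((fun x : 'rV[R]_n => x *m M) @^-1` B) z)%:E)).
  - by rewrite integral_indic// ?setIT//; exact: mM.
  - by apply: measurableT_comp => //; apply: measurable_indic; exact: mM.
  - by move=> x; rewrite lee_fin.
have [C C0 HC] := mulmx_norm_le M.
have [C' C'0 HC'] := mulmx_norm_le (invmx M).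
have nuQfin : (nu Q < +oo)%E.
  apply: (@lebesgue_rV_lty _ _ C'); first exact: mM.
  move=> x /=; rewrite /Q -ball_normE/= sub0r normrN => h.
  rewrite -[x](mulmxK uM) (le_trans (HC' _))// ger_pMr// ltW//.
have nuQ0 : (0 < nu Q)%E.
  apply: (@lt_le_trans _ _ (mu (ball (0 : 'rV[R]_n) C^-1))).
    by rewrite lebesgue_rV_ball ?invr_gt0// lte_fin exprn_gt0// mulr_gt0// invr_gt0.
  apply: le_measure; rewrite ?inE//; [by apply: measurable_rV_ball; rewrite invr_gt0|exact: mM|].
  move=> x; rewrite /Q -!ball_normE/= !sub0r !normrN => h.
  by rewrite (le_lt_trans (HC _))// -(@ltr_pM2l _ C^-1) ?invr_gt0// mulKf ?gt_eqF// mulr1.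
have muQ : mu Q = (2 ^+ n)%:E by rewrite lebesgue_rV_ball// mulr1.
have key A : measurable A -> (nu Q * mu A = mu Q * nu A)%E.
  move=> mA.
  have mf2 : measurable_fun setT (fun p : 'rV[R]_n * 'rV[R]_n => p.2 *m M).
    by apply: (measurableT_comp (measurable_mulmx M)).
  transitivity (\int[mu]_x \int[mu]_z (\1_A x * \1_Q (z *m M + - x))%:E)%E.
    transitivity (\int[mu]_x ((\1_A x)%:E * nu Q))%E.
      rewrite ge0_integralZr//; last exact: measurableT_comp.
      by rewrite integral_indic// setIT muleC.
    apply: eq_integral => x _.
    rewrite -(intM Q (- x) mQ) -ge0_integralZl ?lee_fin//.
    - apply: measurableT_comp => //; apply: measurableT_comp => //.
      by apply: measurable_addrV => //; exact: measurable_mulmx.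
  rewrite (@ge0_fubini_indic n (fun x z => \1_A x * \1_Q (z *m M + - x))); first last.
  - by move=> x z; rewrite mulr_ge0.
  - apply: measurable_funM; first exact: measurableT_comp.
    apply: measurableT_comp => //; apply: measurable_addrV => //.
    exact: measurable_opprV.
  transitivity (\int[mu]_z \int[mu]_x (\1_A (z *m M + x) * \1_Q (- x))%:E)%E.
    apply: eq_integral => z _.
    rewrite -(ge0_integral_shift (z *m M)).
    - by apply: eq_integral => x _; rewrite opprD addrCA subrr addr0 (addrC x).
    - apply: measurableT_comp => //; apply: measurable_funM => //.
      by apply: measurableT_comp => //; apply: measurable_addrV => //; exact: measurable_opprV.
    - by move=> x; rewrite lee_fin mulr_ge0.
  rewrite -(@ge0_fubini_indic n (fun x z => \1_A (z *m M + x) * \1_Q (- x))); first last.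
  - by move=> x z; rewrite mulr_ge0.
  - apply: measurable_funM.
      by apply: measurableT_comp => //; exact: measurable_addrV.
    by apply: measurableT_comp => //; exact: measurable_opprV.
  transitivity (\int[mu]_x ((\1_Q x)%:E * nu A))%E.
    apply: eq_integral => x _.
    have -> : \1_Q (- x) = \1_Q x :> R.
      by rewrite !indicE; congr ((nat_of_bool _)%:R); apply/idP/idP; rewrite !inE /Q -!ball_normE/= !sub0r !normrN.
    rewrite -(intM A x mA).
    under eq_integral do rewrite mulrC EFinM.
    rewrite ge0_integralZl ?lee_fin//.
    - apply: measurableT_comp => //; apply: measurableT_comp => //.
      by apply: measurable_addrV => //; exact: measurable_mulmx.
  rewrite ge0_integralZr//; last exact: measurableT_comp.
  by rewrite integral_indic// setIT.
have nuf : nu Q \is a fin_num by rewrite ge0_fin_numE// ltW.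
exists (fine (nu Q) / 2 ^+ n).
  by rewrite divr_gt0// fine_gt0// nuQ0.
move=> A mA; rewrite -/(nu A) mulrC EFinM -muleA fineK// key// muQ muleA -EFinM mulVf ?mul1e//.
Qed.

(** The constant of the linear case is read off from a ball, whose volume is known. *)
Lemma lebesgue_rV_scale n (s : R) (A : set 'rV[R]_n) : s != 0 -> measurable A ->
  mu ((fun x => s *: x) @^-1` A) = ((`|s| ^- n)%:E * mu A)%E.
Proof.
move=> s0 mA.
have us : (s%:M : 'M[R]_n) \in unitmx.
  by rewrite unitmxE det_scalar unitfE expf_neq0.
have [c c0 Hc] := lebesgue_rV_linear us.
have E B : (fun x : 'rV[R]_n => s *: x) @^-1` B = (fun x => x *m s%:M) @^-1` B.
  by apply/seteqP; split=> x /=; rewrite mul_mx_scalar.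
rewrite E Hc//; congr (_%:E * _)%E.
have s1 : 0 < `|s| by rewrite normr_gt0.
have : mu (ball (0 : 'rV[R]_n) `|s|^-1) = (c%:E * mu (ball (0 : 'rV[R]_n)%R 1%R))%E.
  rewrite -Hc; last exact: measurable_rV_ball.
  rewrite -E; congr (mu _); apply/seteqP; split=> x; rewrite /= -!ball_normE/= !sub0r !normrN normrZ => h.
    by rewrite -(@ltr_pM2l _ `|s|^-1) ?invr_gt0// mulKf ?gt_eqF// mulr1.
  by rewrite -(@ltr_pM2l _ `|s|) // mulfV ?gt_eqF//.
rewrite !lebesgue_rV_ball ?invr_gt0// -EFinM mulr1 => -[].
rewrite exprMn mulrC => /mulIf <-; first by rewrite exprVn.
by rewrite expf_neq0.
Qed.

Lemma ge0_integral_scale n (s : R) (f : 'rV[R]_n -> \bar R) : s != 0 ->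
  measurable_fun setT f -> (forall x, 0 <= f x)%E ->
  (\int[mu]_x f (s *: x)%R = (`|s| ^- n)%:E * \int[mu]_x f x)%E.
Proof.
move=> s0 mf f0.
have ms : measurable_fun setT (fun x : 'rV[R]_n => s *: x) by exact: measurable_scalerV.
have := @ge0_integral_pushforward _ _ _ _ R _ ms mu setT f measurableT mf (fun x _ => f0 x).
rewrite preimage_setT => <-.
have k0 : 0 <= `|s| ^- n by rewrite invr_ge0 exprn_ge0.
rewrite -(@ge0_integral_mscale _ _ _ mu _ measurableT (NngNum k0) f)//.
by apply: eq_measure_integral => A mA _; rewrite [LHS]lebesgue_rV_scale.
Qed.

End rV_topology_measure.

(** The discriminant inequality: insert the minimiser [t = - B / C]. For [C = 0] the expression is
    affine in [t], and if [B] were not 0 the chosen [t] would give it the value -1. *)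
Lemma quad_form_CS (R : realFieldType) (A B C : R) : 0 <= C ->
  (forall t, 0 <= A + 2 * t * B + t ^+ 2 * C) -> B ^+ 2 <= A * C.
Proof.
move=> C0 H; have A0 : 0 <= A by have := H 0; rewrite mulr0 mul0r expr0n mul0r !addr0.
have [C0'|Cn0] := eqVneq C 0.
  suff -> : B = 0 by rewrite expr0n mulr_ge0.
  apply/eqP; apply: contraT => B0.
  have := H (- (A + 1) / (2 * B)); rewrite C0' mulr0 addr0.
  have -> : 2 * (- (A + 1) / (2 * B)) * B = - (A + 1) by field.
  by rewrite opprD addrA subrr add0r ler0N1.
have Cp : 0 < C by rewrite lt_def Cn0.
have := H (- B / C).
have -> : A + 2 * (- B / C) * B + (- B / C) ^+ 2 * C = (A * C - B ^+ 2) / C by field.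
by rewrite pmulr_lge0 ?invr_gt0// subr_ge0.
Qed.

(** * Euclidean norm and integrals of radial kernels *)

Section enorm_theory.
Context {R : realType} {d : nat}.
Implicit Types x y z : 'rV[R]_d.

Lemma dotpC x y : dotp x y = dotp y x.
Proof. by apply: eq_bigr => i _; rewrite mulrC. Qed.

Lemma dotpDl x y z : dotp (x + y) z = dotp x z + dotp y z.
Proof. by rewrite /dotp -big_split; apply: eq_bigr => i _; rewrite mxE mulrDl. Qed.

Lemma dotpZl a x z : dotp (a *: x) z = a * dotp x z.
Proof. by rewrite /dotp big_distrr; apply: eq_bigr => i _ /=; rewrite mxE mulrA. Qed.

Lemma dotpDr x y z : dotp z (x + y) = dotp z x + dotp z y.
Proof. by rewrite dotpC dotpDl !(dotpC z). Qed.

Lemma dotpZr a x z : dotp z (a *: x) = a * dotp z x.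
Proof. by rewrite dotpC dotpZl dotpC. Qed.

Lemma dotpNr x z : dotp z (- x) = - dotp z x.
Proof. by rewrite -scaleN1r dotpZr mulN1r. Qed.

Lemma dotpBr x y z : dotp z (x - y) = dotp z x - dotp z y.
Proof. by rewrite dotpDr dotpNr. Qed.

Lemma dotpBl x y z : dotp (x - y) z = dotp x z - dotp y z.
Proof. by rewrite dotpC dotpBr !(dotpC z). Qed.

Lemma dotp0r z : dotp z 0 = 0.
Proof. by rewrite -(scale0r 0) dotpZr mul0r. Qed.

Lemma dotp_ge0 x : 0 <= dotp x x.
Proof. by apply: sumr_ge0 => i _; rewrite -expr2 sqr_ge0. Qed.

Lemma enorm_ge0 x : 0 <= enorm x. Proof. exact: sqrtr_ge0. Qed.

Lemma enorm_sqr x : enorm x ^+ 2 = dotp x x.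
Proof. by rewrite sqr_sqrtr// dotp_ge0. Qed.

Lemma dotp_le x y : `|dotp x y| <= enorm x * enorm y.
Proof.
rewrite -(@ler_pXn2r _ 2)// ?nnegrE ?mulr_ge0 ?enorm_ge0// exprMn !enorm_sqr.
rewrite -normrX ger0_norm ?sqr_ge0//.
apply: quad_form_CS => [|t]; first exact: dotp_ge0.
have := dotp_ge0 (x + t *: y).
by rewrite !dotpDl !dotpDr !dotpZl !dotpZr (dotpC y x) => /le_trans; apply; apply: eq_lew; ring.
Qed.

Lemma enormD x y : enorm (x + y) <= enorm x + enorm y.
Proof.
rewrite -(@ler_pXn2r _ 2)// ?nnegrE ?addr_ge0 ?enorm_ge0//.
rewrite sqrrD !enorm_sqr dotpDl !dotpDr (dotpC y x).
have := le_trans (ler_norm _) (dotp_le x y); lra.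
Qed.

Lemma enormZ a x : enorm (a *: x) = `|a| * enorm x.
Proof. by rewrite /enorm dotpZl dotpZr mulrA -expr2 sqrtrM ?sqr_ge0// sqrtr_sqr. Qed.

Lemma enormN x : enorm (- x) = enorm x.
Proof. by rewrite -scaleN1r enormZ normrN1 mul1r. Qed.

Lemma enormB x y : enorm (x - y) = enorm (y - x).
Proof. by rewrite -enormN opprB. Qed.

Lemma enorm0 : enorm (0 : 'rV[R]_d) = 0.
Proof. by rewrite /enorm dotp0r sqrtr0. Qed.

Lemma norm_le_enorm x : `|x| <= enorm x.
Proof.
apply: norm_le_coord => [|j]; first exact: enorm_ge0.
rewrite -(@ler_pXn2r _ 2)// ?nnegrE ?enorm_ge0// enorm_sqr -normrX ger0_norm ?sqr_ge0//.
by rewrite /dotp (bigD1 j)//= expr2 lerDl sumr_ge0// => i _; rewrite -expr2 sqr_ge0.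
Qed.

Lemma enorm_le_norm x : enorm x <= (d%:R + 1) * `|x|.
Proof.
rewrite -(@ler_pXn2r _ 2)// ?nnegrE ?mulr_ge0 ?enorm_ge0// enorm_sqr exprMn.
apply: (@le_trans _ _ (\sum_(i < d) `|x| ^+ 2)).
  apply: ler_sum => i _; rewrite -expr2 -[leLHS]ger0_norm ?sqr_ge0// normrX.
  by rewrite ler_pXn2r// ?nnegrE// coord_le_norm.
rewrite sumr_const card_ord -[leLHS]mulr_natl ler_wpM2r ?sqr_ge0//.
have : (0 : R) <= d%:R by []. nra.
Qed.

Lemma enorm_eq0 x : enorm x = 0 -> x = 0.
Proof.
move=> x0; apply/eqP; rewrite -normr_eq0 eq_le normr_ge0 andbT -x0.
exact: norm_le_enorm.
Qed.

Lemma enorm_gt0 x : x != 0 -> 0 < enorm x.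
Proof. by move=> x0; rewrite lt_def enorm_ge0 andbT; apply: contra_neq x0; exact: enorm_eq0. Qed.

Lemma enorm_triangle x y z : enorm (x - z) <= enorm (x - y) + enorm (y - z).
Proof. by apply: le_trans (enormD _ _); rewrite addrA subrK. Qed.

Lemma enorm_lip x y : `|enorm x - enorm y| <= enorm (x - y).
Proof.
have := enormD (x - y) y; have := enormD (y - x) x.
rewrite !subrK (enormB y x) => h1 h2; rewrite ler_norml; apply/andP; split; lra.
Qed.

Lemma lipschitz_continuous (f : 'rV[R]_d -> R) L :
  (forall x y, `|f x - f y| <= L * enorm (x - y)) -> continuous f.
Proof.
move=> H x; apply/(@cvgrPdist_le _ _ _ (nbhs x)) => e e0.
pose K := (`|L| + 1) * (d%:R + 1).
have K0 : 0 < K by rewrite mulr_gt0 ?ltr_wpDl.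
have : \forall y \near x, `|x - y| < e / K.
  by apply/nbhs_ballP; exists (e / K) => /=; [rewrite divr_gt0|move=> y; rewrite -ball_normE].
apply: filterS => y xy; apply: (le_trans (H x y)).
apply: (@le_trans _ _ (K * `|x - y|)).
  rewrite /K -mulrA; apply: (@le_trans _ _ (`|L| * enorm (x - y))).
    by rewrite ler_wpM2r ?enorm_ge0// ler_norm.
  rewrite ler_pM ?enorm_ge0//; [by rewrite lerDl|exact: enorm_le_norm].
by rewrite -ler_pdivlMl// mulrC ltW.
Qed.

Lemma enorm_continuous : continuous (@enorm R d).
Proof. by apply: (@lipschitz_continuous _ 1) => x y; rewrite mul1r enorm_lip. Qed.

Lemma measurable_enorm : measurable_fun setT (@enorm R d).
Proof. by apply: continuous_measurable_rV; exact: enorm_continuous. Qed.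

Lemma measurable_enormB dd (T : measurableType dd) (f g : T -> 'rV[R]_d) :
  measurable_fun setT f -> measurable_fun setT g ->
  measurable_fun setT (fun t => enorm (f t - g t)).
Proof.
by move=> mf mg; apply: (measurableT_comp measurable_enorm); exact: measurable_subrV.
Qed.

Local Notation mu := (@lebesgue_rV R d).

Lemma ge0_integral_subl (x : 'rV[R]_d) (f : 'rV[R]_d -> \bar R) :
  measurable_fun setT f -> (forall x, 0 <= f x)%E ->
  (\int[mu]_w f (x - w)%R = \int[mu]_w f w)%E.
Proof.
move=> mf f0.
have mfN : measurable_fun setT (fun w : 'rV[R]_d => f (- w)).
  by apply: (measurableT_comp mf); exact: measurable_opprV.
transitivity (\int[mu]_w f (- (w + - x))%R)%E.
  by apply: eq_integral => w _; rewrite opprD opprK addrC.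
rewrite (ge0_integral_shift (- x) (f := fun w => f (- w)))//.
have := @ge0_integral_scale R d (-1) f; rewrite oppr_eq0 oner_eq0 normrN1 expr1n invr1 mul1e.
by move=> <-//; apply: eq_integral => w _; rewrite scaleN1r.
Qed.

Lemma nneseries_geometric_le (u : nat -> \bar R) (B z : R) : 0 <= B -> 0 <= z < 1 ->
  (forall n, (0 <= u n <= (B * z ^+ n)%:E)%E) ->
  (\sum_(0 <= n <oo) u n <= (B / (1 - z))%:E)%E.
Proof.
move=> B0 /andP[z0 z1] H.
apply: lime_le; first by apply: is_cvg_nneseries => n _ _; case/andP: (H n).
apply: nearW => n.
apply: (@le_trans _ _ (\sum_(0 <= i < n) (B * z ^+ i)%:E)%E).
  by apply: lee_sum => i _; case/andP: (H i).
rewrite sumEFin lee_fin -mulr_sumr ler_wpM2l// big_mkord.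
have z1' : 0 < 1 - z by rewrite subr_gt0.
rewrite -div1r ler_pdivlMr// mulrC.
have := subrX1 z n; have := exprn_ge0 n z0; lra.
Qed.

(** At any given point a single term of the series of [a n] times the indicator of the ball of
    radius [r n] already dominates [g]; the series is then integrated term by term, the ball being a
    cube of volume [(2 * r n) ^+ d]. *)
Lemma ge0_integral_shells (g : 'rV[R]_d -> R) (a r : nat -> R) (B z : R) :
  (forall h, 0 <= g h) -> measurable_fun setT g ->
  (forall n, 0 <= a n) -> (forall n, 0 < r n) ->
  (forall h, g h != 0 -> exists n, `|h| < r n /\ g h <= a n) ->
  0 <= B -> 0 <= z < 1 -> (forall n, a n * (2 * r n) ^+ d <= B * z ^+ n) ->
  (\int[mu]_h (g h)%:E <= (B / (1 - z))%:E)%E.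
Proof.
move=> g0 mg a0 r0 H B0 z01 Hz.
have mF n : measurable_fun setT (fun h : 'rV[R]_d => (a n * \1_(ball 0 (r n)) h)%:E).
  apply: measurableT_comp => //; apply: measurable_funM => //.
  by apply: measurable_indic; exact: measurable_rV_ball.
have F0 n (h : 'rV[R]_d) : (0 <= (a n * \1_(ball 0 (r n)) h)%:E)%E.
  by rewrite lee_fin mulr_ge0.
apply: (@le_trans _ _ (\int[mu]_h \sum_(0 <= n <oo) (a n * \1_(ball (0 : 'rV[R]_d) (r n)) h)%:E)%E).
  apply: nonneg_le_integral => //.
  - by move=> h _; rewrite lee_fin.
  - move=> h _; have [->|gh] := eqVneq (g h) 0.
      by apply: nneseries_ge0 => n _ _; exact: F0.
    have [n [hn gn]] := H h gh.
    rewrite (@nneseriesD1 _ _ n)//.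
    apply: (@le_trans _ _ (a n * \1_(ball (0 : 'rV[R]_d) (r n)) h)%:E).
      by rewrite indicE mem_set ?mulr1 ?lee_fin// -ball_normE/= sub0r normrN.
    by rewrite leeDl// nneseries_ge0// => k _ _; exact: F0.
rewrite integral_nneseries//.
apply: nneseries_geometric_le => // n; apply/andP; split.
  by apply: integral_ge0 => h _; exact: F0.
under eq_integral do rewrite EFinM.
rewrite ge0_integralZl//.
- rewrite integral_indic// ?setIT//; last exact: measurable_rV_ball.
  have E := lebesgue_rV_ball (0 : 'rV[R]_d) (r0 n).
  apply: (@le_trans _ _ ((a n)%:E * ((2 * r n) ^+ d)%:E)%E); first by rewrite -E.
  by rewrite -EFinM lee_fin.
- by apply: measurableT_comp => //; apply: measurable_indic; exact: measurable_rV_ball.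
- by rewrite lee_fin.
Qed.

Lemma exists_pow2_gt (x : R) : exists n, x < 2 ^+ n.
Proof.
exists (Num.Def.truncn x).+1.
apply: (lt_le_trans (truncnS_gt x)).
by rewrite -natrX ler_nat ltnW// ltn_expl.
Qed.

Lemma pow2_shell (x : R) : 1 <= x -> exists n, 2 ^+ n <= x < 2 ^+ n.+1.
Proof.
move=> x1; have [m Hm mmin] := ex_minnP (exists_pow2_gt x).
case: m Hm mmin => [|m] Hm mmin; first by move: Hm; rewrite expr0 ltNge x1.
exists m; rewrite Hm andbT leNgt; apply/negP => /mmin; by rewrite ltnn.
Qed.

Lemma powR_nat (x : R) (t : R) n : 0 <= x -> (x ^+ n) `^ t = (x `^ t) ^+ n.
Proof.
move=> x0; elim: n => [|n IH]; first by rewrite !expr0 powR1.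
by rewrite !exprS powRM ?exprn_ge0// IH.
Qed.

Lemma powR_lt1 (t : R) : 0 < t -> 0 <= (2 : R) `^ (- t) < 1.
Proof.
move=> t0; rewrite powR_ge0/= powRN invf_lt1 ?powR_gt0//.
have : (1 : R) `^ t < 2 `^ t by apply: gt0_ltr_powR; rewrite ?nnegrE ?ltr1n.
by rewrite powR1.
Qed.

Lemma ler_powR_neg (x y t : R) : 0 < x -> x <= y -> t <= 0 -> y `^ t <= x `^ t.
Proof.
move=> x0 xy t0; rewrite -[t]opprK !(powRN _ (- t)) lef_pV2 ?posrE ?powR_gt0 ?(lt_le_trans x0)//.
by apply: ge0_ler_powR; rewrite ?oppr_ge0// nnegrE ltW// (lt_le_trans x0).
Qed.

Lemma ge0_integral_radial (P : pred R) (q : R) (g : 'rV[R]_d -> R) x : measurable [set r | P r] ->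
    (forall h, g h = if P (enorm h) then enorm h `^ q else 0) ->
  [/\ measurable_fun setT g, forall h, 0 <= g h &
     (\int[mu]_(w in [set w | P (enorm (x - w))]) (enorm (x - w) `^ q)%:E = \int[mu]_w (g w)%:E)%E].
Proof.
move=> mP gE.
have mg : measurable_fun setT g.
  rewrite (funext gE); apply: measurable_fun_ifT => //; last first.
    by apply: (measurableT_comp (measurable_powR _)); exact: measurable_enorm.
  by apply: (measurable_fun_bool true); rewrite setTI; exact: (measurable_preimageT measurable_enorm mP).
have g0 h : 0 <= g h by rewrite gE; case: ifP => // _; exact: powR_ge0.
split=> //; rewrite integral_mkcond.
rewrite (_ : _ \_ _ = fun w => (g (x - w))%:E); last first.
  apply/funext => w; rewrite patchE gE; case: ifPn => [|].
    by rewrite inE/= => ->.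
  by rewrite notin_setE/= => /negP/negPf ->.
by rewrite (@ge0_integral_subl x (fun w => (g w)%:E)); [|exact: measurableT_comp|move=> h; rewrite lee_fin].
Qed.

Lemma far_kernel_integral (t : R) : 0 < t -> exists2 C : R, 0 < C & forall (x : 'rV[R]_d) (e : R), 0 < e ->
  (\int[mu]_(w in [set w | (e <= enorm (x - w))%R]) (enorm (x - w) `^ (- (d%:R + t)))%R%:E
   <= (C * e `^ (- t))%:E)%E.
Proof.
move=> t0; have /andP[z0 z1] := powR_lt1 t0.
(* The shell s_n <= |h| < 2 s_n lies in a cube of side 4 s_n and contributes at most 4^d s_n^(-t);
   consecutive terms have ratio 2^(-t). *)
exists (4 ^+ d / (1 - 2 `^ (- t))); first by rewrite divr_gt0// subr_gt0.
move=> x e e0.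
pose g (h : 'rV[R]_d) := if e <= enorm h then enorm h `^ (- (d%:R + t)) else 0.
have [|mg g0 ->] := @ge0_integral_radial (fun r => e <= r) (- (d%:R + t)) g x _ (fun=> erefl).
  by rewrite -set_itvcy.
pose s n := e * 2 ^+ n.
have s0 n : 0 < s n by rewrite mulr_gt0// exprn_gt0.
have -> : 4 ^+ d / (1 - 2 `^ (- t)) * e `^ (- t) = (4 ^+ d * e `^ (- t)) / (1 - 2 `^ (- t)) by ring.
apply: (@ge0_integral_shells g (fun n => s n `^ (- (d%:R + t))) (fun n => 2 * s n)) => //.
- by move=> n; exact: powR_ge0.
- by move=> n; rewrite mulr_gt0.
- move=> h; rewrite {1}/g; case: ifPn => [eh _|]; last by rewrite eqxx.
  have : 1 <= enorm h / e by rewrite ler_pdivlMr// mul1r.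
  move=> /pow2_shell[n /andP[n1 n2]]; exists n; split.
    rewrite (le_lt_trans (norm_le_enorm h))// /s mulrCA -exprS.
    by rewrite mulrC -ltr_pdivrMr.
  rewrite /g eh ler_powR_neg//.
    by rewrite /s mulrC -ler_pdivlMr.
  by rewrite oppr_le0 addr_ge0// ltW.
- by rewrite mulr_ge0 ?powR_ge0.
- by rewrite z0.
move=> n; rewrite opprD powRD ?lt0r_neq0 ?implybT//.
rewrite powR_invn ?(ltW (s0 n))// !exprMn.
rewrite /s powRM ?(ltW e0) ?exprn_ge0// powR_nat//.
apply: eq_lew.
have -> : (4 : R) = 2 * 2 by ring.
rewrite exprMn; field.
by rewrite !expf_neq0 ?lt0r_neq0// exprn_gt0.
Qed.

Lemma near_kernel_integral (t : R) : 0 < t -> exists2 C : R, 0 < C & forall (x : 'rV[R]_d) (e : R), 0 < e ->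
  (\int[mu]_(w in [set w | (enorm (x - w) <= e)%R]) (enorm (x - w) `^ (t - d%:R))%R%:E
   <= (C * e `^ t)%:E)%E.
Proof.
move=> t0; have /andP[z0 z1] := powR_lt1 t0.
(* Besides the factor 4^d of the cubes, a factor 2^d bounds the oscillation of r^(t-d) over a dyadic
   shell when the exponent is negative. *)
exists (8 ^+ d / (1 - 2 `^ (- t))); first by rewrite divr_gt0// subr_gt0.
move=> x e e0.
pose g (h : 'rV[R]_d) := if enorm h <= e then enorm h `^ (t - d%:R) else 0.
have [|mg g0 ->] := @ge0_integral_radial (fun r => r <= e) (t - d%:R) g x _ (fun=> erefl).
  by rewrite -set_itvNyc.
pose s n := e / 2 ^+ n.
have s0 n : 0 < s n by rewrite divr_gt0// exprn_gt0.
have -> : 8 ^+ d / (1 - 2 `^ (- t)) * e `^ t = (8 ^+ d * e `^ t) / (1 - 2 `^ (- t)) by ring.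
apply: (@ge0_integral_shells g (fun n => 2 ^+ d * s n `^ (t - d%:R)) (fun n => 2 * s n)) => //.
- by move=> n; rewrite mulr_ge0 ?powR_ge0.
- by move=> n; rewrite mulr_gt0.
- move=> h; rewrite {1}/g; case: ifPn => [eh gh|]; last by rewrite eqxx.
  (* At the centre the power is 0 by convention, or 1 if the exponent is 0; the outermost shell
     covers both cases. *)
  have [h0|h0] := eqVneq (enorm h) 0.
    exists 0%N; split.
      by rewrite (le_lt_trans (norm_le_enorm h))// h0 mulr_gt0.
    rewrite /g eh h0; have [->|td] := eqVneq (t - d%:R) 0.
      by rewrite !powRr0 mulr1 exprn_ege1// ler1n.
    by rewrite powR0// mulr_ge0 ?powR_ge0.
  have hp : 0 < enorm h by rewrite lt_def h0 enorm_ge0.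
  have : 1 <= e / enorm h by rewrite ler_pdivlMr// mul1r.
  move=> /pow2_shell[n /andP[n1 n2]]; exists n.
  have hs : enorm h <= s n by rewrite /s ler_pdivlMr// mulrC -ler_pdivlMr.
  have sh : s n < 2 * enorm h.
    rewrite /s ltr_pdivrMr// mulrAC -exprS -ltr_pdivrMr//.
  split.
    by rewrite (le_lt_trans (norm_le_enorm h))//; have := s0 n; lra.
  rewrite /g eh; have [td|td] := leP 0 (t - d%:R).
    apply: (@le_trans _ _ (s n `^ (t - d%:R))).
      by apply: ge0_ler_powR => //; rewrite nnegrE// ltW.
    by rewrite ler_peMl ?powR_ge0// exprn_ege1// ler1n.
  apply: (@le_trans _ _ ((s n / 2) `^ (t - d%:R))).
    by apply: ler_powR_neg; [rewrite divr_gt0|rewrite ler_pdivrMr// mulrC ltW|exact: ltW].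
  rewrite powRM ?(ltW (s0 n)) ?invr_ge0// [leRHS]mulrC; apply: ler_wpM2l; first exact: powR_ge0.
  rewrite -powR_inv1// -powRrM mulN1r opprB -powR_mulrn// ler_powR ?ler1n//; lra.
- by rewrite mulr_ge0 ?powR_ge0.
- by rewrite z0.
move=> n; rewrite powRD ?lt0r_neq0 ?implybT//.
rewrite powR_invn ?(ltW (s0 n))// !exprMn.
rewrite /s powRM ?(ltW e0) ?invr_ge0 ?exprn_ge0// -(powR_inv1 (exprn_ge0 _ _))// -powRrM mulN1r powR_nat//.
apply: eq_lew.
have -> : (8 : R) = 2 * 2 * 2 by ring.
rewrite !exprMn; field.
by rewrite !expf_neq0 ?lt0r_neq0// ?exprn_gt0// powR_gt0// exprn_gt0.
Qed.
End enorm_theory.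

(** * Square-integrable functions as a pre-Hilbert space *)

Section sqint.
Context dd (T : measurableType dd) (R : realType).
Variables (m : {measure set T -> \bar R}) (D : set T).
Hypothesis mD : measurable D.
Implicit Types f g h : T -> R.

Definition sqint f := measurable_fun D f /\
  (\int[m]_(x in D) ((f x) ^+ 2)%:E < +oo)%E.

Definition ip f g : R := \int[m]_(x in D) (f x * g x).

Lemma sqintP f : sqint f <->
  measurable_fun D f /\ m.-integrable D (fun x => ((f x) ^+ 2)%:E).
Proof.
split=> -[mf fi]; split=> //.
  apply/integrableP; split; first by apply: measurableT_comp => //; exact: measurable_funX.
  by under eq_integral do rewrite gee0_abs ?lee_fin ?sqr_ge0//.
by apply: integrable_lty.
Qed.

Lemma sqint_mul f g : sqint f -> sqint g -> m.-integrable D (fun x => (f x * g x)%:E).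
Proof.
move=> /sqintP[mf fi] /sqintP[mg gi].
apply: (@le_integrable _ _ _ m D mD _ (fun x => ((f x) ^+ 2)%:E + ((g x) ^+ 2)%:E)%E).
- by apply: measurableT_comp => //; exact: measurable_funM.
- move=> x _; rewrite -EFinD !abse_EFin lee_fin [leRHS]ger0_norm ?addr_ge0 ?sqr_ge0//.
  rewrite ler_norml; apply/andP; split; nra.
- exact: integrableD.
Qed.

Lemma sqintZ a f : sqint f -> sqint (fun x => a * f x).
Proof.
move=> /sqintP[mf fi]; apply/sqintP; split; first exact: measurable_funM.
under eq_fun do rewrite exprMn EFinM.
exact: integrableZl.
Qed.

Lemma sqintD f g : sqint f -> sqint g -> sqint (f \+ g).
Proof.
move=> /sqintP[mf fi] /sqintP[mg gi]; apply/sqintP.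
have mfg : measurable_fun D (f \+ g) by exact: measurable_funD.
split => //.
apply: (@le_integrable _ _ _ m D mD _ (fun x => 2%:E * (((f x) ^+ 2)%:E + ((g x) ^+ 2)%:E))%E).
- by apply: measurableT_comp => //; exact: measurable_funX.
- move=> x _; rewrite -EFinD -EFinM !abse_EFin lee_fin !ger0_norm ?sqr_ge0 ?mulr_ge0 ?addr_ge0 ?sqr_ge0//=.
  have := sqr_ge0 (f x - g x); nra.
- by apply: integrableZl => //; exact: integrableD.
Qed.

Lemma sqintB f g : sqint f -> sqint g -> sqint (f \- g).
Proof.
move=> sf sg; have -> : f \- g = f \+ (fun x => -1 * g x).
  by apply/funext => x /=; rewrite mulN1r.
by apply: sqintD => //; exact: sqintZ.
Qed.

Lemma sqint0 : sqint (fun=> 0).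
Proof.
split => //; under eq_integral do rewrite expr0n/=.
by rewrite integral0.
Qed.

Lemma ipC f g : ip f g = ip g f.
Proof. by apply: eq_Rintegral => x _; rewrite mulrC. Qed.

Lemma ipDl f g h : sqint f -> sqint g -> sqint h -> ip (f \+ g) h = ip f h + ip g h.
Proof.
move=> sf sg sh; rewrite /ip -RintegralD//; [|exact: sqint_mul..].
by apply: eq_Rintegral => x _; rewrite mulrDl.
Qed.

Lemma ipZl a f g : sqint f -> sqint g -> ip (fun x => a * f x) g = a * ip f g.
Proof.
move=> sf sg; rewrite /ip -RintegralZl//; last exact: sqint_mul.
by apply: eq_Rintegral => x _; rewrite mulrA.
Qed.

Lemma ipBl f g h : sqint f -> sqint g -> sqint h -> ip (f \- g) h = ip f h - ip g h.
Proof.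
move=> sf sg sh; rewrite /ip -RintegralB//; [|exact: sqint_mul..].
by apply: eq_Rintegral => x _; rewrite mulrBl.
Qed.

Lemma ip_ge0 f : 0 <= ip f f.
Proof. by apply: Rintegral_ge0 => x _; rewrite -expr2 sqr_ge0. Qed.

Lemma EFin_ip f : sqint f -> (ip f f)%:E = (\int[m]_(x in D) ((f x) ^+ 2)%:E)%E.
Proof.
move=> sf; rewrite /ip /Rintegral fineK; first by apply: eq_integral => x _; rewrite expr2.
have := sf.2; under eq_integral do rewrite expr2.
by move=> h; rewrite ge0_fin_numE// integral_ge0// => x _; rewrite lee_fin -expr2 sqr_ge0.
Qed.

Lemma ip_CS f g : sqint f -> sqint g -> (ip f g) ^+ 2 <= ip f f * ip g g.
Proof.
move=> sf sg; apply: quad_form_CS => [|t]; first exact: ip_ge0.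
have stg := sqintZ t sg; have sfg := sqintD sf stg.
have := ip_ge0 (f \+ (fun x => t * g x)).
rewrite ipDl// (ipC f) (ipC (fun x => t * g x)) !ipDl// !(ipC _ (fun x => t * g x)) !ipZl//.
by rewrite (ipC g f) (ipC g (fun x => t * g x)) ipZl// => /le_trans; apply; apply: eq_lew; ring.
Qed.

Definition ipnorm f := Num.sqrt (ip f f).

Lemma ipnorm_sqr f : ipnorm f ^+ 2 = ip f f.
Proof. by rewrite sqr_sqrtr// ip_ge0. Qed.

Lemma ip_le f g : sqint f -> sqint g -> `|ip f g| <= ipnorm f * ipnorm g.
Proof.
move=> sf sg; rewrite -(@ler_pXn2r _ 2)// ?nnegrE ?mulr_ge0 ?sqrtr_ge0//.
by rewrite exprMn !ipnorm_sqr -normrX ger0_norm ?sqr_ge0//; exact: ip_CS.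
Qed.

End sqint.

(** * The energy form *)

Section fractional_form.
Context {R : realType} {d : nat} (alpha : R).
Local Notation mu := (@lebesgue_rV R d).
Local Notation mu2 := (mu \x mu)%E.
Implicit Types (y v p g : 'rV[R]_d -> R) (Omega : set 'rV[R]_d).

(** The square root of the reciprocal kernel. With it the energy form becomes [Cda / 2] times the
    L^2 inner product of increments on the product space, so that bilinearity and Cauchy-Schwarz are
    inherited. *)
Definition half_kernel (z : 'rV[R]_d * 'rV[R]_d) : R :=
  enorm (z.1 - z.2) `^ (- ((d%:R + alpha) / 2)).

Definition increment v (z : 'rV[R]_d * 'rV[R]_d) : R := (v z.1 - v z.2) * half_kernel z.

Lemma half_kernelM z : half_kernel z * half_kernel z = (frac_kernel alpha z.1 z.2)^-1.
Proof.
rewrite /half_kernel /frac_kernel -powRN -expr2 -powR_mulrn ?powR_ge0// -powRrM; congr (_ `^ _).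
by field.
Qed.

Lemma incrementM y v z :
  increment y z * increment v z = (y z.1 - y z.2) * (v z.1 - v z.2) / frac_kernel alpha z.1 z.2.
Proof. by rewrite -half_kernelM /increment; ring. Qed.

Lemma incrementB y v : increment (y \- v) = increment y \- increment v.
Proof. by apply/funext => z; rewrite /increment /=; ring. Qed.

Lemma incrementD y v : increment (y \+ v) = increment y \+ increment v.
Proof. by apply/funext => z; rewrite /increment /=; ring. Qed.

Lemma incrementZ a y : increment (fun x => a * y x) = (fun z => a * increment y z).
Proof. by apply/funext => z; rewrite /increment /=; ring. Qed.

Lemma measurable_half_kernel : measurable_fun setT half_kernel.
Proof.
apply: (measurableT_comp (measurable_powR _)).
exact: measurable_enormB.
Qed.

Lemma measurable_increment v : measurable_fun setT v -> measurable_fun setT (increment v).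
Proof.
move=> mv; apply: measurable_funM; last exact: measurable_half_kernel.
by apply: measurable_funB; apply: (measurableT_comp mv).
Qed.

Lemma HspaceP v : Hspace alpha v <-> L2 setT v /\ sqint mu2 setT (increment v).
Proof.
split=> -[L v2]; split=> //.
  split; first by apply: measurable_increment; case: L.
  by under eq_integral do rewrite expr2 incrementM -expr2.
by case: v2 => _; under eq_integral do rewrite expr2 incrementM -expr2.
Qed.

Lemma Hspace_sqint v : Hspace alpha v -> sqint mu2 setT (increment v).
Proof. by move/HspaceP => []. Qed.

Lemma L2_subset (A B : set 'rV[R]_d) v : measurable A -> measurable B -> A `<=` B -> L2 B v -> L2 A v.
Proof.
move=> mA mB AB [mv v2]; split; first exact: measurable_funS mv.
apply: le_lt_trans v2; apply: ge0_subset_integral => //.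
  by apply: measurableT_comp => //; exact: measurable_funX.
by move=> x _; rewrite lee_fin sqr_ge0.
Qed.

Lemma aform_ip y v : aform alpha y v = @Cda R d alpha / 2 * ip mu2 setT (increment y) (increment v).
Proof. by rewrite /aform /ip; congr (_ * _); apply: eq_Rintegral => z _; rewrite incrementM. Qed.

Lemma Gamma_pos_ge0 (s : R) : 0 <= Gamma_pos s.
Proof. by apply: Rintegral_ge0 => x _; rewrite mulr_ge0 ?powR_ge0 ?expR_ge0. Qed.

(** The Gamma value in the numerator is a nonnegative integral over a product of nonnegative
    factors. The value 0 is left open here; the theorem treats it apart, since all energy norms then
    vanish. *)
Lemma Cda_ge0 : 0 < alpha -> 0 <= @Cda R d alpha.
Proof.
move=> a0; rewrite /Cda.
have e0 : 0 <= alpha / 2 + d%:R / 2 by rewrite addr_ge0// divr_ge0// ltW.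
have G : 0 <= Gamma (alpha / 2 + d%:R / 2).
  by apply: divr_ge0; [exact: Gamma_pos_ge0|apply: prodr_ge0 => i _; rewrite addr_ge0].
by apply: divr_ge0; apply: mulr_ge0; rewrite // ?powR_ge0.
Qed.

Lemma HspaceB y v : Hspace alpha y -> Hspace alpha v -> Hspace alpha (y \- v).
Proof.
move=> /HspaceP[y1 y2] /HspaceP[v1 v2]; apply/HspaceP; rewrite incrementB.
by split; apply: sqintB.
Qed.

Lemma HspaceD y v : Hspace alpha y -> Hspace alpha v -> Hspace alpha (y \+ v).
Proof.
move=> /HspaceP[y1 y2] /HspaceP[v1 v2]; apply/HspaceP; rewrite incrementD.
by split; apply: sqintD.
Qed.

Lemma HspaceZ a y : Hspace alpha y -> Hspace alpha (fun x => a * y x).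
Proof.
move=> /HspaceP[y1 y2]; apply/HspaceP; rewrite incrementZ.
by split; apply: sqintZ.
Qed.

Lemma HtildeB Omega y v : Htilde alpha Omega y -> Htilde alpha Omega v -> Htilde alpha Omega (y \- v).
Proof.
move=> [y1 y2] [v1 v2]; split; first exact: HspaceB.
by apply: filterS2 y2 v2 => x h1 h2 nx /=; rewrite h1// h2// subrr.
Qed.

Lemma HtildeD Omega y v : Htilde alpha Omega y -> Htilde alpha Omega v -> Htilde alpha Omega (y \+ v).
Proof.
move=> [y1 y2] [v1 v2]; split; first exact: HspaceD.
by apply: filterS2 y2 v2 => x h1 h2 nx /=; rewrite h1// h2// addr0.
Qed.

Lemma HtildeZ Omega a y : Htilde alpha Omega y -> Htilde alpha Omega (fun x => a * y x).
Proof.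
move=> [y1 y2]; split; first exact: HspaceZ.
by apply: filterS y2 => x h1 nx /=; rewrite h1// mulr0.
Qed.

Lemma Htilde0 Omega : Htilde alpha Omega (fun=> 0).
Proof.
split; last by apply: nearW.
apply/HspaceP; split; first exact: sqint0.
have -> : increment (fun=> 0) = fun=> 0 by apply/funext => z; rewrite /increment subrr mul0r.
exact: sqint0.
Qed.

Lemma aformC y v : aform alpha y v = aform alpha v y.
Proof. by rewrite !aform_ip ipC. Qed.

Lemma aformBl y v w : Hspace alpha y -> Hspace alpha v -> Hspace alpha w ->
  aform alpha (y \- v) w = aform alpha y w - aform alpha v w.
Proof.
by move=> /Hspace_sqint hy /Hspace_sqint hv /Hspace_sqint hw; rewrite !aform_ip incrementB ipBl// mulrBr.
Qed.

Lemma aformDl y v w : Hspace alpha y -> Hspace alpha v -> Hspace alpha w ->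
  aform alpha (y \+ v) w = aform alpha y w + aform alpha v w.
Proof.
by move=> /Hspace_sqint hy /Hspace_sqint hv /Hspace_sqint hw; rewrite !aform_ip incrementD ipDl// mulrDr.
Qed.

Lemma aformZl a y w : Hspace alpha y -> Hspace alpha w ->
  aform alpha (fun x => a * y x) w = a * aform alpha y w.
Proof.
by move=> /Hspace_sqint hy /Hspace_sqint hw; rewrite !aform_ip incrementZ ipZl// mulrCA.
Qed.

Lemma aformBr y v w : Hspace alpha y -> Hspace alpha v -> Hspace alpha w ->
  aform alpha w (y \- v) = aform alpha w y - aform alpha w v.
Proof. by move=> *; rewrite aformC aformBl// !(aformC w). Qed.

Lemma aformDr y v w : Hspace alpha y -> Hspace alpha v -> Hspace alpha w ->
  aform alpha w (y \+ v) = aform alpha w y + aform alpha w v.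
Proof. by move=> *; rewrite aformC aformDl// !(aformC w). Qed.

Lemma aformZr a y w : Hspace alpha y -> Hspace alpha w ->
  aform alpha w (fun x => a * y x) = a * aform alpha w y.
Proof. by move=> *; rewrite aformC aformZl// aformC. Qed.

Hypothesis alpha0 : 0 < alpha.

Lemma aform_ge0 y : 0 <= aform alpha y y.
Proof. by rewrite aform_ip mulr_ge0 ?ip_ge0// divr_ge0// Cda_ge0. Qed.

Lemma Hnorm_sqr y : Hnorm alpha y ^+ 2 = aform alpha y y.
Proof. by rewrite sqr_sqrtr// aform_ge0. Qed.

Lemma Hnorm_ge0 y : 0 <= Hnorm alpha y.
Proof. exact: sqrtr_ge0. Qed.

Lemma aform_le y v : Hspace alpha y -> Hspace alpha v ->
  `|aform alpha y v| <= Hnorm alpha y * Hnorm alpha v.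
Proof.
move=> hy hv; rewrite -(@ler_pXn2r _ 2)// ?nnegrE ?mulr_ge0 ?Hnorm_ge0//.
rewrite exprMn !Hnorm_sqr -normrX ger0_norm ?sqr_ge0// !aform_ip.
have := ip_CS measurableT (Hspace_sqint hy) (Hspace_sqint hv).
have := Cda_ge0 alpha0; set c := @Cda R d alpha; set A := ip _ _ _ _; set B := ip _ _ _ _; set C := ip _ _ _ _ => c0 h.
have -> : c / 2 * B * (c / 2 * C) = (c / 2) ^+ 2 * (B * C) by ring.
by rewrite exprMn ler_wpM2l// sqr_ge0.
Qed.

Lemma Hnorm_triangle y v : Hspace alpha y -> Hspace alpha v ->
  Hnorm alpha (y \+ v) <= Hnorm alpha y + Hnorm alpha v.
Proof.
move=> hy hv; rewrite -(@ler_pXn2r _ 2)// ?nnegrE ?addr_ge0 ?Hnorm_ge0//.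
have hyv := HspaceD hy hv.
rewrite sqrrD !Hnorm_sqr aformDl// !aformDr// (aformC v y).
have := le_trans (ler_norm _) (aform_le hy hv); lra.
Qed.

Lemma HnormZ a y : Hspace alpha y -> Hnorm alpha (fun x => a * y x) = `|a| * Hnorm alpha y.
Proof.
move=> hy; rewrite /Hnorm aformZl ?aformZr//; last exact: HspaceZ.
by rewrite mulrA -expr2 sqrtrM ?sqr_ge0// sqrtr_sqr.
Qed.

End fractional_form.

(** * Poincare inequality and completeness of the energy space *)

Section poincare.
Context {R : realType} {d : nat} (alpha : R) (Omega : set 'rV[R]_d).
Local Notation mu := (@lebesgue_rV R d).
Local Notation mu2 := (mu \x mu)%E.
Hypothesis d0 : (0 < d)%N.
Hypothesis alpha0 : 0 < alpha.
Hypothesis bO : bounded_set Omega.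

Lemma bounded_set_closure_norm : exists2 M : R, 0 < M & forall x, closure Omega x -> `|x| <= M.
Proof.
have [M [_ HM]] := bO.
exists (`|M| + 1); first by rewrite ltr_wpDl.
have H x : Omega x -> `|x| <= `|M| + 1.
  by move=> Ox; apply: (HM (`|M| + 1)) => //; rewrite (le_lt_trans (ler_norm M))// ltrDl.
have cB : closed [set x : 'rV[R]_d | `|x| <= `|M| + 1].
  rewrite (_ : mkset _ = Num.norm @^-1` [set z : R | z <= `|M| + 1]) //.
  apply: closed_comp; last exact: closed_le.
  by move=> x _; exact: norm_continuous.
by move=> x /(closure_subset H); rewrite -((closure_id _).1 cB).
Qed.

(** On a box [B] disjoint from the closure of [Omega] the function vanishes, so [v x] is its
    increment between [x] and any [w] in [B]. Distances from the domain to [B] are at most [L],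
    which bounds the kernel from below. *)
Lemma Htilde_poincare : exists2 P : R, 0 < P & forall v, Htilde alpha Omega v ->
  (\int[mu]_x ((v x) ^+ 2)%:E <= P%:E * \int[mu2]_z ((increment alpha v z) ^+ 2)%:E)%E.
Proof.
have [M M0 HM] := bounded_set_closure_norm.
have [i0] : exists i : 'I_d, True by exists (Ordinal d0).
move=> _.
(* All coordinates of points of [B] exceed [M + 1], those of points of the domain are at most [M];
   one coordinate [i0] tells them apart. *)
pose c : 'rV[R]_d := const_mx (M + 2).
pose B : set 'rV[R]_d := ball c 1.
have mB : measurable B by exact: measurable_rV_ball.
pose L : R := (d%:R + 1) * (2 * M + 3).
have L0 : 0 < L by rewrite /L mulr_gt0// ?ltr_wpDl//; have := M0; lra.
have cn : `|c| <= M + 2.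
  apply: norm_le_coord => [|j]; first by rewrite addr_ge0// ltW.
  by rewrite mxE ger0_norm// addr_ge0// ltW.
have BM w : B w -> ~ closure Omega w.
  move=> /(rV_ballE _ _ ltr01) H /HM wM; have := H i0; rewrite mxE.
  have := coord_le_norm w i0; rewrite !ler_norml !ltr_norml => /andP[? ?] /andP[? ?]; lra.
have BL x w : closure Omega x -> B w -> L `^ (- (d%:R + alpha)) <= half_kernel alpha (x, w) ^+ 2.
  move=> Ox Bw.
  rewrite /half_kernel/= -powR_mulrn ?powR_ge0// -powRrM.
  have -> : - ((d%:R + alpha) / 2) * 2 = - (d%:R + alpha) by field.
  have xw : x != w by apply/eqP => xw; apply: (BM w Bw); rewrite -xw.
  apply: ler_powR_neg.
  - by apply: enorm_gt0; rewrite subr_eq0.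
  - rewrite (le_trans (enorm_le_norm _))// ler_pM2l ?ltr_wpDl//.
    rewrite (le_trans (ler_normB _ _))//.
    have h1 := HM _ Ox.
    have h2 : `|w| <= M + 3.
      rewrite -(subrK c w) (le_trans (ler_normD _ _))//.
      move: Bw; rewrite /B -ball_normE/= distrC => h; lra.
    lra.
  - by rewrite oppr_le0 addr_ge0// ltW.
pose P : R := L `^ (d%:R + alpha).
exists P; first by rewrite powR_gt0.
move=> v [Hv v0]; have [Lv Sv] := (HspaceP alpha v).1 Hv.
have mv : measurable_fun setT v := Lv.1.
have mi := measurable_increment alpha mv.
have mi2 : measurable_fun setT (fun z => ((increment alpha v z) ^+ 2)%:E).
  by apply: measurableT_comp => //; exact: measurable_funX.
rewrite (@fubini_tonelli1 _ _ _ _ R mu mu (fun z => ((increment alpha v z) ^+ 2)%:E))//; last first.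
  by move=> z; rewrite lee_fin sqr_ge0.
rewrite -ge0_integralZl//; first last.
- by rewrite lee_fin powR_ge0.
- by move=> x _; apply: integral_ge0 => w _; rewrite lee_fin sqr_ge0.
- by apply: measurable_fun_fubini_tonelli_F => // z; rewrite lee_fin sqr_ge0.
apply: ae_ge0_le_integral => //.
- by move=> x _; rewrite lee_fin sqr_ge0.
- by apply: measurableT_comp => //; exact: measurable_funX.
- by move=> x _; rewrite mule_ge0 ?lee_fin ?powR_ge0//; apply: integral_ge0 => w _; rewrite lee_fin sqr_ge0.
- apply: measurable_funeM.
  by apply: measurable_fun_fubini_tonelli_F => // z; rewrite lee_fin sqr_ge0.
apply: filterS (v0) => x nx _.
have [Ox|/nx ->] := pselect (closure Omega x); last first.
  by rewrite expr0n/= mule_ge0 ?lee_fin ?powR_ge0//; apply: integral_ge0 => w _; rewrite lee_fin sqr_ge0.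
rewrite /fubini_F.
have mx : measurable_fun setT (fun w => ((increment alpha v (x, w)) ^+ 2)%:E).
  by apply: (measurableT_comp mi2); exact: measurable_pair1.
apply: (@le_trans _ _ (P%:E * \int[mu]_(w in B) ((increment alpha v (x, w)) ^+ 2)%:E)%E); last first.
  rewrite lee_pmul2l ?lte_fin ?powR_gt0//; apply: ge0_subset_integral => //.
  by move=> w _; rewrite lee_fin sqr_ge0.
apply: (@le_trans _ _ (P%:E * \int[mu]_(w in B) ((L `^ (- (d%:R + alpha))) * (v x) ^+ 2)%:E)%E).
  have muB : mu B = (2 ^+ d)%:E by rewrite lebesgue_rV_ball ?mulr1.
  rewrite [X in (P%:E * X)%E](_ : _ = (L `^ (- (d%:R + alpha)) * v x ^+ 2)%:E * (2 ^+ d)%:E)%E; last first.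
    by rewrite integral_cst// -muB.
  rewrite -!EFinM lee_fin.
  rewrite powRN mulrA mulrA mulfV ?gt_eqF ?powR_gt0// mul1r.
  by apply: ler_peMr; rewrite ?sqr_ge0// exprn_ege1// ler1n.
rewrite lee_pmul2l ?lte_fin ?powR_gt0//; apply: ae_ge0_le_integral => //.
- by move=> w _; rewrite lee_fin mulr_ge0 ?powR_ge0 ?sqr_ge0.
- by move=> w _; rewrite lee_fin sqr_ge0.
- exact: measurable_funTS.
apply: filterS v0 => w vw Bw; rewrite lee_fin /increment/= vw ?subr0; last exact: BM.
by rewrite exprMn mulrC ler_wpM2l ?sqr_ge0// BL.
Qed.

End poincare.

Section l2_limits.
Context dd (T : measurableType dd) (R : realType).
Variables (m : {measure set T -> \bar R}) (D : set T).
Hypothesis mD : measurable D.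

Lemma fatou_sqr_le (F : nat -> T -> R) (G : T -> R) (c : R) :
  (forall k, measurable_fun D (F k)) -> measurable_fun D G ->
  {ae m, forall x, D x -> F ^~ x @ \oo --> G x} ->
  (forall k, \int[m]_(x in D) ((F k x) ^+ 2)%:E <= c%:E)%E ->
  (\int[m]_(x in D) ((G x) ^+ 2)%:E <= c%:E)%E.
Proof.
move=> mF mG FG Fc.
have mF2 k : measurable_fun D (fun x => ((F k x) ^+ 2)%:E).
  by apply: measurableT_comp => //; exact: measurable_funX.
have mG2 : measurable_fun D (fun x => ((G x) ^+ 2)%:E).
  by apply: measurableT_comp => //; exact: measurable_funX.
apply: (@le_trans _ _ (\int[m]_(x in D) limn_einf (fun k => ((F k x) ^+ 2)%:E))%E).
  have mI : measurable_fun D (fun x => limn_einf (fun k => ((F k x) ^+ 2)%:E)).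
    apply: (eq_measurable_fun (fun x => (- limn_esup (fun k => - ((F k x) ^+ 2)%:E))%E)).
      by move=> x _; rewrite limn_esupN oppeK.
    apply: measurableT_comp => //; apply: measurable_fun_limn_esup => k.
    exact: measurableT_comp.
  have I0 x : (0 <= limn_einf (fun k => ((F k x) ^+ 2)%:E))%E.
    rewrite limn_einf_lim; apply: lime_ge; first exact: is_cvg_einfs.
    by apply: nearW => n; apply: le_ereal_inf_tmp => _ [k _ <-]; rewrite lee_fin sqr_ge0.
  apply: ae_ge0_le_integral => //.
    by move=> x _; rewrite lee_fin sqr_ge0.
  apply: filterS FG => x FGx Dx.
  have /cvg_limn_einf_sup[->] // : (fun k => ((F k x) ^+ 2)%:E) @ \oo --> ((G x) ^+ 2)%:E.
  by apply: cvg_EFin; [exact: nearW|apply: cvgM; exact: FGx].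
apply: le_trans (fatou m mD mF2 _) _.
  by move=> ? ? _; rewrite lee_fin sqr_ge0.
rewrite limn_einf_lim; apply: lime_le; first exact: is_cvg_einfs.
apply: nearW => n; apply: le_trans (Fc n); apply: ereal_inf_lbound.
by exists n => /=.
Qed.

(** The weights 4^k still leave a convergent series of integrals, so the weighted series of squared
    increments is finite almost everywhere. At such a point the increments are at most a constant
    times 2^-k and telescope absolutely. *)
Lemma ae_cvg_of_fast_sqr (f : nat -> T -> R) (c : R) : 0 <= c ->
  (forall k, measurable_fun D (f k)) ->
  (forall k, \int[m]_(x in D) ((f k.+1 x - f k x) ^+ 2)%:E <= (c * 8 ^- k)%:E)%E ->
  {ae m, forall x, D x -> cvgn (f ^~ x)}.
Proof.
move=> c0 mf fc.
pose u k x : \bar R := (4 ^+ k * (f k.+1 x - f k x) ^+ 2)%:E.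
have u0 k x : (0 <= u k x)%E by rewrite lee_fin mulr_ge0 ?sqr_ge0// exprn_ge0.
have mu k : measurable_fun D (u k).
  apply: measurableT_comp => //; apply: measurable_funM => //.
  by apply: measurable_funX; exact: measurable_funB.
have iS : (\int[m]_(x in D) \sum_(0 <= k <oo) u k x < +oo)%E.
  rewrite integral_nneseries//.
  apply: le_lt_trans (_ : (c / (1 - 2^-1))%:E < +oo)%E; last exact: ltry.
  apply: nneseries_geometric_le => //; first by apply/andP; split; lra.
  move=> n; rewrite integral_ge0//=.
  under eq_integral do rewrite /u EFinM.
  rewrite ge0_integralZl ?lee_fin ?exprn_ge0//.
  - apply: (@le_trans _ _ ((4 ^+ n)%:E * (c * 8 ^- n)%:E)%E).
      by apply: lee_wpmul2l => //; rewrite lee_fin exprn_ge0.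
    rewrite -EFinM lee_fin mulrCA ler_wpM2l//.
    have -> : (8 : R) = 4 * 2 by ring.
    rewrite exprMn invfM mulrA mulfV ?mul1r ?exprVn// expf_neq0//.
  - by apply: measurableT_comp => //; apply: measurable_funX; exact: measurable_funB.
  - by move=> x _; rewrite lee_fin sqr_ge0.
have : m.-integrable D (fun x => \sum_(0 <= k <oo) u k x)%E.
  apply/integrableP; split; first by apply: ge0_emeasurable_sum => //.
  have -> : (\int[m]_(x in D) `|\sum_(0 <= k <oo) u k x| = \int[m]_(x in D) \sum_(0 <= k <oo) u k x)%E.
    by apply: eq_integral => x _; rewrite gee0_abs// nneseries_ge0.
  exact: iS.
move=> /(integrable_ae mD); apply: filterS => x H Dx.
have {}H := H Dx.
set B := fine (\sum_(0 <= k <oo) u k x)%E.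
have BE : (\sum_(0 <= k <oo) u k x)%E = B%:E by rewrite fineK.
have uB k : 4 ^+ k * (f k.+1 x - f k x) ^+ 2 <= B.
  rewrite -lee_fin -BE (@nneseriesD1 _ _ k)// leeDl// nneseries_ge0//.
have B0 : 0 <= B by apply: le_trans (uB 0%N); rewrite mulr_ge0// sqr_ge0.
have ub k : `|f k.+1 x - f k x| <= Num.sqrt B * 2^-1 ^+ k.
  rewrite -(@ler_pXn2r _ 2)// ?nnegrE ?mulr_ge0 ?sqrtr_ge0 ?exprn_ge0//.
  rewrite exprMn sqr_sqrtr// -normrX ger0_norm ?sqr_ge0// exprVn exprVn -exprM mulnC exprM.
  rewrite ler_pdivlMr ?exprn_gt0//.
  by rewrite mulrC (_ : 2 ^+ 2 = 4)//; ring.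
have cT : cvgn (series (fun k => f k.+1 x - f k x)).
  apply: normed_cvg; apply: (@series_le_cvg _ _ (geometric (Num.sqrt B) 2^-1)) => //.
  - by move=> n /=.
  - by move=> n; rewrite mulr_ge0 ?sqrtr_ge0// exprn_ge0.
  - by apply: is_cvg_geometric_series; rewrite ger0_norm//; lra.
have -> : f ^~ x = (fun n => f 0%N x + series (fun k => f k.+1 x - f k x) n).
  apply/funext => n; exact: (eq_sum_telescope (f ^~ x)).
by apply: is_cvgD => //; exact: is_cvg_cst.
Qed.

End l2_limits.

Section ae_product.
Context d1 (T1 : measurableType d1) (R : realType).
Variable m : {sigma_finite_measure set T1 -> \bar R}.

Lemma ae_prod (P : T1 -> Prop) : {ae m, forall x, P x} ->
  {ae (m \x m)%E, forall z : T1 * T1, P z.1 /\ P z.2}.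
Proof.
move=> [A [mA mA0 PA]].
exists ((A `*` setT) `|` (setT `*` A)); split.
- by apply: measurableU; apply: measurableX.
- apply/eqP; rewrite eq_le measure_ge0 andbT.
  apply: le_trans (measureU2 _ _ _) _; try exact: measurableX.
  have E1 : (m \x m)%E (A `*` setT) = 0%E by rewrite product_measure1E// [X in (X * _)%E]mA0 mul0e.
  have E2 : (m \x m)%E (setT `*` A) = 0%E by rewrite product_measure1E// [X in (_ * X)%E]mA0 mule0.
  by rewrite [X in (X + _)%E]E1 [X in (_ + X)%E]E2 adde0.
- move=> z /= H; apply: contrapT => nn; apply: H; split; apply: contrapT => h; apply: nn.
    by left; split => //; exact: PA.
  by right; split => //; exact: PA.
Qed.
End ae_product.

(** * Riesz representation and the solution operator *)

Section riesz.
Context {R : realType} {d : nat} (alpha : R) (Omega : set 'rV[R]_d).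
Local Notation mu := (@lebesgue_rV R d).
Local Notation mu2 := (mu \x mu)%E.
Hypothesis d0 : (0 < d)%N.
Hypothesis alpha0 : 0 < alpha.
Hypothesis bO : bounded_set Omega.
Hypothesis mO : measurable Omega.

(** By Poincare the rate 8^-n also holds in L^2, so the sequence converges almost everywhere;
    Fatou's lemma then carries both bounds over to the limit. *)
Lemma Htilde_complete (v : nat -> 'rV[R]_d -> R) (c : R) : 0 <= c ->
  (forall n, Htilde alpha Omega (v n)) ->
  (forall n k, (n <= k)%N ->
    (\int[mu2]_z ((increment alpha (v k \- v n) z) ^+ 2)%:E <= (c * 8 ^- n)%:E)%E) ->
  exists2 w, Htilde alpha Omega w & forall n,
    (\int[mu2]_z ((increment alpha (v n \- w) z) ^+ 2)%:E <= (c * 8 ^- n)%:E)%E.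
Proof.
move=> c0 Hv Cv.
have [P P0 HP] := Htilde_poincare d0 alpha0 bO.
have mv n : measurable_fun setT (v n) by case: (Hv n) => -[[]].
have L2v n k : (n <= k)%N -> (\int[mu]_x ((v k x - v n x) ^+ 2)%:E <= (P * c * 8 ^- n)%:E)%E.
  move=> nk; apply: le_trans (HP _ (HtildeB (Hv k) (Hv n))) _.
  by rewrite -mulrA EFinM; apply: lee_wpmul2l; [rewrite lee_fin ltW|exact: Cv].
have cv : {ae mu, forall x, setT x -> cvgn (v ^~ x)}.
  apply: (@ae_cvg_of_fast_sqr _ _ R mu setT measurableT v (P * c)) => //.
    by rewrite mulr_ge0// ltW.
  by move=> k; exact: L2v.
(* The upper limit is a measurable representative defined everywhere; almost everywhere it is the
   limit. *)
pose w x := fine (limn_esup (fun n => (v n x)%:E)).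
have mw : measurable_fun setT w.
  apply: measurableT_comp => //; apply: measurable_fun_limn_esup => n.
  exact: measurableT_comp.
have vw : {ae mu, forall x, v ^~ x @ \oo --> w x}.
  apply: filterS cv => x /(_ I) cx.
  suff -> : w x = limn (v ^~ x) by [].
  rewrite /w; have /cvg_limn_einf_sup[_ ->] // : (fun k => (v k x)%:E) @ \oo --> (limn (v ^~ x))%:E.
  by apply: cvg_EFin => //; exact: nearW.
have vs n x : v ^~ x @ \oo --> w x -> (fun k => v (n + k)%N x) @ \oo --> w x.
  move=> h; rewrite (_ : (fun k => v (n + k)%N x) = [sequence v (k + n)%N x]_k).
    by rewrite (cvg_shiftn n (v ^~ x)).
  by apply/funext => k /=; rewrite addnC.
have ivw n : (\int[mu2]_z ((increment alpha (v n \- w) z) ^+ 2)%:E <= (c * 8 ^- n)%:E)%E.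
  apply: (@fatou_sqr_le _ _ R mu2 setT measurableT (fun k => increment alpha (v n \- v (n + k)%N))).
  - by move=> k; apply: measurable_increment; exact: measurable_funB.
  - by apply: measurable_increment; exact: measurable_funB.
  - apply: filterS (ae_prod vw) => -[x y] /= [cx cy] _.
    by rewrite /increment/=; apply: cvgMl; apply: cvgB; apply: cvgB;
      (try exact: cvg_cst); exact: vs.
  - move=> k; apply: le_trans (Cv n (n + k)%N (leq_addr _ _)).
    apply: eq_lew; apply: eq_integral => z _.
    by rewrite /increment/=; congr (_%:E); ring.
have lvw n : (\int[mu]_x ((v n x - w x) ^+ 2)%:E <= (P * c * 8 ^- n)%:E)%E.
  apply: (@fatou_sqr_le _ _ R mu setT measurableT (fun k x => v n x - v (n + k)%N x)).
  - by move=> k; exact: measurable_funB.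
  - exact: measurable_funB.
  - apply: filterS vw => x cx _; apply: cvgB; [exact: cvg_cst|exact: vs].
  - move=> k; apply: le_trans (L2v n (n + k)%N (leq_addr _ _)).
    apply: eq_lew; apply: eq_integral => z _.
    by congr (_%:E); ring.
have wE : w = v 0%N \- (v 0%N \- w) by apply/funext => x /=; rewrite opprB addrC subrK.
have Hvw : Hspace alpha (v 0%N \- w).
  apply/HspaceP; split; split.
  - exact: measurable_funB.
  - by apply: le_lt_trans (lvw 0%N) _; exact: ltry.
  - by apply: measurable_increment; exact: measurable_funB.
  - by apply: le_lt_trans (ivw 0%N) _; exact: ltry.
exists w => //; split.
  by rewrite wE; apply: HspaceB => //; case: (Hv 0%N).
have vz : {ae mu, forall x, forall n, ~ closure Omega x -> v n x = 0}.
  by apply: ae_foralln => n; case: (Hv n).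
apply: filterS2 vz vw => x h1 h2 nx.
apply: (cvg_unique _ h2); first exact: Rhausdorff.
rewrite (_ : v ^~ x = fun=> 0); first exact: cvg_cst.
by apply/funext => n; exact: h1.
Qed.

Hypothesis C0 : 0 < @Cda R d alpha.

Lemma aform_integral y : Hspace alpha y ->
  ((aform alpha y y)%:E = (@Cda R d alpha / 2)%:E *
   \int[mu2]_z ((increment alpha y z) ^+ 2)%:E)%E.
Proof.
by move=> hy; rewrite aform_ip EFinM EFin_ip//; exact: Hspace_sqint.
Qed.

Lemma Htilde_L2 v : Htilde alpha Omega v -> L2 Omega v.
Proof. by case=> -[Lv _] _; apply: L2_subset Lv. Qed.

Lemma normL2_poincare : exists2 P : R, 0 < P & forall v, Htilde alpha Omega v ->
  normL2 Omega v <= P * Hnorm alpha v.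
Proof.
have [P P0 HP] := Htilde_poincare d0 alpha0 bO.
pose K : R := P * (2 / @Cda R d alpha).
have K0 : 0 < K by rewrite mulr_gt0// divr_gt0.
exists (Num.sqrt K); first by rewrite sqrtr_gt0.
move=> v Hv; have hv : Hspace alpha v by case: Hv.
rewrite /Hnorm -(sqrtrM _ (ltW K0)); apply: ler_wsqrtr.
rewrite -lee_fin [leLHS](EFin_ip (Htilde_L2 Hv)).
apply: (@le_trans _ _ (\int[mu]_x ((v x) ^+ 2)%:E)%E).
  apply: ge0_subset_integral => //; last by move=> x _; rewrite lee_fin sqr_ge0.
  by apply: measurableT_comp => //; apply: measurable_funX; case: hv => -[].
apply: le_trans (HP v Hv) _.
rewrite EFinM aform_integral// muleA -EFinM /K -mulrA.
by rewrite (_ : 2 / _ * _ = 1) ?mulr1//; field; rewrite gt_eqF.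
Qed.

Lemma le0_geometric (x K : R) : 0 <= K -> (forall n, x <= K * 8 ^- n) -> x <= 0.
Proof.
move=> K0 H; rewrite leNgt; apply/negP => x0.
have [n Hn] := exists_pow2_gt (K / x).
have := H n; rewrite leNgt => /negP; apply.
rewrite ltr_pdivrMr ?exprn_gt0// mulrC -ltr_pdivrMr//.
apply: (lt_le_trans Hn); apply: lerXn2r; rewrite ?nnegrE//.
by rewrite ler_nat.
Qed.

(** Direct method for the energy [J v = a(v, v) - 2 (g, v)]: the parallelogram identity shows that a
    minimising sequence with gaps 8^-n satisfies the hypothesis of [Htilde_complete]. *)
Lemma riesz g : L2 Omega g -> exists2 s, Htilde alpha Omega s &
  forall v, Htilde alpha Omega v -> aform alpha s v = inner Omega g v.
Proof.
move=> Lg; have [P P0 HP] := normL2_poincare.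
pose J v := aform alpha v v - 2 * inner Omega g v.
have Hs v : Htilde alpha Omega v -> Hspace alpha v by case.
pose G := normL2 Omega g.
have G0 : 0 <= G by exact: sqrtr_ge0.
have gle v : Htilde alpha Omega v -> `|inner Omega g v| <= G * P * Hnorm alpha v.
  move=> Hv; apply: le_trans (ip_le mO Lg (Htilde_L2 Hv)) _.
  by rewrite -mulrA ler_wpM2l//; exact: HP.
pose A := [set J v | v in Htilde alpha Omega].
have hA : has_inf A.
  split; first by exists (J (fun=> 0)); exists (fun=> 0) => //; exact: Htilde0.
  exists (- (G * P) ^+ 2) => _ [v Hv <-].
  have := le_trans (ler_norm _) (gle v Hv).
  rewrite /J -Hnorm_sqr//; set t := Hnorm _ _; set r := inner _ _ _; set q := G * P => h.
  have := sqr_ge0 (t - q); nra.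
set i := inf A.
have iJ v : Htilde alpha Omega v -> i <= J v.
  by move=> Hv; apply: ge_inf => //; [exact: hA.2|exists v].
have innD u v : Htilde alpha Omega u -> Htilde alpha Omega v ->
    inner Omega g (u \+ v) = inner Omega g u + inner Omega g v.
  by move=> /Htilde_L2 Hu /Htilde_L2 Hv; rewrite /inner; have := ipDl mO Hu Hv Lg; rewrite !(ipC _ _ _ g).
have innZ a u : Htilde alpha Omega u -> inner Omega g (fun x => a * u x) = a * inner Omega g u.
  by move=> /Htilde_L2 Hu; have := ipZl mO a Hu Lg; rewrite !(ipC _ _ _ g).
have /choice[v vP] : forall n, exists v, Htilde alpha Omega v /\ J v < i + 8 ^- n.
  move=> n; have [_ [v Hv <-] lv] : exists2 e, A e & e < inf A + 8 ^- n.
    by apply: inf_adherent => //; rewrite invr_gt0 exprn_gt0.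
  by exists v.
have Hv n : Htilde alpha Omega (v n) by case: (vP n).
have Jv n : J (v n) < i + 8 ^- n by case: (vP n).
have par u w : Htilde alpha Omega u -> Htilde alpha Omega w ->
    aform alpha (u \- w) (u \- w) <= 2 * (J u - i) + 2 * (J w - i).
  move=> Hu Hw; have Hm := HtildeZ 2^-1 (HtildeD Hu Hw).
  have := iJ _ Hm; rewrite /J.
  have [hu hw hd hb] : [/\ Hspace alpha u, Hspace alpha w, Hspace alpha (u \+ w) & Hspace alpha (u \- w)].
    by split; [exact: Hs|exact: Hs|apply: HspaceD; exact: Hs|apply: HspaceB; exact: Hs].
  have -> : inner Omega g (fun x => 2^-1 * (u \+ w) x) = 2^-1 * (inner Omega g u + inner Omega g w).
    by rewrite -innD// innZ//; exact: HtildeD.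
  rewrite (aformBl hu hw hb) (aformBr hu hw hu) (aformBr hu hw hw) (aformC _ w u).
  rewrite (aformZl 2^-1 hd); last exact: HspaceZ.
  rewrite (aformZr 2^-1 hd hd) aformDl// !aformDr//.
  rewrite (aformC _ w u); lra.
pose cc := 4 * (2 / @Cda R d alpha).
have [] := @Htilde_complete v cc => //.
- by rewrite mulr_ge0// divr_ge0// ltW.
- move=> n k nk.
  have Hkn := HtildeB (Hv k) (Hv n).
  have /(_ (Hs _ Hkn)) E := @aform_integral (v k \- v n).
  have hC : 0 < @Cda R d alpha / 2 by rewrite divr_gt0.
  rewrite -(@lee_pmul2l _ (@Cda R d alpha / 2)%:E)// ?lte_fin//.
  rewrite -E -EFinM lee_fin.
  have -> : @Cda R d alpha / 2 * (cc * 8 ^- n) = 4 * 8 ^- n.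
    by rewrite /cc; set e := 8 ^- n; field; rewrite gt_eqF.
  apply: le_trans (par _ _ (Hv k) (Hv n)) _.
  have := Jv k; have := Jv n.
  have : (8 : R) ^- k <= 8 ^- n.
    rewrite lef_pV2 ?posrE ?exprn_gt0// ler_weXn2l// ler1n//.
  lra.
move=> s Hsv sP; exists s => // w Hw.
have hw := Hs _ Hw; have hs := Hs _ Hsv.
apply/eqP; rewrite -subr_eq0 -sqrf_eq0 eq_le sqr_ge0 andbT.
apply: (@le0_geometric _ (2 * (4 + 1) * aform alpha w w)).
  by rewrite mulr_ge0// aform_ge0.
move=> n.
have hvn := Hs _ (Hv n).
(* For every t, J(v_n + t w) >= i > J(v_n) - 8^-n; the discriminant of this quadratic inequality in
   t bounds the residual of v_n. *)
have h1 : (aform alpha (v n) w - inner Omega g w) ^+ 2 <= 8 ^- n * aform alpha w w.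
  apply: quad_form_CS => [|t]; first exact: aform_ge0.
  have Ht := HtildeZ t Hw; have ht := Hs _ Ht.
  have := iJ _ (HtildeD (Hv n) Ht).
  have hd : Hspace alpha (v n \+ (fun x => t * w x)) by exact: HspaceD.
  rewrite /J aformDl// !aformDr// !aformZr ?aformZl// innD// innZ// (aformC _ w).
  have := Jv n; rewrite /J => h h'.
  rewrite expr2; lra.
have h2 : (aform alpha (v n \- s) w) ^+ 2 <= 4 * 8 ^- n * aform alpha w w.
  have hvs := HspaceB hvn hs.
  have := aform_le alpha0 hvs hw.
  rewrite -(@ler_pXn2r _ 2)// ?nnegrE ?mulr_ge0 ?Hnorm_ge0// -normrX ger0_norm ?sqr_ge0//.
  rewrite (exprMn _ (Hnorm alpha (v n \- s))) !Hnorm_sqr// => /le_trans; apply.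
  apply: ler_wpM2r; first exact: aform_ge0.
  rewrite -lee_fin aform_integral//.
  have hC : 0 < @Cda R d alpha / 2 by rewrite divr_gt0.
  apply: (@le_trans _ _ ((@Cda R d alpha / 2)%:E * (cc * 8 ^- n)%:E)%E).
    by apply: lee_wpmul2l; [rewrite lee_fin ltW|exact: sP].
  rewrite -EFinM lee_fin; apply: eq_lew.
  by rewrite /cc; set e := 8 ^- n; field; rewrite gt_eqF.
rewrite aformBl// in h2.
set a := aform alpha s w in h2 *; set b := inner Omega g w in h1 *.
set e := aform alpha (v n) w in h1 h2; set q := 8 ^- n * _ in h1.
have -> : 2 * (4 + 1) * aform alpha w w * 8 ^- n = 2 * (4 * q) + 2 * q by rewrite /q; ring.
rewrite -mulrA -/q in h2.
have := sqr_ge0 ((e - b) + (e - a)); nra.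
Qed.

Lemma SopP g : L2 Omega g -> Htilde alpha Omega (Sop alpha Omega g) /\
  forall v, Htilde alpha Omega v -> aform alpha (Sop alpha Omega g) v = inner Omega g v.
Proof.
move=> Lg; rewrite /Sop; case: xgetP => [s -> //|H].
by have [s s1 s2] := riesz Lg; case: (H s).
Qed.

End riesz.

(** * Simplices in barycentric coordinates *)

Section barycentric.
Context {R : realType} {d : nat}.
Implicit Types (K : tsimplex R d) (x y z : 'rV[R]_d) (I : {set 'I_d.+1}).

(** Weights [t] of total 1 with barycentre [x] solve [t *m vmatrix K = (1, x)], the column of ones
    carrying the normalisation. Inverting gives the barycentric coordinates, and the inverse without
    its first row holds their gradients. *)
Definition vmatrix K : 'M[R]_d.+1 := row_mx (const_mx 1 : 'M[R]_(d.+1, 1)) K.1.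

Definition bary K x (i : 'I_d.+1) : R :=
  ((row_mx (1%:M : 'M[R]_(1, 1)) x : 'rV[R]_d.+1) *m invmx (vmatrix K)) 0 i.

Definition bgrad K (i : 'I_d.+1) : 'rV[R]_d :=
  \row_j (invmx (vmatrix K)) (rshift 1 j) i.

Lemma vmatrixP K (t : 'rV[R]_d.+1) :
  t *m vmatrix K = row_mx (\sum_i t 0 i)%:M (\sum_i t 0 i *: row i K.1).
Proof.
have e1 : t *m (const_mx 1 : 'M[R]_(d.+1, 1)) = (\sum_i t 0 i)%:M.
  by apply/matrixP => a b; rewrite !ord1 !mxE mulr1n; apply: eq_bigr => i _; rewrite !mxE mulr1.
have e2 : t *m K.1 = \sum_i t 0 i *: row i K.1.
  by apply/rowP => j; rewrite !mxE summxE; apply: eq_bigr => i _; rewrite !mxE.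
by rewrite -e1 -e2; exact: (@mul_mx_row _ 1 d.+1 1 d t (const_mx 1) K.1).
Qed.

Lemma vmatrix_unit K : nondegenerate_simplex K -> vmatrix K \in unitmx.
Proof.
move=> ndK; rewrite -row_free_unit; apply/inj_row_free => t.
rewrite vmatrixP => tM; have : row_mx (\sum_i t 0 i)%:M (\sum_i t 0 i *: row i K.1) = row_mx (0 : 'M[R]_(1, 1)) (0 : 'rV[R]_d) by rewrite tM row_mx0.
move=> /eq_row_mx[/matrixP/(_ 0 0)].
rewrite !mxE mulr1n => t0 tz.
have : (\row_(i < d) t 0 (lift ord0 i)) *m (\matrix_(i < d) (vert K i.+1 - vert K 0)) = 0.
  move: tz; rewrite big_ord_recl => tz; apply/rowP => j.
  move: tz => /rowP/(_ j); rewrite !mxE summxE => tz.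
  under eq_bigr do rewrite !mxE mulrBr.
  rewrite big_split/= sumrN -mulr_suml.
  have -> : \sum_(i < d) t 0 (lift ord0 i) = - t 0 ord0.
    by apply/eqP; rewrite -addr_eq0 addrC -big_ord_recl t0.
  have -> : inord 0 = ord0 :> 'I_d.+1 by apply: val_inj; rewrite /= inordK.
  rewrite mulNr opprK addrC -[RHS]tz; congr (_ + _); apply: eq_bigr => i _; rewrite !mxE.
  by congr (_ * K.1 _ _); apply: val_inj; rewrite /= inordK// ltnS.
move=> /(congr1 (mulmx^~ (invmx (\matrix_(i < d) (vert K i.+1 - vert K 0))))).
rewrite mul0mx mulmxK// => /rowP tl.
have tl0 i : t 0 (lift ord0 i) = 0 by have := tl i; rewrite !mxE.
apply/rowP => i; rewrite mxE; case: (unliftP ord0 i) => [j ->|->]; first exact: tl0.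
by move: t0; rewrite big_ord_recl big1 ?addr0.
Qed.

Lemma simplex_dist K x y B : (forall i, enorm (row i K.1 - y) <= B) -> simplex K x -> enorm (x - y) <= B.
Proof.
move=> h [t [t0 _ t1 ->]].
have -> : \sum_i t i *: row i K.1 - y = \sum_i t i *: (row i K.1 - y).
  under [RHS]eq_bigr do rewrite scalerBr.
  by rewrite sumrB -scaler_suml t1 scale1r.
have : enorm (\sum_i t i *: (row i K.1 - y)) <= \sum_i t i * B.
  elim/big_ind2 : _ => [|u a v b ua vb|i _]; first by rewrite enorm0.
    exact: le_trans (enormD _ _) (lerD _ _).
  by rewrite enormZ ger0_norm// ler_wpM2l.
by rewrite -mulr_suml t1 mul1r.
Qed.

Section nondegenerate.
Variable K : tsimplex R d.
Hypothesis ndK : nondegenerate_simplex K.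
Let uK := vmatrix_unit ndK.

Lemma baryE x : row_mx (\sum_i bary K x i)%:M (\sum_i bary K x i *: row i K.1) = row_mx (1%:M : 'M[R]_(1, 1)) x.
Proof. by rewrite -vmatrixP mulmxKV. Qed.

Lemma bary_sum x : \sum_i bary K x i = 1.
Proof. by have /eq_row_mx[/matrixP/(_ 0 0)] := baryE x; rewrite !mxE !mulr1n. Qed.

Lemma bary_comb x : \sum_i bary K x i *: row i K.1 = x.
Proof. by have /eq_row_mx[] := baryE x. Qed.

Lemma bary_unique x (t : 'I_d.+1 -> R) : \sum_i t i = 1 -> \sum_i t i *: row i K.1 = x ->
  t =1 bary K x.
Proof.
move=> t1 tx i.
have := vmatrixP K (\row_i t i).
have -> : \sum_i (\row_i t i) 0 i = 1 by rewrite -[RHS]t1; apply: eq_bigr => j _; rewrite mxE.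
have -> : \sum_i (\row_i t i) 0 i *: row i K.1 = x.
  by rewrite -[RHS]tx; apply: eq_bigr => j _; rewrite mxE.
by rewrite /bary => <-; rewrite mulmxK// mxE.
Qed.

Lemma baryB x y i : bary K x i - bary K y i = dotp (bgrad K i) (x - y).
Proof.
rewrite /bary ![in LHS]mxE -sumrB (@big_split_ord _ _ _ 1 d)/= big_ord1.
rewrite !(@row_mxEl _ 1 1 d) subrr add0r /dotp; apply: eq_bigr => j _.
by rewrite !(@row_mxEr _ 1 1 d) !mxE; ring.
Qed.

Lemma bary_vertex i j : bary K (row i K.1) j = (i == j)%:R.
Proof.
rewrite -(@bary_unique (row i K.1) (fun j => (i == j)%:R))//.
  by rewrite (bigD1 i)//= eqxx big1 ?addr0// => k ki; rewrite eq_sym (negbTE ki).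
by rewrite (bigD1 i)//= eqxx scale1r big1 ?addr0// => k ki; rewrite eq_sym (negbTE ki) scale0r.
Qed.

Lemma baryC s x y i : bary K ((1 - s) *: x + s *: y) i = (1 - s) * bary K x i + s * bary K y i.
Proof.
have e : (1 - s) *: x + s *: y - x = s *: (y - x).
  by rewrite scalerBl scale1r scalerBr addrAC [x - _]addrC addrK addrC.
have := baryB ((1 - s) *: x + s *: y) x i; rewrite e dotpZr -baryB; lra.
Qed.

Lemma faceP I x : face K I x <-> forall i, 0 <= bary K x i /\ (i \notin I -> bary K x i = 0).
Proof.
split=> [[t [t0 tI t1 tx]] i|h].
  by rewrite -(@bary_unique x t)//; split; [exact: t0|exact: tI].
exists (bary K x); split; [by move=> i; case: (h i)|by move=> i; case: (h i)| |]; [exact: bary_sum|by rewrite bary_comb].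
Qed.

Lemma simplexP x : simplex K x <-> forall i, 0 <= bary K x i.
Proof.
split=> [/faceP h i|h]; first by case: (h i).
by apply/faceP => i; split=> //; rewrite inE.
Qed.

Lemma simplex_vertex i : simplex K (row i K.1).
Proof. by apply/simplexP => j; rewrite bary_vertex; case: eqP. Qed.

Lemma simplex_convex s x y : 0 <= s <= 1 -> simplex K x -> simplex K y -> simplex K ((1 - s) *: x + s *: y).
Proof.
move=> /andP[s0 s1] /simplexP hx /simplexP hy; apply/simplexP => i.
by rewrite baryC addr_ge0// mulr_ge0// subr_ge0.
Qed.

Lemma bary_le1 x i : simplex K x -> bary K x i <= 1.
Proof.
move=> /simplexP h; rewrite -(bary_sum x) (bigD1 i)//= lerDl.
by apply: sumr_ge0 => j _.
Qed.

Lemma bary_continuous i : continuous (fun x => bary K x i).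
Proof.
apply: (@lipschitz_continuous R d (fun x => bary K x i) (enorm (bgrad K i))) => x y; rewrite baryB.
exact: dotp_le.
Qed.

Lemma measurable_bary i : measurable_fun setT (fun x => bary K x i).
Proof. by apply: continuous_measurable_rV; exact: bary_continuous. Qed.

Lemma simplexE : simplex K = \bigcap_i [set x | 0 <= bary K x i].
Proof. by apply/seteqP; split=> x; [move=> /simplexP h i _; exact: h|move=> h; apply/simplexP => i; exact: h]. Qed.

Lemma closed_simplex : closed (simplex K).
Proof.
rewrite simplexE; apply: closed_bigI => i _.
apply: (@closed_comp _ _ (fun x => bary K x i) [set t | 0 <= t]) => [x _|]; last exact: closed_ge.
exact: bary_continuous.
Qed.

Lemma simplex_interiorP x : (simplex K)° x <-> forall i, 0 < bary K x i.
Proof.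
split=> [hx i|h].
  have Kx := interior_subset hx.
  rewrite lt_neqAle (iffLR (simplexP x) Kx i) andbT; apply/eqP => b0.
  (* If coordinate [i] vanished at [x], the points just beyond [x] on the line from vertex [i],
     reached with a negative parameter, would still lie in the simplex although this coordinate is
     negative there. *)
  have c : (fun t : R => (1 - t) *: x + t *: row i K.1) @ 0 --> x.
    have -> : nbhs x = nbhs ((1 - 0) *: x + 0 *: row i K.1 : 'rV[R]_d) by rewrite subr0 scale1r scale0r addr0.
    apply: cvgD; apply: cvgZr_tmp; last exact: cvg_id.
    by apply: cvgB; [exact: cvg_cst|exact: cvg_id].
  have := c _ hx; rewrite nbhs_simpl /= => /nbhs_ballP[e /= e0 /(_ (- (e / 2)))].
  rewrite /ball/= sub0r opprK ger0_norm ?divr_ge0 ?ltW// => /(_ _)/simplexP.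
  move=> /(_ _ i); have -> : (1 + e / 2) *: x + - (e / 2) *: row i K.1 = (1 - - (e / 2)) *: x + - (e / 2) *: row i K.1 by rewrite opprK.
  rewrite baryC bary_vertex eqxx -b0 mulr0 add0r mulr1 => h; suff : 0 <= - (e / 2) by rewrite oppr_ge0 leNgt divr_gt0.
  by apply: h; rewrite gtr_pMr// invf_lt1// ltr1n.
have : \forall y \near x, forall i, 0 < bary K y i.
  apply: (@filter_forall _ _ (fun i y => 0 < bary K y i) (nbhs x)) => i.
  exact: (@bary_continuous i x [set t | 0 < t] (lt_nbhsr (h i))).
by apply: filterS => y hy; apply/simplexP => i; exact/ltW/hy.
Qed.

Lemma simplex_boundaryP x : boundary (simplex K) x <-> simplex K x /\ exists i, bary K x i = 0.
Proof.
rewrite /boundary /= -(closure_id _).1; last exact: closed_simplex.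
split=> [[Kx nx]|[Kx [i b0]]]; split=> //.
  apply: contrapT => nex; apply: nx; apply/simplex_interiorP => i.
  rewrite lt_neqAle (iffLR (simplexP x) Kx i) andbT; apply/eqP => b0; apply: nex; by exists i.
by move=> /simplex_interiorP/(_ i); rewrite b0 ltxx.
Qed.

Lemma measurable_simplex : measurable (simplex K).
Proof. by apply: closed_measurable_rV; exact: closed_simplex. Qed.

Lemma measurable_simplex_interior : measurable (simplex K)°.
Proof. by apply: open_measurable_rV; exact: open_interior. Qed.

Lemma simplex_bounded : bounded_set (simplex K).
Proof.
pose B := \sum_i enorm (row i K.1).
exists B; split; first exact: num_real.
move=> M BM x Kx; apply: le_trans (norm_le_enorm _) _; apply: le_trans (ltW BM).
rewrite -[x]subr0; apply: (simplex_dist _ Kx) => i; rewrite subr0 /B (bigD1 i)//= lerDl.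
by apply: sumr_ge0 => j _; exact: enorm_ge0.
Qed.

End nondegenerate.
End barycentric.

(** * Lipschitz domains and exterior balls *)

Section enorm_topology.
Context {R : realType} {d : nat}.
Implicit Types (x y z : 'rV[R]_d) (A : set 'rV[R]_d).

Lemma nbhs_enormP x A : nbhs x A <-> exists2 e, 0 < e & forall y, enorm (y - x) < e -> A y.
Proof.
split=> [/nbhs_ballP[e /= e0 xA]|[e e0 xA]].
  exists e => // y xy; apply: xA; rewrite -ball_normE /= distrC.
  exact: le_lt_trans (norm_le_enorm _) xy.
apply/nbhs_ballP; exists (e / (d%:R + 1)) => /=; first by rewrite divr_gt0// ltr_wpDl.
move=> y; rewrite -ball_normE/= distrC => xy; apply: xA.
by apply: le_lt_trans (enorm_le_norm _) _; rewrite mulrC -ltr_pdivlMr// ltr_wpDl.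
Qed.

Lemma closure_enormP x A : closure A x <-> forall e, 0 < e -> exists2 y, A y & enorm (y - x) < e.
Proof.
split=> [cA e e0|h B /nbhs_enormP[e e0 xB]].
  have /cA[y [Ay By]] : nbhs x [set y | enorm (y - x) < e] by apply/nbhs_enormP; exists e.
  by exists y.
by have [y Ay xy] := h e e0; exists y; split=> //; exact: xB.
Qed.

Lemma within_continuous_enormP A (f : 'rV[R]_d -> R) x : {within A, continuous f} -> A x ->
  forall e, 0 < e -> exists2 r, 0 < r & forall y, A y -> enorm (y - x) < r -> `|f x - f y| < e.
Proof.
move=> cf Ax e e0.
have := (iffLR (subspace_continuousP A f) cf) x Ax => /(@cvgrPdist_lt _ _ _ _ _ _ _)/(_ _ e0).
rewrite near_withinE => /nbhs_enormP[r r0 h]; exists r => // y Ay yx; exact: h.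
Qed.

Lemma enorm_leN x y : enorm (x - y) <= enorm x + enorm y.
Proof. by have := enormD x (- y); rewrite enormN. Qed.

End enorm_topology.

Section lipschitz_domain.
Context {R : realType} {d : nat} (Omega : set 'rV[R]_d).
Hypothesis lipO : bounded_lipschitz_domain Omega.
Implicit Types (x y z w : 'rV[R]_d).

Let oO : open Omega. Proof. by case: lipO. Qed.
Let bO : bounded_set Omega. Proof. by case: lipO. Qed.

Lemma domain_measurable : measurable Omega.
Proof. exact: open_measurable_rV. Qed.

Lemma boundaryP x : boundary Omega x <-> closure Omega x /\ ~ Omega x.
Proof. by have E : Omega° = Omega; [exact/interior_id|rewrite /boundary E; split=> [[]|[]]]. Qed.

Lemma compact_boundary : compact (boundary Omega).
Proof.
apply: bounded_closed_compact.
  have [M _ hM] := bounded_set_closure_norm bO.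
  exists M; split; first exact: num_real.
  by move=> N MN x [cx _]; apply: le_trans (hM _ cx) (ltW MN).
rewrite /boundary setDE; apply: closedI; first exact: closed_closure.
exact/open_closedC/open_interior.
Qed.

(* In a boundary chart the points [x - r e + h] with [|h|] small against [r] lie below the graph. *)
Lemma exterior_balls_near x0 : boundary Omega x0 ->
  exists2 e, 0 < e & forall x r, enorm (x - x0) < e -> boundary Omega x -> 0 < r <= 1 ->
    exists2 y, enorm (y - x) <= r & forall w, enorm (w - y) <= e * r -> ~ closure Omega w.
Proof.
move=> bx0; have [_ _ _ _ /(_ _ bx0)[r0 [e [phi [L [r00 e1 phie phiL chart]]]]]] := lipO.
pose q := Num.min 1 (r0 / 4).
have q0 : 0 < q by rewrite lt_min ltr01 divr_gt0.
have q1 : q <= 1 by rewrite ge_min lexx.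
have qr : q <= r0 / 4 by rewrite ge_min lexx orbT.
(* With this [s] a displacement of length at most 2 s q r changes the height relative to the graph
   by at most q r / 2, half of the depth of the centre. *)
pose s := (4 * (`|L| + 1))^-1.
have s0 : 0 < s by rewrite invr_gt0 mulr_gt0.
have sL : (`|L| + 1) * s = 4^-1 by rewrite /s invfM mulrCA divff ?mulr1// gt_eqF.
have s4 : s <= 4^-1 by rewrite -sL ler_peMl// ?(ltW s0)// lerDr.
exists (q * s); first by rewrite mulr_gt0.
move=> x r xx0 /boundaryP[cx nx] /andP[r0' r1].
have qr0 : 0 < q * r by rewrite mulr_gt0.
have qrq : q * r <= q by rewrite ler_piMr// ltW.
exists (x - (q * r) *: e).
  by rewrite addrAC subrr sub0r enormN enormZ e1 mulr1 (ger0_norm (ltW qr0)) ler_piMl ?(ltW r0').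
have below h : enorm h <= 2 * s * (q * r) -> ~ Omega (x - (q * r) *: e + h).
  move=> hh.
  have s2 : 2 * s * (q * r) <= q.
    apply: le_trans qrq; rewrite ler_piMl ?ltW//; lra.
  have qs : q * s <= q by rewrite ler_piMr ?ltW//; lra.
  have near : enorm (x - (q * r) *: e + h - x0) < r0.
    have -> : x - (q * r) *: e + h - x0 = (x - x0) + (h - (q * r) *: e).
      by rewrite addrACA -addrA [h + _]addrC -addrA [- x0 + _]addrC !addrA.
    apply: le_lt_trans (enormD _ _) _.
    have := enorm_leN h ((q * r) *: e); rewrite enormZ e1 mulr1 (ger0_norm (ltW qr0)) => t.
    lra.
  have xnear : enorm (x - x0) < r0 by lra.
  move/(chart _ near).
  have -> : phi (x - (q * r) *: e + h) = phi (x + h).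
    by rewrite addrAC -scaleNr phie.
  rewrite dotpDl dotpBl dotpZl.
  have -> : dotp e e = 1 by rewrite -enorm_sqr e1 expr1n.
  have := phiL (x + h) x; rewrite [x + h - x]addrAC subrr add0r => lp.
  have px : dotp x e <= phi x.
    rewrite leNgt; apply/negP => H; apply: nx; exact: (iffRL (chart _ xnear)).
  have dh : `|dotp h e| <= enorm h by have := dotp_le h e; rewrite e1 mulr1.
  have Lh : L * enorm h <= `|L| * enorm h by rewrite ler_wpM2r ?enorm_ge0// ler_norm.
  have Lh2 : (`|L| + 1) * enorm h <= (q * r) / 2.
    apply: (@le_trans _ _ ((`|L| + 1) * (2 * s * (q * r)))); first by rewrite ler_wpM2l// ltW.
    have -> : (`|L| + 1) * (2 * s * (q * r)) = ((`|L| + 1) * s) * (2 * (q * r)) by ring.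
    rewrite sL; lra.
  move: lp; rewrite ler_norml => /andP[lp _].
  move: dh; rewrite ler_norml => /andP[_ dh].
  lra.
move=> w wy /closure_enormP/(_ (s * (q * r))); case; first by rewrite mulr_gt0.
move=> u Ou uw; apply: (below (u - (x - (q * r) *: e))); last by rewrite addrC subrK.
apply: le_trans (enorm_triangle _ w _) _; rewrite -mulrA mulr_natl mulr2n; apply: lerD; first exact: ltW.
by rewrite mulrCA mulrA.
Qed.

(** Compactness of the boundary makes the ratio [e] of [exterior_balls_near] uniform: the property
    is inherited by smaller [e], so the covering argument runs along the filter of small positive
    numbers. *)
Lemma exterior_balls :
  exists2 e, 0 < e & forall x r, boundary Omega x -> 0 < r <= 1 ->
    exists2 y, enorm (y - x) <= r & forall w, enorm (w - y) <= e * r -> ~ closure Omega w.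
Proof.
pose P (e : R) x := forall r, 0 < r <= 1 ->
    exists2 y, enorm (y - x) <= r & forall w, enorm (w - y) <= e * r -> ~ closure Omega w.
have /compact_near_coveringP/(_ R (0 : R)^'+ (fun e x => boundary Omega x -> P e x) _) := compact_boundary.
case.
  move=> x0 bx0; have [e e0 he] := exterior_balls_near bx0.
  exists ([set x | enorm (x - x0) < e], [set t : R | 0 < t < e]); last first.
    move=> [x t] /= [xx0 /andP[t0 te]] bx r /andP[r0 r1].
    have [|y yx hy] := he x r xx0 bx; first by rewrite r0.
    by exists y => // w wy; apply: hy; apply: le_trans wy _; rewrite ler_wpM2r ?ltW.
  split=> /=; first by apply/nbhs_enormP; exists e.
  by near=> t; apply/andP; split; near: t; [exact: nbhs_right_gt|exact: nbhs_right_lt].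
move=> e /= e0 he; exists (e / 2); first by rewrite divr_gt0.
move=> x r bx r01; apply: (he (e / 2) _ _ x bx bx r r01).
  by rewrite /ball/= sub0r normrN gtr0_norm ?divr_gt0// ltr_pdivrMr// ltr_pMr// ltr1n.
by rewrite divr_gt0.
Unshelve. all: by end_near. Qed.

(** Otherwise the point would be a boundary point, and exterior balls give points outside the
    closure arbitrarily near to it. Thus a Lipschitz domain has no slits. *)
Lemma interior_closure_domain : (closure Omega)° `<=` Omega.
Proof.
have [e e0 ext] := exterior_balls.
move=> x ix; apply: contrapT => nx.
have bx : boundary Omega x by apply/boundaryP; split=> //; exact: interior_subset.
have /nbhs_enormP[r r0 hr] := ix.
pose t := Num.min 1 (r / 2).
have t0 : 0 < t by rewrite lt_min ltr01 divr_gt0.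
have t1 : t <= 1 by rewrite ge_min lexx.
have [|y yx] := ext x t bx; first by rewrite t0.
move/(_ y); rewrite subrr enorm0; case; first by rewrite mulr_ge0 ?ltW.
apply: hr; apply: le_lt_trans yx _.
by apply: le_lt_trans (_ : r / 2 < r); [rewrite ge_min lexx orbT|rewrite ltr_pdivrMr// ltr_pMr// ltr1n].
Qed.

End lipschitz_domain.

Lemma continuous_sum (R : realType) (T : topologicalType) (I : Type) (r : seq I) (F : I -> T -> R) :
  (forall i, continuous (F i)) -> continuous (fun x => \sum_(i <- r) F i x).
Proof.
move=> cF; elim: r => [|i r IH] x.
  rewrite (_ : (fun y => _) = fun=> 0); last by apply/funext => y; rewrite big_nil.
  exact: cvg_cst.
rewrite (_ : (fun y => _) = fun y => F i y + \sum_(j <- r) F j y); last by apply/funext => y; rewrite big_cons.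
by apply: (@cvgD _ _ _ (nbhs x)); [exact: cF|exact: IH].
Qed.

(** * Boundary values of H^1_0 functions *)

Section directional.
Context {R : realType} {d : nat}.
Implicit Types (x e : 'rV[R]_d) (f : 'rV[R]_d -> R).
Local Notation mu := (@lebesgue_rV R d).

Lemma is_derive_line f x e (s : R) : derivable f (x + s *: e) e ->
  is_derive s 1 (fun t : R => f (x + t *: e)) ('D_e f (x + s *: e)).
Proof.
move=> df.
have E : (fun h : R => h^-1 *: (((fun t : R => f (x + t *: e)) \o shift s) (h *: 1) - f (x + s *: e))) =
         (fun h => h^-1 *: ((f \o shift (x + s *: e)) (h *: e) - f (x + s *: e))).
  apply/funext => h /=; congr (_ *: (f _ - _)).
  by rewrite /shift/= -[h%:A]/(h * 1) mulr1 scalerDl addrCA.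
by split; [rewrite /derivable E|rewrite /derive E].
Qed.

Lemma derive_dotp f x e : differentiable f x ->
  'D_e f x = dotp e (\row_i partial i f x).
Proof.
move=> df; rewrite deriveE// [in LHS](row_sum_delta e) linear_sum /dotp.
by apply: eq_bigr => i _; rewrite linearZ/= mxE /partial deriveE.
Qed.

Lemma integral_shift_sqr (g : 'rV[R]_d -> R) e (c : R) : measurable_fun setT g -> 0 <= c ->
  (\int[mu]_x (c%:E * ((g (x + e)) ^+ 2)%:E) = c%:E * \int[mu]_x (g x ^+ 2)%:E)%E.
Proof.
move=> mg c0.
have ms : measurable_fun setT (fun x => g (x + e)).
  by apply: (measurableT_comp mg); apply: measurable_addrV => //; exact: measurable_cst.
rewrite ge0_integralZl//.
- congr (_ * _)%E; apply: (@ge0_integral_shift _ _ e (fun x => (g x ^+ 2)%:E)).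
    by apply/measurable_EFinP/measurable_funX.
  by move=> x; rewrite lee_fin sqr_ge0.
- by apply/measurable_EFinP/measurable_funX.
- by move=> x _; rewrite lee_fin sqr_ge0.
Qed.

(* Fundamental theorem of calculus and Cauchy-Schwarz on the segment, then Tonelli and
   translation invariance. *)
Lemma difference_quotient_le f e (t : R) : 0 < t -> enorm e = 1 -> (forall x, differentiable f x) ->
  (forall i, continuous (partial i f)) ->
  (\int[mu]_x ((f (x + t *: e) - f x) ^+ 2)%:E <= (t ^+ 2)%:E * \sum_(i < d) \int[mu]_x ((partial i f x) ^+ 2)%:E)%E.
Proof.
move=> t0 e1 df cpf.
pose g x := 'D_e f x.
have gE x : g x = \sum_(i < d) e 0 i * partial i f x.
  by rewrite /g derive_dotp//; apply: eq_bigr => i _; rewrite mxE.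
have cg : continuous g.
  rewrite (_ : g = fun x => \sum_(i < d) e 0 i * partial i f x); last by apply/funext => x; rewrite gE.
  by apply: continuous_sum => i x; apply: (@cvgM _ _ (nbhs x) _ (fun=> e 0 i)); [exact: cvg_cst|exact: cpf].
have mg : measurable_fun setT g by exact: continuous_measurable_rV.
have mp i : measurable_fun setT (partial i f) := continuous_measurable_rV (cpf i).
have cline x : continuous (fun s : R => x + s *: e).
  by move=> s; apply: cvgD; [exact: cvg_cst|apply: cvgZr_tmp; exact: cvg_id].
have cgl x : continuous (fun s : R => g (x + s *: e)).
  by move=> s; apply: continuous_comp; [exact: cline|exact: cg].
have sq x : sqint lebesgue_measure `[0, t] (fun s : R => g (x + s *: e)).
  split; first by apply: measurable_funTS; exact: continuous_measurable_fun.
  have /integrableP[_] : lebesgue_measure.-integrable `[0, t] (EFin \o (fun s : R => g (x + s *: e) ^+ 2)).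
    apply: continuous_compact_integrable; first exact: segment_compact.
    apply: continuous_subspaceT => s; apply: (@continuous_comp _ _ _ (fun s : R => g (x + s *: e)) (fun u => u ^+ 2)).
      exact: cgl.
    exact: exprn_continuous.
  apply: le_lt_trans; apply: eq_lew; apply: eq_integral => s _ /=.
  by rewrite ger0_norm ?sqr_ge0.
have sq1 : sqint lebesgue_measure `[0, t] (fun=> 1 : R).
  split; first exact: measurable_cst.
  under eq_integral do rewrite expr1n.
  by rewrite integral_cst//= mul1e lebesgue_measure_itv/= lte_fin t0 -EFinB ltry.
have ip1 : ip lebesgue_measure `[0, t] (fun=> 1 : R) (fun=> 1) = t.
  apply: EFin_inj; rewrite EFin_ip//.
  under eq_integral do rewrite expr1n.
  by rewrite integral_cst//= mul1e lebesgue_measure_itv/= lte_fin t0 -EFinB subr0.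
have ftc x : ip lebesgue_measure `[0, t] (fun s : R => g (x + s *: e)) (fun=> 1) = f (x + t *: e) - f x.
  rewrite /ip /Rintegral; under eq_integral do rewrite mulr1.
  rewrite (@continuous_FTC2 _ _ (fun s => f (x + s *: e)) 0 t t0).
  - by rewrite scale0r addr0 -EFinB.
  - by apply: continuous_subspaceT; exact: cgl.
  - have dl s : derivable (fun s : R => f (x + s *: e)) s 1.
      by apply: ex_derive; apply: is_derive_line; exact: diff_derivable.
    have cl : continuous (fun s : R => f (x + s *: e)).
      by move=> s; apply: differentiable_continuous; apply/derivable1_diffP.
    split; first by move=> s _.
      by apply: cvg_at_right_filter; exact: cl.
    by apply: cvg_at_left_filter; exact: cl.
  - move=> s _; rewrite derive1E; apply: derive_val; apply: is_derive_line; exact: diff_derivable.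
have pw x : (((f (x + t *: e) - f x) ^+ 2)%:E <= t%:E * \int[lebesgue_measure]_(s in `[0%R, t]) ((g (x + s *: e)) ^+ 2)%:E)%E.
  rewrite -ftc -EFin_ip// -EFinM lee_fin mulrC -[X in _ * X]ip1.
  by apply: ip_CS.
have mline : measurable_fun setT (fun p : 'rV[R]_d * R => p.1 + p.2 *: e).
  apply: measurable_addrV; first exact: measurable_fst.
  apply: measurable_fun_rV => i; apply: (eq_measurable_fun (fun p : 'rV[R]_d * R => p.2 * e 0 i)).
    by move=> p _; rewrite mxE.
  by apply: measurable_funM; [exact: measurable_snd|exact: measurable_cst].
have mgl : measurable_fun setT (fun p : 'rV[R]_d * R => g (p.1 + p.2 *: e)).
  exact: (measurableT_comp mg mline).
pose F := fun p : 'rV[R]_d * R => ((g (p.1 + p.2 *: e)) ^+ 2 * \1_`[0, t] p.2)%:E.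
have F0 p : (0 <= F p)%E by rewrite lee_fin mulr_ge0 ?sqr_ge0// indicE.
have mF : measurable_fun setT F.
  apply/measurable_EFinP; apply: measurable_funM; first exact: measurable_funX.
  have m1 : measurable_fun setT (\1_`[0, t] : R -> R) by exact: measurable_indic.
  exact: (measurableT_comp m1 measurable_snd).
have FE x : (\int[lebesgue_measure]_(s in `[0%R, t]) ((g (x + s *: e)) ^+ 2)%:E = \int[lebesgue_measure]_s F (x, s))%E.
  rewrite integral_mkcond; apply: eq_integral => s _; rewrite patchE /F /= indicE.
  by case: ifP => _; rewrite ?mulr1 ?mulr0.
have tF := @fubini_tonelli _ _ _ _ R mu (@lebesgue_measure R) F mF F0.
have I2 : (\int[mu]_x ((f (x + t *: e) - f x) ^+ 2)%:E <= t%:E * (t%:E * \int[mu]_x (g x ^+ 2)%:E))%E.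
  have mf : measurable_fun setT f.
    by apply: continuous_measurable_rV => x; exact: differentiable_continuous.
  apply: (@le_trans _ _ (\int[mu]_x (t%:E * \int[lebesgue_measure]_s F (x, s)))%E).
    apply: nonneg_le_integral => //.
    - by move=> x _; rewrite lee_fin sqr_ge0.
    - by move=> x _; rewrite -FE.
  rewrite ge0_integralZl//; last by rewrite lee_fin ltW.
  - apply: lee_wpmul2l; first by rewrite lee_fin ltW.
    have shiftE (s c : R) := @integral_shift_sqr g (s *: e) c mg.
    have E2 : (\int[lebesgue_measure]_y \int[mu]_x F (x, y) = \int[lebesgue_measure]_s ((\1_`[0, t] s)%:E * \int[mu]_x (g x ^+ 2)%:E))%E.
      apply: eq_integral => s _; rewrite /F/= -(shiftE s); last by rewrite indicE.
      by apply: eq_integral => x _; rewrite EFinM muleC.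
    rewrite tF E2 ge0_integralZr//.
    + rewrite (_ : (\int[_]_x _)%E = t%:E)// integral_indic// setIT.
      by apply: etrans (lebesgue_measure_itv _) _; rewrite /= lte_fin t0 -EFinB subr0.
    + by apply/measurable_EFinP; exact: measurable_indic.
    + by apply: integral_ge0 => x _; rewrite lee_fin sqr_ge0.
  - exact: measurable_fun_fubini_tonelli_F.
  - by move=> x _; apply: integral_ge0.
have mp2 i : measurable_fun setT (fun x => ((partial i f x) ^+ 2)%:E) := (iffRL (measurable_EFinP _ _)) (measurable_funX 2 (mp i)).
apply: (le_trans I2); rewrite muleA -EFinM -expr2; apply: lee_wpmul2l; first by rewrite lee_fin sqr_ge0.
rewrite -ge0_integral_sum//; last first.
- by move=> i x _; rewrite lee_fin sqr_ge0.
apply: nonneg_le_integral => //.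
- by move=> x _; rewrite lee_fin sqr_ge0.
move=> x _; rewrite sumEFin lee_fin /g derive_dotp//.
apply: le_trans (_ : enorm (\row_i partial i f x) ^+ 2 <= _).
  have := dotp_le e (\row_i partial i f x); rewrite e1 mul1r => h.
  by rewrite -real_normK ?num_real// lerXn2r// nnegrE ?enorm_ge0.
by rewrite enorm_sqr; apply: ler_sum => i _; rewrite mxE expr2.
Qed.

End directional.

Section H10_trace.
Context {R : realType} {d : nat} (Omega : set 'rV[R]_d).
Hypothesis lipO : bounded_lipschitz_domain Omega.
Implicit Types (x e : 'rV[R]_d) (f v : 'rV[R]_d -> R).
Local Notation mu := (@lebesgue_rV R d).

Let mO : measurable Omega. Proof. exact: domain_measurable. Qed.

Lemma bounded_L2 f M : measurable_fun Omega f -> (forall x, Omega x -> `|f x| <= M) -> L2 Omega f.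
Proof.
move=> mf fM; split=> //.
have [B _ hB] := bounded_set_closure_norm (let: And5 _ _ _ h _ := lipO in h).
have fin : (mu Omega < +oo)%E.
  by apply: (@lebesgue_rV_lty _ _ _ B) => // x Ox; apply: hB; exact: subset_closure.
apply: (@le_lt_trans _ _ (\int[mu]_(x in Omega) (M ^+ 2)%:E)%E).
  apply: nonneg_le_integral => //.
  - by move=> x _; rewrite lee_fin sqr_ge0.
  - move=> x Ox; rewrite lee_fin -real_normK ?num_real// lerXn2r ?nnegrE//; last exact: fM.
    by apply: le_trans (fM x Ox).
by rewrite integral_cst//= lte_mul_pinfty ?lee_fin ?sqr_ge0.
Qed.

Lemma partial_out (K : set 'rV[R]_d) f i : closed K -> (forall x, ~ K x -> f x = 0) ->
  forall x, ~ K x -> partial i f x = 0.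
Proof.
move=> cK f0 x nK; have oK : open (~` K) by exact: closed_openC.
rewrite /partial (@near_eq_derive _ _ _ f (fun=> 0) x 'e_i) ?derive_cst//.
have : \forall y \near x, (~` K) y by apply: open_nbhs_nbhs.
by apply: filterS => y ny; rewrite f0.
Qed.

Lemma compact_support_bounded (K : set 'rV[R]_d) f : compact K -> continuous f ->
  (forall x, ~ K x -> f x = 0) -> exists M : R, forall x, `|f x| <= M.
Proof.
move=> cK cf f0.
have : compact (f @` K) by apply: continuous_compact => //; exact: continuous_subspaceT.
move/compact_bounded => -[M [_ hM]].
exists (`|M| + 1) => x; have [Kx|nK] := pselect (K x).
  apply: hM; last by exists x.
  by apply: le_lt_trans (ler_norm M) _; rewrite ltrDl.
by rewrite f0// normr0 addr_ge0.
Qed.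

(* A test function vanishes at [x + t e], so its value at [x] is a difference. *)
Lemma H10_strip v e : H10 Omega v -> enorm e = 1 -> exists2 G : R, 0 < G &
  forall t (S : set 'rV[R]_d), 0 < t -> measurable S -> S `<=` Omega -> (forall x, S x -> ~ Omega (x + t *: e)) ->
  (\int[mu]_(x in S) (v x ^+ 2)%:E <= (t ^+ 2 * G)%:E)%E.
Proof.
move=> [L2v [g [phi [L2g tphi cv cg]]]] e1.
pose G0 : R := \sum_(i < d) (2 + 2 * normL2 Omega (g i) ^+ 2).
have G00 : 0 <= G0 by apply: sumr_ge0 => i _; rewrite addr_ge0// mulr_ge0// sqr_ge0.
exists (2 * G0 + 1); first by rewrite ltr_wpDl// mulr_ge0.
move=> t S t0 mS SO SN.
(* The slack [del] pays for replacing [v] by a test function close to it in L^2. The derivatives of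
   the test function differ from [g i] by at most 1 in L^2, which explains the summands 2 + 2
   |g_i|^2 of [G0]. *)
apply/lee_addgt0Pr => del del0.
have near1 : \forall m \near \oo, forall i : 'I_d, normL2 Omega (partial i (phi m) \- g i) <= 1.
  apply: filter_forall => i.
  have /cvgrPdist_le/(_ 1 ltr01) := cg i.
  by apply: filterS => m; rewrite sub0r normrN; apply: le_trans; exact: ler_norm.
pose eta : R := Num.sqrt (del / 2).
have eta0 : 0 < eta by rewrite sqrtr_gt0 divr_gt0.
have near2 : \forall m \near \oo, normL2 Omega (phi m \- v) <= eta.
  have /cvgrPdist_le/(_ _ eta0) := cv.
  by apply: filterS => m; rewrite sub0r normrN; apply: le_trans; exact: ler_norm.
have [m [h1 h2]] : exists m, (forall i : 'I_d, normL2 Omega (partial i (phi m) \- g i) <= 1) /\ normL2 Omega (phi m \- v) <= eta.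
  have [N _ hN] := filterI near1 near2.
  by exists N; apply: hN => /=.
have [sphi [K [cK KO phi0]]] := tphi m.
have clK : closed K by exact: compact_closed.
have df x : differentiable (phi m) x by exact: (sphi [::]).
have cphi : continuous (phi m) by move=> x; exact: differentiable_continuous.
have cp i : continuous (partial i (phi m)) by move=> x; apply: differentiable_continuous; exact: (sphi [:: i]).
have p0 i x : ~ K x -> partial i (phi m) x = 0 by exact: partial_out.
have L2p i : L2 Omega (partial i (phi m)).
  have [M hM] := compact_support_bounded cK (cp i) (p0 i).
  by apply: (@bounded_L2 _ M) => //; apply: measurable_funTS; exact: continuous_measurable_rV.
have L2phi : L2 Omega (phi m).
  have [M hM] := compact_support_bounded cK cphi phi0.
  by apply: (@bounded_L2 _ M) => //; apply: measurable_funTS; exact: continuous_measurable_rV.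
have mphi : measurable_fun setT (phi m) by exact: continuous_measurable_rV.
have Ip i : (\int[mu]_x ((partial i (phi m) x) ^+ 2)%:E <= (2 + 2 * normL2 Omega (g i) ^+ 2)%:E)%E.
  have -> : (\int[mu]_x ((partial i (phi m) x) ^+ 2)%:E = \int[mu]_(x in Omega) ((partial i (phi m) x) ^+ 2)%:E)%E.
    rewrite [RHS]integral_mkcond; apply: eq_integral => x _; rewrite patchE.
    case: ifPn => //; rewrite notin_setE => nx; rewrite p0 ?expr0n//.
    by move=> /KO.
  have -> : normL2 Omega (g i) ^+ 2 = ip mu Omega (g i) (g i) by exact: ipnorm_sqr.
  have sB : sqint mu Omega (partial i (phi m) \- g i) by exact: (sqintB mO (L2p i) (L2g i)).
  apply: (@le_trans _ _ (\int[mu]_(x in Omega) ((2 * ((partial i (phi m) \- g i) x ^+ 2))%:E + (2 * (g i x ^+ 2))%:E))%E).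
    apply: nonneg_le_integral => //.
    - by move=> x _; rewrite lee_fin sqr_ge0.
    - move=> x _; rewrite -EFinD lee_fin /=; have := sqr_ge0 (partial i (phi m) x - 2 * g i x); lra.
  rewrite ge0_integralD//.
  - under eq_integral do rewrite EFinM.
    under [X in (_ + X)%E]eq_integral do rewrite EFinM.
    rewrite !ge0_integralZl//.
    + rewrite -(EFin_ip sB) -(EFin_ip (L2g i : sqint mu Omega (g i))) -!EFinM -EFinD lee_fin lerD2r -[X in _ <= X]mulr1 ler_wpM2l//.
      rewrite -ipnorm_sqr expr_le1//; [exact: h1|exact: sqrtr_ge0].
    + by apply/measurable_EFinP/measurable_funX; case: (L2g i).
    + by move=> x _; rewrite lee_fin sqr_ge0.
    + by apply/measurable_EFinP/measurable_funX; case: sB.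
    + by move=> x _; rewrite lee_fin sqr_ge0.
  - by move=> x _; rewrite lee_fin mulr_ge0// sqr_ge0.
  - by apply/measurable_EFinP; apply: measurable_funM => //; apply: measurable_funX; case: sB.
  - by move=> x _; rewrite lee_fin mulr_ge0// sqr_ge0.
  - by apply/measurable_EFinP; apply: measurable_funM => //; apply: measurable_funX; case: (L2g i).
have Iphi : (\int[mu]_(x in S) (phi m x ^+ 2)%:E <= (t ^+ 2 * G0)%:E)%E.
  apply: (@le_trans _ _ (\int[mu]_x ((phi m (x + t *: e) - phi m x) ^+ 2)%:E)%E).
    have mt : measurable_fun setT (fun x => ((phi m (x + t *: e) - phi m x) ^+ 2)%:E).
      apply/measurable_EFinP/measurable_funX/measurable_funB => //.
      by apply: (measurableT_comp mphi); apply: measurable_addrV => //; exact: measurable_cst.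
    apply: (@le_trans _ _ (\int[mu]_(x in S) ((phi m (x + t *: e) - phi m x) ^+ 2)%:E)%E).
      apply: nonneg_le_integral => //.
      - by move=> x _; rewrite lee_fin sqr_ge0.
      - by move=> x Sx; rewrite lee_fin [phi m (x + _)]phi0 ?sub0r ?sqrrN// => /KO; exact: SN.
    by apply: ge0_subset_integral => // x _; rewrite lee_fin sqr_ge0.
  apply: (le_trans (difference_quotient_le t0 e1 df cp)).
  rewrite [(t ^+ 2 * G0)%:E]EFinM; apply: lee_wpmul2l; first by rewrite lee_fin sqr_ge0.
  by rewrite /G0 -sumEFin; apply: lee_sum => i _; exact: Ip.
have sB : sqint mu Omega (phi m \- v) by exact: (sqintB mO L2phi L2v).
have IB : (\int[mu]_(x in S) ((phi m \- v) x ^+ 2)%:E <= (del / 2)%:E)%E.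
  apply: (@le_trans _ _ (\int[mu]_(x in Omega) ((phi m \- v) x ^+ 2)%:E)%E).
    apply: ge0_subset_integral => //.
      by apply/measurable_EFinP/measurable_funX; case: sB.
    by move=> x _; rewrite lee_fin sqr_ge0.
  rewrite -(EFin_ip sB) lee_fin -ipnorm_sqr -[leRHS]sqr_sqrtr ?divr_ge0 ?(ltW del0)//.
  by rewrite lerXn2r// nnegrE ?sqrtr_ge0.
apply: (@le_trans _ _ (\int[mu]_(x in S) ((2 * ((phi m \- v) x ^+ 2))%:E + (2 * (phi m x ^+ 2))%:E))%E).
  have mvS : measurable_fun S v by apply: measurable_funS SO _ => //; case: L2v.
  have mpS : measurable_fun S (phi m) by exact: measurable_funTS.
  apply: nonneg_le_integral => //.
  - by move=> x _; rewrite lee_fin sqr_ge0.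
  - move=> x _; rewrite -EFinD lee_fin /=; have := sqr_ge0 (v x - 2 * phi m x); lra.
have mvS : measurable_fun S (phi m \- v) by apply: measurable_funS SO _ => //; case: sB.
have mpS : measurable_fun S (phi m) by exact: measurable_funTS.
rewrite ge0_integralD//; last first.
- by apply/measurable_EFinP; apply: measurable_funM => //; apply: measurable_funX.
- by move=> x _; rewrite lee_fin mulr_ge0// sqr_ge0.
- by apply/measurable_EFinP; apply: measurable_funM => //; apply: measurable_funX.
- by move=> x _; rewrite lee_fin mulr_ge0// sqr_ge0.
under eq_integral do rewrite EFinM.
under [X in (_ + X)%E]eq_integral do rewrite EFinM.
rewrite !ge0_integralZl//; last first.
- by move=> x _; rewrite lee_fin sqr_ge0.
- by apply/measurable_EFinP/measurable_funX.
- by move=> x _; rewrite lee_fin sqr_ge0.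
- by apply/measurable_EFinP/measurable_funX.
apply: (@le_trans _ _ (2%:E * (del / 2)%:E + 2%:E * (t ^+ 2 * G0)%:E)%E).
  by apply: leeD; apply: lee_wpmul2l.
rewrite -!EFinM -!EFinD lee_fin; have := sqr_ge0 t; lra.
Qed.

End H10_trace.

Section trace_zero.
Context {R : realType} {d : nat} (Omega : set 'rV[R]_d).
Hypothesis lipO : bounded_lipschitz_domain Omega.
Implicit Types (x e : 'rV[R]_d) (v : 'rV[R]_d -> R).
Local Notation mu := (@lebesgue_rV R d).

(* If [v] did not vanish at a boundary point, the mass of [v ^ 2] on a boundary strip of width
   [t] would be at least of order [t], but it is at most of order [t ^ 2]. *)
Lemma H10_boundary0 v : {within closure Omega, continuous v} -> H10 Omega v ->
  forall x, boundary Omega x -> v x = 0.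
Proof.
move=> cv Hv x0 bx0; apply/eqP; apply: contrapT => /negP v0.
have [oO mO] : open Omega /\ measurable Omega by split; [case: lipO|exact: domain_measurable].
have [_ _ _ _ /(_ _ bx0)[r0 [e [phi [L [r00 e1 phie phiL chart]]]]]] := lipO.
have [cx nx] := (iffLR (boundaryP lipO x0) bx0).
pose m : R := `|v x0| / 2.
have m0 : 0 < m by rewrite divr_gt0// normr_gt0.
have [r1 r10 near1] := within_continuous_enormP cv cx m0.
have big x : closure Omega x -> enorm (x - x0) < r1 -> m ^+ 2 <= v x ^+ 2.
  move=> Cx xx0; have := near1 x Cx xx0 => h.
  rewrite -[v x ^+ 2]real_normK ?num_real// lerXn2r ?nnegrE ?(ltW m0)//.
  have := ler_normD (v x0 - v x) (v x); rewrite subrK.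
  have : `|v x0| = 2 * m by rewrite /m; field.
  lra.
have e1' : enorm (- e) = 1 by rewrite enormN.
have [G G0 strip] := H10_strip lipO Hv e1'.
have L1 : 1 <= `|L| + 1 by rewrite lerDr.
(* Not being in [Omega] puts [x0] on or below the graph; being a limit of points of [Omega] puts it
   on or above. *)
have phix0 : phi x0 = dotp x0 e.
  apply/eqP; rewrite eq_le; apply/andP; split; last first.
    rewrite leNgt; apply/negP => H; apply: nx; apply: (iffRL (chart _ _)) => //.
    by rewrite subrr enorm0.
  apply/ler_addgt0Pr => del del0.
  have mdel : 0 < Num.min r0 (del / (`|L| + 1)) by rewrite lt_min r00 divr_gt0// (lt_le_trans ltr01 L1).
  have [y Oy] := iffLR (closure_enormP _ _) cx _ mdel.
  rewrite lt_min => /andP[yr]; rewrite ltr_pdivlMr ?(lt_le_trans ltr01 L1)// => yd.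
  have := iffLR (chart _ yr) Oy; have := phiL y x0; have := dotp_le (y - x0) e.
  rewrite e1 mulr1 dotpBl !ler_norml => /andP[_ a1] /andP[a2 a3] a4.
  have a5 : L * enorm (y - x0) <= `|L| * enorm (y - x0) by rewrite ler_wpM2r ?enorm_ge0// ler_norm.
  lra.
(* Height above the graph: in the chart [Omega] is where it is positive, and moving down along [e]
   by [s] lowers it by exactly [s]. *)
pose del x := dotp x e - phi x.
have delE x s : del (x - s *: e) = del x - s.
  rewrite /del -scaleNr phie dotpDl dotpZl.
  have -> : dotp e e = 1 by rewrite -enorm_sqr e1 expr1n.
  lra.
pose rho := Num.min r0 r1 / 8.
have mr0 : 0 < Num.min r0 r1 by rewrite lt_min r00.
have rho0 : 0 < rho by rewrite divr_gt0.
have rhor x : enorm (x - x0) <= 4 * rho -> enorm (x - x0) < r0 /\ enorm (x - x0) < r1.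
  move=> h; have : enorm (x - x0) < Num.min r0 r1.
    by apply: le_lt_trans h _; rewrite /rho; lra.
  by rewrite lt_min => /andP.
clearbody rho.
have inO x : enorm (x - x0) <= 4 * rho -> Omega x <-> 0 < del x.
  by move=> /rhor[h _]; rewrite (chart _ h) /del subr_gt0.
pose kap := rho / (4 * (`|L| + 1) * (d%:R + 1)).
have kap0 : 0 < kap by rewrite divr_gt0// mulr_gt0 ?ltr_wpDl// mulr_gt0// (lt_le_trans ltr01 L1).
pose W := ball (x0 + rho *: e) kap.
have Wd x : W x -> enorm (x - x0) <= 3 / 2 * rho /\ 0 < del x <= 3 / 2 * rho.
  rewrite /W -ball_normE /= distrC => xW.
  pose h := x - (x0 + rho *: e).
  have hk : (`|L| + 1) * enorm h <= rho / 4.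
    apply: (@le_trans _ _ ((`|L| + 1) * ((d%:R + 1) * kap))).
      rewrite ler_wpM2l ?(le_trans ler01 L1)//.
      by apply: le_trans (enorm_le_norm _) _; rewrite ler_wpM2l// ?addr_ge0// ltW.
    rewrite /kap; apply: eq_lew; field.
    by rewrite !gt_eqF ?ltr_wpDl// (lt_le_trans ltr01 L1).
  have xE : x = x0 + rho *: e + h by rewrite /h addrC subrK.
  have h1 : enorm h <= (`|L| + 1) * enorm h by rewrite ler_peMl// enorm_ge0.
  split.
    rewrite xE -[x0 + _ + h]addrA [x0 + _]addrC addrK.
    by have := enormD (rho *: e) h; rewrite enormZ e1 mulr1 (ger0_norm (ltW rho0)); lra.
  have -> : del x = del (x0 + h) + rho.
    by rewrite xE addrAC; have := delE (x0 + h) (- rho); rewrite scaleNr !opprK.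
  have : `|del (x0 + h)| <= (`|L| + 1) * enorm h.
    have -> : del (x0 + h) = dotp h e - (phi (x0 + h) - phi x0) by rewrite /del dotpDl phix0; ring.
    apply: le_trans (ler_normB _ _) _; rewrite mulrDl mul1r addrC; apply: lerD.
      have := phiL (x0 + h) x0; rewrite [x0 + h]addrC addrK => /le_trans; apply.
      by rewrite ler_wpM2r ?enorm_ge0// ler_norm.
    by have := dotp_le h e; rewrite e1 mulr1.
  by rewrite ler_norml => /andP[b1 b2]; apply/andP; split; lra.
have mW : (0 < fine (mu W))%R by rewrite /W lebesgue_rV_ball//= exprn_gt0// mulr_gt0.
pose c := fine (mu W).
have muW : mu W = c%:E by rewrite /c /W lebesgue_rV_ball.
(* the width of the contradicting strip *)
pose A := m ^+ 2 * c / (8 * rho * G).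
have A0 : 0 < A.
  by apply: divr_gt0; [apply: mulr_gt0 => //; exact: exprn_gt0|apply: mulr_gt0 => //; exact: mulr_gt0].
pose t := Num.min rho A / 2.
have t0 : 0 < t by rewrite divr_gt0// lt_min rho0.
have trho : t < rho by rewrite /t ltr_pdivrMr// (@le_lt_trans _ _ rho) ?ge_min ?lexx//; lra.
have tA : t < A by rewrite /t ltr_pdivrMr// (@le_lt_trans _ _ A) ?ge_min ?lexx ?orbT//; lra.
clearbody t.
pose S := Omega `&` ((fun x => x - t *: e) @^-1` (~` Omega)) `&` [set x | enorm (x - x0) <= 4 * rho - t].
have mS : measurable S.
  apply: measurableI; first apply: measurableI => //.
    have mt : measurable_fun setT (fun x : 'rV[R]_d => x - t *: e).
      by apply: measurable_subrV => //; exact: measurable_cst.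
    by apply: measurable_preimageT => //; exact: measurableC.
  apply: closed_measurable_rV.
  apply: (@closed_comp _ _ (fun x => enorm (x - x0)) [set s | s <= 4 * rho - t]); last exact: closed_le.
  move=> x _; apply: (@lipschitz_continuous _ _ (fun x => enorm (x - x0)) 1) => a b; rewrite mul1r.
  by apply: le_trans (enorm_lip _ _) _; rewrite opprB addrA subrK.
have SO : S `<=` Omega by move=> x [[]].
have Sstrip := strip t S t0 mS SO _.
have {Sstrip}hS : (\int[mu]_(x in S) (v x ^+ 2)%:E <= (t ^+ 2 * G)%:E)%E.
  by apply: Sstrip => x [[_ +] _]; rewrite /preimage/= scalerN.
have lowS : ((m ^+ 2)%:E * mu S <= (t ^+ 2 * G)%:E)%E.
  apply: le_trans hS; rewrite -integral_cst//.
  apply: nonneg_le_integral => //.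
  - by move=> x _; rewrite lee_fin sqr_ge0.
  - move=> x [[Ox _] /= xS]; rewrite lee_fin; apply: big; first exact: subset_closure.
    by apply: (rhor _ _).2; lra.
pose N := (Num.truncn (2 * rho / t)).+1.
have N0 : 0 < N%:R :> R by rewrite ltr0n.
have Nt : 2 * rho / t < N%:R.
  have := truncn_itv (_ : 0 <= 2 * rho / t); rewrite /N => /(_ _)/andP[|_ //].
  by apply: divr_ge0; [apply: mulr_ge0 => //; exact: ltW|exact: ltW].
have Nt2 : N%:R <= 4 * rho / t.
  have -> : 4 * rho / t = 2 * rho / t + 2 * rho / t by field; rewrite gt_eqF.
  rewrite /N -addn1 natrD; apply: lerD.
    by rewrite truncn_le//; apply: divr_ge0; [apply: mulr_ge0 => //; exact: ltW|exact: ltW].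
  by rewrite ler_pdivlMr// mul1r; lra.
(* Moving a point of [W] down in steps of [t] until its height is in ]0, t] brings it into the strip
   [S]. Fewer than [N] steps, a number of order rho / t, are needed, so the measure of [S] is at
   least of order [t]. *)
have cover : W `<=` \bigcup_(k in `I_N) ((fun x => x - (k%:R * t) *: e) @^-1` S).
  move=> x Wx; have [xn /andP[d0 d2]] := Wd x Wx.
  have [k [kN dk1 dk2]] : exists k : nat, [/\ (k < N)%N, 0 < del x - k%:R * t & del x - k%:R * t <= t].
    have [n []] : exists n : nat, (n <= N)%N /\ del x <= n%:R * t.
      by exists N; split=> //; move: Nt; rewrite ltr_pdivrMr// => Nt; lra.
    elim: n => [|n IH] nN dn; first by move: dn; rewrite mul0r leNgt d0.
    have [le_n|lt_n] := leP (del x) (n%:R * t); first by apply: IH => //; exact: ltnW.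
    exists n; split=> //; first by rewrite subr_gt0.
    by move: dn; rewrite -natr1 mulrDl mul1r; lra.
  exists k => //=; rewrite /preimage /S /=.
  have kt : 0 <= k%:R * t by rewrite mulr_ge0// ltW.
  have n1 : enorm (x - (k%:R * t) *: e - x0) <= 3 * rho.
    have -> : x - (k%:R * t) *: e - x0 = (x - x0) - (k%:R * t) *: e by rewrite addrAC.
    by apply: le_trans (enorm_leN _ _) _; rewrite enormZ e1 mulr1 ger0_norm//; lra.
  have n2 : enorm (x - (k%:R * t) *: e - t *: e - x0) <= 4 * rho.
    have -> : x - (k%:R * t) *: e - t *: e - x0 = (x - (k%:R * t) *: e - x0) - t *: e by rewrite addrAC.
    by apply: le_trans (enorm_leN _ _) _; rewrite enormZ e1 mulr1 (gtr0_norm t0); lra.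
  split; last lra.
  split; first by apply: (iffRL (inO _ _)); [lra|rewrite delE].
  by move=> /(iffLR (inO _ n2)); rewrite !delE; lra.
have mSk k : measurable ((fun x => x - (k%:R * t) *: e) @^-1` S).
  by apply: measurable_preimageT => //; apply: measurable_subrV => //; exact: measurable_cst.
have muSk k : mu ((fun x => x - (k%:R * t) *: e) @^-1` S) = mu S by exact: lebesgue_rV_shift.
have mWW : measurable W by exact: measurable_rV_ball.
pose Sk k := (fun x => x - (k%:R * t) *: e) @^-1` S.
have sub : (mu W <= \sum_(k < N) mu (Sk k))%E.
  by apply: (content_subadditive mu (F := Sk) (fun k _ => mSk k) mWW); rewrite -bigcup_mkord.
have [s sE] : exists s : R, mu S = s%:E.
  have : (mu S < +oo)%E.
    rewrite ltey; apply/eqP => H; move: lowS; rewrite H gt0_muley//.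
    by rewrite lte_fin exprn_gt0.
  have : (0 <= mu S)%E by exact: measure_ge0.
  by case: (mu S) => // r _ _; exists r.
move: sub lowS; rewrite (eq_bigr (fun=> s%:E)) => [|k _]; last by rewrite muSk.
rewrite sumEFin sumr_const card_ord muW sE -EFinM !lee_fin -mulr_natl => cN sG.
have s0 : 0 <= s by rewrite -lee_fin -sE measure_ge0.
have : m ^+ 2 * c <= 4 * rho * t * G.
  apply: (@le_trans _ _ (N%:R * (m ^+ 2 * s))).
    by rewrite mulrCA ler_wpM2l// sqr_ge0.
  apply: (@le_trans _ _ ((4 * rho / t) * (t ^+ 2 * G))).
    by rewrite ler_pM// ?mulr_ge0 ?sqr_ge0// ler0n.
  apply: eq_lew; field; by rewrite gt_eqF.
have : 4 * rho * t * G < 4 * rho * A * G.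
  by rewrite ltr_pM2r// ltr_pM2l// mulr_gt0.
have -> : 4 * rho * A * G = m ^+ 2 * c / 2 by rewrite /A; field; rewrite !gt_eqF.
have : 0 < m ^+ 2 * c by rewrite mulr_gt0// exprn_gt0.
lra.
Qed.

Lemma VT_boundary0 T v x : VT Omega T v -> ~ Omega x -> v x = 0.
Proof.
move=> [cv Hv _ v0] nx; have [cx|ncx] := pselect (closure Omega x); last exact: v0.
by apply: (H10_boundary0 cv Hv); apply/boundaryP.
Qed.

End trace_zero.

Lemma ge0_integral_setU_le (dd : measure_display) (T : measurableType dd) (R : realType)
    (m : {measure set T -> \bar R}) (A B : set T) (f : T -> \bar R) :
  measurable A -> measurable B -> measurable_fun (A `|` B) f -> (forall x, (A `|` B) x -> (0 <= f x)%E) ->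
  (\int[m]_(x in A `|` B) f x <= \int[m]_(x in A) f x + \int[m]_(x in B) f x)%E.
Proof.
move=> mA mB mf f0.
have E : A `|` B = A `|` (B `\` A).
  by apply/seteqP; split=> x [Ax|Bx]; [left|have [|] := pselect (A x); [left|right]|left|right; case: Bx].
rewrite {1}E ge0_integral_setU//.
- apply: leeD2l; apply: ge0_subset_integral => //.
  + exact: measurableD.
  + by apply: measurable_funS mf => //; exact: measurableU.
  + by move=> x Bx; apply: f0; right.
- exact: measurableD.
- by rewrite -E.
- by move=> x; rewrite -E; exact: f0.
- by rewrite /disj_set; apply/eqP; rewrite setIDA setIC -setIDA setDv setI0.
Qed.

(** * Discrete functions are Lipschitz and have finite energy *)

Section piecewise_lipschitz.
Context {R : realType}.

(* Follow a closed set containing [a] up to its last point in [a, b]; the rest of the interval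
   is covered by the other sets. *)
Lemma lipschitz_closed_cover (f : R -> R) (L : R) (s : seq (set R)) (a b : R) : 0 <= L -> a <= b ->
  (forall A, A \in s -> closed A) ->
  (forall t, a <= t <= b -> exists2 A, A \in s & A t) ->
  (forall A, A \in s -> forall t u, A t -> A u -> a <= t <= b -> a <= u <= b -> `|f t - f u| <= L * `|t - u|) ->
  `|f b - f a| <= L * (b - a).
Proof.
move=> L0; have [n] := ubnP (size s); elim: n s a => // n IH s a sn ab cl cov lip.
have [|A As Aa] := cov a; first by rewrite lexx.
pose B := A `&` [set t | a <= t <= b].
have hb : has_ubound B by exists b => t [_ /andP[]].
have Ba : B a by split=> //=; rewrite lexx.
have clB : closed B.
  apply: closedI; first exact: cl.
  rewrite (_ : mkset _ = `[a, b]%classic); first exact: interval_closed.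
  by apply/seteqP; split=> t /=; rewrite in_itv.
pose q := sup B.
have [Aq /andP[aq qb]] : B q.
  by rewrite [B](closure_id _).1//; apply: closure_sup => //; exists a.
have h1 : `|f q - f a| <= L * (q - a).
  by have := lip A As q a Aq Aa; rewrite aq qb lexx ab (ger0_norm (_ : 0 <= q - a)) ?subr_ge0//; apply.
have [qb'|lt_qb] := leP b q.
  by have <- : q = b by apply/eqP; rewrite eq_le qb qb'.
have subs C : C \in rem A s -> C \in s by exact: mem_rem.
have rest t : q < t <= b -> exists2 C, C \in rem A s & C t.
  move=> /andP[qt tb]; have [|C Cs Ct] := cov t; first by rewrite (le_trans aq (ltW qt)).
  exists C => //; have : C != A.
    apply/eqP => CA; have := qt; rewrite ltNge => /negP; apply; apply: ub_le_sup => //.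
    by split; [rewrite -CA|rewrite /= (le_trans aq (ltW qt)) tb].
  by move=> CA; move: (perm_to_rem As) => /perm_mem/(_ C); rewrite Cs in_cons (negbTE CA) /= => <-.
have : exists2 C, C \in rem A s & C q.
  apply: contrapT => nC.
  pose U := \bigcup_(C in [set` rem A s]) C.
  have clU : closed U.
    rewrite /U bigcup_seq; apply: closed_bigsetU => C Cs; by apply: cl; exact: subs.
  have nU : ~ U q by move=> [C Cs Cq]; apply: nC; exists C.
  have : nbhs q (~` U) by apply: open_nbhs_nbhs; split=> //; exact: closed_openC.
  move=> /nbhs_ballP[e /= e0 hU].
  pose t := q + Num.min e (b - q) / 2.
  have m0 : 0 < Num.min e (b - q) by rewrite lt_min e0 subr_gt0.
  have qt : q < t by rewrite ltrDl divr_gt0.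
  have tb : t <= b.
    have : Num.min e (b - q) <= b - q by rewrite ge_min lexx orbT.
    by rewrite /t; lra.
  have [|C Cs Ct] := rest t; first by rewrite qt.
  apply: (hU t); last by exists C.
  rewrite /ball/= distrC ger0_norm ?subr_ge0 ?(ltW qt)// /t addrC addKr.
  have : Num.min e (b - q) <= e by rewrite ge_min lexx.
  lra.
move=> [C0 C0s C0q].
have h2 : `|f b - f q| <= L * (b - q).
  apply: (IH (rem A s)) => //.
  - by rewrite size_rem//; move: sn As; case: (s) => //= ? ? ; rewrite ltnS.
  - by move=> C /subs; exact: cl.
  - move=> t /andP[qt tb]; move: qt; rewrite le_eqVlt => /predU1P[<-|qt]; first by exists C0.
    by apply: rest; rewrite qt.
  - move=> C /subs Cs t u Ct Cu /andP[t1 t2] /andP[u1 u2]; apply: (lip C) => //.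
      by rewrite (le_trans aq).
    by rewrite (le_trans aq).
have := ler_normD (f b - f q) (f q - f a); rewrite addrA subrK; lra.
Qed.
End piecewise_lipschitz.

Lemma measurable_integral_snd (R : realType) (n : nat) (h : 'rV[R]_n -> 'rV[R]_n -> R) :
  measurable_fun setT (fun p : 'rV[R]_n * 'rV[R]_n => h p.1 p.2) -> (forall x y, 0 <= h x y) ->
  measurable_fun setT (fun x => (\int[lebesgue_rV n]_y (h x y)%:E)%E).
Proof.
move=> mh h0.
have mF : measurable_fun setT (fun p : 'rV[R]_n * 'rV[R]_n => (h p.1 p.2)%:E) by exact/measurable_EFinP.
have mG : measurable_fun setT (fubini_F (lebesgue_rV n) (fun p : 'rV[R]_n * 'rV[R]_n => (h p.1 p.2)%:E)).
  by apply: measurable_fun_fubini_tonelli_F => // p; rewrite lee_fin.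
exact: mG.
Qed.

Section VT_lipschitz.
Context {R : realType} {d : nat} (Omega : set 'rV[R]_d).
Hypothesis lipO : bounded_lipschitz_domain Omega.
Implicit Types (x y : 'rV[R]_d) (v : 'rV[R]_d -> R).

(** Along a segment, the preimages of the simplices and of the complement of [Omega] are closed and
    cover the parameter interval; on each of them the function is affine or zero, so
    [lipschitz_closed_cover] applies. *)
Lemma piecewise_affine_lipschitz T v : conforming_mesh Omega T ->
  (forall x, ~ Omega x -> v x = 0) -> (forall K, K \in T -> P1_on (simplex K) v) ->
  exists2 L, 0 <= L & forall x y, `|v x - v y| <= L * enorm (x - y).
Proof.
move=> [_ ndT clT _ _] v0 P1.
have [L L0 hL] : exists2 L, 0 <= L & forall K, K \in T -> forall x y, simplex K x -> simplex K y -> `|v x - v y| <= L * enorm (x - y).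
  have : forall K, K \in T -> P1_on (simplex K) v by [].
  elim: (T) => [_|K T' IH h]; first by exists 0.
  have [L L0 hL] := IH (fun K' KT => h K' (mem_behead (s := K :: T') KT)).
  have [c [g cg]] := h K (mem_head _ _).
  exists (L + enorm g); first by rewrite addr_ge0 ?enorm_ge0.
  move=> K'; rewrite in_cons => /predU1P[->|KT'] x y Kx Ky.
    rewrite !cg// opprD addrACA subrr add0r -dotpBr; apply: le_trans (dotp_le _ _) _.
    by rewrite ler_wpM2r ?enorm_ge0// lerDr.
  by apply: le_trans (hL K' KT' x y Kx Ky) _; rewrite ler_wpM2r ?enorm_ge0// lerDl enorm_ge0.
exists L => // x y.
pose p (t : R) := x + t *: (y - x).
have cp : continuous p.
  by move=> t; apply: cvgD; [exact: cvg_cst|apply: cvgZr_tmp; exact: cvg_id].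
have pB t u : p t - p u = (t - u) *: (y - x) by rewrite /p opprD addrACA subrr add0r scalerBl.
have := @lipschitz_closed_cover R (v \o p) (L * enorm (y - x)) ((p @^-1` (~` Omega)) :: [seq p @^-1` (simplex K) | K <- T]) 0 1.
rewrite subr0 mulr1 /= /p scale0r addr0 scale1r [x + _]addrC subrK distrC enormB; apply => //.
- by rewrite mulr_ge0// enorm_ge0.
- move=> A; rewrite in_cons => /predU1P[->|/mapP[K KT ->]].
    by apply: closed_comp => [t _|]; [exact: cp|apply: open_closedC; case: lipO].
  by apply: closed_comp => [t _|]; [exact: cp|apply: closed_simplex; case: (ndT K KT)].
- move=> t _; have [Op|nOp] := pselect (Omega (p t)); last first.
    by exists (p @^-1` (~` Omega)); rewrite ?mem_head.
  have : closure Omega (p t) by exact: subset_closure.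
  rewrite clT => -[K KT Kp]; exists (p @^-1` simplex K) => //.
  by rewrite in_cons; apply/orP; right; apply/mapP; exists K.
- move=> A; rewrite in_cons => /predU1P[->|/mapP[K KT ->]] t u At Au _ _ /=.
    by rewrite !v0// subrr normr0 mulr_ge0 ?mulr_ge0 ?enorm_ge0.
  apply: le_trans (hL K KT _ _ At Au) _.
  by rewrite -[x + t *: _ - _]/(p t - p u) pB enormZ (enormB y x) mulrA mulrAC.
Qed.

Lemma VT_lipschitz T v : conforming_mesh Omega T -> VT Omega T v ->
  exists2 L, 0 <= L & forall x y, `|v x - v y| <= L * enorm (x - y).
Proof.
move=> cT Vv; apply: (piecewise_affine_lipschitz cT); last by case: Vv.
by move=> x; exact: (VT_boundary0 lipO Vv).
Qed.

Section Htilde.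
Variable alpha : R.
Hypothesis alpha02 : 0 < alpha < 2.

Local Notation mu := (@lebesgue_rV R d).

Lemma sqr_div_powR (e : R) : 0 < e -> e ^+ 2 / e `^ (d%:R + alpha) = e `^ (2 - alpha - d%:R).
Proof.
move=> e0; rewrite -powRN -powR_mulrn ?ltW// -powRD ?(gt_eqF e0) ?implybT//; congr (_ `^ _); ring.
Qed.

Lemma frac_kernel_ge0 (x y : 'rV[R]_d) : 0 <= frac_kernel alpha x y.
Proof. exact: powR_ge0. Qed.

Lemma measurable_div_kernel (f : 'rV[R]_d * 'rV[R]_d -> R) : measurable_fun setT f ->
  measurable_fun setT (fun z => f z / frac_kernel alpha z.1 z.2).
Proof.
move=> mf; apply: measurable_funM => //.
rewrite (_ : (fun z => _) = fun z : 'rV[R]_d * 'rV[R]_d => enorm (z.1 - z.2) `^ (- (d%:R + alpha))).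
  apply: (measurableT_comp (measurable_powR _)); apply: measurable_enormB; [exact: measurable_fst|exact: measurable_snd].
by apply/funext => z; rewrite powRN.
Qed.

(** Near [x] the squared Lipschitz bound leaves a power of the distance with exponent 2 - alpha - d,
    integrable because alpha < 2; away from [x] boundedness and alpha > 0 suffice. *)
Lemma lipschitz_increment_integral v L M : measurable_fun setT v ->
  (forall x y, `|v x - v y| <= L * enorm (x - y)) -> (forall x, `|v x| <= M) ->
  exists2 C : R, 0 <= C & forall x, (\int[mu]_y ((v x - v y) ^+ 2 / frac_kernel alpha x y)%:E <= C%:E)%E.
Proof.
move=> mv lv bv; have /andP[a0 a2] := alpha02.
have [C1 C10 near1] := @near_kernel_integral R d (2 - alpha) (ltac:(by rewrite subr_gt0)).
have [C2 C20 far1] := @far_kernel_integral R d alpha a0.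
exists (L ^+ 2 * C1 + (2 * M) ^+ 2 * C2).
  by rewrite addr_ge0// mulr_ge0 ?sqr_ge0// ltW.
move=> x.
pose A := [set w | enorm (x - w) <= 1]; pose B := [set w | 1 <= enorm (x - w)].
have menx : measurable_fun setT (fun w : 'rV[R]_d => enorm (x - w)).
  by apply: measurable_enormB => //; exact: measurable_cst.
have mA : measurable A.
  rewrite (_ : A = (fun w => enorm (x - w)) @^-1` `]-oo, 1]); last by apply/seteqP; split=> w /=; rewrite in_itv.
  exact: measurable_preimageT.
have mB : measurable B.
  rewrite (_ : B = (fun w => enorm (x - w)) @^-1` `[1, +oo[); last by apply/seteqP; split=> w /=; rewrite in_itv/= andbT.
  exact: measurable_preimageT.
pose h y := (v x - v y) ^+ 2 / frac_kernel alpha x y.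
have h0 y : 0 <= h y by rewrite divr_ge0 ?sqr_ge0 ?frac_kernel_ge0.
have mh : measurable_fun setT (EFin \o h).
  apply/measurable_EFinP.
  have mz : measurable_fun setT (fun y : 'rV[R]_d => (x, y)) by exact: measurable_pair1.
  have mk := @measurable_div_kernel (fun z => (v z.1 - v z.2) ^+ 2).
  apply: (measurableT_comp (mk _) mz).
  by apply: measurable_funX; apply: measurable_funB; apply: (measurableT_comp mv); [exact: measurable_fst|exact: measurable_snd].
have mpow (s : R) : measurable_fun setT (fun w : 'rV[R]_d => enorm (x - w) `^ s).
  exact: (measurableT_comp (measurable_powR s) menx).
have IA : (\int[mu]_(y in A) (h y)%:E <= (L ^+ 2 * C1)%:E)%E.
  apply: (@le_trans _ _ (\int[mu]_(y in A) ((L ^+ 2)%:E * (enorm (x - y) `^ (2 - alpha - d%:R))%:E))%E).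
    apply: nonneg_le_integral => //.
    - by move=> y _; rewrite lee_fin.
    move=> y Ay; rewrite -EFinM lee_fin /h.
    have [e0|] := eqVneq (enorm (x - y)) 0.
      have -> : y = x by apply/eqP; rewrite eq_sym -subr_eq0; apply/eqP; exact: enorm_eq0.
      by rewrite subrr expr0n mul0r mulr_ge0 ?sqr_ge0 ?powR_ge0.
    move=> e0; have {}e0 : 0 < enorm (x - y) by rewrite lt_neqAle eq_sym e0 enorm_ge0.
    rewrite -sqr_div_powR// mulrA; apply: ler_wpM2r; first by rewrite invr_ge0 frac_kernel_ge0.
    rewrite -exprMn -[leLHS]real_normK ?num_real// lerXn2r ?nnegrE//.
    by apply: le_trans (lv x y).
  rewrite ge0_integralZl//.
  - rewrite [leRHS]EFinM; apply: lee_wpmul2l; first by rewrite lee_fin sqr_ge0.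
    by have := near1 x 1 ltr01; rewrite powR1 mulr1.
  - by apply: measurable_funTS; exact/measurable_EFinP.
  - by move=> y _; rewrite lee_fin powR_ge0.
  - by rewrite lee_fin sqr_ge0.
have IB : (\int[mu]_(y in B) (h y)%:E <= ((2 * M) ^+ 2 * C2)%:E)%E.
  apply: (@le_trans _ _ (\int[mu]_(y in B) (((2 * M) ^+ 2)%:E * (enorm (x - y) `^ (- (d%:R + alpha)))%:E))%E).
    apply: nonneg_le_integral => //.
    - by move=> y _; rewrite lee_fin.
    move=> y By; rewrite -EFinM lee_fin /h powRN; apply: ler_wpM2r; first by rewrite invr_ge0 powR_ge0.
    have vv : `|v x - v y| <= 2 * M.
      by apply: le_trans (ler_normB _ _) _; rewrite mulr_natl mulr2n lerD.
    by rewrite -[leLHS]real_normK ?num_real// lerXn2r ?nnegrE// (le_trans _ vv).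
  rewrite ge0_integralZl//.
  - rewrite [leRHS]EFinM; apply: lee_wpmul2l; first by rewrite lee_fin sqr_ge0.
    by have := far1 x 1 ltr01; rewrite powR1 mulr1.
  - by apply: measurable_funTS; exact/measurable_EFinP.
  - by move=> y _; rewrite lee_fin powR_ge0.
  - by rewrite lee_fin sqr_ge0.
have AB : setT = A `|` B.
  by apply/seteqP; split=> // y _; rewrite /A /B /=; have [|/ltW] := leP (enorm (x - y)) 1; [left|right].
rewrite EFinD AB; apply: le_trans (leeD IA IB).
apply: ge0_integral_setU_le => //; last by move=> y _; rewrite lee_fin; exact: h0.
by apply: measurable_funTS; exact: mh.
Qed.

Lemma lipschitz_Htilde v L : (forall x y, `|v x - v y| <= L * enorm (x - y)) ->
  (forall x, ~ Omega x -> v x = 0) -> Htilde alpha Omega v.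
Proof.
move=> lv v0.
have mO : measurable Omega by exact: domain_measurable.
have cv : continuous v by exact: lipschitz_continuous lv.
have mv : measurable_fun setT v by exact: continuous_measurable_rV.
have [B B0 hB] := bounded_set_closure_norm (let: And5 _ _ _ h _ := lipO in h).
have finO : (mu Omega < +oo)%E.
  by apply: (@lebesgue_rV_lty _ _ _ B) => // x Ox; apply: hB; exact: subset_closure.
pose M := `|v 0| + `|L| * ((d%:R + 1) * B).
have M0 : 0 <= M by rewrite addr_ge0// !mulr_ge0// ?addr_ge0// ltW.
have bv x : `|v x| <= M.
  have [Ox|nO] := pselect (Omega x); last by rewrite v0// normr0.
  have := ler_normD (v 0) (v x - v 0); rewrite addrC subrK => /le_trans; apply.
  rewrite lerD2l; apply: le_trans (lv x 0) _; rewrite subr0.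
  apply: (@le_trans _ _ (`|L| * enorm x)); first by rewrite ler_wpM2r ?enorm_ge0// ler_norm.
  rewrite ler_wpM2l//; apply: le_trans (enorm_le_norm _) _; rewrite ler_wpM2l ?addr_ge0//.
  by apply: hB; exact: subset_closure.
have L2v : L2 setT v.
  split=> //; rewrite (_ : (\int[mu]_x _)%E = \int[mu]_(x in Omega) ((v x ^+ 2)%:E))%E; last first.
    rewrite [RHS]integral_mkcond; apply: eq_integral => x _; rewrite patchE.
    by case: ifPn => //; rewrite notin_setE => nO; rewrite v0// expr0n.
  have bOv x : Omega x -> `|v x| <= M by [].
  by have [] := bounded_L2 lipO (measurable_funTS mv) bOv.
have [C C0 hC] := lipschitz_increment_integral mv lv bv.
split; last by apply/aeW => x nx; apply: v0 => Ox; apply: nx; exact: subset_closure.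
split=> //.
pose h (x y : 'rV[R]_d) := (v x - v y) ^+ 2 / frac_kernel alpha x y.
have h0 x y : 0 <= h x y by rewrite divr_ge0 ?sqr_ge0 ?frac_kernel_ge0.
have hC' x : (\int[mu]_y (h x y)%:E <= C%:E)%E by exact: hC.
have hsym x y : h x y = h y x.
  by rewrite /h /frac_kernel enormB -[v x - v y]opprB sqrrN.
have mh : measurable_fun setT (fun p : 'rV[R]_d * 'rV[R]_d => h p.1 p.2).
  apply: (@measurable_div_kernel (fun z => (v z.1 - v z.2) ^+ 2)).
  by apply: measurable_funX; apply: measurable_funB; apply: (measurableT_comp mv).
have mI : measurable_fun setT (\1_Omega : 'rV[R]_d -> R) by exact: measurable_indic.
pose h1 (x y : 'rV[R]_d) : R := \1_Omega x * h x y.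
have mh1 : measurable_fun setT (fun p : 'rV[R]_d * 'rV[R]_d => h1 p.1 p.2).
  by apply: measurable_funM => //; exact: (measurableT_comp mI).
have h10 x y : 0 <= h1 x y by rewrite mulr_ge0// indicE.
have Ih1 : (\int[mu]_x \int[mu]_y (h1 x y)%:E <= C%:E * mu Omega)%E.
  apply: (@le_trans _ _ (\int[mu]_x (C%:E * (\1_Omega x)%:E))%E).
    apply: nonneg_le_integral => //.
    - by move=> x _; apply: integral_ge0 => y _; rewrite lee_fin.
    move=> x _; rewrite /h1 indicE; case: (x \in Omega) => /=; last first.
      by rewrite mule0; under eq_integral do rewrite mul0r; rewrite integral0.
    by rewrite mule1; under eq_integral do rewrite mul1r.
  rewrite ge0_integralZl//.
  - by rewrite integral_indic// setIT.
  - exact/measurable_EFinP.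
pose h2 (x y : 'rV[R]_d) : R := \1_Omega y * h x y.
have mh2 : measurable_fun setT (fun p : 'rV[R]_d * 'rV[R]_d => h2 p.1 p.2).
  by apply: measurable_funM => //; exact: (measurableT_comp mI).
have h20 x y : 0 <= h2 x y by rewrite mulr_ge0// indicE.
have Ih2 : (\int[mu]_x \int[mu]_y (h2 x y)%:E <= C%:E * mu Omega)%E.
  rewrite (ge0_fubini_indic mh2 h20); apply: le_trans Ih1.
  apply: eq_lew; apply: eq_integral => x _; apply: eq_integral => y _.
  by rewrite /h1 /h2 hsym.
have mE (f : 'rV[R]_d -> 'rV[R]_d -> R) : measurable_fun setT (fun p : 'rV[R]_d * 'rV[R]_d => f p.1 p.2) ->
    measurable_fun setT (fun p : 'rV[R]_d * 'rV[R]_d => (f p.1 p.2)%:E) by move=> mf; exact/measurable_EFinP.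
(* The integrand vanishes unless one of the two points is in [Omega]; each of the two cases costs at
   most [C] times the volume of [Omega]. *)
apply: (@le_lt_trans _ _ (\int[mu \x mu]_z ((h1 z.1 z.2)%:E + (h2 z.1 z.2)%:E))%E).
  apply: nonneg_le_integral => //.
  - by move=> z _; rewrite lee_fin; exact: h0.
  move=> [x y] _ /=; rewrite -EFinD lee_fin -/(h x y) /h1 /h2.
  rewrite !indicE; case: (boolP (x \in Omega)) => xO /=; first by rewrite mul1r lerDl mulr_ge0.
  case: (boolP (y \in Omega)) => yO /=; first by rewrite mul0r add0r mul1r.
  rewrite !mul0r addr0 /h !v0 ?subrr ?expr0n ?mul0r//; [by rewrite notin_setE in yO|by rewrite notin_setE in xO].
rewrite ge0_integralD//; first last.
- exact: (mE h2 mh2).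
- by move=> z _; rewrite lee_fin.
- exact: (mE h1 mh1).
- by move=> z _; rewrite lee_fin.
rewrite (fubini_tonelli1 _ (mE h1 mh1)); last by move=> z; rewrite lee_fin.
rewrite (fubini_tonelli1 _ (mE h2 mh2)); last by move=> z; rewrite lee_fin.
apply: (le_lt_trans (leeD Ih1 Ih2)).
by apply: lte_add_pinfty; apply: lte_mul_pinfty => //; rewrite lee_fin.
Qed.

Lemma VT_Htilde T : conforming_mesh Omega T -> VT Omega T `<=` Htilde alpha Omega.
Proof.
move=> cT v Vv; have [L _ hL] := VT_lipschitz cT Vv.
by apply: (lipschitz_Htilde hL) => x; exact: (VT_boundary0 lipO Vv).
Qed.

End Htilde.
End VT_lipschitz.

(** * Elementary inequalities of the error analysis *)

Section numeric.
Context {R : realType}.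

Lemma sqr_le_add (x y w : R) : 0 <= x -> x <= y + w -> x ^+ 2 <= 2 * y ^+ 2 + 2 * w ^+ 2.
Proof.
move=> x0 xyw; apply: (@le_trans _ _ ((y + w) ^+ 2)).
  by rewrite ler_pXn2r// nnegrE// (le_trans x0).
by have := sqr_ge0 (y - w); nra.
Qed.

Lemma sup_nonneg (A : set R) : (forall x, A x -> 0 <= x) -> 0 <= sup A.
Proof.
move=> A0; have [[[x Ax] uA]|/sup_out ->//] := pselect (has_sup A).
exact: le_trans (A0 x Ax) (ub_le_sup uA Ax).
Qed.

Lemma inf_nonneg (A : set R) : (forall x, A x -> 0 <= x) -> 0 <= inf A.
Proof.
move=> A0; have [[x Ax]|/nonemptyPn ->] := pselect (A !=set0); last by rewrite inf0.
by apply: lb_le_inf; [exists x|].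
Qed.

(** [g] stands for [gamma], [P] for the Poincare constant. One factor 1 + 1/g comes from solving for
    the control and the state error together, the other from the bound n^2 + z^2 / g; the last
    factor reflects the energy stability of the solution operator. *)
Definition L2_const (g P : R) : R := (1 + g^-1) ^+ 2 * (2 + 2 * P ^+ 4 + 2 * (P ^+ 2 / g) ^+ 2).

(** Dictionary: [A], [B] are the L^2 errors of control and state, [yy], [pp] the energy errors of
    state and adjoint. [n], [Hn] are the L^2 and energy norms of y - y_k - S(u - u_k), and [z], [Hz]
    those of p - p_k - S(y - y_k). [hY], [hZ] are the energy norms of the two S-terms; [i1] pairs
    the first remainder with the state error, [i2] the second with the control error. *)
Lemma L2_error_numeric (g P Th A B yy pp Hn Hz n z i1 i2 hY hZ : R) :
  0 < g -> 0 < P -> 0 <= Th -> 0 <= A -> 0 <= B -> 0 <= yy -> 0 <= pp -> 0 <= n -> 0 <= z ->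
  n <= Th * Hn -> z <= Th * Hz -> Hn <= yy + hY -> Hz <= pp + hZ ->
  g * A ^+ 2 <= - (i2 + (B ^+ 2 - i1)) -> A <= P / g * pp -> B <= P * yy ->
  hY <= P * A -> hZ <= P * B -> i1 <= B * n -> - (z * A) <= i2 ->
  A ^+ 2 + B ^+ 2 <= L2_const g P * Th ^+ 2 * (yy ^+ 2 + pp ^+ 2).
Proof.
move=> g0' P0 Th0 A0 B0 y0 p0 n0 z0 e1 z1 e2 z2 m c b YP ZP k3 k4.
pose G := g^-1; have G0 : 0 < G by rewrite invr_gt0.
have gg : g * G = 1 by rewrite mulfV// gt_eqF.
(* Complete the squares of [B - n] and of [g * A - z] in the monotonicity inequality. *)
have m' : g * A ^+ 2 + B ^+ 2 <= n ^+ 2 + G * z ^+ 2.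
  have s1 := sqr_ge0 (B - n).
  have s2 : 0 <= G * (g * A - z) ^+ 2 by rewrite mulr_ge0// ?sqr_ge0// ltW.
  have s3 : G * (g * A - z) ^+ 2 = g * A ^+ 2 - 2 * (A * z) + G * z ^+ 2.
    have -> : G * (g * A - z) ^+ 2 = (g * G) * (g * A ^+ 2) - 2 * (g * G) * (A * z) + G * z ^+ 2 by ring.
    by rewrite gg; ring.
  rewrite s3 in s2; have s4 : (B - n) ^+ 2 = B ^+ 2 - 2 * (B * n) + n ^+ 2 by ring.
  rewrite s4 in s1; rewrite mulrC in k4; lra.
have m2 : A ^+ 2 + B ^+ 2 <= (1 + G) * (n ^+ 2 + G * z ^+ 2).
  have := sqr_ge0 A; have := sqr_ge0 B.
  move: m'; set A2 := A ^+ 2; set B2 := B ^+ 2; set N := n ^+ 2 + _ => m' B20 A20.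
  have t1 : A2 <= G * N.
    by rewrite -(@ler_pM2l _ g)// [leRHS]mulrA gg mul1r; lra.
  have t2 : B2 <= N by have : 0 <= g * A2 by [rewrite mulr_ge0// ltW]; lra.
  by rewrite mulrDl mul1r; lra.
have hE : n ^+ 2 <= Th ^+ 2 * (2 * yy ^+ 2 + 2 * (P ^+ 2 * G * pp) ^+ 2).
  apply: (@le_trans _ _ ((Th * (yy + P ^+ 2 * G * pp)) ^+ 2)).
    rewrite ler_pXn2r// ?nnegrE//; last first.
      by rewrite mulr_ge0// addr_ge0// !mulr_ge0// ?sqr_ge0// ltW.
    apply: (le_trans e1); apply: ler_wpM2l => //; apply: (le_trans e2); rewrite lerD2l; apply: (le_trans YP).
    have -> : P ^+ 2 * G * pp = P * (P * G * pp) by ring.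
    by apply: ler_wpM2l => //; exact: ltW.
  rewrite exprMn; apply: ler_wpM2l; first exact: sqr_ge0.
  by apply: sqr_le_add => //; rewrite addr_ge0// !mulr_ge0// ?sqr_ge0// ltW.
have hZ2 : z ^+ 2 <= Th ^+ 2 * (2 * pp ^+ 2 + 2 * (P ^+ 2 * yy) ^+ 2).
  apply: (@le_trans _ _ ((Th * (pp + P ^+ 2 * yy)) ^+ 2)).
    rewrite ler_pXn2r// ?nnegrE//; last first.
      by rewrite mulr_ge0// addr_ge0// !mulr_ge0// ?sqr_ge0// ltW.
    apply: (le_trans z1); apply: ler_wpM2l => //; apply: (le_trans z2); rewrite lerD2l; apply: (le_trans ZP).
    have -> : P ^+ 2 * yy = P * (P * yy) by ring.
    by apply: ler_wpM2l => //; exact: ltW.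
  rewrite exprMn; apply: ler_wpM2l; first exact: sqr_ge0.
  by apply: sqr_le_add => //; rewrite addr_ge0// !mulr_ge0// ?sqr_ge0// ltW.
pose S := yy ^+ 2 + pp ^+ 2.
pose k := 2 + 2 * P ^+ 4 + 2 * (P ^+ 2 * G) ^+ 2.
have T0 := sqr_ge0 Th; have Y0 := sqr_ge0 yy; have Q0 := sqr_ge0 pp.
have P40 : 0 <= P ^+ 4 by rewrite exprn_ge0// ltW.
have K0 := sqr_ge0 (P ^+ 2 * G).
have hn : n ^+ 2 <= Th ^+ 2 * (k * S).
  apply: (le_trans hE); apply: ler_wpM2l => //.
  rewrite exprMn /k /S; move: Y0 Q0 P40 K0; set yq := yy ^+ 2; set pq := pp ^+ 2; set p4 := P ^+ 4; set kq := (_ ^+ 2) => {}Y0 {}Q0 {}P40 {}K0.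
  have := mulr_ge0 P40 Y0; have := mulr_ge0 P40 Q0; have := mulr_ge0 K0 Y0; nra.
have hz : z ^+ 2 <= Th ^+ 2 * (k * S).
  apply: (le_trans hZ2); apply: ler_wpM2l => //.
  have -> : (P ^+ 2 * yy) ^+ 2 = P ^+ 4 * yy ^+ 2 by ring.
  rewrite /k /S; move: Y0 Q0 P40 K0; set yq := yy ^+ 2; set pq := pp ^+ 2; set p4 := P ^+ 4; set kq := (_ ^+ 2) => {}Y0 {}Q0 {}P40 {}K0.
  have := mulr_ge0 P40 Q0; have := mulr_ge0 K0 Y0; have := mulr_ge0 K0 Q0; nra.
apply: (le_trans m2).
have -> : L2_const g P * Th ^+ 2 * (yy ^+ 2 + pp ^+ 2) = (1 + G) * (Th ^+ 2 * (k * S) + G * (Th ^+ 2 * (k * S))).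
  by rewrite /L2_const /k /S /G; ring.
apply: ler_wpM2l; first by rewrite addr_ge0// ltW.
by apply: lerD => //; apply: ler_wpM2l => //; exact: ltW.
Qed.

Definition quasi_const (g P : R) : R :=
  12 + 3 * P ^+ 4 + (2 * P ^+ 2 * g^-1 + 3 * P ^+ 2) * (4 * P ^+ 2 * g^-1 + 6 * P ^+ 2 + 2).

(** Dictionary: [A] is the L^2 error of the control. [N] and [hy] are the L^2 and energy norms of
    the difference between discrete state and comparison state, [hp] the energy norm for the
    adjoints. [E1], [E2] are the energy errors of the comparison pair, [X], [Y] those of the
    discrete solution. *)
Lemma quasi_numeric (g P A N E1 E2 hy hp X Y : R) : 0 < g -> 0 < P ->
  0 <= A -> 0 <= N -> 0 <= E1 -> 0 <= E2 -> 0 <= hy -> 0 <= hp -> 0 <= X -> 0 <= Y ->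
  g * A ^+ 2 + N ^+ 2 <= P * E2 * A + E1 * hp + hy * E2 + P * E1 * N ->
  hy <= E1 + P * A -> hp <= E2 + P * (P * E1 + N) -> X <= E1 + hy -> Y <= E2 + hp ->
  X ^+ 2 + Y ^+ 2 <= quasi_const g P * (E1 ^+ 2 + E2 ^+ 2).
Proof.
move=> g0 P0 A0 N0 E10 E20 hy0 hp0 X0 Y0 m hyA hpN XE YE.
pose G := g^-1; have G0 : 0 < G by rewrite invr_gt0.
have gg : g * G = 1 by rewrite mulfV// gt_eqF.
have m1 : g * A ^+ 2 + N ^+ 2 <= 2 * (P * E2 * A) + 2 * (E1 * E2) + (P * E1) ^+ 2 + 2 * (P * E1 * N).
  apply: (le_trans m).
  have t1 : E1 * hp <= E1 * (E2 + P * (P * E1 + N)) by apply: ler_wpM2l.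
  have t2 : hy * E2 <= (E1 + P * A) * E2 by apply: ler_wpM2r.
  have -> : (P * E1) ^+ 2 = E1 * (P * (P * E1)) by ring.
  have t3 : E1 * (E2 + P * (P * E1 + N)) = E1 * E2 + E1 * (P * (P * E1)) + P * E1 * N by ring.
  have t4 : (E1 + P * A) * E2 = E1 * E2 + P * E2 * A by ring.
  lra.
pose M := (4 * P ^+ 2 * G + 6 * P ^+ 2 + 2) * (E1 ^+ 2 + E2 ^+ 2).
have m2 : g * A ^+ 2 + N ^+ 2 <= M.
  have s1 : 0 <= G * (g * A - 2 * (P * E2)) ^+ 2 by rewrite mulr_ge0 ?sqr_ge0// ltW.
  have e1 : G * (g * A - 2 * (P * E2)) ^+ 2 = g * A ^+ 2 - 4 * (P * E2 * A) + 4 * G * (P * E2) ^+ 2.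
    have -> : G * (g * A - 2 * (P * E2)) ^+ 2 = (g * G) * (g * A ^+ 2) - 4 * (g * G) * (P * E2 * A) + 4 * G * (P * E2) ^+ 2 by ring.
    by rewrite gg; ring.
  have s2 := sqr_ge0 (N - 2 * (P * E1)).
  have e2 : (N - 2 * (P * E1)) ^+ 2 = N ^+ 2 - 4 * (P * E1 * N) + 4 * (P * E1) ^+ 2 by ring.
  have s3 := sqr_ge0 (E1 - E2); have e3 : (E1 - E2) ^+ 2 = E1 ^+ 2 - 2 * (E1 * E2) + E2 ^+ 2 by ring.
  have p1 : 0 <= G * (P * E1) ^+ 2 by rewrite mulr_ge0 ?sqr_ge0// ltW.
  have p2 := sqr_ge0 (P * E2).
  have eM : M = 4 * (G * (P * E1) ^+ 2) + 4 * G * (P * E2) ^+ 2 + 6 * (P * E1) ^+ 2 + 6 * (P * E2) ^+ 2 + 2 * E1 ^+ 2 + 2 * E2 ^+ 2.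
    by rewrite /M; ring.
  rewrite e1 in s1; rewrite e2 in s2; rewrite e3 in s3; lra.
have A2 := sqr_ge0 A; have N2 := sqr_ge0 N.
have MA : A ^+ 2 <= G * M.
  by rewrite -(@ler_pM2l _ g)// [leRHS]mulrA gg mul1r; lra.
have MN : N ^+ 2 <= M by have : 0 <= g * A ^+ 2 by [rewrite mulr_ge0// ltW]; lra.
have hX : X ^+ 2 <= 2 * (2 * E1) ^+ 2 + 2 * (P * A) ^+ 2 by apply: sqr_le_add => //; lra.
have hY : Y ^+ 2 <= 3 * (2 * E2) ^+ 2 + 3 * (P ^+ 2 * E1) ^+ 2 + 3 * (P * N) ^+ 2.
  have Yb : Y <= 2 * E2 + P ^+ 2 * E1 + P * N.
    have : P * (P * E1 + N) = P ^+ 2 * E1 + P * N by ring.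
    lra.
  apply: (@le_trans _ _ ((2 * E2 + P ^+ 2 * E1 + P * N) ^+ 2)).
    by rewrite ler_pXn2r// nnegrE// (le_trans Y0).
  have := sqr_ge0 (2 * E2 - P ^+ 2 * E1); have := sqr_ge0 (2 * E2 - P * N); have := sqr_ge0 (P ^+ 2 * E1 - P * N).
  set x := 2 * E2; set y := P ^+ 2 * E1; set z := P * N.
  have -> : (x + y + z) ^+ 2 = x ^+ 2 + y ^+ 2 + z ^+ 2 + 2 * (x * y) + 2 * (x * z) + 2 * (y * z) by ring.
  have -> : (y - z) ^+ 2 = y ^+ 2 - 2 * (y * z) + z ^+ 2 by ring.
  have -> : (x - z) ^+ 2 = x ^+ 2 - 2 * (x * z) + z ^+ 2 by ring.
  have -> : (x - y) ^+ 2 = x ^+ 2 - 2 * (x * y) + y ^+ 2 by ring.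
  lra.
have P2 := sqr_ge0 P; have P4 : 0 <= P ^+ 4 by rewrite exprn_ge0// ltW.
have hA : (P * A) ^+ 2 <= P ^+ 2 * (G * M) by rewrite exprMn ler_wpM2l.
have hN : (P * N) ^+ 2 <= P ^+ 2 * M by rewrite exprMn ler_wpM2l.
have E12 := sqr_ge0 E1; have E22 := sqr_ge0 E2.
have -> : quasi_const g P * (E1 ^+ 2 + E2 ^+ 2) = 12 * E1 ^+ 2 + 12 * E2 ^+ 2 + 3 * (P ^+ 4 * E1 ^+ 2) + 3 * (P ^+ 4 * E2 ^+ 2) + 2 * (P ^+ 2 * (G * M)) + 3 * (P ^+ 2 * M).
  by rewrite /quasi_const /M /G; ring.
have h8 : (2 * E1) ^+ 2 = 4 * E1 ^+ 2 by ring.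
have h9 : (2 * E2) ^+ 2 = 4 * E2 ^+ 2 by ring.
have h10 : (P ^+ 2 * E1) ^+ 2 = P ^+ 4 * E1 ^+ 2 by ring.
have h11 : 0 <= P ^+ 4 * E2 ^+ 2 by rewrite mulr_ge0.
rewrite h8 in hX; rewrite h9 h10 in hY; lra.
Qed.

End numeric.

(** * Continuous against discrete optimality system *)

Section discrete_control.
Context {R : realType} {d : nat} (alpha : R) (Omega : set 'rV[R]_d).
Local Notation mu := (@lebesgue_rV R d).
Local Notation inn := (inner Omega).
Local Notation nrm := (normL2 Omega).
Local Notation aF := (aform alpha).
Local Notation nH := (Hnorm alpha).
Local Notation Ht := (Htilde alpha Omega).
Hypothesis d0 : (0 < d)%N.
Hypothesis alpha0 : 0 < alpha.
Hypothesis bO : bounded_set Omega.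
Hypothesis mO : measurable Omega.
Hypothesis C0 : 0 < @Cda R d alpha.
Variable P : R.
Hypothesis P0 : 0 < P.
Hypothesis PP : forall v, Ht v -> nrm v <= P * nH v.

Let HL v : Ht v -> L2 Omega v. Proof. exact: Htilde_L2. Qed.
Let HH v : Ht v -> Hspace alpha v. Proof. by case. Qed.

Let nrm_ge0 (v : 'rV[R]_d -> R) : 0 <= nrm v. Proof. exact: sqrtr_ge0. Qed.

Let nrm_sqr v : nrm v ^+ 2 = inn v v. Proof. exact: ipnorm_sqr. Qed.

Let inn_le v w : L2 Omega v -> L2 Omega w -> inn v w <= nrm v * nrm w.
Proof. by move=> Lv Lw; apply: le_trans (ler_norm _) (ip_le mO Lv Lw). Qed.

Let inn_ge v w : L2 Omega v -> L2 Omega w -> - (nrm v * nrm w) <= inn v w.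
Proof. by move=> Lv Lw; have := ip_le mO Lv Lw; rewrite ler_norml => /andP[]. Qed.

Let innC v w : inn v w = inn w v. Proof. exact: ipC. Qed.

Let innBl u v w : L2 Omega u -> L2 Omega v -> L2 Omega w -> inn (u \- v) w = inn u w - inn v w.
Proof. exact: ipBl. Qed.

Let innDl u v w : L2 Omega u -> L2 Omega v -> L2 Omega w -> inn (u \+ v) w = inn u w + inn v w.
Proof. exact: ipDl. Qed.

Let L2B u v : L2 Omega u -> L2 Omega v -> L2 Omega (u \- v).
Proof. exact: sqintB. Qed.

Let a_le v w : Ht v -> Ht w -> aF v w <= nH v * nH w.
Proof. by move=> /HH hv /HH hw; apply: le_trans (ler_norm _) (aform_le alpha0 hv hw). Qed.

Let a_ge v w : Ht v -> Ht w -> - (nH v * nH w) <= aF v w.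
Proof. by move=> /HH hv /HH hw; have := aform_le alpha0 hv hw; rewrite ler_norml => /andP[]. Qed.

Let nH_ge0 (v : 'rV[R]_d -> R) : 0 <= nH v. Proof. exact: Hnorm_ge0. Qed.

Let innZl c v w : L2 Omega v -> L2 Omega w -> inn (fun x => c * v x) w = c * inn v w.
Proof. exact: ipZl. Qed.

Let nrmZ c v : L2 Omega v -> nrm (fun x => c * v x) = `|c| * nrm v.
Proof.
move=> Lv; have Lc : L2 Omega (fun x => c * v x) by exact: sqintZ.
rewrite /normL2 innZl// innC innZl//.
by rewrite mulrA -expr2 sqrtrM ?sqr_ge0// sqrtr_sqr.
Qed.

Let nrm_tri v w : L2 Omega v -> L2 Omega w -> nrm (v \- w) <= nrm v + nrm w.
Proof.
move=> Lv Lw; have Lvw := L2B Lv Lw.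
rewrite -(@ler_pXn2r _ 2)// ?nnegrE ?addr_ge0//.
have -> : nrm (v \- w) ^+ 2 = nrm v ^+ 2 - 2 * inn v w + nrm w ^+ 2.
  rewrite (nrm_sqr (v \- w)) (innBl Lv Lw Lvw) (innC v (v \- w)) (innC w (v \- w)).
  rewrite (innBl Lv Lw Lv) (innBl Lv Lw Lw) (innC w v) !nrm_sqr; ring.
by have := inn_ge Lv Lw; lra.
Qed.

Let nH_sqrB v w : Ht v -> Ht w -> nH (v \- w) ^+ 2 = nH v ^+ 2 - 2 * aF v w + nH w ^+ 2.
Proof.
move=> Hv Hw; rewrite !Hnorm_sqr// (aformBl (HH Hv) (HH Hw) (HH (HtildeB Hv Hw))).
rewrite (aformBr (HH Hv) (HH Hw) (HH Hv)) (aformBr (HH Hv) (HH Hw) (HH Hw)) (aformC _ w v); ring.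
Qed.

Let nH_tri v w : Ht v -> Ht w -> nH (v \- w) <= nH v + nH w.
Proof.
move=> Hv Hw; have -> : v \- w = v \+ (fun x => -1 * w x) by apply/funext => x /=; ring.
apply: le_trans (Hnorm_triangle alpha0 (HH Hv) (HspaceZ _ (HH Hw))) _.
by rewrite HnormZ ?normrN1 ?mul1r//; exact: HH.
Qed.

(** Aubin-Nitsche: for [g] the normalised [e], the norm of [e] equals a(S g, e), from which
    orthogonality removes any [chi] of [V]. The infimum over [chi] is one of the numbers whose
    supremum is [Th]. *)
Lemma sup_inf_duality (V : set ('rV[R]_d -> R)) (Th : R) (e : 'rV[R]_d -> R) :
  V `<=` Ht -> V (fun=> 0) ->
  Th = sup [set r | exists g : 'rV[R]_d -> R, [/\ L2 Omega g, nrm g = 1 &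
      r = inf [set nH (Sop alpha Omega g \- chi) | chi in V]]] ->
  Ht e -> (forall chi, V chi -> aF e chi = 0) -> nrm e <= Th * nH e.
Proof.
move=> VH V0 ThE He eV.
have Le := HL He.
have [->|n0] := eqVneq (nrm e) 0.
  apply: mulr_ge0 => //; rewrite ThE; apply: sup_nonneg => _ [g [_ _ ->]].
  by apply: inf_nonneg => _ [chi _ <-].
have np : 0 < nrm e by rewrite lt_def n0 nrm_ge0.
pose g x := (nrm e)^-1 * e x.
have Lg : L2 Omega g by exact: sqintZ.
have ng : nrm g = 1 by rewrite nrmZ// ger0_norm ?invr_ge0// mulVf.
have [HS SE] := SopP d0 alpha0 bO mO C0 Lg.
set s := Sop alpha Omega g in HS SE.
have ne : nrm e = inn g e.
  by rewrite innZl// -nrm_sqr expr2 mulKf.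
set A := [set nH (s \- chi) | chi in V].
have A0 : A !=set0 by exists (nH (s \- fun=> 0)), (fun=> 0).
have lA : has_inf A by split=> //; exists 0 => _ [chi _ <-].
have h1 : nrm e <= inf A * nH e.
  have [He0|Hp] := eqVneq (nH e) 0.
    by rewrite (le_trans (PP He))// He0 !mulr0.
  have Hp' : 0 < nH e by rewrite lt_def Hp nH_ge0.
  rewrite -ler_pdivrMr//; apply: lb_le_inf => // _ [chi Vchi <-].
  rewrite ler_pdivrMr// ne -SE//.
  have Hc := VH _ Vchi.
  rewrite (_ : aF s e = aF (s \- chi) e); last first.
    by rewrite aformBl ?(aformC _ chi) ?eV ?subr0//; exact: HH.
  by apply: a_le => //; exact: HtildeB.
apply: (le_trans h1); rewrite ler_wpM2r// ThE; apply: ub_le_sup; last by exists g.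
(* The choice [chi = 0] bounds all these infima by [P]; for an unbounded set [sup] would be a
   default value. *)
exists P => _ [k [Lk nk ->]].
have [HSk SEk] := SopP d0 alpha0 bO mO C0 Lk.
apply: (@le_trans _ _ (nH (Sop alpha Omega k \- fun=> 0))).
  apply: ge_inf; last by exists (fun=> 0).
  by exists 0 => _ [chi _ <-].
have -> : Sop alpha Omega k \- (fun=> 0) = Sop alpha Omega k by apply/funext => x /=; rewrite subr0.
set t := Sop _ _ _ in HSk SEk *.
have [->|Ht0] := eqVneq (nH t) 0; first exact: ltW.
have Hp' : 0 < nH t by rewrite lt_def Ht0 nH_ge0.
rewrite -(@ler_pM2l _ (nH t))// -expr2 Hnorm_sqr// SEk// mulrC.
by apply: le_trans (inn_le Lk (HL HSk)) _; rewrite nk mul1r; exact: PP.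
Qed.

Lemma Sop_le g : L2 Omega g -> nH (Sop alpha Omega g) <= P * nrm g.
Proof.
move=> Lk; have [HSk SEk] := SopP d0 alpha0 bO mO C0 Lk.
set t := Sop _ _ _ in HSk SEk *.
have [->|Ht0] := eqVneq (nH t) 0; first by rewrite mulr_ge0// ltW.
have Hp' : 0 < nH t by rewrite lt_def Ht0 nH_ge0.
rewrite -(@ler_pM2l _ (nH t))// -expr2 Hnorm_sqr// SEk//.
apply: le_trans (inn_le Lk (HL HSk)) _.
by rewrite mulrC mulrA (mulrC _ P); apply: ler_wpM2r => //; exact: PP.
Qed.

Variables (gamma beta ua ub : R) (f yd : 'rV[R]_d -> R).
Hypothesis gamma0 : 0 < gamma.
Hypothesis beta0 : 0 < beta.
Hypothesis Lf : L2 Omega f.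
Hypothesis Lyd : L2 Omega yd.
Variables (y p u l : 'rV[R]_d -> R).
Hypothesis sol : optimality_system alpha Omega gamma beta ua ub f yd Ht y p u l.

Section one_level.
Variable V : set ('rV[R]_d -> R).
Hypothesis VH : V `<=` Ht.
Variables (yh ph uh lh : 'rV[R]_d -> R).
Hypothesis solh : optimality_system alpha Omega gamma beta ua ub f yd V yh ph uh lh.

Lemma discrete_Ht : [/\ Ht y, Ht p, Ht yh & Ht ph].
Proof. by case: sol => -[? ?] _ _ _ _; case: solh => -[? ?] _ _ _ _; split => //; exact: VH. Qed.

Lemma discrete_L2 : [/\ L2 Omega u, L2 Omega uh, L2 Omega l & L2 Omega lh].
Proof. by case: sol => _ [[? _] [? _]] _ _ _; case: solh => _ [[? _] [? _]] _ _ _; split. Qed.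

Lemma galerkin_state chi : V chi -> aF (y \- yh) chi = inn (u \- uh) chi.
Proof.
move=> Vc; have Hc := VH Vc; have [hy hp hyh hph] := discrete_Ht; have [Lu Luh _ _] := discrete_L2.
rewrite aformBl; try exact: HH.
case: sol => _ _ E _ _; case: solh => _ _ Eh _ _.
have Lc := HL Hc; rewrite E// Eh// innBl// !innDl//; ring.
Qed.

Lemma galerkin_adjoint chi : V chi -> aF chi (p \- ph) = inn (y \- yh) chi.
Proof.
move=> Vc; have Hc := VH Vc; have [hy hp hyh hph] := discrete_Ht.
rewrite aformBr; try exact: HH.
case: sol => _ _ _ E _; case: solh => _ _ _ Eh _.
have [Lc Ly Lyh] : [/\ L2 Omega chi, L2 Omega y & L2 Omega yh] by split; exact: HL.
rewrite E// Eh// !innBl//; ring.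
Qed.

(** The control is not discretised: both controls range over the same set, so each is admissible in
    the variational inequality of the other. Their sum leaves the adjoint difference and a
    subgradient term of favourable sign. *)
Lemma control_monotone : gamma * nrm (u \- uh) ^+ 2 <= - inn (p \- ph) (u \- uh).
Proof.
have [hy hp hyh hph] := discrete_Ht; have [Lu Luh Ll Llh] := discrete_L2.
have [Lp Lph] : L2 Omega p /\ L2 Omega ph by split; exact: HL.
case: sol => _ [Uu [_ sl]] _ _ VI; case: solh => _ [Uuh [_ slh]] _ _ VIh.
have h1 := VI _ Uuh; have h2 := VIh _ Uu.
have h3 := sl _ Luh; have h4 := slh _ Lu.
have E (q v w m : 'rV[R]_d -> R) : L2 Omega q -> L2 Omega v -> L2 Omega w -> L2 Omega m ->
    inn (fun x => q x + gamma * v x + beta * w x) m = inn q m + gamma * inn v m + beta * inn w m.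
  move=> Lq Lv Lw Lm.
  have Lg : L2 Omega (fun x => gamma * v x) by exact: sqintZ.
  have Lb : L2 Omega (fun x => beta * w x) by exact: sqintZ.
  have Lqg : L2 Omega (q \+ (fun x => gamma * v x)) by exact: sqintD.
  have -> : inn (fun x => q x + gamma * v x + beta * w x) m = inn ((q \+ (fun x => gamma * v x)) \+ (fun x => beta * w x)) m by [].
  rewrite (innDl Lqg Lb Lm) (innDl Lq Lg Lm).
  by rewrite !innZl.
have [Lu1 Lu2] : L2 Omega (uh \- u) /\ L2 Omega (u \- uh) by split; exact: L2B.
rewrite E// in h1; rewrite E// in h2.
have N q : L2 Omega q -> inn q (uh \- u) = - inn q (u \- uh).
  by move=> Lq; rewrite !(innC q) !innBl//; ring.
rewrite !N// in h1; rewrite N// in h3.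
rewrite nrm_sqr innBl// innBl//.
have h5 : 0 <= beta * (inn l (u \- uh) - inn lh (u \- uh)) by rewrite mulr_ge0 ?(ltW beta0)// subr_ge0; lra.
lra.
Qed.

Let du := u \- uh.
Let dy := y \- yh.
Let dp := p \- ph.

Let Hdy : Ht dy. Proof. by have [*] := discrete_Ht; exact: HtildeB. Qed.
Let Hdp : Ht dp. Proof. by have [*] := discrete_Ht; exact: HtildeB. Qed.
Let Ldu : L2 Omega du. Proof. by have [*] := discrete_L2; exact: L2B. Qed.

Lemma control_le_adjoint : nrm (u \- uh) <= P / gamma * nH (p \- ph).
Proof.
have := control_monotone; rewrite -/du -/dp => h.
have h' := inn_ge (HL Hdp) Ldu.
have [->|n0] := eqVneq (nrm du) 0; first by apply: mulr_ge0 => //; apply: mulr_ge0; rewrite ?invr_ge0 ltW.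
have np : 0 < nrm du by rewrite lt_def n0 nrm_ge0.
rewrite -(@ler_pM2l _ gamma)// mulrA mulrCA mulfV ?gt_eqF// mulr1.
apply: le_trans (PP Hdp).
rewrite -(@ler_pM2r _ (nrm du))//; lra.
Qed.

Lemma L2_error_le (Th : R) : 0 <= Th ->
  (forall e, Ht e -> (forall chi, V chi -> aF e chi = 0) -> nrm e <= Th * nH e) ->
  nrm (u \- uh) ^+ 2 + nrm (y \- yh) ^+ 2 <=
  L2_const gamma P * Th ^+ 2 * (nH (y \- yh) ^+ 2 + nH (p \- ph) ^+ 2).
Proof.
move=> Th0 dual; rewrite -/du -/dy -/dp.
have [HY YE] := SopP d0 alpha0 bO mO C0 Ldu.
have [HZ ZE] := SopP d0 alpha0 bO mO C0 (HL Hdy).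
have YP := Sop_le Ldu; have ZP := Sop_le (HL Hdy).
set Y := Sop alpha Omega du in HY YE YP; set Z := Sop alpha Omega dy in HZ ZE ZP.
have He : Ht (dy \- Y) by exact: HtildeB.
have Hz : Ht (dp \- Z) by exact: HtildeB.
have e1 : nrm (dy \- Y) <= Th * nH (dy \- Y).
  apply: dual => // chi Vc; have Hc := VH Vc.
  by rewrite aformBl ?YE ?galerkin_state ?subrr//; exact: HH.
have z1 : nrm (dp \- Z) <= Th * nH (dp \- Z).
  apply: dual => // chi Vc; have Hc := VH Vc.
  by rewrite aformBl ?ZE 1?(aformC _ dp) ?galerkin_adjoint ?subrr//; exact: HH.
have e2 := nH_tri Hdy HY; have z2 := nH_tri Hdp HZ.
have m := control_monotone; rewrite -/du -/dp in m.
have c := control_le_adjoint; rewrite -/du -/dp in c.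
have b := PP Hdy.
(* Symmetry of the solution operator: (S dy, du) = a(S du, S dy) = (dy, S du). This is how the
   squared state error enters with the good sign. *)
have k1 : inn Z du = inn dy dy - inn dy (dy \- Y).
  rewrite innC -YE// aformC ZE// (innC dy (dy \- Y)) innBl ?(innC dy Y)//; try exact: HL.
  by ring.
have k2 : inn dp du = inn (dp \- Z) du + inn Z du by rewrite innBl ?subrK//; exact: HL.
have k3 := inn_le (HL Hdy) (HL He); have k4 := inn_ge (HL Hz) Ldu.
rewrite k2 k1 -nrm_sqr in m.
have := nrm_ge0 du; have := nrm_ge0 dy; have := nH_ge0 dy; have := nH_ge0 dp.
have := nrm_ge0 (dy \- Y); have := nrm_ge0 (dp \- Z).
move: e1 z1 e2 z2 m c b YP ZP k3 k4.
move: (nH (dy \- Y)) (nH (dp \- Z)) (nrm (dy \- Y)) (nrm (dp \- Z)) (inn dy (dy \- Y)) (inn (dp \- Z) du) (nH Y) (nH Z).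
move: (nrm du) (nrm dy) (nH dy) (nH dp).
move=> A B yy pp Hn Hz' n z i1 i2 hY hZ e1 z1 e2 z2 m c b YP ZP k3 k4 z0 n0 p0 y0 B0 A0.
exact: (L2_error_numeric gamma0 P0 Th0 A0 B0 y0 p0 n0 z0 e1 z1 e2 z2 m c b YP ZP k3 k4).
Qed.

(** [yk - yh] is an admissible test function, so the mixed term of the Pythagoras expansion is the
    L^2 product of [u - uh] with it, and likewise for the adjoints. Young's inequality splits these
    products and half of the left-hand side is absorbed, whence the factors 2 and 4. *)
Lemma level_step (yk pk : 'rV[R]_d -> R) : V (yk \- yh) -> V (pk \- ph) -> Ht yk -> Ht pk ->
  nH (yk \- yh) ^+ 2 + nH (pk \- ph) ^+ 2 <=
  2 * ((nH (y \- yk) ^+ 2 + nH (p \- pk) ^+ 2) - (nH (y \- yh) ^+ 2 + nH (p \- ph) ^+ 2))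
  + 4 * P ^+ 2 * (nrm (u \- uh) ^+ 2 + nrm (y \- yh) ^+ 2).
Proof.
move=> Vy Vp Hyk Hpk; rewrite -/du -/dy -/dp.
have [hy hp hyh hph] := discrete_Ht.
have half (v vh vk g : 'rV[R]_d -> R) : Ht v -> Ht vh -> Ht vk -> L2 Omega g ->
    aF (v \- vh) (vk \- vh) = inn g (vk \- vh) ->
    nH (vk \- vh) ^+ 2 <= 2 * (nH (v \- vk) ^+ 2 - nH (v \- vh) ^+ 2) + 4 * P ^+ 2 * nrm g ^+ 2.
  move=> Hv Hvh Hvk Lg E.
  have Hd := HtildeB Hvk Hvh; have He := HtildeB Hv Hvh.
  have -> : v \- vk = (v \- vh) \- (vk \- vh) by apply/funext => x /=; ring.
  have h := inn_le Lg (HL Hd); have h2 := PP Hd.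
  rewrite (nH_sqrB He Hd) E.
  have := nrm_ge0 g; have := nH_ge0 (vk \- vh); have := nrm_ge0 (vk \- vh).
  move: h h2; move: (nH (vk \- vh)) (nH (v \- vh)) (nrm (vk \- vh)) (nrm g) (inn _ _).
  move=> D e dn gn i h h2 dn0 D0 gn0.
  have : i <= P * gn * D.
    apply: (le_trans h); have -> : P * gn * D = gn * (P * D) by ring.
    by apply: ler_wpM2l.
  have := sqr_ge0 (D - 2 * (P * gn)); set q := P * gn => hq hi.
  have -> : 4 * P ^+ 2 * gn ^+ 2 = 4 * q ^+ 2 by rewrite /q; ring.
  have hq2 : (D - 2 * q) ^+ 2 = D ^+ 2 - 4 * (q * D) + 4 * q ^+ 2 by ring.
  rewrite hq2 in hq; lra.
have h1 := half y yh yk du hy hyh Hyk Ldu (galerkin_state Vy).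
have h2 := half p ph pk dy hp hph Hpk (HL Hdy).
rewrite aformC (galerkin_adjoint Vp) in h2.
have {}h2 := h2 erefl; rewrite -/dy -/dp in h1 h2; lra.
Qed.

(** Eliminating a(my, mp) between the state identity tested with [mp] and the adjoint identity
    tested with [my] produces the term -|my|^2 in the monotonicity inequality. Every other term then
    contains a comparison error [ey] or [ep] as a factor, so the bound involves no duality
    argument. *)
Lemma quasi_optimal (yk pk : 'rV[R]_d -> R) : V (yh \- yk) -> V (ph \- pk) -> Ht yk -> Ht pk ->
  nH (y \- yh) ^+ 2 + nH (p \- ph) ^+ 2 <=
  quasi_const gamma P * (nH (y \- yk) ^+ 2 + nH (p \- pk) ^+ 2).
Proof.
move=> Vy Vp Hyk Hpk; rewrite -/dy -/dp.
have [hy hp hyh hph] := discrete_Ht.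
have VI := control_monotone; rewrite -/du -/dp in VI.
have Gy := galerkin_state Vy; have Gyp := galerkin_state Vp; rewrite -/dy -/du in Gy Gyp.
have Gp := galerkin_adjoint Vp; have Gpy := galerkin_adjoint Vy; rewrite -/dy -/dp in Gp Gpy.
set my := yh \- yk in Vy Gy Gpy *; set mp := ph \- pk in Vp Gyp Gp *.
set ey := y \- yk; set ep := p \- pk.
have [Hmy Hmp Hey Hep] : [/\ Ht my, Ht mp, Ht ey & Ht ep] by split; exact: HtildeB.
have Ey : dy = ey \- my by apply/funext => x; rewrite /dy /ey /my /=; ring.
have Ep : dp = ep \- mp by apply/funext => x; rewrite /dp /ep /mp /=; ring.
have aE v : Ht v -> aF dy v = aF ey v - aF my v.
  by move=> Hv; rewrite Ey (aformBl (HH Hey) (HH Hmy) (HH Hv)).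
have aP v : Ht v -> aF v dp = aF v ep - aF v mp.
  by move=> Hv; rewrite Ep (aformBr (HH Hep) (HH Hmp) (HH Hv)).
rewrite aE// in Gy; rewrite aE// in Gyp; rewrite aP// in Gp; rewrite aP// in Gpy.
have i1 : inn dp du = inn ep du - inn mp du by rewrite Ep innBl//; exact: HL.
have i2 : inn dy my = inn ey my - nrm my ^+ 2 by rewrite nrm_sqr Ey innBl//; exact: HL.
have Lmp := HL Hmp; have Lmy := HL Hmy; have Lep := HL Hep; have Ley := HL Hey.
have b1 := inn_ge Lep Ldu; have b2 := PP Hep; have b3 := PP Hey; have b4 := PP Hmp; have b5 := PP Hmy.
have b6 := inn_le Ley Lmy; have b7 := a_le Hey Hmp; have b8 := a_ge Hmy Hep.
have b9 := inn_ge Ldu Lmy; have b10 := a_le Hey Hmy; have b11 := a_le Hmp Hep.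
have b12 := inn_ge (HL Hdy) Lmp.
have b13 : nrm dy <= P * nH ey + nrm my.
  by rewrite Ey; apply: le_trans (nrm_tri Ley Lmy) _; rewrite lerD2r.
have c1 := nH_tri Hey Hmy; have c2 := nH_tri Hep Hmp; rewrite -Ey in c1; rewrite -Ep in c2.
have sq v := Hnorm_sqr alpha0 v.
have hmy : nH my <= nH ey + P * nrm du.
  have [->|n0] := eqVneq (nH my) 0; first by rewrite addr_ge0// mulr_ge0// ltW.
  have np : 0 < nH my by rewrite lt_def n0 nH_ge0.
  rewrite -(@ler_pM2r _ (nH my))// -expr2 sq mulrDl.
  have : nrm du * nrm my <= P * nrm du * nH my by rewrite (mulrC P) -mulrA; apply: ler_wpM2l.
  clear VI Gyp Gp Gpy i1 i2 b1 b2 b3 b4 b5 b6 b7 b8 b11 b12 b13 c1 c2 n0 np; lra.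
have hmp : nH mp <= nH ep + P * (P * nH ey + nrm my).
  have [->|n0] := eqVneq (nH mp) 0.
    by rewrite addr_ge0// mulr_ge0 ?(ltW P0)// addr_ge0// mulr_ge0// ltW.
  have np : 0 < nH mp by rewrite lt_def n0 nH_ge0.
  rewrite -(@ler_pM2r _ (nH mp))// -expr2 sq mulrDl.
  have : nrm dy * nrm mp <= P * (P * nH ey + nrm my) * nH mp.
    apply: (@le_trans _ _ ((P * nH ey + nrm my) * (P * nH mp))); first by apply: ler_pM.
    by apply: eq_lew; ring.
  rewrite (mulrC (nH mp)) in b11; clear VI Gy Gyp Gpy i1 i2 b1 b2 b3 b4 b5 b6 b7 b8 b9 b10 b13 c1 c2 hmy n0 np; lra.
apply: (@quasi_numeric _ gamma P (nrm du) (nrm my) _ _ (nH my) (nH mp)) => //.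
have q1 : nrm ep * nrm du <= P * nH ep * nrm du by apply: ler_wpM2r.
have q2 : nrm ey * nrm my <= P * nH ey * nrm my by apply: ler_wpM2r.
rewrite (innC mp du) in i1; clear b2 b3 b4 b5 b9 b10 b11 b12 b13 c1 c2 hmy hmp; lra.
Qed.

Lemma reliability_step (eta_y eta_p : R) :
  aF (y \- yh) (y \- yh) <= inn (u \- uh) (y \- yh) + eta_y * nH (y \- yh) ->
  aF (p \- ph) (p \- ph) <= inn (y \- yh) (p \- ph) + eta_p * nH (p \- ph) ->
  0 <= eta_y -> 0 <= eta_p ->
  nH (y \- yh) ^+ 2 + nH (p \- ph) ^+ 2 <=
  2 * P ^+ 2 * (nrm (u \- uh) ^+ 2 + nrm (y \- yh) ^+ 2) + 2 * (eta_y ^+ 2 + eta_p ^+ 2).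
Proof.
rewrite -/du -/dy -/dp => h1 h2 e1 e2.
have gen (v g : 'rV[R]_d -> R) (eta : R) : Ht v -> L2 Omega g -> 0 <= eta ->
    aF v v <= inn g v + eta * nH v -> nH v ^+ 2 <= 2 * P ^+ 2 * nrm g ^+ 2 + 2 * eta ^+ 2.
  move=> Hv Lg eta0; rewrite -Hnorm_sqr//.
  have h := inn_le Lg (HL Hv); have h' := PP Hv.
  have := nrm_ge0 g; have := nH_ge0 v; move: h h'.
  move: (nH v) (nrm v) (nrm g) (inn _ _) => D n gn i h h' D0 gn0 hD.
  have hD' : D <= P * gn + eta.
    have [->|Dn] := eqVneq D 0; first by rewrite addr_ge0// mulr_ge0// ltW.
    have Dp : 0 < D by rewrite lt_def Dn.
    rewrite -(@ler_pM2r _ D)// -expr2 mulrDl; apply: (le_trans hD); rewrite lerD2r; apply: (le_trans h).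
    by rewrite (mulrC P) -mulrA; apply: ler_wpM2l.
  have := sqr_le_add D0 hD'; rewrite exprMn; lra.
have g1 := gen dy du eta_y Hdy Ldu e1 h1; have g2 := gen dp dy eta_p Hdp (HL Hdy) e2 h2.
lra.
Qed.

End one_level.
End discrete_control.

Lemma min_weight_sum_le (R : realType) (I : Type) (s : seq I) (A B : I -> \bar R) (a b : R) :
  0 < a -> 0 < b -> (forall i, 0 <= A i)%E -> (forall i, 0 <= B i)%E ->
  ((Num.min a b)%:E * (\sum_(i <- s) A i + \sum_(i <- s) B i) <=
   \sum_(i <- s) (a%:E * A i + b%:E * B i))%E.
Proof.
move=> a0 b0 A0 B0.
have m0 : (0 <= (Num.min a b)%:E)%E by rewrite lee_fin le_min !ltW.
elim: s => [|i s IH]; first by rewrite !big_nil adde0 mule0.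
rewrite !big_cons addeACA ge0_muleDr ?adde_ge0 ?sume_ge0//; apply: leeD => //.
rewrite ge0_muleDr//; apply: leeD; apply: lee_wpmul2r => //.
  by rewrite lee_fin ge_min lexx.
by rewrite lee_fin ge_min lexx orbT.
Qed.

Lemma exists_eq (T : Type) (x : T) : exists y, y = x.
Proof. by exists x. Qed.

Lemma weighted_residual_ge0 (R : realType) (d : nat) (alpha : R) (T : mesh R d) K r : (0 <= weighted_residual alpha T K r)%E.
Proof. by apply: integral_ge0 => x _; rewrite lee_fin sqr_ge0. Qed.

Lemma estimator_ge0 (R : realType) (d : nat) (alpha Cst Cad : R) f yd u y p (T : mesh R d) : 0 <= Cst -> 0 <= Cad ->
  (0 <= estimator_sq alpha Cst Cad f yd u y p T)%E.
Proof.
by move=> ? ?; apply: sume_ge0 => K _; apply: adde_ge0; apply: mule_ge0; rewrite ?lee_fin ?weighted_residual_ge0.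
Qed.

(** * Measure of thin layers of a simplex *)

Section layers.
Context {R : realType} {d : nat}.
Implicit Types (x y g : 'rV[R]_d) (A : set 'rV[R]_d).
Local Notation mu := (@lebesgue_rV R d).

Lemma bounded_measure_fin A y0 (D : R) : measurable A -> (forall x, A x -> enorm (x - y0) <= D) ->
  exists2 m : R, 0 <= m & mu A = m%:E.
Proof.
move=> mA AD.
have : (mu A < +oo)%E.
  apply: (@lebesgue_rV_lty _ _ _ (D + enorm y0)) => // x Ax.
  apply: le_trans (norm_le_enorm _) _; rewrite -[x in enorm x](subrK y0).
  by apply: le_trans (enormD _ _) _; rewrite lerD2r AD.
have : (0 <= mu A)%E by exact: measure_ge0.
by case: (mu A) => // m m0 _; exists m.
Qed.

(* The translates of the layer by multiples of [t] along an axis are disjoint. *)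
Lemma layer_measure A y0 g (a b D : R) j : measurable A -> 0 < D -> a < b -> g 0 j != 0 ->
  (forall x, A x -> enorm (x - y0) <= D) -> (forall x, A x -> a <= dotp g x <= b) ->
  (mu A <= ((6 * D) ^+ d * (4 * (b - a) / (`|g 0 j| * D)))%:E)%E.
Proof.
move=> mA D0 ab gj AD Ag.
have [m m0 mE] := bounded_measure_fin mA AD; rewrite mE lee_fin.
have gj0 : 0 < `|g 0 j| by rewrite normr_gt0.
(* A translation by [t] along axis [j] changes [dotp g] by twice the width of the layer. *)
pose t := 2 * (b - a) / `|g 0 j|.
have t0 : 0 < t by rewrite divr_gt0// mulr_gt0// subr_gt0.
have tg : t * `|g 0 j| = 2 * (b - a) by rewrite /t divfK// gt_eqF.
have D6 : 0 < (6 * D) ^+ d by rewrite exprn_gt0// mulr_gt0.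
have -> : 4 * (b - a) / (`|g 0 j| * D) = 2 * t / D by rewrite /t; field; rewrite !gt_eqF.
clearbody t.
have ball3 : mu (ball y0 (3 * D)) = ((6 * D) ^+ d)%:E.
  by rewrite lebesgue_rV_ball ?mulr_gt0//; congr (_ ^+ _)%:E; ring.
have inb x : enorm (x - y0) <= 2 * D -> ball y0 (3 * D) x.
  move=> h; rewrite -ball_normE /= distrC; apply: le_lt_trans (norm_le_enorm _) _.
  by apply: le_lt_trans h _; lra.
(* For [t > D] the claim follows from the volume of the ball of radius 3 D; otherwise about D / t
   translates fit into that ball. *)
have [tD|Dt] := leP t D; last first.
  have : (mu A <= mu (ball y0 (3 * D)))%E.
    have mb : measurable (ball y0 (3 * D)) by apply: measurable_rV_ball; exact: mulr_gt0.
    apply: le_measure; rewrite ?inE//.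
    by move=> x Ax; apply: inb; apply: le_trans (AD x Ax) _; lra.
  rewrite mE ball3 lee_fin => h; apply: (le_trans h).
  by rewrite ler_peMr ?(ltW D6)// ler_pdivlMr// mul1r; lra.
pose N := Num.truncn (D / t).
have /andP[N1 N2] : N%:R <= D / t < N.+1%:R.
  by apply: trunc_itv; apply: divr_ge0; exact: ltW.
have Nt : N%:R * t <= D by rewrite -ler_pdivlMr.
have N0 : (0 < N)%N.
  rewrite lt0n; apply/eqP => N00; move: N2; rewrite N00 ltr_pdivrMr// mul1r; lra.
have Nr0 : 0 < N%:R :> R by rewrite ltr0n.
have Nt2 : D <= 2 * (N%:R * t).
  move: N2; rewrite ltr_pdivrMr// -natr1 mulrDl mul1r => N2.
  have : t <= N%:R * t by rewrite ler_peMl ?(ltW t0)// ler1n.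
  lra.
pose Ak k := (fun x : 'rV[R]_d => x - (k%:R * t) *: delta_mx 0 j) @^-1` A.
have mAk k : measurable (Ak k).
  by apply: measurable_preimageT => //; apply: measurable_subrV => //; exact: measurable_cst.
have muAk k : mu (Ak k) = m%:E by rewrite -mE; exact: lebesgue_rV_shift.
have dotpe (x : 'rV[R]_d) : dotp x (delta_mx 0 j) = x 0 j.
  rewrite /dotp (bigD1 j)//= big1 ?addr0 ?mxE ?eqxx ?mulr1// => i ij.
  by rewrite mxE (negbTE ij) andbF mulr0.
have enorme : enorm (delta_mx 0 j : 'rV[R]_d) = 1 by rewrite /enorm dotpe mxE !eqxx sqrtr1.
have triv : trivIset `I_N Ak.
  apply/trivIsetP => k l kN lN kl; apply/seteqP; split=> // x [/= xk xl]; exfalso.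
  have := Ag _ xk; have := Ag _ xl; rewrite !dotpBr !dotpZr dotpe => /andP[l1 l2] /andP[k1 k2].
  have : `|(k%:R - l%:R) * (t * g 0 j)| <= b - a.
    rewrite mulrBl !(mulrA _ t) ler_norml; move: l1 l2 k1 k2.
    move: (k%:R * t * g 0 j) (l%:R * t * g 0 j) (dotp g x) => X Y Z *; apply/andP; split; lra.
  rewrite !normrM (gtr0_norm t0) tg => h.
  have : 1 <= `|k%:R - l%:R : R|.
    wlog lk : k l kl kN lN xk xl l1 l2 k1 k2 h / (l < k)%N.
      move=> H; have [lk|kl'|E] := ltngtP l k; first exact: (H k l).
        by rewrite distrC; apply: (H l k) => //; [rewrite eq_sym|rewrite distrC].
      by rewrite E eqxx in kl.
    by rewrite -natrB ?(ltnW lk)// normr_nat ler1n subn_gt0.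
  move=> h1; have : 1 * (2 * (b - a)) <= `|k%:R - l%:R : R| * (2 * (b - a)).
    by rewrite ler_wpM2r// mulr_ge0// subr_ge0 ltW.
  lra.
have : (\sum_(k < N) mu (Ak k) <= mu (ball y0 (3 * D)))%E.
  rewrite -(measure_semi_additive_ord_I mu (fun k _ => mAk k) triv); last exact: bigsetU_measurable.
  have mb : measurable (ball y0 (3 * D)) by apply: measurable_rV_ball; exact: mulr_gt0.
  apply: le_measure; rewrite ?inE//; first exact: bigsetU_measurable.
  rewrite -bigcup_mkord => x [k /= kN xk]; apply: inb.
  have := AD _ xk; rewrite addrAC => h.
  rewrite -[x - y0](subrK ((k%:R * t) *: delta_mx 0 j)); apply: le_trans (enormD _ _) _.
  rewrite [X in _ + X]enormZ enorme mulr1 ger0_norm; last by rewrite mulr_ge0// ltW.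
  have : k%:R * t <= N%:R * t by rewrite ler_wpM2r ?(ltW t0)// ler_nat ltnW.
  lra.
rewrite (eq_bigr (fun=> m%:E)) => [|k _]; last exact: muAk.
rewrite sumEFin sumr_const card_ord ball3 lee_fin -[m *+ N]mulr_natl => h.
rewrite -(ler_pM2l Nr0); apply: (le_trans h).
rewrite mulrCA ler_peMr ?(ltW D6)// !mulrA ler_pdivlMr// mul1r; lra.
Qed.

Lemma hyperplane_null A y0 g (c D : R) : measurable A -> g != 0 ->
  (forall x, A x -> enorm (x - y0) <= D) -> (forall x, A x -> dotp g x = c) -> mu A = 0%E.
Proof.
move=> mA g0 AD Ac.
have [j gj] : exists j, g 0 j != 0.
  apply: contrapT => h; move/eqP: g0; apply; apply/rowP => j; rewrite mxE.
  by apply/eqP; apply: contrapT => /negP gj; apply: h; exists j.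
have [m m0 mE] := bounded_measure_fin mA AD; rewrite mE; congr EFin.
pose D' := `|D| + 1.
have D'0 : 0 < D' by rewrite ltr_wpDl.
pose M := (6 * D') ^+ d * (4 / (`|g 0 j| * D')).
have gj0 : 0 < `|g 0 j| by rewrite normr_gt0.
have M0 : 0 < M.
  by apply: mulr_gt0; [apply: exprn_gt0; exact: mulr_gt0|apply: divr_gt0 => //; exact: mulr_gt0].
apply/eqP; rewrite eq_le m0 andbT; apply/ler_addgt0Pr => e e0; rewrite add0r.
have eM : 0 < e / M by rewrite divr_gt0.
have := @layer_measure A y0 g c (c + e / M) D' j mA D'0 _ gj _ _.
rewrite mE lee_fin [c + _]addrC addrK => h; apply: le_trans (h _ _ _) _.
- by rewrite ltrDr.
- by move=> x Ax; apply: le_trans (AD x Ax) _; rewrite /D'; have := ler_norm D; lra.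
- by move=> x Ax; rewrite Ac// lexx lerDr ltW.
apply: eq_lew; rewrite /M; field.
by rewrite !gt_eqF ?exprn_gt0 ?mulr_gt0// normr_gt0.
Qed.

Section simplex_layers.
Hypothesis d0 : (0 < d)%N.
Variable K : tsimplex R d.
Hypothesis ndK : nondegenerate_simplex K.

(** Coordinate [i] drops from 1 to 0 along an edge of length at most [D]; the drop is a sum of [d]
    terms, one of which must be at least 1 / d. *)
Lemma bgrad_ge (D : R) (i : 'I_d.+1) : (forall x y, simplex K x -> simplex K y -> enorm (x - y) <= D) ->
  exists j, 1 <= d%:R * D * `|bgrad K i 0 j|.
Proof.
move=> KD.
have [k ik] : exists k, k != i.
  case: (eqVneq i ord0) => [->|i0]; last by exists ord0; rewrite eq_sym.
  exists (lift ord0 (Ordinal d0)); rewrite eq_sym; exact: neq_lift.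
have h1 : dotp (bgrad K i) (row i K.1 - row k K.1) = 1.
  by rewrite -baryB !bary_vertex// eqxx (negbTE ik) subr0.
have zD := KD _ _ (simplex_vertex ndK i) (simplex_vertex ndK k).
apply: contrapT => nj.
have h j : d%:R * D * `|bgrad K i 0 j| < 1.
  by rewrite ltNge; apply/negP => h; apply: nj; exists j.
have D0 : 0 <= D by apply: le_trans zD; exact: enorm_ge0.
have : d%:R * dotp (bgrad K i) (row i K.1 - row k K.1) < d%:R * 1 :> R.
  rewrite /dotp mulr_sumr.
  apply: (@le_lt_trans _ _ (\sum_(j < d) d%:R * D * `|bgrad K i 0 j|)).
    apply: ler_sum => j _; rewrite -mulrA ler_wpM2l// mulrC.
    apply: le_trans (ler_norm _) _; rewrite normrM ler_wpM2r//.
    by apply: le_trans zD; apply: le_trans (coord_le_norm _ _) (norm_le_enorm _).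
  rewrite mulr1 -[X in _ < X%:R]card_ord -sumr_const; apply: ltr_sum; last by move=> j _; exact: h.
  by apply/hasP; exists (Ordinal d0); rewrite ?mem_index_enum.
by rewrite h1 ltxx.
Qed.

Lemma bgrad_neq0 i : bgrad K i != 0.
Proof.
have [D [_ hD]] := simplex_bounded K.
pose B := (d%:R + 1) * (2 * (`|D| + 1)).
have KB x y : simplex K x -> simplex K y -> enorm (x - y) <= B.
  move=> Kx Ky; apply: le_trans (enorm_le_norm _) _; rewrite /B ler_wpM2l ?addr_ge0//.
  apply: le_trans (ler_normB _ _) _.
  have DD : D < `|D| + 1 by apply: le_lt_trans (ler_norm D) _; rewrite ltrDl.
  by rewrite mulr_natl mulr2n; apply: lerD; exact: hD.
have [j] := bgrad_ge i KB.
by apply: contraPneq => ->; rewrite mxE normr0 mulr0 ler10.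
Qed.

Lemma bary_dotp x i : bary K x i = bary K 0 i + dotp (bgrad K i) x.
Proof. by have := baryB K x 0 i; rewrite subr0 => <-; rewrite addrC subrK. Qed.

Lemma bary_layer_null (c : R) i : mu (simplex K `&` [set x | bary K x i = c]) = 0%E.
Proof.
have [D [_ hD]] := simplex_bounded K.
apply: (@hyperplane_null _ 0 (bgrad K i) (c - bary K 0 i) ((d%:R + 1) * (`|D| + 1))).
- apply: measurableI; first exact: measurable_simplex.
  rewrite (_ : mkset _ = (fun x => bary K x i) @^-1` [set c]) //.
  by apply: measurable_preimageT => //; exact: measurable_bary.
- exact: bgrad_neq0.
- move=> x [Kx _]; rewrite subr0; apply: le_trans (enorm_le_norm _) _.
  rewrite ler_wpM2l ?addr_ge0//; apply: hD => //.
  by apply: le_lt_trans (ler_norm D) _; rewrite ltrDl.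
- by move=> x [_ /= <-]; rewrite bary_dotp; ring.
Qed.

Lemma simplex_interior_conull : mu (simplex K `\` (simplex K)°) = 0%E.
Proof.
have mB : measurable (simplex K `\` (simplex K)°).
  by apply: measurableD; [exact: measurable_simplex|exact: measurable_simplex_interior].
pose F n := simplex K `&` [set x | bary K x (inord n) = 0].
have mF n : measurable (F n).
  apply: measurableI; first exact: measurable_simplex.
  rewrite (_ : mkset _ = (fun x => bary K x (inord n)) @^-1` [set 0]) //.
  by apply: measurable_preimageT => //; exact: measurable_bary.
apply/eqP; rewrite eq_le measure_ge0 andbT.
have muF i : mu (F i) = 0%E by exact: bary_layer_null.
have S0 : (\sum_(k < d.+1) mu (F k) = 0)%E by apply: big1 => i _; exact: muF.
rewrite -S0; apply: (content_subadditive mu (F := F) (n := d.+1) (fun n _ => mF n) mB).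
 rewrite -bigcup_mkord => x [Kx nx].
have : boundary (simplex K) x.
  by rewrite /boundary -(closure_id _).1//; exact: closed_simplex.
move=> /(simplex_boundaryP ndK)[_ [i b0]]; exists i => //=.
by split=> //=; rewrite inord_val.
Qed.

End simplex_layers.
End layers.

(** * Smooth cut-offs and test functions *)

Section L2_convergence.
Context {R : realType} {d : nat}.
Local Notation mu := (@lebesgue_rV R d).

Lemma L2_cvg_dominated (Omega : set 'rV[R]_d) (fn : nat -> 'rV[R]_d -> R) (f : 'rV[R]_d -> R) (C : R) :
  measurable Omega -> (mu Omega < +oo)%E ->
  (forall n, measurable_fun Omega (fn n)) -> measurable_fun Omega f ->
  (forall n (x : 'rV[R]_d), Omega x -> `|fn n x - f x| <= C) ->
  {ae mu, forall x, Omega x -> fn n x @[n --> \oo] --> f x} ->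
  (fun n => normL2 Omega (fn n \- f)) @ \oo --> (0 : R).
Proof.
move=> mO fO mfn mf bC cv.
pose F n x := (((fn n \- f) x) ^+ 2)%:E.
have mF n : measurable_fun Omega (F n) by apply/measurable_EFinP/measurable_funX/measurable_funB.
have iC : mu.-integrable Omega (fun=> (C ^+ 2)%:E).
  apply/integrableP; split; first exact: measurable_cst.
  under eq_integral do rewrite gee0_abs ?lee_fin ?sqr_ge0//.
  by rewrite integral_cst//= lte_mul_pinfty ?lee_fin ?sqr_ge0.
have [||_ _] := @dominated_convergence _ _ R mu Omega mO F (cst 0%E) (fun=> (C ^+ 2)%:E) mF (measurable_cst _) _ iC.
- apply: filterS cv => x cx Ox; rewrite /F.
  apply: cvg_EFin; first by near=> n.
  have : (fn n x - f x) ^+ 2 @[n --> \oo] --> (0 : R).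
    rewrite -[X in _ --> X](_ : (f x - f x) ^+ 2 = 0); last by rewrite subrr expr0n.
    have c1 : fn n x - f x @[n --> \oo] --> f x - f x by apply: cvgB; [exact: cx|exact: cvg_cst].
    exact: (cvgM c1 c1).
  exact.
- apply/aeW => x n Ox; rewrite lee_fin /= ger0_norm ?sqr_ge0//.
  by rewrite -real_normK ?num_real// lerXn2r ?nnegrE// ?bC// (le_trans _ (bC n x Ox)).
rewrite integral0 => h.
have E n : normL2 Omega (fn n \- f) = Num.sqrt (fine (\int[mu]_(x in Omega) F n x)%E).
  rewrite /normL2 /inner /Rintegral; congr (Num.sqrt (fine _)).
rewrite (_ : (fun n => _) = fun n => Num.sqrt (fine (\int[mu]_(x in Omega) F n x)%E)); last by apply/funext.
rewrite -[X in _ --> X]sqrtr0; apply: continuous_cvg; first exact: sqrt_continuous.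
exact: (fine_cvg h).
Unshelve. all: by end_near. Qed.

End L2_convergence.

Section flat_functions.
Context {R : realType}.
Implicit Types (t u : R) (k : nat).

(* The derivatives of [expR (- t^-1)], extended by zero to [t <= 0], are combinations of these. *)
Definition flat k t : R := if 0 < t then t^-1 ^+ k * expR (- t^-1) else 0.

(** From u / k <= exp (u / k), raised to the power k. *)
Lemma expr_mul_expRN_le u k : 0 <= u -> u ^+ k * expR (- u) <= k%:R ^+ k.
Proof.
move=> u0; case: k => [|k]; first by rewrite !expr0 mul1r expR_le1 oppr_le0.
have k0 : 0 < k.+1%:R :> R by rewrite ltr0n.
have : (u / k.+1%:R) ^+ k.+1 <= expR u.
  have -> : expR u = expR (u / k.+1%:R) ^+ k.+1.
    by rewrite -expRM_natl -mulr_natl; congr expR; field; rewrite addrC natr1 gt_eqF.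
  rewrite lerXn2r ?nnegrE ?divr_ge0 ?expR_ge0 ?(ltW k0)//.
  by apply: le_trans (expR_ge1Dx _); rewrite lerDr.
rewrite expr_div_n ler_pdivrMr ?exprn_gt0// => h.
by rewrite expRN ler_pdivrMr ?expR_gt0// mulrC.
Qed.

Lemma flat_ge0 k t : 0 <= flat k t.
Proof. by rewrite /flat; case: ifP => // t0; rewrite mulr_ge0 ?exprn_ge0 ?expR_ge0// invr_ge0 ltW. Qed.

Lemma flat_le k t : flat k t <= k.+1%:R ^+ k.+1 * `|t|.
Proof.
rewrite /flat; case: ifP => t0; last by rewrite mulr_ge0// exprn_ge0.
have := @expr_mul_expRN_le t^-1 k.+1 (ltac:(by rewrite invr_ge0 ltW)).
rewrite exprS -mulrA ler_pdivrMl// => h.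
by rewrite (gtr0_norm t0) [leRHS]mulrC.
Qed.

Lemma is_derive_flat k t : is_derive t 1 (flat k) (- (k%:R) * flat k.+1 t + flat k.+2 t).
Proof.
have [t0|t0|->] := ltrgtP t 0.
- have -> : - k%:R * flat k.+1 t + flat k.+2 t = 0.
    by rewrite /flat ltNge (ltW t0)/= mulr0 addr0.
  apply: (near_eq_is_derive _ (is_derive_cst (0 : R) t (1 : R))).
  have := lt_nbhsl t0; apply: filterS => s s0.
  by rewrite /flat ltNge (ltW s0).
- pose G u := u ^+ k * expR (- u).
  have dG : is_derive t^-1 1 G (k%:R * t^-1 ^+ k.-1 * expR (- t^-1) - t^-1 ^+ k * expR (- t^-1)).
    have d1 : is_derive t^-1 1 (fun u : R => u ^+ k) (k%:R * t^-1 ^+ k.-1).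
      have := @is_deriveX _ _ (@id R) k t^-1 1 1 _; rewrite /GRing.scale/= mulr1.
      rewrite -mulr_natl (_ : id ^+ k = fun u : R => u ^+ k); last first.
        by apply/funext => u; elim: (k) => [|n IH]; rewrite ?expr0// !exprS -IH.
      by apply; exact: is_derive_id.
    have d2 : is_derive t^-1 1 (fun u : R => expR (- u)) (- expR (- t^-1)).
      have := @is_derive1_comp _ expR -%R t^-1 (expR (- t^-1)) (- 1).
      by rewrite mulrN1; apply.
    have h := is_deriveM d1 d2; apply: (is_derive_eq h); rewrite /GRing.scale/=; ring.
  have dV : is_derive t 1 (fun s : R => s^-1) (- t ^- 2).
    have := @is_deriveV _ id t 1 1; rewrite /GRing.scale/= mulr1; apply; by rewrite gt_eqF.
  have := is_derive1_comp dG dV => dGV.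
  have {}dGV : is_derive t 1 (G \o (fun s => s^-1)) (- k%:R * flat k.+1 t + flat k.+2 t).
    apply: (is_derive_eq dGV); rewrite /flat t0.
    have -> : t ^- 2 = t^-1 ^+ 2 by rewrite exprVn.
    by case: (k) => [|n]; rewrite /= ?exprS ?expr0; ring.
  apply: (near_eq_is_derive _ dGV).
  by have := lt_nbhsr t0; apply: filterS => s s0; rewrite /flat s0.
- have -> : - k%:R * flat k.+1 0 + flat k.+2 0 = 0 by rewrite /flat ltxx mulr0 addr0.
  (* At 0 the difference quotient of [flat k] has absolute value [flat k.+1], which tends to 0 with
     its argument. *)
  have key : (fun h : R => h^-1 *: ((flat k \o shift 0) (h *: 1) - flat k 0)) @ 0^' --> (0 : R).
    apply/cvgrPdist_le => e e0.
    pose c : R := k.+2%:R ^+ k.+2.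
    have c0 : 0 < c by rewrite exprn_gt0// ltr0n.
    near=> h; rewrite sub0r normrN /= /shift/= addr0 [h%:A]mulr1.
    rewrite {2}/flat ltxx subr0.
    have h0 : h != 0 by near: h; exact: nbhs_dnbhs_neq.
    have -> : `|h^-1 *: flat k h| = flat k.+1 h.
      rewrite /flat; case: ifP => hp; last by rewrite scaler0 normr0.
      rewrite exprS -mulrA ger0_norm// mulr_ge0 ?invr_ge0 ?(ltW hp)//.
      by rewrite mulr_ge0 ?exprn_ge0 ?expR_ge0// invr_ge0 ltW.
    apply: (le_trans (flat_le _ _)); rewrite -/c mulrC -ler_pdivlMr//; apply/ltW.
    near: h; apply: dnbhs0_lt; exact: divr_gt0.
  split; first by apply/cvg_ex; exists 0.
  exact/cvg_lim.
Unshelve. all: by end_near. Qed.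

Inductive smooth1 : (R -> R) -> Prop :=
| smooth1_cst c : smooth1 (fun=> c)
| smooth1_id : smooth1 id
| smooth1D f g : smooth1 f -> smooth1 g -> smooth1 (f \+ g)
| smooth1M f g : smooth1 f -> smooth1 g -> smooth1 (f \* g)
| smooth1V f : (forall t, f t != 0) -> smooth1 f -> smooth1 (fun t => (f t)^-1)
| smooth1_comp f g : smooth1 f -> smooth1 g -> smooth1 (f \o g)
| smooth1_flat k : smooth1 (flat k).

Lemma smooth1_derive f : smooth1 f -> exists2 f', smooth1 f' & forall t, is_derive t 1 f (f' t).
Proof.
elim=> {f} [c||f g _ [f' sf' df] _ [g' sg' dg]|f g sf [f' sf' df] sg [g' sg' dg]|f f0 sf [f' sf' df]|f g sf [f' sf' df] sg [g' sg' dg]|k].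
- by exists (fun=> 0); [exact: smooth1_cst|move=> t; exact: is_derive_cst].
- by exists (fun=> 1); [exact: smooth1_cst|move=> t; exact: is_derive_id].
- by exists (f' \+ g'); [exact: smooth1D|move=> t; exact: is_deriveD].
- exists ((f \* g') \+ (g \* f')); first by apply: smooth1D; exact: smooth1M.
  by move=> t; exact: is_deriveM.
- exists ((fun=> -1) \* ((fun t => (f t)^-1) \* (fun t => (f t)^-1)) \* f').
    apply: smooth1M => //; apply: smooth1M; first exact: smooth1_cst.
    by apply: smooth1M; exact: smooth1V.
  move=> t; apply: (is_derive_eq (is_deriveV (f0 t) (df t))).
  by rewrite /= mulN1r -invfM -expr2.
- exists ((f' \o g) \* g'); first by apply: smooth1M => //; exact: smooth1_comp.
  by move=> t; exact: is_derive1_comp.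
- exists ((fun t => - k%:R * flat k.+1 t) \+ flat k.+2).
    apply: smooth1D; last exact: smooth1_flat.
    by apply: (@smooth1M (fun=> - k%:R)); [exact: smooth1_cst|exact: smooth1_flat].
  by move=> t; exact: is_derive_flat.
Qed.

Lemma smooth1_continuous f : smooth1 f -> continuous f.
Proof.
move=> /smooth1_derive[f' _ df] t; apply: differentiable_continuous; apply/derivable1_diffP.
by case: (df t).
Qed.

Definition step_fun t : R := flat 0 t / (flat 0 t + flat 0 (1 - t)).

Lemma flat0_gt0 t : 0 < t -> 0 < flat 0 t.
Proof. by move=> t0; rewrite /flat t0 expr0 mul1r expR_gt0. Qed.

Lemma step_den_gt0 t : 0 < flat 0 t + flat 0 (1 - t).
Proof.
have [t0|t0] := ltP 0 t; first by rewrite ltr_wpDr ?flat_ge0 ?flat0_gt0.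
by rewrite ltr_wpDl ?flat_ge0// flat0_gt0//; lra.
Qed.

Lemma step_fun_smooth1 : smooth1 step_fun.
Proof.
have s1 : smooth1 (fun t => flat 0 (1 - t)).
  apply: (@smooth1_comp (flat 0) (fun t => 1 - t)); first exact: smooth1_flat.
  apply: (@smooth1D (fun=> 1) -%R); first exact: smooth1_cst.
  rewrite (_ : -%R = (fun=> -1) \* id); last by apply/funext => t /=; rewrite mulN1r.
  by apply: smooth1M; [exact: smooth1_cst|exact: smooth1_id].
apply: (@smooth1M (flat 0)); first exact: smooth1_flat.
apply: (@smooth1V (fun t => flat 0 t + flat 0 (1 - t))); first by move=> t; rewrite gt_eqF// step_den_gt0.
by apply: smooth1D => //; exact: smooth1_flat.
Qed.

Lemma step_fun0 t : t <= 0 -> step_fun t = 0.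
Proof. by move=> t0; rewrite /step_fun {1}/flat ltNge t0 mul0r. Qed.

Lemma step_fun1 t : 1 <= t -> step_fun t = 1.
Proof.
move=> t1; have t0 : 0 < t by lra.
have z : flat 0 (1 - t) = 0 by rewrite /flat ltNge; case: leP => //; lra.
by rewrite /step_fun z addr0 divff// gt_eqF// flat0_gt0.
Qed.

Lemma step_fun_01 t : 0 <= step_fun t <= 1.
Proof.
have d0 := step_den_gt0 t.
rewrite /step_fun divr_ge0 ?flat_ge0 ?(ltW d0)//= ler_pdivrMr// mul1r lerDl flat_ge0//.
Qed.

(** The derivative is continuous on [0, 1], hence bounded there, and 0 outside, where the step is
    locally constant; at the two end points it vanishes by continuity. *)
Lemma step_fun_derive : exists2 f, smooth1 f & exists2 M : R, 0 < M &
  forall t, [/\ is_derive t 1 step_fun (f t), `|f t| <= M, t <= 0 -> f t = 0 & 1 <= t -> f t = 0].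
Proof.
have [f sf df] := smooth1_derive step_fun_smooth1.
have cf := smooth1_continuous sf.
have d0 t : t < 0 -> f t = 0.
  move=> t0; have [_ <-] := df t.
  rewrite (@near_eq_derive R R R _ (fun=> 0)) ?derive_cst//.
  by have := lt_nbhsl t0; apply: filterS => s s0; rewrite step_fun0// ltW.
have d1 t : 1 < t -> f t = 0.
  move=> t1; have [_ <-] := df t.
  rewrite (@near_eq_derive R R R _ (fun=> 1)) ?derive_cst//.
  by have := lt_nbhsr t1; apply: filterS => s s0; rewrite step_fun1// ltW.
have z0 : f 0 = 0.
  have h1 : f x @[x --> 0^'-] --> f 0 by apply: cvg_at_left_filter; exact: cf.
  have h2 : f x @[x --> 0^'-] --> (0 : R).
    apply: (@cvg_trans _ ((fun=> (0 : R)) @ 0^'-)); last exact: cvg_cst.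
    by apply: near_eq_cvg; near=> s; rewrite d0.
  by rewrite -(cvg_lim (@Rhausdorff R) h1); exact: cvg_lim.
have z1 : f 1 = 0.
  have h1 : f x @[x --> 1^'+] --> f 1 by apply: cvg_at_right_filter; exact: cf.
  have h2 : f x @[x --> 1^'+] --> (0 : R).
    apply: (@cvg_trans _ ((fun=> (0 : R)) @ 1^'+)); last exact: cvg_cst.
    by apply: near_eq_cvg; near=> s; rewrite d1.
  by rewrite -(cvg_lim (@Rhausdorff R) h1); exact: cvg_lim.
have cn : {within `[0, 1], continuous (fun t => `|f t|)}.
  by apply: continuous_subspaceT => t; apply: continuous_comp; [exact: cf|exact: norm_continuous].
have [c _ hc] := EVT_max ler01 cn.
exists f => //; exists (`|f c| + 1); first by rewrite ltr_wpDl.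
move=> t; split => //.
- have [t0|t0] := ltP t 0; first by rewrite d0// normr0 addr_ge0.
  have [t1|t1] := ltP 1 t; first by rewrite d1// normr0 addr_ge0.
  by apply: le_trans (hc t _) _; [rewrite in_itv/= t0|rewrite lerDl].
- by rewrite le_eqVlt => /predU1P[->//|]; exact: d0.
- by rewrite le_eqVlt => /predU1P[<-//|]; exact: d1.
Unshelve. all: by end_near. Qed.

End flat_functions.

Section smooth_functions.
Context {R : realType} {d : nat}.
Implicit Types (f g : 'rV[R]_d -> R) (x : 'rV[R]_d).

(** The analogue of [smooth1] on R^d; functions of one variable enter through composition. *)
Inductive smooth_expr : ('rV[R]_d -> R) -> Prop :=
| smooth_expr_affine c a : smooth_expr (fun x => c + dotp a x)
| smooth_exprD f g : smooth_expr f -> smooth_expr g -> smooth_expr (f \+ g)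
| smooth_exprM f g : smooth_expr f -> smooth_expr g -> smooth_expr (f \* g)
| smooth_expr_comp h f : smooth1 h -> smooth_expr f -> smooth_expr (h \o f).

Lemma smooth_expr_cst (c : R) : smooth_expr (fun=> c).
Proof.
rewrite (_ : (fun=> c) = fun x => c + dotp 0 x); first exact: smooth_expr_affine.
by apply/funext => x; rewrite dotpC dotp0r addr0.
Qed.

Lemma dotp_linear (a : 'rV[R]_d) : linear (dotp a).
Proof. by move=> k u v; rewrite dotpDr dotpZr. Qed.

HB.instance Definition _ (a : 'rV[R]_d) := GRing.isLinear.Build R 'rV[R]_d R _ (dotp a) (dotp_linear a).

Lemma differentiable_affine (c : R) (a : 'rV[R]_d) x : differentiable (fun x => c + dotp a x) x.
Proof.
have cL : continuous (dotp a : 'rV[R]_d -> R).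
  apply: (@lipschitz_continuous _ _ _ (enorm a)) => y z /=; rewrite -dotpBr; exact: dotp_le.
apply: (@differentiableD _ _ _ (fun=> c) (dotp a)); first exact: differentiable_cst.
exact: linear_differentiable.
Qed.

Lemma derive_comp1 (h : R -> R) f (k : R) v x : differentiable f x -> is_derive (f x) 1 h k ->
  'D_v (h \o f) x = k * 'D_v f x.
Proof.
move=> df dh.
have dhf : differentiable (h \o f) x.
  by apply: differentiable_comp => //; apply/derivable1_diffP; case: dh.
have d1 : is_derive (0 : R) (1 : R) (fun t : R => f (x + t *: v)) ('D_v f x).
  by have := @is_derive_line _ _ f x v 0; rewrite scale0r addr0; apply; exact: diff_derivable.
have d2 : is_derive (0 : R) (1 : R) (fun t : R => (h \o f) (x + t *: v)) ('D_v (h \o f) x).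
  by have := @is_derive_line _ _ (h \o f) x v 0; rewrite scale0r addr0; apply; exact: diff_derivable.
have d3 : is_derive (0 : R) (1 : R) (h \o (fun t : R => f (x + t *: v))) (k * 'D_v f x).
  by apply: is_derive1_comp; rewrite scale0r addr0.
by rewrite -(@derive_val _ _ _ _ _ _ _ d2); exact: (@derive_val _ _ _ _ _ _ _ d3).
Qed.

Lemma derive_affine (c : R) (a v : 'rV[R]_d) x : 'D_v (fun x => c + dotp a x) x = dotp a v.
Proof.
apply: cvg_lim => //.
apply: (@cvg_trans _ ((fun=> dotp a v) @ 0^')); last exact: cvg_cst.
apply: near_eq_cvg; near=> h.
have h0 : h != 0 by near: h; exact: nbhs_dnbhs_neq.
rewrite /= /shift/= dotpDr dotpZr.
have -> : c + (h * dotp a v + dotp a x) - (c + dotp a x) = h * dotp a v by ring.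
by rewrite [RHS]/GRing.scale/= mulKf.
Unshelve. all: by end_near. Qed.

Lemma smooth_expr_differentiable f : smooth_expr f -> forall x, differentiable f x.
Proof.
elim=> {f} [c a|f g _ df _ dg|f g _ df _ dg|h f sh _ df] x.
- exact: differentiable_affine.
- exact: differentiableD.
- exact: differentiableM.
- apply: differentiable_comp => //; apply/derivable1_diffP.
  by have [h' _ dh] := smooth1_derive sh; case: (dh (f x)).
Qed.

Lemma smooth_expr_partial f i : smooth_expr f -> smooth_expr (partial i f).
Proof.
elim=> {f} [c a|f g sf df sg dg|f g sf df sg dg|h f sh sf df].
- rewrite (_ : partial i _ = fun=> dotp a 'e_i); first exact: smooth_expr_cst.
  by apply/funext => x; exact: derive_affine.
- rewrite (_ : partial i _ = partial i f \+ partial i g); first exact: smooth_exprD.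
  by apply/funext => x; rewrite /partial deriveD//; apply: diff_derivable; exact: smooth_expr_differentiable.
- rewrite (_ : partial i _ = (f \* partial i g) \+ (g \* partial i f)).
    by apply: smooth_exprD; exact: smooth_exprM.
  by apply/funext => x; rewrite /partial deriveM//; apply: diff_derivable; exact: smooth_expr_differentiable.
- have [h' sh' dh] := smooth1_derive sh.
  rewrite (_ : partial i _ = (h' \o f) \* partial i f).
    by apply: smooth_exprM => //; exact: smooth_expr_comp.
  by apply/funext => x; apply: derive_comp1 => //; exact: smooth_expr_differentiable.
Qed.

Lemma smooth_expr_smooth f : smooth_expr f -> smooth f.
Proof.
move=> sf s; apply: smooth_expr_differentiable.
by elim: s => //= i s IH; exact: smooth_expr_partial.
Qed.

Lemma smoothB f g : smooth f -> smooth g -> smooth (f \- g).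
Proof.
move=> sf sg s x.
suff -> : foldr partial (f \- g) s = foldr partial f s \- foldr partial g s.
  by apply: differentiableB; [exact: sf|exact: sg].
elim: s => //= i s ->; apply/funext => y; rewrite /partial.
by apply: deriveB; apply: diff_derivable; [exact: sf|exact: sg].
Qed.

Lemma test_functionB Omega f g : test_function Omega f -> test_function Omega g -> test_function Omega (f \- g).
Proof.
move=> [sf [K [cK KO f0]]] [sg [K' [cK' KO' g0]]]; split; first exact: smoothB.
exists (K `|` K'); split; [|by move=> x [/KO|/KO']|].
  have := @bigsetU_compact 'rV[R]_d (set 'rV[R]_d) id [:: K; K'] (mem [:: K; K']).
  rewrite !big_cons big_nil !inE !eqxx orbT setU0; apply => C.
  by rewrite !inE => /orP[]/eqP->.
by move=> x nK /=; rewrite f0 ?g0 ?subrr// => Kx; apply: nK; [right|left].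
Qed.

End smooth_functions.

Section VT_operations.
Context {R : realType} {d : nat} (Omega : set 'rV[R]_d).
Hypothesis lipO : bounded_lipschitz_domain Omega.
Implicit Types (x : 'rV[R]_d) (f g v w : 'rV[R]_d -> R) (T : mesh R d).
Local Notation mu := (@lebesgue_rV R d).
Local Notation nrm := (normL2 Omega).
Let mO : measurable Omega. Proof. exact: domain_measurable. Qed.

Lemma normL2_triangle f g : L2 Omega f -> L2 Omega g -> nrm (f \- g) <= nrm f + nrm g.
Proof.
move=> Lf Lg; have LB : L2 Omega (f \- g) := sqintB mO Lf Lg.
rewrite -(@ler_pXn2r _ 2)// ?nnegrE ?addr_ge0 ?sqrtr_ge0//.
have -> : nrm (f \- g) ^+ 2 = ip mu Omega (f \- g) (f \- g) := ipnorm_sqr _ _ _.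
have E1 : ip mu Omega (f \- g) (f \- g) = ip mu Omega f (f \- g) - ip mu Omega g (f \- g) by exact: ipBl.
have E2 : ip mu Omega f (f \- g) = ip mu Omega f f - ip mu Omega g f by rewrite ipC; exact: ipBl.
have E3 : ip mu Omega g (f \- g) = ip mu Omega f g - ip mu Omega g g by rewrite ipC; exact: ipBl.
have F1 : nrm f ^+ 2 = ip mu Omega f f := ipnorm_sqr _ _ _.
have F2 : nrm g ^+ 2 = ip mu Omega g g := ipnorm_sqr _ _ _.
rewrite E1 E2 E3 sqrrD F1 F2 (ipC _ _ g f).
have := ip_le mO Lf Lg; rewrite ler_norml => /andP[h _].
have : ipnorm mu Omega f * ipnorm mu Omega g = nrm f * nrm g by [].
lra.
Qed.

Lemma test_function_L2 f : test_function Omega f -> L2 Omega f /\ forall i, L2 Omega (partial i f).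
Proof.
move=> [sf [K [cK KO f0]]].
have clK : closed K by exact: compact_closed.
have cf : continuous f by move=> x; apply: differentiable_continuous; exact: (sf [::]).
have cp i : continuous (partial i f) by move=> x; apply: differentiable_continuous; exact: (sf [:: i]).
have aux g : continuous g -> (forall x, ~ K x -> g x = 0) -> L2 Omega g.
  move=> cg g0; have [M hM] := compact_support_bounded cK cg g0.
  apply: (@bounded_L2 _ _ _ lipO _ M) => //.
  by apply: measurable_funTS; exact: continuous_measurable_rV.
split; first exact: aux.
by move=> i; apply: aux => //; exact: partial_out.
Qed.

Lemma H10B v w : H10 Omega v -> H10 Omega w -> H10 Omega (v \- w).
Proof.
move=> [Lv [g [phi [Lg tphi cphi cg]]]] [Lw [h [psi [Lh tpsi cpsi ch]]]].
split; first exact: (sqintB mO Lv Lw).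
exists (fun i => g i \- h i), (fun n => phi n \- psi n); split.
- by move=> i; exact: (sqintB mO (Lg i) (Lh i)).
- by move=> n; exact: test_functionB.
- have b n : nrm ((phi n \- psi n) \- (v \- w)) <= nrm (phi n \- v) + nrm (psi n \- w).
    have [L1 _] := test_function_L2 (tphi n); have [L2' _] := test_function_L2 (tpsi n).
    have -> : (phi n \- psi n) \- (v \- w) = (phi n \- v) \- (psi n \- w) by apply/funext => x /=; ring.
    apply: normL2_triangle; [exact: (sqintB mO L1 Lv)|exact: (sqintB mO L2' Lw)].
  apply: (@squeeze_cvgr _ _ _ _ (fun=> 0) (fun n => nrm (phi n \- v) + nrm (psi n \- w))).
  + by near=> n; rewrite sqrtr_ge0 b.
  + exact: cvg_cst.
  + by rewrite -[X in _ --> X]addr0; exact: cvgD.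
- move=> i; have b n : nrm (partial i (phi n \- psi n) \- (g i \- h i)) <= nrm (partial i (phi n) \- g i) + nrm (partial i (psi n) \- h i).
    have [_ L1] := test_function_L2 (tphi n); have [_ L2'] := test_function_L2 (tpsi n).
    have -> : partial i (phi n \- psi n) \- (g i \- h i) = (partial i (phi n) \- g i) \- (partial i (psi n) \- h i).
      apply/funext => x /=; rewrite /partial deriveB; first ring.
        by apply: diff_derivable; have [s _] := tphi n; exact: (s [::]).
      by apply: diff_derivable; have [s _] := tpsi n; exact: (s [::]).
    apply: normL2_triangle; [exact: (sqintB mO (L1 i) (Lg i))|exact: (sqintB mO (L2' i) (Lh i))].
  apply: (@squeeze_cvgr _ _ _ _ (fun=> 0) (fun n => nrm (partial i (phi n) \- g i) + nrm (partial i (psi n) \- h i))).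
  + by near=> n; rewrite sqrtr_ge0 b.
  + exact: cvg_cst.
  + by rewrite -[X in _ --> X]addr0; exact: cvgD.
Unshelve. all: by end_near. Qed.

Lemma VT_sub T v w : VT Omega T v -> VT Omega T w -> VT Omega T (v \- w).
Proof.
move=> [cv Hv Pv v0] [cw Hw Pw w0]; split.
- by move=> x; apply: cvgB; [exact: cv|exact: cw].
- exact: H10B.
- move=> K KT; have [c [a va]] := Pv K KT; have [c' [a' wa]] := Pw K KT.
  exists (c - c'), (a - a') => x Kx; rewrite /= va// wa// dotpBl; ring.
- by move=> x nx /=; rewrite v0// w0// subrr.
Qed.

End VT_operations.

(* Cut-offs: [cutoff e K] is 1 where all barycentric coordinates are at least [- e] and 0 where
   one of them is at most [- 2 e]; it is a square so that its gradient vanishes with it. *)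
Section cutoff.
Context {R : realType} {d : nat}.
Implicit Types (x : 'rV[R]_d) (K : tsimplex R d) (T : mesh R d) (e : R).

Definition cutoff_root e K x := \prod_(i < d.+1) step_fun (2 + e^-1 * bary K x i).
Definition cutoff e K x := cutoff_root e K x ^+ 2.

Lemma cutoff_root_smooth e K : smooth_expr (cutoff_root e K).
Proof.
have sb i : smooth_expr (fun x => step_fun (2 + e^-1 * bary K x i)).
  rewrite (_ : (fun x => _) = step_fun \o (fun x => (2 + e^-1 * bary K 0 i) + dotp (e^-1 *: bgrad K i) x)).
    by apply: smooth_expr_comp; [exact: step_fun_smooth1|exact: smooth_expr_affine].
  by apply/funext => x /=; rewrite bary_dotp dotpZl mulrDr addrA.
rewrite /cutoff_root; elim: (index_enum _) => [|i s IH].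
  rewrite (_ : (fun x => _) = fun=> 1); first exact: smooth_expr_cst.
  by apply/funext => x; rewrite big_nil.
rewrite (_ : (fun x => _) = (fun x => step_fun (2 + e^-1 * bary K x i)) \* (fun x => \prod_(j <- s) step_fun (2 + e^-1 * bary K x j))).
  exact: smooth_exprM.
by apply/funext => x; rewrite big_cons.
Qed.

Lemma cutoff_smooth e K : smooth_expr (cutoff e K).
Proof. exact: (smooth_exprM (cutoff_root_smooth e K) (cutoff_root_smooth e K)). Qed.

Lemma cutoff_root_01 e K x : 0 <= cutoff_root e K x <= 1.
Proof.
rewrite /cutoff_root; elim/big_ind : _ => [|a b /andP[a0 a1] /andP[b0 b1]|i _]; first by rewrite ler01 lexx.
  by rewrite mulr_ge0// mulr_ile1.
exact: step_fun_01.
Qed.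

Lemma cutoff_01 e K x : 0 <= cutoff e K x <= 1.
Proof. by have /andP[a b] := cutoff_root_01 e K x; rewrite sqr_ge0 expr_le1. Qed.

Lemma cutoff_root0 e K x i : 0 < e -> bary K x i <= - (2 * e) -> cutoff_root e K x = 0.
Proof.
move=> e0 bi; rewrite /cutoff_root (bigD1 i)//= step_fun0 ?mul0r//.
by rewrite -(ler_pM2l e0) mulr0 mulrDr mulVKf ?gt_eqF//; lra.
Qed.

Lemma cutoff1 e K x : 0 < e -> (forall i, 0 <= bary K x i) -> cutoff e K x = 1.
Proof.
move=> e0 h; rewrite /cutoff /cutoff_root big1 ?expr1n// => i _; rewrite step_fun1//.
have : 0 <= e^-1 * bary K x i by rewrite mulr_ge0// invr_ge0 ltW.
lra.
Qed.

Lemma derive_cutoff e K x v : 'D_v (cutoff e K) x = 2 * cutoff_root e K x * 'D_v (cutoff_root e K) x.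
Proof.
have dr : derivable (cutoff_root e K) x v.
  by apply: diff_derivable; apply: smooth_expr_differentiable; exact: cutoff_root_smooth.
rewrite (_ : cutoff e K = cutoff_root e K * cutoff_root e K)//.
by rewrite deriveM// /GRing.scale/=; ring.
Qed.

Lemma prod_derive_le (I : finType) (F : I -> 'rV[R]_d -> R) (B : I -> R) x v :
  (forall i, differentiable (F i) x) -> (forall i y, 0 <= F i y <= 1) ->
  (forall i, `|'D_v (F i) x| <= B i) ->
  `|'D_v (fun y => \prod_i F i y) x| <= \sum_i B i.
Proof.
move=> dF F01 FB.
suff : forall s : seq I, [/\ differentiable (fun y => \prod_(i <- s) F i y) x, 0 <= \prod_(i <- s) F i x <= 1 &
    `|'D_v (fun y => \prod_(i <- s) F i y) x| <= \sum_(i <- s) B i].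
  by move=> /(_ (index_enum I))[].
elim=> [|i s [ds /andP[s0 s1] hs]].
  rewrite !big_nil (_ : (fun y => _) = fun=> 1); last by apply/funext => y; rewrite big_nil.
  by split; [exact: differentiable_cst|rewrite ler01 lexx|rewrite derive_cst normr0].
rewrite !big_cons (_ : (fun y => _) = F i * (fun y => \prod_(j <- s) F j y)); last by apply/funext => y; rewrite big_cons.
have /andP[f0 f1] := F01 i x.
split; first exact: differentiableM.
  by rewrite mulr_ge0// mulr_ile1.
rewrite (deriveM (diff_derivable (dF i)) (diff_derivable ds)).
rewrite /GRing.scale/= addrC; apply: le_trans (ler_normD _ _) _; rewrite !normrM; apply: lerD.
  by rewrite (ger0_norm s0) (le_trans _ (FB i))// ler_piMl.
by rewrite (ger0_norm f0) (le_trans _ hs)// ler_piMl.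
Qed.

End cutoff.

Section helpers.
Context {R : realType}.

Lemma seq_uniform_bound (I : eqType) (s : seq I) (P : I -> R -> Prop) :
  (forall K, K \in s -> exists C, P K C) -> (forall K C C', C <= C' -> P K C -> P K C') ->
  exists2 C : R, 0 < C & forall K, K \in s -> P K C.
Proof.
move=> hP mP; elim: s hP => [_|K s IH hP]; first by exists 1.
have [C C0 hC] := IH (fun K' h => hP K' (mem_behead (s := K :: s) h)).
have [C' hC'] := hP K (mem_head _ _).
exists (Num.max C C'); first by rewrite lt_max C0.
move=> K'; rewrite in_cons => /predU1P[->|/hC].
  by apply: mP hC'; rewrite le_max lexx orbT.
by apply: mP; rewrite le_max lexx.
Qed.

(* [soft_cut] is the identity for [|u| >= 3] and vanishes for [|u| <= 2]. *)
Definition soft_cut (u : R) := u * (step_fun (u - 2) + step_fun (- u - 2)).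

Lemma soft_cut_smooth1 : smooth1 soft_cut.
Proof.
have sN : smooth1 (fun u : R => - u - 2).
  rewrite (_ : (fun u => _) = (fun=> - 2) \+ ((fun=> -1) \* id)).
    by apply: smooth1D; [exact: smooth1_cst|apply: smooth1M; [exact: smooth1_cst|exact: smooth1_id]].
  by apply/funext => u /=; ring.
have sP : smooth1 (fun u : R => u - 2).
  by apply: (@smooth1D _ id (fun=> - 2)); [exact: smooth1_id|exact: smooth1_cst].
apply: (@smooth1M _ id); first exact: smooth1_id.
by apply: smooth1D; [apply: (@smooth1_comp _ step_fun)|apply: (@smooth1_comp _ step_fun (fun u => - u - 2))] => //; exact: step_fun_smooth1.
Qed.

Lemma soft_cut0 u : `|u| <= 2 -> soft_cut u = 0.
Proof.
rewrite ler_norml => /andP[u1 u2]; rewrite /soft_cut !step_fun0 ?addr0 ?mulr0//; lra.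
Qed.

Lemma soft_cut_id u : 3 <= `|u| -> soft_cut u = u.
Proof.
rewrite /soft_cut; have [u0|u0] := ler0P u => h.
  by rewrite step_fun0 ?step_fun1 ?add0r ?mulr1//; lra.
by rewrite step_fun1 ?[step_fun (- u - 2)]step_fun0 ?addr0 ?mulr1//; lra.
Qed.

Lemma soft_cut_near u : `|soft_cut u - u| <= 3.
Proof.
have [h|h] := leP 3 `|u|; first by rewrite soft_cut_id// subrr normr0.
have -> : soft_cut u - u = u * (step_fun (u - 2) + step_fun (- u - 2) - 1) by rewrite /soft_cut; ring.
have /andP[a0 a1] := step_fun_01 (u - 2); have /andP[b0 b1] := step_fun_01 (- u - 2).
rewrite normrM; have : `|step_fun (u - 2) + step_fun (- u - 2) - 1| <= 1 by rewrite ler_norml; apply/andP; split; lra.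
move=> h1; apply: (@le_trans _ _ (3 * 1)); last by rewrite mulr1.
by apply: ler_pM => //; exact: ltW.
Qed.

Lemma soft_cut_derive : exists2 f : R -> R, (forall u : R, is_derive u 1 soft_cut (f u)) &
  exists2 M : R, 0 < M & [/\ forall u : R, `|f u| <= M, f 0 = 0 & forall u : R, 3 < `|u| -> f u = 1].
Proof.
have [f sf df] := smooth1_derive soft_cut_smooth1.
have cf := smooth1_continuous sf.
have f1 u : 3 < `|u| -> f u = 1.
  move=> u3; have [_ <-] := df u.
  rewrite (@near_eq_derive R R R _ id) ?derive_id//.
  have : \forall v \near u, 3 < `|v|.
    exact: (@norm_continuous R R u [set t | 3 < t] (lt_nbhsr u3)).
  by apply: filterS => v v3; rewrite soft_cut_id// ltW.
have f0 : f 0 = 0.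
  have [_ <-] := df 0.
  rewrite (@near_eq_derive R R R _ (fun=> 0)) ?derive_cst//.
  have h : `|0 : R| < 2 by rewrite normr0.
  have : \forall v \near (0 : R), `|v| < 2.
    exact: (@norm_continuous R R 0 [set t | t < 2] (lt_nbhsl h)).
  by apply: filterS => v v2; rewrite soft_cut0// ltW.
have cn : {within `[- 4, 4], continuous (fun t => `|f t|)}.
  by apply: continuous_subspaceT => t; apply: continuous_comp; [exact: cf|exact: norm_continuous].
have le44 : - 4 <= 4 :> R by lra.
have [c _ hc] := EVT_max le44 cn.
exists f => //; exists (`|f c| + 1); first by rewrite ltr_wpDl.
split=> // u; have [u3|u3] := ltP 3 `|u|; first by rewrite f1// normr1 lerDr.
apply: le_trans (hc u _) _; last by rewrite lerDl.
by move: u3; rewrite ler_norml in_itv/= => /andP[a b]; apply/andP; split; lra.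
Qed.

End helpers.

Section near_simplex.
Context {R : realType} {d : nat} (K : tsimplex R d).
Hypothesis ndK : nondegenerate_simplex K.

Definition barycenter : 'rV[R]_d := \sum_i (d.+1%:R^-1 : R) *: row i K.1.

Lemma bary_barycenter i : bary K barycenter i = d.+1%:R^-1.
Proof.
rewrite -(@bary_unique _ _ _ ndK barycenter (fun=> d.+1%:R^-1))//.
by rewrite sumr_const card_ord -[LHS]mulr_natl divff.
Qed.

Lemma simplex_interior_dense x (U : set 'rV[R]_d) : simplex K x -> nbhs x U -> exists2 y, (simplex K)° y & U y.
Proof.
move=> Kx /nbhs_enormP[r r0 rU].
pose D := enorm (barycenter - x) + 1.
have D0 : 0 < D by rewrite ltr_wpDl// enorm_ge0.
pose s := Num.min 1 (r / D) / 2.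
have m0 : 0 < Num.min 1 (r / D) by rewrite lt_min ltr01 divr_gt0.
have s0 : 0 < s by rewrite divr_gt0.
have s1 : s < 1 by rewrite /s; have : Num.min 1 (r / D) <= 1 by [rewrite ge_min lexx]; lra.
have sr : s * D < r.
  rewrite -ltr_pdivlMr//; rewrite /s; have : Num.min 1 (r / D) <= r / D by rewrite ge_min lexx orbT.
  have : 0 < r / D by rewrite divr_gt0.
  lra.
exists ((1 - s) *: x + s *: barycenter).
  apply/(simplex_interiorP ndK) => i; rewrite baryC// bary_barycenter.
  rewrite ltr_wpDl ?mulr_gt0 ?invr_gt0// mulr_ge0 ?subr_ge0 ?(ltW s1)//.
  exact: (iffLR (simplexP ndK x) Kx).
apply: rU; have -> : (1 - s) *: x + s *: barycenter - x = s *: (barycenter - x).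
  by rewrite scalerBl scale1r scalerBr addrAC [x - _]addrC addrK addrC.
rewrite enormZ (gtr0_norm s0); apply: le_lt_trans sr.
by rewrite ler_wpM2l ?(ltW s0)// lerDl.
Qed.

(* Contract towards the barycenter. *)
Lemma near_simplex : exists2 C : R, 0 < C & forall e x, 0 < e <= 1 -> (forall i, - (2 * e) < bary K x i) ->
  exists2 x', simplex K x' & enorm (x - x') <= C * e.
Proof.
pose Dm := \sum_i enorm (row i K.1 - barycenter).
have Dm0 : 0 <= Dm by apply: sumr_ge0 => i _; exact: enorm_ge0.
pose n1 : R := d.+1%:R.
have n10 : 0 < n1 by rewrite ltr0n.
exists (2 * n1 * ((1 + 4 * n1) * Dm) + 1); first by rewrite ltr_wpDl// !mulr_ge0// ?addr_ge0 ?mulr_ge0// ltW.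
move=> e x /andP[e0 e1] xe.
(* The fraction of the way to the barycentre after which a coordinate equal to - 2 e has become
   exactly 0. *)
pose s := 2 * e / (2 * e + n1^-1).
have den : 0 < 2 * e + n1^-1 by rewrite addr_gt0// ?mulr_gt0 ?invr_gt0.
have s0 : 0 < s by rewrite divr_gt0// mulr_gt0.
have s1 : s <= 1 by rewrite ler_pdivrMr// mul1r lerDl invr_ge0 ltW.
have se : s <= 2 * n1 * e.
  rewrite ler_pdivrMr//; have -> : 2 * n1 * e * (2 * e + n1^-1) = 2 * e + 4 * n1 * e * e by field; rewrite gt_eqF.
  by rewrite lerDl !mulr_ge0// ltW.
exists ((1 - s) *: x + s *: barycenter).
  apply/(simplexP ndK) => i; rewrite baryC// bary_barycenter.
  apply: (@le_trans _ _ ((1 - s) * - (2 * e) + s / n1)).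
    apply: eq_lew; rewrite /s; field.
    by rewrite !gt_eqF// ltr_wpDl ?mulr_gt0// !mulr_ge0// ltW.
  by rewrite lerD2r ler_wpM2l ?subr_ge0// ltW.
have -> : x - ((1 - s) *: x + s *: barycenter) = s *: (x - barycenter).
  by rewrite opprD addrA scalerBl scale1r opprB addrCA subrr addr0 scalerBr.
rewrite enormZ (gtr0_norm s0).
have xb : enorm (x - barycenter) <= (1 + 4 * n1) * Dm.
  have -> : x - barycenter = \sum_i bary K x i *: (row i K.1 - barycenter).
    under eq_bigr do rewrite scalerBr.
    by rewrite sumrB -scaler_suml bary_sum// scale1r bary_comb.
  have : enorm (\sum_i bary K x i *: (row i K.1 - barycenter)) <= \sum_i `|bary K x i| * Dm.
    elim/big_ind2 : _ => [|u a w b ua wb|i _]; first by rewrite enorm0.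
      exact: le_trans (enormD _ _) (lerD _ _).
    rewrite enormZ ler_wpM2l// /Dm (bigD1 i)//= lerDl.
    by apply: sumr_ge0 => j _; exact: enorm_ge0.
  move/le_trans; apply; rewrite -mulr_suml ler_wpM2r//.
  apply: (@le_trans _ _ (\sum_i (bary K x i + 4 * e))).
    apply: ler_sum => i _; have := xe i; have [b0|b0] := ler0P (bary K x i); lra.
  rewrite big_split/= bary_sum// sumr_const card_ord -[_ *+ _]mulr_natl lerD2l -/n1.
  by rewrite mulrC ler_wpM2r ?(ltW n10)// ler_piMr.
apply: (@le_trans _ _ (2 * n1 * e * ((1 + 4 * n1) * Dm))).
  by apply: ler_pM => //; [exact: ltW|exact: enorm_ge0].
have -> : 2 * n1 * e * ((1 + 4 * n1) * Dm) = 2 * n1 * ((1 + 4 * n1) * Dm) * e by ring.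
by rewrite ler_wpM2r ?(ltW e0)// lerDl.
Qed.

End near_simplex.

Lemma dotp_delta (R : realType) (d : nat) (x : 'rV[R]_d) (j : 'I_d) : dotp x (delta_mx 0 j) = x 0 j.
Proof.
rewrite /dotp (bigD1 j)//= big1 ?addr0 ?[delta_mx _ _ _ _]mxE ?eqxx ?mulr1// => i ij.
by rewrite [delta_mx _ _ _ _]mxE (negbTE ij) andbF mulr0.
Qed.

Lemma derive_blend (R : realType) (V : normedModType R) (b a c : V -> R) x v :
  derivable b x v -> derivable a x v -> derivable c x v ->
  'D_v (fun y => (1 - c y) * b y + c y * a y) x =
  (1 - c x) * 'D_v b x + c x * 'D_v a x + 'D_v c x * (a x - b x).
Proof.
move=> db da dc; have dB := derivableB da db; have dM := derivableM dc dB.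
have -> : (fun y => (1 - c y) * b y + c y * a y) = b + c * (a - b).
  by apply/funext => y; rewrite !fctE; ring.
rewrite (deriveD db dM) (deriveM dc dB) (deriveB da db).
rewrite -[(a - b) x]/(a x - b x) /GRing.scale/=.
move: ('D_v a x) ('D_v b x) ('D_v c x) (a x) (b x) (c x) => p q r A B C; ring.
Qed.

Section cutoff_gradient.
Context {R : realType} {d : nat} (K : tsimplex R d).
Hypothesis ndK : nondegenerate_simplex K.

Lemma cutoff_root_derive : exists2 C : R, 0 < C & forall e x i, 0 < e ->
  `|partial i (cutoff_root e K) x| <= C / e /\
  ((forall j, 0 <= bary K x j) -> partial i (cutoff_root e K) x = 0).
Proof.
have [f _ [M M0 hf]] := @step_fun_derive R.
pose G := \sum_j enorm (bgrad K j).
have G0 : 0 <= G by apply: sumr_ge0 => j _; exact: enorm_ge0.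
exists (M * G + 1); first by rewrite ltr_wpDl// mulr_ge0// ltW.
move=> e x i e0.
pose h j (y : 'rV[R]_d) := (2 + e^-1 * bary K 0 j) + dotp (e^-1 *: bgrad K j) y.
have hE j y : 2 + e^-1 * bary K y j = h j y by rewrite /h bary_dotp dotpZl mulrDr addrA.
have dh j : differentiable (h j) x by exact: differentiable_affine.
have dF j : differentiable (fun y => step_fun (2 + e^-1 * bary K y j)) x.
  rewrite (_ : (fun y => _) = step_fun \o h j); last by apply/funext => y /=; rewrite hE.
  apply: differentiable_comp => //; apply/derivable1_diffP.
  by have [[]] := hf (h j x).
have DF j : partial i (fun y => step_fun (2 + e^-1 * bary K y j)) x = f (2 + e^-1 * bary K x j) * (e^-1 * bgrad K j 0 i).
  rewrite /partial (_ : (fun y => _) = step_fun \o h j); last by apply/funext => y /=; rewrite hE.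
  have [d1 _ _ _] := hf (h j x).
  by rewrite (derive_comp1 _ (dh j) d1) derive_affine dotpZl hE dotp_delta.
have bd (B : 'I_d.+1 -> R) : (forall j, `|f (2 + e^-1 * bary K x j) * (e^-1 * bgrad K j 0 i)| <= B j) ->
    `|partial i (cutoff_root e K) x| <= \sum_j B j.
  move=> hB; apply: (@prod_derive_le R d _ (fun j y => step_fun (2 + e^-1 * bary K y j))) => //.
    by move=> j y; exact: step_fun_01.
  by move=> j; have := DF j; rewrite /partial => ->.
split.
  apply: le_trans (bd (fun j => M * enorm (bgrad K j) / e) _) _.
    move=> j; have [_ fM _ _] := hf (2 + e^-1 * bary K x j).
    rewrite normrM -mulrA ler_pM// normrM gtr0_norm ?invr_gt0// mulrC ler_wpM2r ?invr_ge0 ?(ltW e0)//.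
    exact: le_trans (coord_le_norm _ _) (norm_le_enorm _).
  rewrite -mulr_suml -mulr_sumr ler_wpM2r ?invr_ge0 ?(ltW e0)//.
  by rewrite lerDl.
move=> b0; apply/eqP; rewrite -normr_le0; apply: le_trans (bd (fun=> 0) _) _.
  move=> j; have [_ _ _ ->] := hf (2 + e^-1 * bary K x j); first by rewrite mul0r normr0.
  have : 0 <= e^-1 * bary K x j by rewrite mulr_ge0// invr_ge0 ltW.
  lra.
by rewrite big1.
Qed.

End cutoff_gradient.

(** * Piecewise affine functions as limits of test functions *)

Section blend.
Context {R : realType} {d : nat}.
Variable aff : tsimplex R d -> R * 'rV[R]_d.
Local Notation afun K := (fun x => (aff K).1 + dotp (aff K).2 x).

(* Later (outer) simplices override earlier ones in a neighbourhood of themselves. *)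
Fixpoint blend e (s : mesh R d) : 'rV[R]_d -> R :=
  if s is K :: s' then fun x => (1 - cutoff e K x) * blend e s' x + cutoff e K x * afun K x
  else fun=> 0.

Lemma blend_smooth e s : smooth_expr (blend e s).
Proof.
elim: s => [|K s IH] /=; first exact: smooth_expr_cst.
apply: (@smooth_exprD _ _ (fun x => (1 - cutoff e K x) * blend e s x) (fun x => cutoff e K x * afun K x)).
  apply: (@smooth_exprM _ _ (fun x => 1 - cutoff e K x)) => //.
  rewrite (_ : (fun x => _) = (fun=> 1) \+ ((fun=> -1) \* cutoff e K)).
    apply: smooth_exprD; first exact: smooth_expr_cst.
    by apply: smooth_exprM; [exact: smooth_expr_cst|exact: cutoff_smooth].
  by apply/funext => x /=; rewrite mulN1r.
by apply: smooth_exprM; [exact: cutoff_smooth|exact: smooth_expr_affine].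
Qed.

Lemma partial_blend e K s i x : partial i (blend e (K :: s)) x =
  (1 - cutoff e K x) * partial i (blend e s) x + cutoff e K x * (aff K).2 0 i
  + 2 * cutoff_root e K x * partial i (cutoff_root e K) x * (afun K x - blend e s x).
Proof.
have dB := diff_derivable (v := 'e_i) (smooth_expr_differentiable (blend_smooth e s) x).
have dc := diff_derivable (v := 'e_i) (smooth_expr_differentiable (cutoff_smooth e K) x).
have da := diff_derivable (v := 'e_i) (smooth_expr_differentiable (smooth_expr_affine (aff K).1 (aff K).2) x).
by rewrite /partial /= (derive_blend dB da dc) derive_affine derive_cutoff dotp_delta.
Qed.

End blend.

Section piecewise_affine.
Context {R : realType} {d : nat} (Omega : set 'rV[R]_d).
Hypothesis lipO : bounded_lipschitz_domain Omega.
Hypothesis d0 : (0 < d)%N.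
Variable T : mesh R d.
Hypothesis cT : conforming_mesh Omega T.
Local Notation mu := (@lebesgue_rV R d).

Let ndT K : K \in T -> nondegenerate_simplex K.
Proof. by case: cT => _ h _ _ _ /h[]. Qed.

Lemma mesh_cover x : closure Omega x -> exists2 K, K \in T & simplex K x.
Proof. by case: cT => _ _ -> _ _. Qed.

Lemma mesh_closure K x : K \in T -> simplex K x -> closure Omega x.
Proof. by case: cT => _ _ -> _ _ KT Kx; exists K. Qed.

Lemma mesh_interior_sub K x : K \in T -> (simplex K)° x -> Omega x.
Proof.
move=> KT Kx; apply: (interior_closure_domain lipO).
by move: x Kx; apply: interiorS => x; exact: mesh_closure.
Qed.

Lemma mesh_interior_disjoint K K' x : K \in T -> K' \in T -> (simplex K)° x -> simplex K' x -> K = K'.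
Proof.
move=> KT KT' Kx Kx'; apply/eqP; apply: contrapT => /negP KK'.
have [_ _ _ h _] := cT.
have nx : nbhs x (simplex K)° by apply: open_nbhs_nbhs; split=> //; exact: open_interior.
have [y y1 y2] := simplex_interior_dense (ndT KT') Kx' nx.
by have : ((simplex K)° `&` (simplex K')°) y by []; rewrite h.
Qed.

Lemma mesh_conull : {ae mu, forall x, closure Omega x -> exists2 K, K \in T & (simplex K)° x}.
Proof.
have : {ae mu, forall x, forall K, K \in T -> simplex K x -> (simplex K)° x}.
  have : forall K, K \in T -> nondegenerate_simplex K by [].
  elim: (T) => [_|K s IH h]; first by apply/aeW.
  have aeK : {ae mu, forall x, simplex K x -> (simplex K)° x}.
    exists (simplex K `\` (simplex K)°); split.
    - apply: measurableD; [exact: (measurable_simplex (h K (mem_head K s)))|exact: (measurable_simplex_interior K)].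
    - exact: (simplex_interior_conull d0 (h K (mem_head K s))).
    - by move=> x /= /not_implyP.
  have aes := IH (fun K' h' => h K' (mem_behead (s := K :: s) h')).
  apply: filterS (filterI aeK aes) => x [h1 h2] K'; rewrite in_cons => /predU1P[->//|]; exact: h2.
apply: filterS => x h /mesh_cover[K KT Kx]; exists K => //; exact: h.
Qed.

Variable v : 'rV[R]_d -> R.
Hypothesis v0 : forall x, ~ Omega x -> v x = 0.
Hypothesis vP1 : forall K, K \in T -> P1_on (simplex K) v.

Let aff K : R * 'rV[R]_d := xget (0, 0) [set p : R * 'rV[R]_d | forall x, simplex K x -> v x = p.1 + dotp p.2 x].
Let afun K := (fun x => (aff K).1 + dotp (aff K).2 x).

Let affP K x : K \in T -> simplex K x -> v x = afun K x.
Proof.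
move=> /vP1[c [g h]]; rewrite /afun /aff.
by case: xgetP => [p -> /= hp|/(_ (c, g))]; [exact: hp|case].
Qed.

Let lip_v : exists2 L, 0 <= L & forall x y, `|v x - v y| <= L * enorm (x - y).
Proof. exact: (piecewise_affine_lipschitz lipO cT). Qed.

(** Where the cut-off of [K] is not zero, the point is within O(e) of [K]; there [v] coincides with
    its affine extension from [K], and both are Lipschitz. *)
Let near_bound : exists2 C : R, 0 < C & forall K, K \in T -> forall e x, 0 < e <= 1 -> cutoff_root e K x != 0 ->
  `|afun K x - v x| <= C * e.
Proof.
have [L L0 hL] := lip_v.
apply: seq_uniform_bound => [K KT|K C C' CC' h e x e01 r0]; last first.
  by apply: le_trans (h e x e01 r0) _; rewrite ler_wpM2r//; case/andP: e01 => /ltW.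
have [C C0 hC] := near_simplex (ndT KT).
exists ((enorm (aff K).2 + L) * C) => e x e01 r0.
have [e0 _] := andP e01.
have [x' Kx' xx'] : exists2 x', simplex K x' & enorm (x - x') <= C * e.
  apply: hC => // i; rewrite ltNge; apply/negP => bi.
  by move: r0; rewrite (cutoff_root0 e0 bi) eqxx.
have -> : afun K x - v x = dotp (aff K).2 (x - x') + (v x' - v x).
  by rewrite (affP KT Kx') /afun dotpBr; ring.
apply: le_trans (ler_normD _ _) _; rewrite -mulrA mulrDl; apply: lerD.
  by apply: le_trans (dotp_le _ _) _; rewrite ler_wpM2l ?enorm_ge0.
by apply: le_trans (hL _ _) _; rewrite enormB ler_wpM2l.
Qed.

(** The points at which the blend over the list [s] is controlled. On [K] itself the cut-off is 1
    and has gradient 0, so the rest of the list has to be controlled only off [K]. *)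
Let cover (s : mesh R d) x := ~ Omega x \/ exists2 K, K \in s & simplex K x.

Let cover_tail K s x : cover (K :: s) x -> ~ simplex K x -> cover s x.
Proof.
move=> [nO|[K']]; first by left.
by rewrite in_cons => /predU1P[-> ?|Ks Kx _]; [done|right; exists K'].
Qed.

Let blend_near C : 0 < C -> (forall K, K \in T -> forall e x, 0 < e <= 1 -> cutoff_root e K x != 0 -> `|afun K x - v x| <= C * e) ->
  forall s : mesh R d, {subset s <= T} -> forall e x, 0 < e <= 1 -> cover s x -> `|blend aff e s x - v x| <= C * e.
Proof.
move=> C0 hC; elim=> [_ e x /andP[e0 _] [nO|[K]]|K s IH sT e x e01 cx]; last 2 first.
- by rewrite in_nil.
- have [e0 _] := andP e01; have KT : K \in T by apply: sT; rewrite mem_head.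
  have Ce : 0 <= C * e by rewrite mulr_ge0 ?ltW.
  have [Kx|nK] := pselect (simplex K x).
    rewrite /= cutoff1//; last exact: (iffLR (simplexP (ndT KT) x) Kx).
    by rewrite subrr mul0r add0r mul1r (affP KT Kx) subrr normr0.
  have hs : `|blend aff e s x - v x| <= C * e.
    by apply: IH => //; [move=> K' h; apply: sT; rewrite in_cons h orbT|exact: cover_tail cx nK].
  rewrite /=; have [r0|r0] := eqVneq (cutoff_root e K x) 0.
    by rewrite /cutoff r0 expr0n/= subr0 mul1r mul0r addr0.
  have /andP[c0 c1] := cutoff_01 e K x.
  have -> : (1 - cutoff e K x) * blend aff e s x + cutoff e K x * ((aff K).1 + dotp (aff K).2 x) - v x =
    (1 - cutoff e K x) * (blend aff e s x - v x) + cutoff e K x * (afun K x - v x) by rewrite /afun; ring.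
  have h1 := hC K KT e x e01 r0; move: c0 c1; move: (cutoff e K x) => c c0 c1.
  apply: le_trans (ler_normD _ _) _; rewrite !normrM (ger0_norm c0) ger0_norm ?subr_ge0//.
  have := ler_wpM2l c0 h1; have c1' : 0 <= 1 - c by rewrite subr_ge0.
  have := ler_wpM2l c1' hs; lra.
- by rewrite /= v0// subrr normr0 mulr_ge0 ?ltW.
Qed.

(** The gradient of a cut-off is O(1 / e), but it multiplies the difference of two approximations of
    [v], which is O(e); the products stay bounded as [e] tends to 0. *)
Let blend_gradient : exists2 C : R, 0 < C & forall e x i, 0 < e <= 1 -> `|partial i (blend aff e T) x| <= C.
Proof.
have [C C0 hC] := near_bound.
suff : forall s : mesh R d, {subset s <= T} -> exists2 B : R, 0 < B & forall e x i, 0 < e <= 1 -> cover s x ->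
    `|partial i (blend aff e s) x| <= B.
  move=> /(_ T)[//|B B0 hB]; exists B => // e x i e01; apply: hB => //.
  have [Ox|] := pselect (Omega x); last by left.
  by right; apply: mesh_cover; exact: subset_closure.
elim=> [_|K s IH sT]; first by exists 1 => // e x i _ _; rewrite /partial /= derive_cst normr0.
have sT' : {subset s <= T} by move=> K' h; apply: sT; rewrite in_cons h orbT.
have [B B0 hB] := IH sT'.
have KT : K \in T by apply: sT; rewrite mem_head.
have [G G0 hG] := cutoff_root_derive K.
exists (B + enorm (aff K).2 + 4 * G * C).
  by rewrite ltr_wpDr ?mulr_ge0 ?(ltW G0) ?(ltW C0)// ltr_wpDr ?enorm_ge0.
move=> e x i e01 cx; have [e0 _] := andP e01.
have gi : `|(aff K).2 0 i| <= enorm (aff K).2 by apply: le_trans (coord_le_norm _ _) (norm_le_enorm _).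
have [hG1 hG2] := hG e x i e0.
rewrite partial_blend; have [Kx|nK] := pselect (simplex K x).
  have b0 := iffLR (simplexP (ndT KT) x) Kx.
  rewrite cutoff1// subrr mul0r add0r mul1r hG2// mulr0 mul0r addr0.
  by apply: le_trans gi _; have := mulr_ge0 (ltW G0) (ltW C0); lra.
have cs := cover_tail cx nK.
have hs := hB e x i e01 cs.
have [r0|r0] := eqVneq (cutoff_root e K x) 0.
  rewrite /cutoff r0 expr0n/= subr0 mul1r !mul0r mulr0 !mul0r !addr0.
  by apply: le_trans hs _; have := mulr_ge0 (ltW G0) (ltW C0); have := enorm_ge0 (aff K).2; lra.
have /andP[c0 c1] := cutoff_01 e K x; have /andP[rr0 rr1] := cutoff_root_01 e K x.
have hd : `|afun K x - blend aff e s x| <= 2 * C * e.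
  have := hC K KT e x e01 r0; have := blend_near C0 hC sT' e01 cs; rewrite distrC => a1 a2.
  by have := ler_distD (v x) (afun K x) (blend aff e s x); lra.
move: c0 c1; move: (cutoff e K x) => c c0 c1.
apply: le_trans (ler_normD _ _) _; apply: lerD.
  apply: le_trans (ler_normD _ _) _; rewrite !normrM (ger0_norm c0) ger0_norm ?subr_ge0//.
  apply: lerD; last by apply: le_trans gi; rewrite ler_piMl.
  by apply: le_trans hs; rewrite ler_piMl// gerBl.
rewrite -/(afun K x) !normrM (ger0_norm rr0) ger0_norm//.
apply: (@le_trans _ _ (2 * 1 * (G / e) * (2 * C * e))).
  by rewrite !ler_pM// ?mulr_ge0// ?ler_wpM2l.
by apply: eq_lew; field; rewrite gt_eqF.
Qed.

Let blend_exact e K0 x i : 0 < e -> K0 \in T -> simplex K0 x ->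
  (forall K, K \in T -> K != K0 -> cutoff_root e K x = 0) ->
  blend aff e T x = afun K0 x /\ partial i (blend aff e T) x = (aff K0).2 0 i.
Proof.
move=> e0 K0T K0x other.
suff : forall s : mesh R d, {subset s <= T} -> K0 \in s -> blend aff e s x = afun K0 x /\ partial i (blend aff e s) x = (aff K0).2 0 i.
  exact.
elim=> [|K s IH sT]; first by rewrite in_nil.
have KT : K \in T by apply: sT; rewrite mem_head.
have [KK _|KK] := eqVneq K K0.
  have b0 := iffLR (simplexP (ndT K0T) x) K0x.
  have [G G0 /(_ e x i e0)[_ hG]] := cutoff_root_derive K0.
  rewrite partial_blend /= KK cutoff1// hG// subrr !mul0r add0r mul1r mulr0 mul0r add0r addr0.
  by split=> //; ring.
rewrite in_cons eq_sym (negbTE KK)/= => K0s.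
have [|h1 h2] := IH _ K0s; first by move=> K' h; apply: sT; rewrite in_cons h orbT.
have r0 := other K KT KK.
rewrite partial_blend /= /cutoff r0 expr0n/= subr0 !mul1r !mul0r mulr0 !mul0r !addr0.
by split.
Qed.

Let eps (n : nat) : R := n.+1%:R^-1.
Let eps01 n : 0 < eps n <= 1.
Proof. by rewrite invr_gt0 ltr0n/= invf_le1// ler1n. Qed.

Let eps_cvg0 : eps @ \oo --> (0 : R).
Proof. exact: cvg_harmonic. Qed.

(** A point interior to one simplex has a negative coordinate in every other one, hence leaves the
    shrinking supports of the other cut-offs. *)
Let others_vanish K0 x : K0 \in T -> (simplex K0)° x ->
  \forall n \near \oo, forall K, K \in T -> K != K0 -> cutoff_root (eps n) K x = 0.
Proof.
move=> K0T K0x.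
suff : forall s : mesh R d, {subset s <= T} -> \forall n \near \oo, forall K, K \in s -> K != K0 -> cutoff_root (eps n) K x = 0 by exact.
elim=> [_|K s IH sT]; first by near=> n.
have KT : K \in T by apply: sT; rewrite mem_head.
have hs := IH (fun K' h => sT K' (mem_behead (s := K :: s) h)).
have [KK|KK] := eqVneq K K0.
  apply: filterS hs => n h K'; rewrite in_cons => /predU1P[->|]; last exact: h.
  by rewrite KK eqxx.
have [i bi] : exists i, bary K x i < 0.
  apply: contrapT => nb; move/eqP: KK; apply; apply/esym; apply: (mesh_interior_disjoint K0T KT K0x).
  by apply/(simplexP (ndT KT)) => i; rewrite leNgt; apply/negP => h; apply: nb; exists i.
have e0 : 0 < - bary K x i / 2 by rewrite divr_gt0// oppr_gt0.
have he : \forall n \near \oo, eps n < - bary K x i / 2.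
  have /cvgrPdist_lt/(_ _ e0) := eps_cvg0; apply: filterS => n; rewrite sub0r normrN.
  by apply: le_lt_trans; exact: ler_norm.
apply: filterS (filterI he hs) => n [h1 h2] K'; rewrite in_cons => /predU1P[-> _|]; last exact: h2.
have /andP[en _] := eps01 n.
by apply: (cutoff_root0 en (i := i)); lra.
Unshelve. all: by end_near. Qed.

(** The approximants apply [soft_cut] at scale [r n] to the blend. Where |v| <= r_n the blend is at
    most 2 r_n in absolute value and they vanish, so their supports are compact in the domain. Their
    gradients are uniformly bounded and converge at the interior points of the elements, so
    dominated convergence applies. *)
Lemma P1_VT : VT Omega T v.
Proof.
have [L L0 hL] := lip_v.
have cv : continuous v by exact: lipschitz_continuous hL.
have mO := domain_measurable lipO.
have [C C0 hC] := near_bound.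
have [G G0 hG] := blend_gradient.
have [f df [M M0 [fM f0 f1]]] := @soft_cut_derive R.
have [Bd _ hBd] := bounded_set_closure_norm (let: And5 _ _ _ h _ := lipO in h).
have mv : measurable_fun setT v by exact: continuous_measurable_rV.
have finO : (mu Omega < +oo)%E.
  by apply: (@lebesgue_rV_lty _ _ _ Bd) => // x Ox; apply: hBd; exact: subset_closure.
have cov x : cover T x.
  have [Ox|] := pselect (Omega x); last by left.
  by right; apply: mesh_cover; exact: subset_closure.
pose r n := C * eps n.
have r0 n : 0 < r n by rewrite mulr_gt0//; have /andP[] := eps01 n.
pose phi n (x : 'rV[R]_d) := r n * soft_cut ((r n)^-1 * blend aff (eps n) T x).
have near_b n x : `|blend aff (eps n) T x - v x| <= r n.
  by apply: (blend_near C0 hC) => //; exact: eps01.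
have sphi n : smooth_expr (phi n).
  apply: (@smooth_exprM _ _ (fun=> r n)); first exact: smooth_expr_cst.
  apply: (@smooth_expr_comp _ _ soft_cut (fun x => (r n)^-1 * blend aff (eps n) T x)); first exact: soft_cut_smooth1.
  apply: (@smooth_exprM _ _ (fun=> (r n)^-1)); first exact: smooth_expr_cst.
  exact: blend_smooth.
have phi_near n x : `|phi n x - v x| <= 4 * r n.
  have h1 := near_b n x; have h2 := soft_cut_near ((r n)^-1 * blend aff (eps n) T x).
  have h3 : `|phi n x - blend aff (eps n) T x| <= 3 * r n.
    have -> : phi n x - blend aff (eps n) T x = r n * (soft_cut ((r n)^-1 * blend aff (eps n) T x) - (r n)^-1 * blend aff (eps n) T x).
      by rewrite mulrBr mulVKf ?gt_eqF.
    by rewrite normrM (gtr0_norm (r0 n)) mulrC ler_wpM2r ?(ltW (r0 n)).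
  by have := ler_distD (blend aff (eps n) T x) (phi n x) (v x); lra.
have dphi n i x : partial i (phi n) x = f ((r n)^-1 * blend aff (eps n) T x) * partial i (blend aff (eps n) T) x.
  have dbl := smooth_expr_differentiable (blend_smooth aff (eps n) T) x.
  have dh : is_derive (blend aff (eps n) T x) 1 (fun u : R => r n * soft_cut ((r n)^-1 * u)) (f ((r n)^-1 * blend aff (eps n) T x)).
    have d1 : is_derive (blend aff (eps n) T x) 1 (fun u : R => (r n)^-1 * u) (r n)^-1.
      have := @is_deriveZ _ _ _ id (r n)^-1 (blend aff (eps n) T x) 1 1 _.
      by rewrite /GRing.scale/= mulr1; apply; exact: is_derive_id.
    have d2 := is_derive1_comp (df _) d1.
    have d3 := @is_deriveZ _ _ _ (soft_cut \o (fun u : R => (r n)^-1 * u)) (r n) (blend aff (eps n) T x) 1 _ d2.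
    apply: (is_derive_eq d3); rewrite /GRing.scale/= mulrCA mulfV ?mulr1//; by rewrite gt_eqF.
  exact: (derive_comp1 'e_i dbl dh).
(* The weak gradient is masked to the set [v != 0]. As [soft_cut] has derivative 0 at 0, the
   approximate gradients vanish at the zeros of [v], so with the mask they converge at every
   interior point of an element. *)
pose g i (x : 'rV[R]_d) := \1_[set x | v x != 0] x * \sum_(K <- T) \1_((simplex K)°) x * (aff K).2 0 i.
have mg i : measurable_fun setT (g i).
  apply: measurable_funM.
    apply: measurable_indic; rewrite (_ : mkset _ = v @^-1` (~` [set 0])); last first.
      by apply/seteqP; split=> x /= /eqP.
    by apply: measurable_preimageT => //; exact: measurableC.
  apply: measurable_sum => K; apply: measurable_funM => //; apply: measurable_indic.
  exact: measurable_simplex_interior.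
have gK i K x : K \in T -> (simplex K)° x -> g i x = if v x == 0 then 0 else (aff K).2 0 i.
  move=> KT Kx; rewrite /g indicE; have [vx|vx] := eqVneq (v x) 0.
    by rewrite memNset ?mul0r//= vx eqxx.
  rewrite mem_set// mul1r (bigD1_seq K)//=; last by case: cT.
  rewrite indicE mem_set// mul1r big_seq_cond big1 ?addr0// => K' /andP[KT' KK'].
  rewrite indicE memNset ?mul0r// => Kx'; move/eqP: KK'; apply; apply/esym.
  by apply: (mesh_interior_disjoint KT KT' Kx); exact: interior_subset.
pose Gg := \sum_(K <- T) enorm (aff K).2.
have gb i x : `|g i x| <= Gg.
  rewrite /g normrM; apply: (@le_trans _ _ (1 * Gg)); last by rewrite mul1r.
  apply: ler_pM => //; first by rewrite indicE; case: (_ \in _); rewrite ?normr1 ?normr0.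
  apply: le_trans (ler_norm_sum _ _ _) _; apply: ler_sum => K _; rewrite normrM.
  apply: (@le_trans _ _ (1 * enorm (aff K).2)); last by rewrite mul1r.
  apply: ler_pM => //; first by rewrite indicE; case: (_ \in _); rewrite ?normr1 ?normr0.
  exact: le_trans (coord_le_norm _ _) (norm_le_enorm _).
have Vb x : Omega x -> `|v x| <= `|v 0| + L * ((d%:R + 1) * Bd).
  move=> Ox; have := ler_normD (v 0) (v x - v 0); rewrite addrC subrK => /le_trans; apply.
  rewrite lerD2l; apply: le_trans (hL x 0) _; rewrite subr0 ler_wpM2l//.
  by apply: le_trans (enorm_le_norm _) _; rewrite ler_wpM2l ?addr_ge0//; apply: hBd; exact: subset_closure.
have mphi n : measurable_fun setT (phi n).
  by apply: continuous_measurable_rV => x; apply: differentiable_continuous; exact: smooth_expr_differentiable.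
have mdphi n i : measurable_fun setT (partial i (phi n)).
  apply: continuous_measurable_rV => x; apply: differentiable_continuous.
  by apply: smooth_expr_differentiable; exact: smooth_expr_partial.
have rcv : r @ \oo --> (0 : R).
  rewrite -[X in _ --> X](mulr0 C); apply: cvgM; [exact: cvg_cst|exact: eps_cvg0].
split.
- exact: continuous_subspaceT.
- split; first by apply: (bounded_L2 lipO _ Vb); exact: measurable_funTS.
  exists g, phi; split.
  + by move=> i; apply: (@bounded_L2 _ _ _ lipO _ Gg) => //; exact: measurable_funTS.
  + move=> n; split; first exact: smooth_expr_smooth.
    exists (closure Omega `&` [set x | r n <= `|v x|]); split.
    * apply: bounded_closed_compact.
        exists Bd; split; first exact: num_real.
        by move=> B BB x [cx _]; apply: le_trans (hBd _ cx) (ltW BB).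
      apply: closedI; first exact: closed_closure.
      apply: (@closed_comp _ _ (fun x => `|v x|) [set t | r n <= t]); last exact: closed_ge.
      by move=> x _; apply: continuous_comp; [exact: cv|exact: norm_continuous].
    * move=> x [cx /= rv]; apply: contrapT => /v0 vx; move: rv; rewrite vx normr0.
      by rewrite leNgt r0.
    * move=> x nK; have vr : `|v x| <= r n.
        rewrite leNgt; apply/negP => h; apply: nK; split; last exact: ltW.
        apply: contrapT => ncx; move: h; rewrite v0 ?normr0; last by move=> Ox; apply: ncx; exact: subset_closure.
        by rewrite ltNge (ltW (r0 n)).
      rewrite /phi soft_cut0 ?mulr0// normrM gtr0_norm ?invr_gt0// ler_pdivrMl//.
      have := near_b n x; have := ler_normD (blend aff (eps n) T x - v x) (v x); rewrite subrK; lra.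
  + apply: (@L2_cvg_dominated _ _ _ _ _ (4 * C)) => //.
    * by move=> n; exact: measurable_funTS.
    * exact: measurable_funTS.
    * move=> n x _; apply: le_trans (phi_near n x) _; rewrite ler_wpM2l// /r ler_piMr ?(ltW C0)//.
      by case/andP: (eps01 n).
    * apply/aeW => x _; apply/cvgrPdist_le => e e0.
      have e4 : 0 < e / 4 by rewrite divr_gt0.
      have /cvgrPdist_le/(_ _ e4) := rcv; apply: filterS => n; rewrite sub0r normrN gtr0_norm// => h.
      by rewrite distrC; apply: le_trans (phi_near n x) _; lra.
  + move=> i; apply: (@L2_cvg_dominated _ _ _ _ _ (M * G + Gg)) => //.
    * by move=> n; exact: measurable_funTS.
    * exact: measurable_funTS.
    * move=> n x _; apply: le_trans (ler_normB _ _) _; apply: lerD => //.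
      by rewrite dphi normrM ler_pM//; apply: hG; exact: eps01.
    * apply: filterS mesh_conull => x hx Ox.
      have [K KT Kx] := hx (subset_closure Ox).
      have Kx' := interior_subset Kx.
      apply: (@cvg_trans _ ((fun=> g i x) @ \oo)); last exact: cvg_cst.
      apply: near_eq_cvg; have ho := others_vanish KT Kx.
      have [vx|vx] := eqVneq (v x) 0.
        apply: filterS ho => n h; have /andP[en _] := eps01 n.
        have [E1 E2] := blend_exact i en KT Kx' h.
        by rewrite dphi E1 -(affP KT Kx') vx mulr0 f0 mul0r (gK i K x)// vx eqxx.
      have v3 : 0 < `|v x| / 3 by rewrite divr_gt0// normr_gt0.
      have hr : \forall n \near \oo, r n < `|v x| / 3.
        have /cvgrPdist_lt/(_ _ v3) := rcv; apply: filterS => n; rewrite sub0r normrN.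
        by apply: le_lt_trans; exact: ler_norm.
      apply: filterS (filterI ho hr) => n [h rn]; have /andP[en _] := eps01 n.
      have [E1 E2] := blend_exact i en KT Kx' h.
      rewrite dphi E1 E2 -(affP KT Kx') f1 ?mul1r ?(gK i K x) ?(negbTE vx)//.
      by rewrite normrM gtr0_norm ?invr_gt0// ltr_pdivlMl// mulrC; lra.
- exact: vP1.
- by move=> x nx; apply: v0 => Ox; apply: nx; exact: subset_closure.
Qed.

End piecewise_affine.

(** * Bisection: nestedness and nondegeneracy *)

Section convexity.
Context {R : realType} {d : nat}.
Implicit Types (K : tsimplex R d) (x : 'rV[R]_d).

Lemma simplex_row K i : simplex K (row i K.1).
Proof.
exists (fun j => (i == j)%:R); split.
- by move=> j; case: eqP.
- by move=> j; rewrite inE.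
- by rewrite (bigD1 i)//= eqxx big1 ?addr0// => k ki; rewrite eq_sym (negbTE ki).
- by rewrite (bigD1 i)//= eqxx scale1r big1 ?addr0// => k ki; rewrite eq_sym (negbTE ki) scale0r.
Qed.

Lemma simplex_comb K (I : finType) (t : I -> R) (y : I -> 'rV[R]_d) :
  (forall i, 0 <= t i) -> \sum_i t i = 1 -> (forall i, simplex K (y i)) -> simplex K (\sum_i t i *: y i).
Proof.
move=> t0 t1 /choice[W hW].
exists (fun j => \sum_i t i * W i j); split.
- by move=> j; apply: sumr_ge0 => i _; case: (hW i) => h _ _ _; rewrite mulr_ge0.
- by move=> j; rewrite inE.
- rewrite exchange_big/= -[RHS]t1; apply: eq_bigr => i _; rewrite -mulr_sumr.
  by case: (hW i) => _ _ -> _; rewrite mulr1.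
- under [RHS]eq_bigr do rewrite scaler_suml.
  rewrite exchange_big/=; apply: eq_bigr => i _.
  case: (hW i) => _ _ _ ->; rewrite scaler_sumr; apply: eq_bigr => j _.
  by rewrite scalerA.
Qed.

Lemma simplex_midpt K : simplex K (midpt K).
Proof.
have -> : midpt K = \sum_(b : bool) 2^-1 *: (if b then vert K 0 else vert K d).
  by rewrite big_bool /= /midpt scalerDr.
apply: simplex_comb => [b||b]; first by rewrite invr_ge0.
  by rewrite big_bool/=; field.
by case: b; exact: simplex_row.
Qed.

Lemma simplex_sub K K' : (forall i, simplex K' (row i K.1)) -> simplex K `<=` simplex K'.
Proof. by move=> h x [t [t0 _ t1 ->]]; exact: simplex_comb. Qed.

Lemma child1_sub K : simplex (child1 K) `<=` simplex K.
Proof.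
apply: simplex_sub => i; rewrite rowK.
by case: ifP => _; [exact: simplex_row|case: ifP => _; [exact: simplex_midpt|exact: simplex_row]].
Qed.

Lemma child2_sub K : simplex (child2 K) `<=` simplex K.
Proof.
apply: simplex_sub => i; rewrite rowK.
case: ifP => _; first exact: simplex_row.
by case: ifP => _; [exact: simplex_midpt|case: ifP => _; exact: simplex_row].
Qed.

Lemma refinement_sub T T' : refinement T T' ->
  forall K, K \in T' -> exists2 K0, K0 \in T & simplex K `<=` simplex K0.
Proof.
elim=> [K KT|T1 K T2 _ IH K']; first by exists K.
rewrite mem_cat !in_cons => /orP[h|/or3P[/eqP->|/eqP->|h]].
- by apply: IH; rewrite mem_cat h.
- have [|K0 K0T KK0] := IH K; first by rewrite mem_cat in_cons eqxx orbT.
  by exists K0 => //; apply: subset_trans KK0; exact: child1_sub.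
- have [|K0 K0T KK0] := IH K; first by rewrite mem_cat in_cons eqxx orbT.
  by exists K0 => //; apply: subset_trans KK0; exact: child2_sub.
- by apply: IH; rewrite mem_cat in_cons h !orbT.
Qed.

Lemma VT_refinement (Omega : set 'rV[R]_d) T T' : refinement T T' -> VT Omega T `<=` VT Omega T'.
Proof.
move=> TT' v [cv Hv Pv v0]; split => // K /(refinement_sub TT')[K0 K0T KK0].
by have [c [g h]] := Pv K0 K0T; exists c, g => x Kx; apply: h; exact: KK0.
Qed.

End convexity.

Section reflection.
Context {R : realType} {d : nat}.
Local Notation mu := (@lebesgue_rV R d).
Implicit Types (g e x : 'rV[R]_d) (A : set 'rV[R]_d).

Definition reflect_mx g e : 'M[R]_d := 1%:M - g^T *m e.

Lemma reflect_mxE g e x : x *m reflect_mx g e = x - dotp g x *: e.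
Proof.
rewrite mulmxBr mulmx1 mulmxA; congr (_ - _); apply/rowP => j.
rewrite !mxE big_ord1 !mxE; congr (_ * _).
by rewrite /dotp; apply: eq_bigr => i _; rewrite !mxE mulrC.
Qed.

Lemma reflect_mxK g e : dotp g e = 2 -> reflect_mx g e *m reflect_mx g e = 1%:M.
Proof.
move=> ge; apply/row_matrixP => i; rewrite !rowE mulmxA !reflect_mxE dotpBr dotpZr ge.
rewrite mulmx1 -addrA -opprD -scalerDl; move: (dotp g _) => c.
have -> : c + (c - c * 2) = 0 by ring.
by rewrite scale0r subr0.
Qed.

(** The linear part is an involution, so the factor [c] by which it scales volumes satisfies
    [c * c = 1]. *)
Lemma lebesgue_reflect g e (a : 'rV[R]_d) A : dotp g e = 2 -> measurable A ->
  mu ((fun x => x - dotp g (x - a) *: e) @^-1` A) = mu A.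
Proof.
move=> ge mA.
have uM : reflect_mx g e \in unitmx by have /mulmx1_unit[] := reflect_mxK ge.
have [c c0 hc] := lebesgue_rV_linear uM.
have c1 : c = 1.
  have mB : measurable (ball (0 : 'rV[R]_d) 1) by exact: measurable_rV_ball.
  have mB' : measurable ((fun x => x *m reflect_mx g e) @^-1` (ball (0 : 'rV[R]_d) 1)).
    by apply: measurable_preimageT => //; exact: measurable_mulmx.
  have h1 := hc _ mB; have h2 := hc _ mB'.
  have E : (fun x : 'rV[R]_d => x *m reflect_mx g e) @^-1` ((fun x => x *m reflect_mx g e) @^-1` (ball (0 : 'rV[R]_d) 1)) = ball (0 : 'rV[R]_d) 1.
    by apply/seteqP; split=> x; rewrite /preimage/= -mulmxA reflect_mxK// mulmx1.
  move: h2; rewrite E h1 lebesgue_rV_ball// -!EFinM => -[].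
  have p0 : 0 < (2 * 1 : R) ^+ d by rewrite exprn_gt0// mulr1.
  move=> h; have : c * c = 1 by apply: (mulIf (lt0r_neq0 p0)); rewrite mul1r -mulrA -h.
  by move=> cc; apply/eqP; rewrite -(@eqrXn2 _ 2)// ?ltW// expr1n expr2 cc.
pose b := dotp g a *: e.
have E : (fun x => x - dotp g (x - a) *: e) @^-1` A = (fun x => x *m reflect_mx g e) @^-1` ((fun x => x + b) @^-1` A).
  apply/seteqP; split=> x; rewrite /preimage/= reflect_mxE /b dotpBr scalerBl opprB addrA [x + _]addrC;
    by rewrite addrAC [_ + x]addrC addrAC.
have mb : measurable ((fun x => x + b) @^-1` A).
  by apply: measurable_preimageT => //; apply: measurable_addrV => //; exact: measurable_cst.
by rewrite E hc// c1 mul1e; exact: lebesgue_rV_shift.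
Qed.

End reflection.

Section nondegeneracy.
Context {R : realType} {d : nat}.
Hypothesis d0 : (0 < d)%N.
Local Notation mu := (@lebesgue_rV R d).
Implicit Types (K : tsimplex R d).

Lemma degenerate_plane K : ~ nondegenerate_simplex K ->
  exists g c, g != 0 /\ forall x, simplex K x -> dotp g x = c.
Proof.
move=> nK; pose W : 'M[R]_d := \matrix_(i < d) (vert K i.+1 - vert K 0).
have [u u0 uW] : exists2 u : 'rV[R]_d, u != 0 & u *m W^T = 0.
  apply: contrapT => h; apply: nK; rewrite /nondegenerate_simplex -/W -unitmx_tr -row_free_unit.
  apply/inj_row_free => u uW; apply/eqP; apply: contrapT => /negP u0; apply: h; by exists u.
exists u, (dotp u (vert K 0)); split=> // x [t [_ _ t1 ->]].
have hz i : dotp u (row i K.1) = dotp u (vert K 0).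
  have [->|i0] := eqVneq i ord0.
    by congr (dotp u (row _ _)); apply: val_inj; rewrite /= inordK.
  case: (unliftP ord0 i) i0 => [j ->|->]; last by rewrite eqxx.
  move=> _; apply/eqP; rewrite -subr_eq0 -dotpBr; apply/eqP.
  move/rowP/(_ j): uW; rewrite !mxE => uW; rewrite -[RHS]uW /dotp; apply: eq_bigr => k _.
  rewrite !mxE; congr (_ * (K.1 _ _ - _)).
  by apply: val_inj; rewrite /= inordK// ltnS.
rewrite dotpC; have : forall s : seq 'I_d.+1, dotp (\sum_(i <- s) t i *: row i K.1) u = (\sum_(i <- s) t i) * dotp u (vert K 0).
  elim=> [|i s IH]; first by rewrite !big_nil dotpC dotp0r mul0r.
  by rewrite !big_cons dotpDl dotpZl IH dotpC hz mulrDl.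
by move=> ->; rewrite t1 mul1r.
Qed.

Lemma simplex_measure K : nondegenerate_simplex K -> exists2 m : R, 0 < m & mu (simplex K) = m%:E.
Proof.
move=> ndK.
have [D [_ hD]] := simplex_bounded K.
have [m m0 mE] := @bounded_measure_fin R d (simplex K) 0 ((d%:R + 1) * (`|D| + 1)) (measurable_simplex ndK)
  (fun x Kx => ltac:(rewrite subr0; apply: le_trans (enorm_le_norm _) _; rewrite ler_wpM2l ?addr_ge0//; apply: hD => //; apply: le_lt_trans (ler_norm D) _; rewrite ltrDl//)).
exists m => //; rewrite lt_neqAle m0 andbT; apply/eqP => m00.
pose b : 'rV[R]_d := \sum_i (d.+1%:R^-1 : R) *: row i K.1.
have ib : (simplex K)° b.
  apply/(simplex_interiorP ndK) => i.
  rewrite -(@bary_unique _ _ _ ndK b (fun=> d.+1%:R^-1))// ?invr_gt0//.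
  by rewrite sumr_const card_ord -[LHS]mulr_natl divff.
have /nbhs_ballP[e /= e0 hb] := ib.
have : (mu (ball b e) <= mu (simplex K))%E.
  have mb : measurable (ball b e) by exact: measurable_rV_ball.
  by apply: le_measure; rewrite ?inE//; exact: measurable_simplex.
by rewrite lebesgue_rV_ball// mE -m00 lee_fin leNgt exprn_gt0// mulr_gt0.
Qed.

Lemma degenerate_null K A : ~ nondegenerate_simplex K -> measurable A -> A `<=` simplex K -> mu A = 0%E.
Proof.
move=> /degenerate_plane[g [c [g0 gc]]] mA AK.
apply: (@hyperplane_null R d A 0 g c (\sum_i enorm (row i K.1))) => // [x Ax|x /AK]; last exact: gc.
apply: simplex_dist (AK _ Ax) => i; rewrite subr0 (bigD1 i)//= lerDl.
by apply: sumr_ge0 => j _; exact: enorm_ge0.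
Qed.

Variable K : tsimplex R d.
Hypothesis ndK : nondegenerate_simplex K.

Let vert0 : vert K 0 = row ord0 K.1.
Proof. by congr row; apply: val_inj; rewrite /= inordK. Qed.
Let vertd : vert K d = row ord_max K.1.
Proof. by congr row; apply: val_inj; rewrite /= inordK. Qed.
Let od : (ord_max : 'I_d.+1) != ord0. Proof. by rewrite -val_eqE/= -lt0n. Qed.

Let od' : (ord0 == ord_max :> 'I_d.+1) = false. Proof. by rewrite eq_sym (negbTE od). Qed.

Let half i j := simplex K `&` [set x | bary K x j <= bary K x i].

Let m_half i j : measurable (half i j).
Proof.
apply: measurableI; first exact: measurable_simplex.
rewrite (_ : mkset _ = (fun x => bary K x i - bary K x j) @^-1` `[0, +oo[); last first.
  by apply/seteqP; split=> x /=; rewrite in_itv/= andbT subr_ge0.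
by apply: measurable_preimageT => //; apply: measurable_funB; exact: measurable_bary.
Qed.

(* The affine reflection exchanging the end points of the refinement edge. *)
Let half_swap : mu (half ord0 ord_max) = mu (half ord_max ord0).
Proof.
pose g := bgrad K ord0 - bgrad K ord_max.
pose e := row ord0 K.1 - row ord_max K.1.
pose a := 2^-1 *: (row ord0 K.1 + row ord_max K.1).
have ae i : dotp (bgrad K i) e = (i == ord0)%:R - (i == ord_max)%:R.
  by rewrite -baryB !bary_vertex// ![_ == i]eq_sym.
have ge : dotp g e = 2.
  by rewrite dotpBl !ae !eqxx (negbTE od) od' /=; ring.
have ba i : bary K a i = 2^-1 * ((i == ord0)%:R + (i == ord_max)%:R).
  have -> : a = (1 - 2^-1) *: row ord0 K.1 + 2^-1 *: row ord_max K.1.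
    by rewrite /a scalerDr; congr (_ *: _ + _); field.
  by rewrite baryC// !bary_vertex// ![_ == i]eq_sym; field.
have gx x : dotp g (x - a) = bary K x ord0 - bary K x ord_max.
  by rewrite dotpBl -!baryB !ba !eqxx (negbTE od) od' /=; ring.
rewrite -(lebesgue_reflect a ge (m_half ord_max ord0)); congr (mu _).
have bs x i : bary K (x - dotp g (x - a) *: e) i = bary K x i - (bary K x ord0 - bary K x ord_max) * ((i == ord0)%:R - (i == ord_max)%:R).
  have := baryB K (x - dotp g (x - a) *: e) x i.
  by rewrite addrAC subrr sub0r dotpNr dotpZr ae gx; lra.
have b0 x : bary K (x - dotp g (x - a) *: e) ord0 = bary K x ord_max.
  by rewrite bs eqxx od' /=; ring.
have bd x : bary K (x - dotp g (x - a) *: e) ord_max = bary K x ord0.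
  by rewrite bs eqxx (negbTE od) /=; ring.
have bi x i : i != ord0 -> i != ord_max -> bary K (x - dotp g (x - a) *: e) i = bary K x i.
  by move=> /negbTE i0 /negbTE i1; rewrite bs i0 i1 /=; ring.
apply/seteqP; split=> x [Kx h]; split; rewrite /= ?b0 ?bd//.
- apply/(simplexP ndK) => i; have hx := iffLR (simplexP ndK x) Kx.
  have [->|i0] := eqVneq i ord0; first by rewrite b0.
  have [->|i1] := eqVneq i ord_max; first by rewrite bd.
  by rewrite bi.
- apply/(simplexP ndK) => i; have hx := iffLR (simplexP ndK _) Kx.
  have [->|i0] := eqVneq i ord0; first by rewrite -bd.
  have [->|i1] := eqVneq i ord_max; first by rewrite -b0.
  by rewrite -bi.
- by move: h; rewrite /= b0 bd.
Qed.

(** The two halves, in each of which one end point of the refinement edge dominates, have equal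
    measure and cover [K]. *)
Let half_ge i j : (i = ord0 /\ j = ord_max) \/ (i = ord_max /\ j = ord0) -> (mu (simplex K) <= 2%:E * mu (half i j))%E.
Proof.
move=> ij.
have -> : (2%:E * mu (half i j) = mu (half ord0 ord_max) + mu (half ord_max ord0))%E.
  have -> : (2%:E : \bar R) = (1%:E + 1%:E)%E by rewrite -EFinD; congr EFin; ring.
  by rewrite ge0_muleDl ?lee_fin// !mul1e; case: ij => -[-> ->]; rewrite half_swap.
have -> : simplex K = half ord0 ord_max `|` half ord_max ord0.
  apply/seteqP; split=> x; last by case=> -[].
  by move=> Kx; have [h|/ltW h] := leP (bary K x ord_max) (bary K x ord0); [left|right].
exact: measureU2.
Qed.

(** With [m] the midpoint of the edge, b_i z_i + b_j z_j = (b_i - b_j) z_i + 2 b_j m. Where b_j <=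
    b_i this is a convex combination of points of the child. *)
Let in_child (c : tsimplex R d) i j :
  i != j -> simplex c (row i K.1) -> simplex c (2^-1 *: (row i K.1 + row j K.1)) ->
  (forall k, k != i -> k != j -> simplex c (row k K.1)) ->
  half i j `<=` simplex c.
Proof.
move=> ij ci cm ck x [Kx /= hx].
have b0 := iffLR (simplexP ndK x) Kx.
pose t k := if k == i then bary K x i - bary K x j else if k == j then 2 * bary K x j else bary K x k.
pose y k := if k == j then 2^-1 *: (row i K.1 + row j K.1) else row k K.1.
have ji : (j == i) = false by rewrite eq_sym (negbTE ij).
have -> : x = \sum_k t k *: y k.
  rewrite -[LHS](bary_comb ndK) (bigD1 i)//= (bigD1 j)/=; last by rewrite eq_sym.
  rewrite [RHS](bigD1 i)//= [X in _ = _ + X](bigD1 j)/=; last by rewrite eq_sym.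
  rewrite !addrA; congr (_ + _); last first.
    by apply: eq_bigr => k /andP[/negbTE ki /negbTE kj]; rewrite /t /y ki kj.
  rewrite /t /y !eqxx ji (negbTE ij) scalerA mulrAC divff ?mul1r// scalerDr addrA -scalerDl.
  by rewrite subrK.
apply: simplex_comb.
- move=> k; rewrite /t; case: ifP => _; first by rewrite subr_ge0.
  by case: ifP => _ //; rewrite mulr_ge0.
- rewrite -(bary_sum ndK x) (bigD1 i)//= (bigD1 j)/=; last by rewrite eq_sym.
  rewrite [RHS](bigD1 i)//= [X in _ = _ + X](bigD1 j)/=; last by rewrite eq_sym.
  rewrite !addrA; congr (_ + _); last first.
    by apply: eq_bigr => k /andP[/negbTE ki /negbTE kj]; rewrite /t ki kj.
  by rewrite /t !eqxx ji; ring.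
- move=> k; rewrite /y; have [//|kj] := eqVneq k j.
  by have [->//|ki] := eqVneq k i; exact: ck.
Qed.

Let midptE : midpt K = 2^-1 *: (row ord0 K.1 + row ord_max K.1).
Proof. by rewrite /midpt vert0 vertd. Qed.

Let mid_index (k : 'I_d.+1) : k != ord0 -> k != ord_max -> (0 < k < d)%N.
Proof.
move=> k0 kd; have k0' : (k != 0%N :> nat) := k0; have kd' : (k != d :> nat) := kd.
by rewrite lt0n k0' ltn_neqAle kd' -ltnS ltn_ord.
Qed.

Let vert_ord (k : 'I_d.+1) : vert K k = row k K.1.
Proof. by rewrite /vert inord_val. Qed.

Let half_child1 : half ord0 ord_max `<=` simplex (child1 K).
Proof.
apply: in_child; first by rewrite od'.
- by have := simplex_row (child1 K) ord0; rewrite rowK /= vert0.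
- by have := simplex_row (child1 K) (inord 1); rewrite rowK inordK ?ltnS//= midptE.
- move=> k k0 kd; have /andP[kk0 kkd] := mid_index k0 kd.
  have := simplex_row (child1 K) (inord k.+1); rewrite rowK inordK ?ltnS//=.
  by rewrite eqSS -[k == 0%N :> nat]negbK -lt0n kk0 /= vert_ord.
Qed.

Let half_child2 : (K.2 < d)%N -> half ord_max ord0 `<=` simplex (child2 K).
Proof.
move=> gd; apply: in_child => //.
- by have := simplex_row (child2 K) ord0; rewrite rowK /= vertd.
- by have := simplex_row (child2 K) (inord 1); rewrite rowK inordK ?ltnS//= midptE addrC.
- move=> k kd k0; have /andP[kk0 kkd] := mid_index k0 kd.
  have [kg|gk] := leqP k K.2.
    have := simplex_row (child2 K) (inord k.+1); rewrite rowK inordK ?ltnS//=.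
    by rewrite eqSS -[k == 0%N :> nat]negbK -lt0n kk0 /= kg vert_ord.
  have lt1 : (d + K.2 - k < d)%N by lia.
  have gt0 : (0 < d + K.2 - k)%N by lia.
  have := simplex_row (child2 K) (inord (d + K.2 - k).+1); rewrite rowK inordK ?ltnS//=.
  rewrite eqSS -[_ == 0%N :> nat]negbK -lt0n gt0 /=.
  have -> : (d + K.2 - k <= K.2)%N = false by apply/negbTE; rewrite -ltnNge; lia.
  have -> : (d + K.2 - (d + K.2 - k) = k)%N by lia.
  by rewrite vert_ord.
Qed.

(** A child contains one half of [K], hence has positive measure; a degenerate simplex lies in a
    hyperplane and has none. *)
Let child_aux c i j (m : R) : (i = ord0 /\ j = ord_max) \/ (i = ord_max /\ j = ord0) ->
  half i j `<=` simplex c -> mu (simplex K) = m%:E -> 0 < m ->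
  nondegenerate_simplex c /\ ((m / 2)%:E <= mu (simplex c))%E.
Proof.
move=> ij sub mE m0; have := half_ge ij; rewrite mE => hm.
have ndc : nondegenerate_simplex c.
  apply: contrapT => nc; move: hm; rewrite (degenerate_null nc _ sub)// mule0 lee_fin.
  by rewrite leNgt m0.
split=> //; apply: (@le_trans _ _ (mu (half i j))).
  rewrite -(@lee_pmul2l _ 2)// -EFinM; apply: le_trans hm.
  by rewrite lee_fin mulrC divfK.
by apply: le_measure; rewrite ?inE//; exact: measurable_simplex.
Qed.

Lemma child1_measure (m : R) : mu (simplex K) = m%:E -> 0 < m ->
  nondegenerate_simplex (child1 K) /\ ((m / 2)%:E <= mu (simplex (child1 K)))%E.
Proof. by apply: child_aux half_child1; left. Qed.

Lemma child2_measure (m : R) : (K.2 < d)%N -> mu (simplex K) = m%:E -> 0 < m ->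
  nondegenerate_simplex (child2 K) /\ ((m / 2)%:E <= mu (simplex (child2 K)))%E.
Proof. by move=> gd; apply: child_aux (half_child2 gd); right. Qed.

End nondegeneracy.

(** * Uniform shape regularity under bisection *)

Section shape_regularity.
Context {R : realType} {d : nat}.
Hypothesis d0 : (0 < d)%N.
Local Notation mu := (@lebesgue_rV R d).
Implicit Types (K : tsimplex R d) (B : nat -> 'rV[R]_d) (s : R).

(* A simplex of tag [g] is spanned by a chain of [d] steps of length at most [s], of which the
   last [g] have been halved; [B k] is the sum of the first [k] steps. *)
Definition bisection_frame K (g : nat) B s :=
  [/\ B 0%N = 0, forall k, (k < d)%N -> enorm (B k.+1 - B k) <= s,
      forall i, (0 < i <= g)%N -> vert K i - vert K 0 = 2^-1 *: B (d - g + i)%N &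
      forall i, (g < i <= d)%N -> vert K i - vert K 0 = B (i - g)%N].

Let vert_mx (F : 'I_d.+1 -> 'rV[R]_d) g i : (i <= d)%N -> vert ((\matrix_i F i, g) : tsimplex R d) i = F (inord i).
Proof. by move=> _; rewrite /vert /= rowK. Qed.

Let half_sum (u w : 'rV[R]_d) : 2^-1 *: (u + w) - w = 2^-1 *: (u - w).
Proof.
by rewrite scalerDr scalerBr -addrA -[X in _ + (_ - X)]scale1r -scalerBl -scaleNr; congr (_ + _ *: _); field.
Qed.

Lemma frame_child1 K B s : (K.2 < d)%N -> bisection_frame K K.2 B s ->
  bisection_frame (child1 K) K.2.+1 B s.
Proof.
move=> gd [B0 Bs h1 h2].
have v0 : vert (child1 K) 0 = vert K 0 by rewrite vert_mx//= inordK.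
have vi i : (1 < i <= d)%N -> vert (child1 K) i = vert K i.-1.
  move=> /andP[i1 id]; rewrite vert_mx// inordK ?ltnS//.
  by case: i i1 id => [|[|i]].
have v1 : vert (child1 K) 1 - vert K 0 = 2^-1 *: B (d - K.2)%N.
  rewrite vert_mx// inordK ?ltnS//= /midpt -h2 ?gd ?leqnn//.
  by rewrite [_ + vert K d]addrC half_sum.
split => // i.
- move=> /andP[i0 ig]; rewrite v0.
  have [->|i1] := eqVneq i 1%N; first by rewrite v1; congr (_ *: B _); lia.
  rewrite vi; last by lia.
  by rewrite h1; [congr (_ *: B _); lia|lia].
- move=> /andP[ig id]; rewrite v0 vi; last by lia.
  by rewrite h2; [congr (B _); lia|lia].
Qed.

(** This child starts at the other end z_d of the refinement edge, where the partial sum is [B n].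
    Its chain runs through the first [n] steps backwards with opposite signs, then through the
    remaining steps unchanged. *)
Lemma frame_child2 K B s : (K.2 < d)%N -> bisection_frame K K.2 B s ->
  exists B', bisection_frame (child2 K) K.2.+1 B' s.
Proof.
move=> gd [B0 Bs h1 h2]; set n := (d - K.2)%N.
have n0 : (0 < n)%N by rewrite subn_gt0.
pose B' k := if (k < n)%N then B (n - k)%N - B n else B k - B n - B n.
exists B'.
have v0 : vert (child2 K) 0 = vert K d by rewrite vert_mx//= inordK.
have zd : vert K d - vert K 0 = B n by rewrite h2 ?gd ?leqnn.
have v1 : vert (child2 K) 1 = midpt K by rewrite vert_mx// inordK ?ltnS.
have va i : (1 < i <= K.2.+1)%N -> vert (child2 K) i = vert K i.-1.
  move=> /andP[i1 ig]; have id : (i <= d)%N by lia.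
  by rewrite vert_mx// inordK ?ltnS//; case: i i1 ig id => [|[|i]] //= _ + _; rewrite ltnS => ->.
have vb i : (K.2.+1 < i <= d)%N -> vert (child2 K) i = vert K (d + K.2 - i.-1).
  move=> /andP[ig id]; rewrite vert_mx// inordK ?ltnS//.
  case: i ig id => [|[|i]] //= ig id.
  by rewrite leqNgt (_ : (K.2 < i.+1)%N) //; lia.
have two (u : 'rV[R]_d) : u = 2^-1 *: (u + u) by rewrite -[u in u + u]scale1r -scalerDl scalerA mulVf ?scale1r.
split.
- by rewrite /B' n0 subn0 subrr.
- move=> k kd; rewrite /B'; have [k1|k1] := ltnP k.+1 n.
    rewrite (ltnW k1) opprD addrACA subrr addr0 enormB.
    have := Bs (n - k.+1)%N; have -> : (n - k.+1).+1 = (n - k)%N by lia.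
    by apply; lia.
  have [k2|k2] := ltnP k n; last by rewrite opprD addrACA subrr addr0 opprD addrACA subrr addr0; exact: Bs.
  have kn : k.+1 = n by lia.
  have -> : (n - k = 1)%N by lia.
  have -> : B k.+1 - B n - B n - (B 1%N - B n) = - B 1%N by rewrite kn subrr sub0r opprB addKr.
  rewrite enormN.
  by have := Bs 0%N d0; rewrite B0 subr0.
- move=> i /andP[i0 ig]; rewrite v0.
  have nlt : (d - K.2.+1 + i < n)%N = false by apply/negbTE; rewrite -leqNgt /n; lia.
  rewrite /B' nlt; have [i1|i1] := eqVneq i 1%N.
    rewrite i1 v1 /midpt half_sum; congr (_ *: _).
    have -> : (d - K.2.+1 + 1 = n)%N by rewrite /n; lia.
    by rewrite subrr sub0r -zd opprB.
  have i2 : (1 < i <= K.2.+1)%N by lia.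
  have i3 : (0 < i.-1 <= K.2)%N by lia.
  rewrite va//; have := h1 _ i3; have -> : (d - K.2 + i.-1 = d - K.2.+1 + i)%N by lia.
  move=> E; have -> : vert K i.-1 - vert K d = (vert K i.-1 - vert K 0) - (vert K d - vert K 0) by rewrite opprB addrA subrK.
  by rewrite E zd [X in _ - X]two -scalerBr opprD addrA.
- move=> i /andP[ig id]; rewrite v0 vb ?ig//.
  have nlt : (i - K.2.+1 < n)%N by rewrite /n; lia.
  rewrite /B' nlt.
  have -> : vert K (d + K.2 - i.-1) - vert K d = (vert K (d + K.2 - i.-1) - vert K 0) - (vert K d - vert K 0) by rewrite opprB addrA subrK.
  rewrite zd h2; last by lia.
  by congr (B _ - _); rewrite /n; lia.
Qed.

(** When the tag reaches [d] all steps have been halved; the tag returns to 0 and the halving moves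
    into the chain. *)
Lemma frame_reset K B s : bisection_frame K d B s -> bisection_frame K 0 (fun k => 2^-1 *: B k) (s / 2).
Proof.
move=> [B0 Bs h1 h2]; split.
- by rewrite B0 scaler0.
- move=> k kd; rewrite -scalerBr enormZ ger0_norm ?invr_ge0// mulrC ler_wpM2r ?invr_ge0//; exact: Bs.
- by move=> i /andP[i0]; rewrite leqNgt i0.
- by move=> i hi; rewrite h1// subnn add0n subn0.
Qed.

Lemma frame_init K D : (K.2 < d)%N -> (forall i, enorm (vert K i - vert K 0) <= D) ->
  exists B, bisection_frame K K.2 B (4 * D).
Proof.
move=> gd hD; set n := (d - K.2)%N.
(* The two vertex formulas of a frame are inverted. Vertices that a frame stores with the factor 1/2
   are doubled, hence |B k| <= 2 D and steps of length at most 4 D. *)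
pose B k := if k == 0%N then 0 else if (k <= n)%N then vert K (K.2 + k) - vert K 0 else 2 *: (vert K (k - n) - vert K 0).
have D0 : 0 <= D by apply: le_trans (hD 0%N); exact: enorm_ge0.
have B2 k : enorm (B k) <= 2 * D.
  rewrite /B; case: ifP => _; first by rewrite enorm0 mulr_ge0.
  case: ifP => _; first by apply: le_trans (hD _) _; lra.
  by rewrite enormZ ger0_norm// ler_wpM2l.
exists B; split.
- by rewrite /B eqxx.
- by move=> k _; apply: le_trans (enorm_leN _ _) _; have := B2 k; have := B2 k.+1; lra.
- move=> i /andP[i0 ig]; rewrite /B.
  have -> : (d - K.2 + i == 0)%N = false by apply/negbTE; lia.
  have -> : (d - K.2 + i <= n)%N = false by apply/negbTE; rewrite -ltnNge /n; lia.
  have -> : (d - K.2 + i - n = i)%N by rewrite /n; lia.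
  by rewrite scalerA mulVf// scale1r.
- move=> i /andP[ig id]; rewrite /B.
  have -> : (i - K.2 == 0)%N = false by apply/negbTE; lia.
  have -> : (i - K.2 <= n)%N by rewrite /n; lia.
  by congr (vert K _ - _); lia.
Qed.

Lemma frame_diam K g B s : (g <= d)%N -> bisection_frame K g B s ->
  forall x z, simplex K x -> simplex K z -> enorm (x - z) <= 2 * (d%:R * s).
Proof.
move=> gd [B0 Bs h1 h2].
have s0 : 0 <= s by apply: le_trans (Bs 0%N d0); exact: enorm_ge0.
have Bk k : (k <= d)%N -> enorm (B k) <= d%:R * s.
  move=> kd; apply: (@le_trans _ _ (k%:R * s)); last by rewrite ler_wpM2r// ler_nat.
  elim: k kd => [|k IH] kd; first by rewrite B0 enorm0 mul0r.
  have := enormD (B k.+1 - B k) (B k); rewrite subrK => /le_trans; apply.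
  by rewrite -natr1 mulrDl mul1r addrC lerD// ?IH ?Bs// ltnW.
have ds0 : 0 <= d%:R * s by rewrite mulr_ge0.
have vK (i : 'I_d.+1) : enorm (row i K.1 - vert K 0) <= d%:R * s.
  have -> : row i K.1 = vert K i by rewrite /vert inord_val.
  have [->|i0] := eqVneq (i : nat) 0%N; first by rewrite subrr enorm0.
  have id : (i <= d)%N by rewrite -ltnS.
  have [ig|gi] := leqP i g.
    rewrite h1 ?lt0n ?i0// enormZ ger0_norm ?invr_ge0//.
    have Bd : enorm (B (d - g + i)%N) <= d%:R * s by apply: Bk; lia.
    by have := enorm_ge0 (B (d - g + i)%N); lra.
  by rewrite h2 ?gi//; apply: Bk; lia.
move=> x z Kx Kz; have h a : simplex K a -> enorm (a - vert K 0) <= d%:R * s by exact: simplex_dist.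
have := enorm_triangle x (vert K 0) z; rewrite [enorm (vert K 0 - z)]enormB.
by have := h x Kx; have := h z Kz; lra.
Qed.

(** The factor [2 ^+ K.2] keeps the account within a cycle of tags: a bisection leaves [s] and may
    halve the volume, and at the reset [s] is halved, which divides [s ^+ d] by exactly the
    accumulated 2^d. *)
Definition shape_inv (A : R) K := [/\ nondegenerate_simplex K, (K.2 < d)%N &
  exists B s m, [/\ bisection_frame K K.2 B s, mu (simplex K) = m%:E, 0 < m & s ^+ d <= A * 2 ^+ K.2 * m]].

Lemma shape_inv_child A K c : 0 <= A -> shape_inv A K -> c = child1 K \/ c = child2 K -> shape_inv A c.
Proof.
move=> A0 [ndK gd [B [s [m [fr mE m0 sA]]]]] hc.
have [ndc mc] : nondegenerate_simplex c /\ ((m / 2)%:E <= mu (simplex c))%E.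
  by case: hc => ->; [exact: child1_measure|exact: child2_measure].
have [B' fr'] : exists B', bisection_frame c K.2.+1 B' s.
  by case: hc => ->; [exists B; exact: frame_child1|exact: frame_child2 fr].
have c2 : c.2 = (K.2.+1 %% d)%N by case: hc => ->.
have [m' m'0 m'E] := simplex_measure ndc.
move: mc; rewrite m'E lee_fin => mc.
split => //; first by rewrite c2 ltn_mod.
have sA' : s ^+ d <= A * 2 ^+ K.2.+1 * m'.
  apply: (le_trans sA); rewrite exprS -!mulrA ler_wpM2l// [2 * (_ * _)]mulrCA ler_wpM2l ?exprn_ge0//; lra.
have [gd1|gd1] := ltnP K.2.+1 d.
  by rewrite c2 modn_small//; exists B', s, m'.
have gE : K.2.+1 = d by apply/eqP; rewrite eqn_leq gd gd1.
rewrite c2 gE modnn; exists (fun k => 2^-1 *: B' k), (s / 2), m'; split => //.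
  by move: fr'; rewrite gE; exact: frame_reset.
rewrite expr0 mulr1 expr_div_n ler_pdivrMr ?exprn_gt0//; apply: (le_trans sA').
by rewrite gE mulrAC.
Qed.

Lemma hK_pow K (m : R) : mu (simplex K) = m%:E -> 0 < m -> 0 < hK K /\ hK K ^+ d = m.
Proof.
move=> mE m0; rewrite /hK mE /=; split; first exact: powR_gt0.
rewrite -powR_mulrn ?powR_ge0// -powRrM mulVf ?powRr1 ?ltW//.
by rewrite pnatr_eq0 -lt0n.
Qed.

Lemma refinement_shape_regular (kappa : R) : exists2 C : R, 0 < C & forall T0 T : mesh R d,
  (forall K, K \in T0 -> nondegenerate_simplex K /\ (K.2 < d)%N) -> shape_regular kappa T0 -> refinement T0 T ->
  forall K, K \in T -> [/\ nondegenerate_simplex K, 0 < hK K, mu (simplex K) = (hK K ^+ d)%:E &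
    forall x z, simplex K x -> simplex K z -> enorm (x - z) <= C * hK K].
Proof.
pose A := (4 * `|kappa|) ^+ d.
have A0 : 0 <= A by rewrite exprn_ge0// mulr_ge0.
(* As [a >= 1], [A <= a ^+ d]; since 2^tag <= 2^d, the invariant yields s <= 2 a h, and the diameter
   is at most 2 d s. *)
pose a := A + 1.
have a1 : 1 <= a by rewrite lerDr.
exists (2 * (d%:R * (a * 2))).
  by rewrite !mulr_gt0// ?ltr0n// (lt_le_trans ltr01 a1).
move=> T0 T nd0 sr ref.
have inv : forall K, K \in T -> shape_inv A K.
  elim: ref => [K KT|T1 K T2 _ IH K'].
    have [ndK gK] := nd0 K KT; split => //.
    have [m m0 mE] := simplex_measure ndK.
    have [hK0 hKd] := hK_pow mE m0.
    have hv i : enorm (vert K i - vert K 0) <= `|kappa| * hK K.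
      apply: le_trans (sr K KT _ _ (simplex_row K _) (simplex_row K _)) _.
      by rewrite ler_wpM2r ?(ltW hK0)// ler_norm.
    have [B fr] := frame_init gK hv.
    exists B, (4 * (`|kappa| * hK K)), m; split => //.
    rewrite mulrA exprMn hKd -/A -mulrA ler_wpM2l// ler_peMl ?(ltW m0)//.
    by rewrite exprn_ege1// ler1n.
  rewrite mem_cat !in_cons => /orP[h|/or3P[/eqP->|/eqP->|h]].
  - by apply: IH; rewrite mem_cat h.
  - by apply: (shape_inv_child (K := K)) => //; [apply: IH; rewrite mem_cat in_cons eqxx orbT|left].
  - by apply: (shape_inv_child (K := K)) => //; [apply: IH; rewrite mem_cat in_cons eqxx orbT|right].
  - by apply: IH; rewrite mem_cat in_cons h !orbT.
move=> K KT; have [ndK gd [B [s [m [fr mE m0 sA]]]]] := inv K KT.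
have [hK0 hKd] := hK_pow mE m0; split => //; first by rewrite hKd.
move=> x z Kx Kz; apply: le_trans (frame_diam (ltnW gd) fr Kx Kz) _.
rewrite -!mulrA ler_wpM2l// ler_wpM2l//.
have s0 : 0 <= s by case: fr => _ /(_ 0%N d0) h _ _; apply: le_trans h; exact: enorm_ge0.
have a0 : 0 <= a by rewrite (le_trans ler01 a1).
rewrite -(@ler_pXn2r _ d)// ?nnegrE ?mulr_ge0 ?(ltW hK0)//.
apply: (le_trans sA); rewrite !exprMn hKd mulrA ler_wpM2r ?(ltW m0)//.
apply: ler_pM => //.
  by apply: (@le_trans _ _ a); [rewrite lerDl|rewrite ler_eXnr].
by rewrite ler_eXn2l ?ltr1n// ltnW.
Qed.

End shape_regularity.

Section bary_bounds.
Context {R : realType} {d : nat}.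
Hypothesis d0 : (0 < d)%N.
Local Notation mu := (@lebesgue_rV R d).
Implicit Types (K : tsimplex R d) (x y z : 'rV[R]_d).

Definition shape_bounded (C : R) K := [/\ nondegenerate_simplex K, 0 < hK K, mu (simplex K) = (hK K ^+ d)%:E &
  forall x z, simplex K x -> simplex K z -> enorm (x - z) <= C * hK K].

(** The whole simplex is a layer of width 1 for its coordinate [i]. So [layer_measure] bounds its
    volume h^d by a multiple of h^d / (h |g_j|), for each nonzero component g_j of the gradient. *)
Lemma bary_lipschitz (C : R) : 0 < C -> exists2 L : R, 0 < L & forall K, shape_bounded C K ->
  forall i x y, `|bary K x i - bary K y i| <= L / hK K * enorm (x - y).
Proof.
move=> C0; pose G := (6 * C) ^+ d * (4 / C).
have G0 : 0 < G by rewrite mulr_gt0// ?divr_gt0// exprn_gt0// mulr_gt0.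
exists (d%:R * G); first by rewrite mulr_gt0// ltr0n.
move=> K [ndK h0 mE diam] i x y; set h := hK K in h0 mE diam *.
pose g := bgrad K i.
have gG j : `|g 0 j| <= G / h.
  have [->|gj] := eqVneq (g 0 j) 0; first by rewrite normr0 divr_ge0 ?(ltW G0) ?(ltW h0).
  have := @layer_measure R d (simplex K) (row ord0 K.1) g (- bary K 0 i) (1 - bary K 0 i) (C * h) j.
  rewrite mE => /(_ (measurable_simplex ndK)); rewrite mulr_gt0// => /(_ isT).
  have -> : 1 - bary K 0 i - - bary K 0 i = 1 by rewrite opprK subrK.
  rewrite mulr1 lee_fin => H.
  have {H} : h ^+ d <= (6 * (C * h)) ^+ d * (4 / (`|g 0 j| * (C * h))).
    apply: H => // [|z Kz|z Kz].
    - lra.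
    - by apply: diam => //; exact: simplex_row.
    - by have := iffLR (simplexP ndK z) Kz i; have := bary_le1 ndK i Kz; rewrite (bary_dotp K z) -/g; lra.
  rewrite mulrA exprMn mulrAC -[leLHS]mul1r ler_pM2r ?exprn_gt0//.
  have ng : 0 < `|g 0 j| by rewrite normr_gt0.
  have -> : (6 * C) ^+ d * (4 / (`|g 0 j| * (C * h))) = G / h / `|g 0 j|.
    by rewrite /G; field; rewrite !lt0r_neq0.
  by rewrite ler_pdivlMr// mul1r.
rewrite baryB// -/g /dotp; apply: le_trans (ler_norm_sum _ _ _) _.
have -> : d%:R * G / h * enorm (x - y) = \sum_(j < d) (G / h * enorm (x - y)).
  by rewrite sumr_const card_ord -[RHS]mulr_natl !mulrA.
apply: ler_sum => j _; rewrite normrM ler_pM//.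
exact: le_trans (coord_le_norm _ _) (norm_le_enorm _).
Qed.

End bary_bounds.

(** * Comparable sizes in a vertex star *)

Section segments.
Context {R : realType} {d : nat}.
Implicit Types (x y z : 'rV[R]_d) (A B : set 'rV[R]_d).

(** The function that is 0 on [A] and 1 on [B] has Lipschitz constant 0 on each of two closed sets
    covering the segment; by [lipschitz_closed_cover] it is constant. *)
Lemma segment_closed_split A B x y : closed A -> closed B ->
  (forall t : R, 0 <= t <= 1 -> (A `|` B) (x + t *: (y - x)) /\ ~ (A `&` B) (x + t *: (y - x))) ->
  A x -> A y.
Proof.
move=> cA cB h Ax; pose p (t : R) := x + t *: (y - x).
have cp : continuous p.
  by move=> t; apply: cvgD; [exact: cvg_cst|apply: cvgZr_tmp; exact: cvg_id].
pose f t : R := if `[< A (p t) >] then 0 else 1.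
have p0 : p 0 = x by rewrite /p scale0r addr0.
have p1 : p 1 = y by rewrite /p scale1r addrC subrK.
have := @lipschitz_closed_cover R f 0 [:: p @^-1` A; p @^-1` B] 0 1 (lexx _) ler01.
rewrite mul0r normr_le0 subr_eq0 /f p0 p1 => H.
apply: contrapT => nAy; move: H; rewrite (asboolT Ax) (asboolF nAy) => H.
suff : (1 : R) == 0 by rewrite oner_eq0.
apply: H => [S|t ht|S].
- by rewrite !inE => /orP[]/eqP ->; apply: closed_comp => // t _; exact: cp.
- by have [[Ap|Bp] _] := h t ht; [exists (p @^-1` A)|exists (p @^-1` B)] => //; rewrite !inE eqxx ?orbT.
- rewrite !inE => /orP[]/eqP -> t u; rewrite /preimage/= mul0r => pt pu ht hu.
    by rewrite (asboolT pt) (asboolT pu) subrr normr0.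
  have [_ nt] := h t ht; have [_ nu] := h u hu.
  by rewrite !asboolF ?subrr ?normr0// => [Au|At]; [apply: nu|apply: nt].
Qed.

Hypothesis d2 : (1 < d)%N.
Variable Omega : set 'rV[R]_d.
Hypothesis lipO : bounded_lipschitz_domain Omega.

(* For [z] on the boundary the path from [x] to [y] runs inside [Omega], first up along the axis
   of the chart at [z], then across, then down; it avoids [z], which is not in [Omega]. *)
Lemma closed_split_near_point A B z (r : R) : closed A -> closed B -> 0 < r -> closure Omega z ->
  (forall x, closure Omega x -> enorm (x - z) < r -> (A `|` B) x) -> A `&` B `<=` [set z] ->
  exists2 e : R, 0 < e & forall x y, Omega x -> Omega y -> x != z -> y != z ->
    enorm (x - z) < e -> enorm (y - z) < e -> A x -> A y.
Proof.
move=> cA cB r0 cz AB ABz.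
have seg (P : set 'rV[R]_d) x y : P `<=` closure Omega -> P `<=` [set x | enorm (x - z) < r] -> ~ P z ->
    (forall t : R, 0 <= t <= 1 -> P (x + t *: (y - x))) -> A x -> A y.
  move=> PO Pr Pz hP; apply: segment_closed_split cA cB _ => t /hP Pt; split.
    by apply: AB; [exact: PO|exact: Pr].
  by move=> /ABz tz; apply: Pz; rewrite -tz.
have [Oz|nOz] := pselect (Omega z).
  have /nbhs_enormP[e1 e10 he1] : nbhs z Omega by apply: open_nbhs_nbhs; split=> //; case: lipO.
  pose e := Num.min r e1; have e0 : 0 < e by rewrite lt_min r0 e10.
  have conv x y (t : R) : enorm (x - z) < e -> enorm (y - z) < e -> 0 <= t <= 1 -> enorm (x + t *: (y - x) - z) < e.
    move=> xe ye /andP[t0 t1].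
    have -> : x + t *: (y - x) - z = (1 - t) *: (x - z) + t *: (y - z).
      by apply/rowP => j; rewrite !mxE; ring.
    apply: le_lt_trans (enormD _ _) _; rewrite !enormZ !ger0_norm ?subr_ge0//.
    have [->|t0'] := eqVneq t 0; first by rewrite subr0 mul1r mul0r addr0.
    have : t * enorm (y - z) < t * e by rewrite ltr_pM2l// lt_neqAle eq_sym t0'.
    have : (1 - t) * enorm (x - z) <= (1 - t) * e by rewrite ler_wpM2l ?subr_ge0// ltW.
    lra.
  have direct x y : enorm (x - z) < e -> enorm (y - z) < e ->
      (forall t : R, 0 <= t <= 1 -> x + t *: (y - x) != z) -> A x -> A y.
    move=> xe ye nz; apply: (seg ([set x | enorm (x - z) < e] `\` [set z])) => [u [ue _]|u [ue _]|[_]|t ht].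
    - by apply: subset_closure; apply: he1; apply: lt_le_trans ue _; rewrite ge_min lexx orbT.
    - by apply: lt_le_trans ue _; rewrite ge_min lexx.
    - exact.
    - by split; [exact: conv|apply/eqP; exact: nz].
  exists e => // x y Ox Oy xz yz xe ye Ax.
  have [[t [ht tz]]|nt] := pselect (exists t : R, 0 <= t <= 1 /\ x + t *: (y - x) = z); last first.
    by apply: direct Ax => // t ht; apply/eqP => tz; apply: nt; exists t.
  have [k xk] : exists k, (x - z) 0 k != 0.
    apply: contrapT => h; move/eqP: xz; apply; apply/rowP => k; apply/eqP; apply: contrapT => /negP hk.
    by apply: h; exists k; rewrite !mxE subr_eq0.
  have [i ik] : exists i : 'I_d, i != k.
    have [h|h] := eqVneq k (Ordinal (ltnW d2)); last by exists (Ordinal (ltnW d2)); rewrite eq_sym.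
    by exists (Ordinal d2); rewrite h.
  have yk : (y - z) 0 k != 0.
    apply: contra_neq xk => yk; have tv := tz; move/rowP/(_ k): tz; rewrite !mxE in yk * => tz.
    have yz' : y 0 k = z 0 k by lra.
    have {}tz' : (1 - t) * (x 0 k - z 0 k) = 0.
      have -> : (1 - t) * (x 0 k - z 0 k) = x 0 k + t * (z 0 k - x 0 k) - z 0 k by ring.
      by rewrite -{1}yz' tz subrr.
    move/eqP: tz'; rewrite mulf_eq0 => /orP[|/eqP//]; rewrite subr_eq0 => /eqP t1.
    by move/eqP: yz => []; rewrite -tv -t1 scale1r addrC subrK.
  (* When the segment runs through [z], detour over a point displaced from [z] along an axis [i]
     different from an axis [k] in which [x] and [z] differ. This is where [d >= 2] enters. *)
  pose q := z + (e / 2) *: delta_mx 0 i.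
  have qk : q 0 k = z 0 k by rewrite !mxE /= eq_sym (negbTE ik) mulr0 addr0.
  have qi : q 0 i = z 0 i + e / 2 by rewrite !mxE /= !eqxx mulr1.
  have qe : enorm (q - z) < e.
    have -> : q - z = (e / 2) *: delta_mx 0 i by rewrite /q addrC addKr.
    rewrite enormZ ger0_norm ?divr_ge0 ?(ltW e0)//.
    have -> : enorm (delta_mx 0 i : 'rV[R]_d) = 1.
      by rewrite /enorm dotp_delta mxE !eqxx sqrtr1.
    by rewrite mulr1 ltr_pdivrMr// ltr_pMr// ltr1n.
  clearbody q; have aux u (s : R) : (u - z) 0 k != 0 -> u + s *: (q - u) != z.
    move=> uk; apply: contra_neq uk => /rowP h.
    have := h i; have := h k; rewrite !mxE qk qi => hk hi.
    have {}hk : (1 - s) * (u 0 k - z 0 k) = 0.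
      have -> : (1 - s) * (u 0 k - z 0 k) = u 0 k + s * (z 0 k - u 0 k) - z 0 k by ring.
      by rewrite hk subrr.
    move/eqP: hk; rewrite mulf_eq0 => /orP[|/eqP//]; rewrite subr_eq0 => /eqP s1.
    by move: hi; rewrite -s1; lra.
  apply: (direct q) => //.
    move=> s hs; have -> : q + s *: (y - q) = y + (1 - s) *: (q - y) by apply/rowP => j; rewrite !mxE; ring.
    exact: aux.
  by apply: direct Ax => // s _; exact: aux.
have [_ _ _ _ /(_ z)[]] := lipO; first exact/(boundaryP lipO).
move=> r1 [a [phi [L [r10 a1 pa pL pO]]]].
pose L1 := `|L| + 1; have L10 : 0 < L1 by rewrite ltr_wpDl.
have pL1 u v : `|phi u - phi v| <= L1 * enorm (u - v).
  apply: le_trans (pL _ _) _; rewrite ler_wpM2r ?enorm_ge0// (le_trans (ler_norm L))// lerDl//.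
pose rr := Num.min r r1; have rr0 : 0 < rr by rewrite lt_min r0.
pose e := rr / (4 * (L1 + 1)); have e0 : 0 < e by rewrite divr_gt0// mulr_gt0// addr_gt0.
(* The height needed for the crossing: over a distance of at most 2 e the graph rises by at most 2
   L1 e, and the height of the moving point drops by at most 2 e. *)
pose tau := 2 * (L1 + 1) * e.
have tE : tau + e + e <= rr.
  have -> : rr = 4 * (L1 + 1) * e by rewrite /e mulrC divfK// lt0r_neq0// mulr_gt0// addr_gt0.
  by rewrite /tau; nra.
have tau0 : 0 < tau by rewrite mulr_gt0// mulr_gt0// addr_gt0.
have da : dotp a a = 1 by rewrite -enorm_sqr a1 expr1n.
pose P := Omega `&` [set x | enorm (x - z) < rr].
have up x s : Omega x -> enorm (x - z) < e -> 0 <= s <= tau -> P (x + s *: a).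
  move=> Ox xe /andP[s0 st].
  have xr : enorm (x + s *: a - z) < rr.
    rewrite addrAC; apply: le_lt_trans (enormD _ _) _.
    by rewrite enormZ a1 mulr1 ger0_norm//; lra.
  have r1r : rr <= r1 by rewrite ge_min lexx orbT.
  split=> //; apply/pO; first exact: lt_le_trans xr r1r.
  rewrite pa dotpDl dotpZl da mulr1; have : phi x < dotp x a by apply/pO => //; lra.
  lra.
have segP x y : (forall t : R, 0 <= t <= 1 -> P (x + t *: (y - x))) -> A x -> A y.
  apply: seg => [u [Ou _]|u [_ ur]|[]//]; first exact: subset_closure.
  by apply: lt_le_trans ur _; rewrite ge_min lexx.
exists e => // x y Ox Oy xz yz xe ye Ax.
have ht (t : R) : 0 <= t <= 1 -> 0 <= t * tau <= tau.
  by move=> /andP[t0 t1]; rewrite mulr_ge0 ?(ltW tau0)//= ler_piMl// ltW.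
apply: (segP (y + tau *: a)).
  move=> t t01; have -> : y + tau *: a + t *: (y - (y + tau *: a)) = y + ((1 - t) * tau) *: a.
    by apply/rowP => j; rewrite !mxE; ring.
  by apply: up => //; apply: ht; lra.
apply: (segP (x + tau *: a)); last first.
  apply: segP Ax => t t01; have -> : x + t *: (x + tau *: a - x) = x + (t * tau) *: a.
    by apply/rowP => j; rewrite !mxE; ring.
  by apply: up => //; exact: ht.
move=> t t01; set u := (X in P X).
have uE : u = x + t *: (y - x) + tau *: a by apply/rowP => j; rewrite !mxE; ring.
have xy : enorm (t *: (y - x)) <= 2 * e.
  move: t01 => /andP[t0 t1]; rewrite enormZ ger0_norm//.
  have := enorm_triangle y z x; rewrite [enorm (z - x)]enormB => h.
  have := enorm_ge0 (y - x); nra.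
have ur : enorm (u - z) < rr.
  have -> : u - z = (1 - t) *: (x - z) + t *: (y - z) + tau *: a by rewrite uE; apply/rowP => j; rewrite !mxE; ring.
  apply: le_lt_trans (enormD _ _) _; apply: le_lt_trans (lerD (enormD _ _) (lexx _)) _.
  move: t01 => /andP[t0 t1]; rewrite !enormZ a1 mulr1 !ger0_norm ?subr_ge0 ?(ltW tau0)//.
  have := enorm_ge0 (x - z); have := enorm_ge0 (y - z); nra.
have r1r : rr <= r1 by rewrite ge_min lexx orbT.
split=> //; apply/pO; first exact: lt_le_trans ur r1r.
rewrite uE pa !dotpDl !dotpZl da mulr1.
have h1 : phi x < dotp x a.
  apply/pO => //; apply: lt_le_trans xe _; lra.
have h2 := pL1 (x + t *: (y - x)) x; rewrite [x + _ - x]addrAC subrr add0r in h2.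
have h3 := dotp_le (t *: (y - x)) a; rewrite a1 mulr1 dotpZl in h3.
have h4 : L1 * enorm (t *: (y - x)) <= L1 * (2 * e) by rewrite ler_wpM2l// ltW.
move: h2 h3; rewrite !ler_norml => /andP[_ h2] /andP[h3 _].
rewrite /tau; nra.
Qed.

End segments.

Section star.
Context {R : realType} {d : nat} (Omega : set 'rV[R]_d).
Hypothesis lipO : bounded_lipschitz_domain Omega.
Hypothesis d0 : (0 < d)%N.
Variable T : mesh R d.
Hypothesis cT : conforming_mesh Omega T.
Local Notation mu := (@lebesgue_rV R d).

Let ndT K : K \in T -> nondegenerate_simplex K.
Proof. by case: cT => _ h _ _ _ /h[]. Qed.

Lemma bary_comb_sum K (I : finType) (t : I -> R) (y : I -> 'rV[R]_d) j : nondegenerate_simplex K -> \sum_i t i = 1 ->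
  bary K (\sum_i t i *: y i) j = \sum_i t i * bary K (y i) j.
Proof.
move=> ndK t1; rewrite (bary_dotp K).
under [RHS]eq_bigr do rewrite (bary_dotp K) mulrDr.
rewrite big_split/= -mulr_suml t1 mul1r; congr (_ + _).
rewrite (big_morph (dotp (bgrad K j)) (fun a b => dotpDr a b _) (dotp0r _)).
by apply: eq_bigr => i _; rewrite dotpZr.
Qed.

(** By conformity the vertex lies in the face spanned by common vertices; being an extreme point of
    [K0], it is one of them. *)
Lemma mesh_vertex K K0 i0 : K \in T -> K0 \in T -> simplex K (row i0 K0.1) -> exists i, row i K.1 = row i0 K0.1.
Proof.
move=> KT K0T Kz; have [->|KK0] := eqVneq K K0; first by exists i0.
have [_ _ _ _ /(_ K K0 KT K0T KK0) h] := cT.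
have [t [t0 tI t1 zE]] : face K [set i | [exists j, row i K.1 == row j K0.1]]%SET (row i0 K0.1).
  by rewrite -h; split=> //; exact: simplex_row.
have [i ti] : exists i, 0 < t i.
  apply: contrapT => n; have : \sum_i t i <= 0.
    by apply: sumr_le0 => i _; rewrite leNgt; apply/negP => ti; apply: n; exists i.
  by rewrite t1 ler10.
have common k : t k != 0 -> exists j, row k K.1 = row j K0.1.
  move=> tk; have : k \in [set i | [exists j, row i K.1 == row j K0.1]]%SET.
    by apply: contraT => /tI /eqP; rewrite (negbTE tk).
  by rewrite inE => /existsP[j /eqP E]; exists j.
have [j ij] := common i (lt0r_neq0 ti); exists i; rewrite ij.
have := bary_comb_sum (fun k => row k K.1) j (ndT K0T) t1.
rewrite -zE (bary_vertex (ndT K0T)) (bigD1 i)//= ij (bary_vertex (ndT K0T)) eqxx mulr1.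
have [->//|_] := eqVneq i0 j; move=> E; have : (0 : R) < false%:R; last by rewrite ltxx.
rewrite E ltr_wpDr//; apply: sumr_ge0 => k _.
have [->|/common[j' ->]] := eqVneq (t k) 0; first by rewrite mul0r.
by rewrite (bary_vertex (ndT K0T)) mulr_ge0.
Qed.

(** A point of the common face other than the vertex gives nonzero weight to a second common
    vertex. *)
Lemma common_edge K K' i0 i0' p : K \in T -> K' \in T -> K != K' -> row i0 K.1 = row i0' K'.1 ->
  simplex K p -> simplex K' p -> p != row i0 K.1 ->
  exists j j', row j K.1 = row j' K'.1 /\ j != i0 /\ j' != i0'.
Proof.
move=> KT K'T KK' zE Kp Kp' pz.
have [_ _ _ _ /(_ K K' KT K'T KK') h] := cT.
have [t [t0 tI t1 pE]] : face K [set i | [exists j, row i K.1 == row j K'.1]]%SET p by rewrite -h.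
have [j ji tj] : exists2 j, j != i0 & t j != 0.
  apply: contrapT => n; move/eqP: pz; apply.
  have tz j : j != i0 -> t j = 0 by move=> ji; apply/eqP; apply: contrapT => /negP tj; apply: n; exists j.
  move: t1; rewrite (bigD1 i0)//= big1 ?addr0// => ti.
  by rewrite pE (bigD1 i0)//= big1 ?addr0 ?ti ?scale1r// => j /tz ->; rewrite scale0r.
have : j \in [set i | [exists j, row i K.1 == row j K'.1]]%SET.
  by apply: contraT => /tI /eqP; rewrite (negbTE tj).
rewrite inE => /existsP[j' /eqP E]; exists j, j'; split=> //; split=> //.
apply: contra_neq ji => j'i; move: E; rewrite j'i -zE => E.
have := bary_vertex (ndT KT) j i0; rewrite E (bary_vertex (ndT KT)) eqxx.
by case: eqP => // _ /eqP; rewrite oner_eq0.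
Qed.

Variable C : R.
Hypothesis C1 : 1 <= C.
Hypothesis sT : forall K, K \in T -> shape_bounded C K.

(* Packing: the parts of the simplices near the vertex, scaled to the smallest size, are disjoint. *)
Lemma star_size (s : seq (tsimplex R d)) z (h : R) : 0 < h -> uniq s -> {subset s <= T} ->
  (forall K, K \in s -> simplex K z /\ h <= hK K) -> (size s)%:R <= (4 * C) ^+ d.
Proof.
move=> h0 us sub hs.
have C0 : 0 < C by exact: lt_le_trans ltr01 C1.
(* Contraction towards [z] by [sc K] gives every image diameter at most [h] and volume
   [(h / C) ^+ d]. The images stay inside their simplices because [z] belongs to them and the
   factors are at least 1. *)
pose sc (K : tsimplex R d) := C * hK K / h.
have sc1 K : K \in s -> 1 <= sc K.
  move=> Ks; have [_ hh] := hs K Ks; rewrite /sc ler_pdivlMr// mul1r.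
  by apply: (le_trans hh); rewrite ler_peMl// ltW// (lt_le_trans h0 hh).
pose A (K : tsimplex R d) := (fun x => z + sc K *: (x - z)) @^-1` (simplex K)°.
have mA K : K \in s -> measurable (A K).
  move=> Ks; apply: measurable_preimageT; last exact: measurable_simplex_interior.
  apply: measurable_addrV; first exact: measurable_cst.
  by apply: measurable_scalerV; apply: measurable_subrV => //; exact: measurable_cst.
have AE K : K \in s -> mu (A K) = ((h / C) ^+ d)%:E.
  move=> Ks; have KT := sub K Ks; have [ndK hK0 mE _] := sT KT.
  have sc0 : 0 < sc K by exact: lt_le_trans ltr01 (sc1 K Ks).
  have -> : A K = (fun x => x + - z) @^-1` ((fun x => sc K *: x) @^-1` ((fun x => x + z) @^-1` (simplex K)°)).
    by apply/seteqP; split=> x; rewrite /A/preimage/= [z + _]addrC.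
  have mi : measurable ((fun x => x + z) @^-1` (simplex K)°).
    apply: measurable_preimageT; last exact: measurable_simplex_interior.
    by apply: measurable_addrV => //; exact: measurable_cst.
  rewrite lebesgue_rV_shift; last by apply: measurable_preimageT => //; exact: measurable_scalerV.
  rewrite lebesgue_rV_scale ?lt0r_neq0// lebesgue_rV_shift; last exact: measurable_simplex_interior.
  have -> : mu (simplex K)° = mu (simplex K).
    rewrite -[in RHS](setDUK (@interior_subset _ (simplex K))) measureU//.
    - by have N : mu (simplex K `\` (simplex K)°) = 0%E := simplex_interior_conull d0 ndK; rewrite -[LHS]adde0; congr (_ + _)%E.
    - exact: measurable_simplex_interior.
    - by apply: measurableD; [exact: measurable_simplex|exact: measurable_simplex_interior].
    - by rewrite setDE setICA setICr setI0.
  rewrite mE -EFinM gtr0_norm// -exprVn -exprMn; congr (_ ^+ _)%:E.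
  by rewrite /sc; field; rewrite !lt0r_neq0.
have AB K x : K \in s -> A K x -> ball z (2 * h) x.
  move=> Ks Ax; have [Kz _] := hs K Ks; have [_ hK0 _ diam] := sT (sub K Ks).
  have sc0 : 0 < sc K by exact: lt_le_trans ltr01 (sc1 K Ks).
  have := diam _ _ (interior_subset Ax) Kz; rewrite addrC addKr enormZ gtr0_norm// => H.
  have {}H : enorm (x - z) <= h.
    rewrite -(ler_pM2l sc0); apply: le_trans H _; rewrite /sc -[leRHS]mulrA mulVf ?mulr1//.
    exact: lt0r_neq0.
  apply/(rV_ballE _ _ (mulr_gt0 _ h0)) => // j; rewrite distrC.
  have := coord_le_norm (x - z) j; have := norm_le_enorm (x - z); rewrite !mxE; lra.
have tr K K' x : K \in s -> K' \in s -> A K x -> A K' x -> K = K'.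
  have Ai L : L \in s -> A L x -> (simplex L)° x.
    move=> Ls; have ndL := ndT (sub L Ls); rewrite /A/preimage/= => /(simplex_interiorP ndL) hi.
    apply/(simplex_interiorP ndL) => i; have := hi i.
    have [Lz _] := hs L Ls; have zi := iffLR (simplexP ndL z) Lz i.
    have := baryB L (z + sc L *: (x - z)) z i; rewrite [z + _]addrC addrK dotpZr -baryB => E.
    by have := sc1 L Ls => s1 hp; have : 0 < (sc L - 1) * bary L z i + bary L (sc L *: (x - z) + z) i; nra.
  move=> Ks K's AK AK'; apply: (mesh_interior_disjoint cT (sub _ Ks) (sub _ K's) (Ai _ Ks AK)).
  exact: interior_subset (Ai _ K's AK').
have key (s' : seq (tsimplex R d)) : uniq s' -> {subset s' <= s} ->
    measurable (\big[setU/set0]_(K <- s') A K) /\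
    mu (\big[setU/set0]_(K <- s') A K) = ((size s')%:R * (h / C) ^+ d)%:E.
  elim: s' => [_ _|K s' IH /= /andP[Ks' us'] sub']; first by rewrite big_nil measure0 mul0r.
  have Ks : K \in s by apply: sub'; exact: mem_head.
  have [|mU muE] := IH us'; first by move=> L Ls'; apply: sub'; rewrite in_cons Ls' orbT.
  rewrite big_cons; split; first by apply: measurableU => //; exact: mA.
  transitivity (mu (A K) + mu (\big[setU/set0]_(L <- s') A L))%E; last first.
    by rewrite AE// muE -EFinD -[in RHS]natr1 mulrDl mul1r addrC.
  apply: measureU => //; first exact: mA.
  apply/seteqP; split=> // x [AKx]; rewrite -bigcup_seq => -[L /= Ls' ALx].
    move/negP: Ks'; apply; rewrite (tr K L x)//; apply: sub'; by rewrite in_cons Ls' orbT.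
have [|mU muE] := key s us; first by [].
have : (mu (\big[setU/set0]_(K <- s) A K) <= mu (ball z (2 * h)))%E.
  apply: le_measure; rewrite ?inE//; first by apply: measurable_rV_ball; rewrite mulr_gt0.
  by move=> x; rewrite -bigcup_seq => -[K /= Ks /(AB _ _ Ks)].
rewrite muE lebesgue_rV_ball ?mulr_gt0// lee_fin => H.
have hC : 0 < (h / C) ^+ d by rewrite exprn_gt0// divr_gt0.
rewrite -(ler_pM2r hC); apply: le_trans H _; rewrite -exprMn.
have -> : 4 * C * (h / C) = 2 * (2 * h) by field; exact: lt0r_neq0.
exact: lexx.
Qed.

Variable L : R.
Hypothesis L0 : 0 < L.
Hypothesis baryL : forall K, K \in T -> forall i x y, `|bary K x i - bary K y i| <= L / hK K * enorm (x - y).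

(** A barycentric coordinate of [K'] changes by 1 along the common edge, whose length is at most the
    diameter of [K]. *)
Lemma common_edge_size K K' i0 i0' p : K \in T -> K' \in T -> K != K' -> row i0 K.1 = row i0' K'.1 ->
  simplex K p -> simplex K' p -> p != row i0 K.1 -> hK K' <= L * C * hK K.
Proof.
move=> KT K'T KK' zE Kp Kp' pz.
have [j [j' [jE [ji ji']]]] := common_edge KT K'T KK' zE Kp Kp' pz.
have := baryL K'T j' (row j' K'.1) (row i0' K'.1).
rewrite !(bary_vertex (ndT K'T)) eqxx [i0' == j']eq_sym (negbTE ji') subr0 normr1 -jE -zE.
have [_ hK0 _ diam] := sT KT; have [_ hK'0 _ _] := sT K'T.
rewrite mulrAC ler_pdivlMr// mul1r => /le_trans; apply.
rewrite -mulrA ler_wpM2l ?(ltW L0)//; apply: diam; exact: simplex_row.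
Qed.

Lemma star_gap K1 K2 i1 i2 (t : R) : (1 < d)%N -> K1 \in T -> K2 \in T -> row i1 K1.1 = row i2 K2.1 ->
  hK K1 <= t < hK K2 ->
  exists K, [/\ K \in T, simplex K (row i1 K1.1), t < hK K & hK K <= L * C * t].
Proof.
move=> d2 K1T K2T zE /andP[K1t tK2]; set z := row i1 K1.1 in zE *.
apply: contrapT => nK.
pose U (P : pred (tsimplex R d)) := \big[setU/set0]_(K <- [seq K <- T | P K]) simplex K.
have UP P x : U P x <-> exists K, [/\ K \in T, P K & simplex K x].
  rewrite /U -bigcup_seq; split=> [[K /= ]|[K [KT PK Kx]]]; last by exists K => //=; rewrite mem_filter PK.
  by rewrite mem_filter => /andP[PK KT] Kx; exists K.
have cU P : closed (U P).
  by apply: closed_bigsetU => K; rewrite mem_filter => /andP[_ /ndT ndK]; exact: closed_simplex.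
pose low K := `[< simplex K z >] && (hK K <= t).
pose high K := `[< simplex K z >] && (t < hK K).
pose far K := ~~ `[< simplex K z >].
have nz : ~ U far z by move/UP => [K [_ /asboolP]].
have /nbhs_enormP[r r0 hr] : nbhs z (~` U far).
  by apply: open_nbhs_nbhs; split=> //; apply: closed_openC.
have cz : closure Omega z by apply: (mesh_closure cT K1T); exact: simplex_row.
have cover x : closure Omega x -> enorm (x - z) < r -> (U low `|` U high) x.
  move=> /(mesh_cover cT)[K KT Kx] xr.
  have Kz : simplex K z.
    by apply: contrapT => nKz; apply: (hr x xr); apply/UP; exists K; split=> //; apply/asboolP.
  have [ht|ht] := leP (hK K) t; [left|right]; apply/UP; exists K; split=> //; apply/andP; split=> //; exact/asboolP.
have sep : U low `&` U high `<=` [set z].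
  move=> x [/UP[K [KT /andP[/asboolP Kz Kt] Kx]] /UP[K' [K'T /andP[/asboolP K'z tK'] K'x]]].
  apply: contrapT => /= xz; apply: nK; exists K'; split=> //.
  have [a az] := mesh_vertex KT K1T Kz; have [a' az'] := mesh_vertex K'T K1T K'z.
  have KK' : K != K' by apply: contraTneq Kt => ->; rewrite -ltNge.
  apply: le_trans (common_edge_size KT K'T KK' (etrans az (esym az')) Kx K'x _) _; first by rewrite az; apply/eqP.
  by rewrite ler_wpM2l// mulr_ge0 ?(ltW L0)// (le_trans ler01).
have [e e0 he] := closed_split_near_point d2 lipO (cU low) (cU high) r0 cz cover sep.
have near_z K i : K \in T -> row i K.1 = z -> exists x, [/\ (simplex K)° x, x != z & enorm (x - z) < e].
  move=> KT Ez; have : nbhs z [set x | enorm (x - z) < e] by apply/nbhs_enormP; exists e.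
  have Kz : simplex K z by rewrite -Ez; exact: simplex_row.
  move=> /(simplex_interior_dense (ndT KT) Kz)[x Kx xe].
  exists x; split=> //; apply/eqP => xz.
  have := iffLR (simplex_interiorP (ndT KT) x) Kx.
  rewrite xz -Ez; have [j ji] : exists j : 'I_d.+1, j != i.
    have [h|h] := eqVneq i ord0; last by exists ord0; rewrite eq_sym.
    by exists ord_max; rewrite h -val_eqE/= -lt0n.
  by move=> /(_ j); rewrite (bary_vertex (ndT KT)) eq_sym (negbTE ji) ltxx.
have [x [Kx xz xe]] := near_z K1 i1 K1T erefl.
have [y [Ky yz ye]] := near_z K2 i2 K2T (esym zE).
have lx : U low x.
  apply/UP; exists K1; split=> //; last exact: interior_subset.
  by rewrite /low K1t andbT; apply/asboolP; exact: simplex_row.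
have hy : U high y.
  apply/UP; exists K2; split=> //; last exact: interior_subset.
  by rewrite /high tK2 andbT; apply/asboolP; rewrite zE; exact: simplex_row.
have ly : U low y.
  apply: (he x y) => //; [exact: (mesh_interior_sub lipO cT K1T)|exact: (mesh_interior_sub lipO cT K2T)].
by move/eqP: yz; apply; exact: sep.
Qed.

(** For a larger ratio, each of [N] successive bands of sizes, bounded by powers of [L * C], would
    contain a simplex at the vertex: more of them than the packing bound [star_size] allows. *)
Lemma star_comparable K K' i i' (N : nat) : (1 < d)%N -> 1 <= L * C -> (4 * C) ^+ d < N%:R ->
  K \in T -> K' \in T -> row i K.1 = row i' K'.1 -> hK K <= (L * C) ^+ N * hK K'.
Proof.
move=> d2; set M := L * C => M1 hN KT K'T zE.
have [_ h0 _ _] := sT K'T; set h := hK K' in h0 *.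
rewrite leNgt; apply/negP => big.
pose P j := [pred K | [&& `[< simplex K (row i' K'.1) >], h <= hK K & hK K <= M ^+ j * h]].
have Mj j : 1 <= M ^+ j by exact: exprn_ege1.
have uT : uniq T by case: cT.
have key j : (j <= N)%N -> (j < count (P j) T)%N.
  elim: j => [_|j IH jN].
    rewrite -has_count; apply/hasP; exists K' => //=; rewrite expr0 mul1r !lexx !andbT.
    by apply/asboolP; exact: simplex_row.
  have hj : h <= M ^+ j * h <  hK K.
    by rewrite ler_peMl ?(ltW h0)//=; apply: le_lt_trans big; rewrite ler_pM2r// ler_weXn2l// ltnW.
  have [K2 [K2T K2z tK2 K2M]] := star_gap d2 K'T KT (esym zE) hj.
  apply: leq_ltn_trans (IH (ltnW jN)) _.
  have -> : count (P j.+1) T = (count (predI (P j) (P j.+1)) T + count (predI (predC (P j)) (P j.+1)) T)%N.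
    by have := count_predC (P j) [seq K <- T | P j.+1 K]; rewrite !count_filter size_filter => <-.
  have -> : count (predI (P j) (P j.+1)) T = count (P j) T.
    apply: eq_count => J; apply/andP/idP => [[]//|h1]; split=> //.
    case/and3P: h1 => a1 a2 h1; apply/and3P; split=> //.
    by apply: le_trans h1 _; rewrite ler_pM2r// ler_weXn2l.
  rewrite -[X in (X < _)%N]addn0 ltn_add2l -has_count; apply/hasP; exists K2 => //=.
  have -> : `[< simplex K2 (row i' K'.1) >] by apply/asboolP.
  have -> /= : h <= hK K2.
    by apply: le_trans (ltW tK2); case/andP: hj.
  by rewrite -ltNge tK2 exprS -mulrA.
have := key N (leqnn N); rewrite -size_filter => big2.
have : (size [seq K <- T | P N K])%:R <= (4 * C) ^+ d.
  apply: (star_size (z := row i' K'.1) h0) => [|J|J]; first by rewrite filter_uniq.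
    by rewrite mem_filter => /andP[].
  by rewrite mem_filter => /andP[/and3P[/asboolP Jz hJ _] _].
by move=> /le_lt_trans/(_ hN); rewrite ltr_nat ltnNge (ltnW big2).
Qed.

End star.

(** * Quasi-interpolation from vertex averages *)

Section local_average.
Context {R : realType} {d : nat} (alpha : R).
Hypothesis alpha0 : 0 < alpha.
Local Notation mu := (@lebesgue_rV R d).
Implicit Types (A K : set 'rV[R]_d) (w : 'rV[R]_d -> R).

(** One variable runs over [K], the other over the whole space. As elements overlap in null sets
    only, these local terms add up to at most the global seminorm, although the averages behind the
    estimates are taken outside [K]. *)
Definition seminorm_from K w := (\int[mu]_(x in K) \int[mu]_y ((w x - w y) ^+ 2 / frac_kernel alpha x y)%:E)%E.

Lemma measurable_pair_increment w : measurable_fun setT w ->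
  measurable_fun setT (fun p : 'rV[R]_d * 'rV[R]_d => (w p.1 - w p.2) ^+ 2 / frac_kernel alpha p.1 p.2).
Proof.
move=> mw; apply: (measurable_div_kernel alpha); apply: measurable_funX.
by apply: measurable_funB; [exact: (measurableT_comp mw measurable_fst)|exact: (measurableT_comp mw measurable_snd)].
Qed.

Lemma measurable_slice_increment x w : measurable_fun setT w ->
  measurable_fun setT (fun y => (w x - w y) ^+ 2 / frac_kernel alpha x y).
Proof. by move=> mw; exact: (measurableT_comp (measurable_pair_increment mw) (pair1_measurable x)). Qed.

Lemma pair_increment_ge0 w x y : 0 <= (w x - w y) ^+ 2 / frac_kernel alpha x y.
Proof. by rewrite divr_ge0 ?sqr_ge0// frac_kernel_ge0. Qed.

Lemma slice_increment_ge0 w x : (0 <= \int[mu]_y ((w x - w y) ^+ 2 / frac_kernel alpha x y)%:E)%E.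
Proof. by apply: integral_ge0 => y _; rewrite lee_fin pair_increment_ge0. Qed.

Lemma seminorm_from_ge0 K w : (0 <= seminorm_from K w)%E.
Proof. by apply: integral_ge0 => x _; exact: slice_increment_ge0. Qed.

(** Write the difference as the mean of [w x - w y] and use Cauchy-Schwarz; for [x] in [K] and [y]
    in [A] the reciprocal kernel is at least [rho] to the power -(d + alpha). The set [A] may lie
    outside [K]. *)
Lemma local_average_le K A w (m rho : R) : measurable K -> measurable A -> 0 < m -> mu A = m%:E -> 0 <= rho ->
  L2 setT w -> (forall x y, K x -> A y -> enorm (x - y) <= rho) ->
  (\int[mu]_(x in K) ((w x - m^-1 * \int[mu]_(y in A) w y) ^+ 2)%:E <=
   (rho `^ (d%:R + alpha) / m)%:E * seminorm_from K w)%E.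
Proof.
move=> mK mA m0 mE rho0 Lw rhoP; have mw : measurable_fun setT w by case: Lw.
have LA : sqint mu A w by apply: (@L2_subset R d A setT).
have L1 : sqint mu A (fun=> 1).
  split; first exact: measurable_cst.
  by rewrite integral_cst// (_ : _ A = m%:E) ?ltry// -EFinM ltry.
have cst (c : R) : sqint mu A (fun=> c).
  by rewrite (_ : (fun=> c) = (fun x => c * 1)); [exact: sqintZ|apply/funext => x; rewrite mulr1].
rewrite /seminorm_from -ge0_integralZl//; last first.
- by rewrite lee_fin divr_ge0 ?powR_ge0// ltW.
- by move=> x _; exact: slice_increment_ge0.
- apply: measurable_funTS; apply: (measurable_integral_snd (h := fun x y => (w x - w y) ^+ 2 / frac_kernel alpha x y)).
    exact: measurable_pair_increment.
  by move=> x y; exact: pair_increment_ge0.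
apply: nonneg_le_integral => //.
- by move=> x _; rewrite lee_fin sqr_ge0.
move=> x Kx.
have Lx : sqint mu A (fun y => w x - w y) by apply: sqintB.
have E : w x - m^-1 * \int[mu]_(y in A) w y = m^-1 * ip mu A (fun y => w x - w y) (fun=> 1).
  rewrite (ipBl mA (cst (w x)) LA L1) mulrBr; congr (_ - _ * _).
    rewrite /ip; under eq_Rintegral do rewrite mulr1.
    by rewrite Rintegral_cst// (_ : _ A = m%:E)//= mulrCA mulVf ?mulr1// lt0r_neq0.
  by rewrite /ip; under [RHS]eq_Rintegral do rewrite mulr1.
have CS := ip_CS mA Lx L1.
have i1 : ip mu A (fun=> 1) (fun=> 1) = m.
  by rewrite /ip; under eq_Rintegral do rewrite mulr1; rewrite Rintegral_cst// (_ : _ A = m%:E)//= mul1r.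
rewrite i1 in CS.
have h1 : (w x - m^-1 * \int[mu]_(y in A) w y) ^+ 2 <= m^-1 * ip mu A (fun y => w x - w y) (fun y => w x - w y).
  rewrite E exprMn; apply: le_trans (ler_wpM2l (sqr_ge0 _) CS) _.
  rewrite mulrCA mulrA expr2 mulrAC -mulrA [m * _]mulrC -mulrA mulVf ?lt0r_neq0// mulr1 mulrC.
  exact: lexx.
apply: le_trans (_ : (m^-1 * ip mu A (fun y => w x - w y) (fun y => w x - w y))%:E <= _)%E; first by rewrite lee_fin.
rewrite EFinM (EFin_ip Lx) [_ `^ _ / _]mulrC EFinM -muleA.
rewrite lee_pmul2l//; last by rewrite lte_fin invr_gt0.
rewrite -ge0_integralZl//; last first.
- by rewrite lee_fin powR_ge0.
- by move=> y _; rewrite lee_fin pair_increment_ge0.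
- by apply/measurable_EFinP; exact: (measurable_slice_increment x mw).
apply: (@le_trans _ _ (\int[mu]_(y in A) ((rho `^ (d%:R + alpha))%:E * ((w x - w y) ^+ 2 / frac_kernel alpha x y)%:E))%E).
  apply: nonneg_le_integral => //.
  - by move=> y _; rewrite lee_fin sqr_ge0.
  move=> y Ay; rewrite -EFinM lee_fin.
  have [->|xy] := eqVneq x y; first by rewrite subrr expr0n /= mul0r mulr0.
  have e0 : 0 < enorm (x - y) by rewrite enorm_gt0// subr_eq0.
  have k0 : 0 < frac_kernel alpha x y by rewrite powR_gt0.
  rewrite mulrCA ler_peMr ?sqr_ge0// ler_pdivlMr// mul1r.
  by rewrite ge0_ler_powR// ?nnegrE ?enorm_ge0 ?addr_ge0 ?(ltW alpha0)//; exact: rhoP.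
apply: ge0_subset_integral => //.
- apply: measurable_funeM; apply/measurable_EFinP.
  exact: (measurable_slice_increment x mw).
- by move=> y _; rewrite -EFinM lee_fin mulr_ge0 ?powR_ge0// pair_increment_ge0.
Qed.

End local_average.

Section quasi_interpolation.
Context {R : realType} {d : nat} (alpha : R) (Omega : set 'rV[R]_d).
Hypothesis alpha0 : 0 < alpha.
Hypothesis lipO : bounded_lipschitz_domain Omega.
Hypothesis d0 : (0 < d)%N.
Local Notation mu := (@lebesgue_rV R d).

(** Dividing by [H] turns an element size into a radius at most 1, the range in which
    [exterior_balls] is stated. *)
Lemma mesh_size_bound : exists2 H : R, 1 <= H & forall (T : mesh R d) (C : R) K, conforming_mesh Omega T -> K \in T ->
  shape_bounded C K -> hK K <= H.
Proof.
have [B B0 hB] := bounded_set_closure_norm (let: And5 _ _ _ b _ := lipO in b).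
exists (2 * (B + 1) + 1); first by lra.
move=> T C K cT KT [ndK h0 mE _].
apply: (@le_trans _ _ (2 * (B + 1))); last by lra.
have : (mu (simplex K) <= mu (ball (0%R : 'rV[R]_d) (B + 1)%R))%E.
  apply: le_measure; rewrite ?inE; [exact: measurable_simplex|by apply: measurable_rV_ball; lra|].
  move=> x Kx; have := hB x (mesh_closure cT KT Kx) => xB.
  by rewrite -ball_normE /= sub0r normrN; lra.
rewrite lebesgue_rV_ball; last by lra.
by rewrite mE lee_fin ler_pXn2r ?nnegrE//; [exact: ltW|lra].
Qed.

Variables (C M : R).
Hypothesis C1 : 1 <= C.
Hypothesis M1 : 1 <= M.

(** The value is the mean over one simplex of the star, unless some element of the star has a point
    outside [Omega] with nonzero weight at the vertex. Then the value must be 0, which is also the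
    mean of [w] over an exterior ball of size comparable to the element, so the same estimate
    applies. *)
Lemma vertex_average : exists2 Cq : R, 0 < Cq & forall T : mesh R d, conforming_mesh Omega T ->
  (forall K, K \in T -> shape_bounded C K) ->
  (forall K K' i i', K \in T -> K' \in T -> row i K.1 = row i' K'.1 -> hK K <= M * hK K') ->
  forall w, L2 setT w -> {ae mu, forall x, ~ closure Omega x -> w x = 0} ->
  forall K0 i0, K0 \in T -> exists W : R,
    (forall K i x, K \in T -> row i K.1 = row i0 K0.1 -> simplex K x -> ~ Omega x -> bary K x i != 0 -> W = 0) /\
    forall K i, K \in T -> row i K.1 = row i0 K0.1 ->
      (\int[mu]_(x in simplex K) ((w x - W) ^+ 2)%:E <= (Cq * hK K `^ alpha)%:E * seminorm_from alpha (simplex K) w)%E.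
Proof.
have [H H1 hH] := mesh_size_bound.
have [e e0 he] := exterior_balls lipO.
have H0 : 0 < H by exact: lt_le_trans ltr01 H1.
have C0 : 0 < C by exact: lt_le_trans ltr01 C1.
have M0 : 0 < M by exact: lt_le_trans ltr01 M1.
have D0 : 0 < d%:R + 1 :> R by rewrite ltr_wpDl.
(* Relative to the element size, [Q] bounds the distance to the points of the averaging set and 1 /
   P the d-th root of its volume from below, for both kinds of averaging set. *)
pose Q := C + C * M + M * (1 + e); pose P := M * (1 + H * (d%:R + 1) / (2 * e)).
have Q0 : 0 < Q by rewrite /Q !addr_gt0// !mulr_gt0// addr_gt0.
have b0 : 0 < H * (d%:R + 1) / (2 * e) by rewrite divr_gt0// !mulr_gt0.
have P0 : 0 < P by rewrite mulr_gt0// addr_gt0.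
exists (Q `^ (d%:R + alpha) * P ^+ d); first by rewrite mulr_gt0 ?powR_gt0 ?exprn_gt0.
move=> T cT sT comp w Lw w0 K0 i0 K0T.
have mw : measurable_fun setT w by case: Lw.
have main A m K : measurable A -> mu A = m%:E -> 0 < m -> K \in T -> (hK K / P) ^+ d <= m ->
    (forall x y, simplex K x -> A y -> enorm (x - y) <= Q * hK K) ->
    (\int[mu]_(x in simplex K) ((w x - m^-1 * \int[mu]_(y in A) w y) ^+ 2)%:E <=
      (Q `^ (d%:R + alpha) * P ^+ d * hK K `^ alpha)%:E * seminorm_from alpha (simplex K) w)%E.
  move=> mA mE m0 KT hm rhoP; have [ndK h0 _ _] := sT K KT.
  have rho0 : 0 <= Q * hK K by rewrite mulr_ge0 ?ltW.
  apply: le_trans (local_average_le alpha0 (measurable_simplex ndK) mA m0 mE rho0 Lw rhoP) _.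
  apply: lee_wpmul2r.
    exact: seminorm_from_ge0.
  rewrite lee_fin ler_pdivrMr// powRM ?(ltW Q0) ?(ltW h0)// -!mulrA ler_wpM2l ?powR_ge0//.
  rewrite powRD; last by rewrite (lt0r_neq0 h0) implybT.
  rewrite powR_mulrn ?(ltW h0)// [leRHS]mulrCA mulrC ler_wpM2l ?powR_ge0//.
  by rewrite -ler_pdivrMl ?exprn_gt0// mulrC -expr_div_n.
have [[K1 [i1 [x1 [K1T zE K1x1 nO b1]]]]|good] := pselect (exists K i x,
    [/\ K \in T, row i K.1 = row i0 K0.1, simplex K x, ~ Omega x & bary K x i != 0]); last first.
  have [ndK0 h0 mE diam0] := sT K0 K0T.
  exists ((hK K0 ^+ d)^-1 * \int[mu]_(y in simplex K0) w y); split.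
    by move=> K i x KT zE Kx nO b; exfalso; apply: good; exists K, i, x.
  move=> K i KT zE; have [ndK hK0 _ diam] := sT K KT.
  have c1 := comp _ _ _ _ KT K0T zE; have c2 := comp _ _ _ _ K0T KT (esym zE).
  apply: (main (simplex K0) _ K (measurable_simplex ndK0) mE (exprn_gt0 _ h0) KT).
  - rewrite ler_pXn2r ?nnegrE ?divr_ge0 ?(ltW P0) ?(ltW hK0) ?(ltW h0)// ler_pdivrMr//.
    apply: (le_trans c1); rewrite mulrC ler_wpM2l ?(ltW h0)// /P ler_peMr ?(ltW M0)//; lra.
  - move=> x y Kx K0y; have := enorm_triangle x (row i0 K0.1) y.
    have := diam x _ Kx (simplex_row K i); rewrite zE.
    have := diam0 _ y (simplex_row K0 i0) K0y.
    have : C * hK K0 <= C * (M * hK K) by rewrite ler_wpM2l ?(ltW C0).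
    have : 0 <= M * (1 + e) * hK K by rewrite !mulr_ge0 ?(ltW M0) ?(ltW hK0)// addr_ge0// ltW.
    by rewrite /Q; clear; lra.
have [ndK1 h1 _ diam1] := sT K1 K1T.
pose r := hK K1 / H.
have r0 : 0 < r by rewrite divr_gt0.
have r1 : r <= 1 by rewrite ler_pdivrMr// mul1r; exact: hH cT K1T (sT K1 K1T).
have bx : boundary Omega x1 by apply/(boundaryP lipO); split=> //; apply: (mesh_closure cT K1T).
have [|y yx yO] := he x1 r bx; first by rewrite r0.
pose t := e * r / (d%:R + 1); have t0 : 0 < t by rewrite divr_gt0// mulr_gt0.
pose A := ball y t.
have mA : measurable A by exact: measurable_rV_ball.
have m0 : 0 < (2 * t) ^+ d by rewrite exprn_gt0// mulr_gt0.
have Ay u : A u -> enorm (u - y) <= e * r.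
  move=> Au; apply: le_trans (enorm_le_norm _) _.
  rewrite mulrC -ler_pdivlMr//; apply: ltW; move: Au; by rewrite /A -ball_normE /= distrC.
have Iw : \int[mu]_(u in A) w u = 0.
  rewrite /Rintegral (_ : integral _ _ _ = 0%E)//.
  rewrite (ae_eq_integral (cst 0%E)) ?integral0//; last first.
    by apply: filterS w0 => u hu Au; rewrite hu//; apply: yO; exact: Ay.
  by apply: measurable_funTS; apply/measurable_EFinP.
exists 0; split=> // K i KT zE'; have [ndK hK0 _ diam] := sT K KT.
have c1 := comp _ _ _ _ KT K1T (etrans zE' (esym zE)); have c2 := comp _ _ _ _ K1T KT (etrans zE (esym zE')).
have := main A ((2 * t) ^+ d) K mA (lebesgue_rV_ball _ t0) m0 KT; rewrite Iw mulr0; apply.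
- have tP : 2 * t * (H * (d%:R + 1) / (2 * e)) = hK K1.
    by rewrite /t /r; field; rewrite !lt0r_neq0.
  have tle : hK K / P <= 2 * t.
    rewrite ler_pdivrMr//; apply: (le_trans c1); rewrite /P mulrCA ler_wpM2l ?(ltW M0)//.
    by rewrite mulrDr mulr1 tP lerDr mulr_ge0// ltW.
  have u0 : 0 <= hK K / P by exact: ltW (divr_gt0 hK0 P0).
  have v0 : 0 <= 2 * t by rewrite mulr_ge0// ltW.
  by apply: lerXn2r; rewrite ?nnegrE.
- move=> x u Kx Au.
  have a1 := enorm_triangle x (row i K.1) u; have a2 := enorm_triangle (row i K.1) x1 u; have a3 := enorm_triangle x1 y u.
  have a4 := diam x _ Kx (simplex_row K i); have a5 := diam1 _ x1 (simplex_row K1 i1) K1x1.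
  rewrite zE -zE' in a5.
  have a6 := Ay u Au; rewrite enormB in a6; rewrite enormB in yx.
  have rh : r <= M * hK K.
    apply: le_trans c2; rewrite /r ler_pdivrMr// ler_peMr// ltW//.
  have : C * hK K1 <= C * (M * hK K) by rewrite ler_wpM2l ?(ltW C0).
  have : e * r <= e * (M * hK K) by rewrite ler_wpM2l// ltW.
  by move: a1 a2 a3 a4 a5 a6 yx rh; rewrite /Q; clear; lra.
Qed.

Section interpolant.
Variable T : mesh R d.
Hypothesis cT : conforming_mesh Omega T.
Variable W : 'rV[R]_d -> R.
Hypothesis W0 : forall K i x, K \in T -> simplex K x -> ~ Omega x -> bary K x i != 0 -> W (row i K.1) = 0.

Let ndT K : K \in T -> nondegenerate_simplex K.
Proof. by case: cT => _ h _ _ _ /h[]. Qed.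

Let nodal K x := \sum_i bary K x i * W (row i K.1).

(** On the common face only common vertices carry weight, so both nodal sums reduce to the same
    sum. *)
Let nodal_consistent K K' x : K \in T -> K' \in T -> simplex K x -> simplex K' x -> nodal K x = nodal K' x.
Proof.
move=> KT K'T Kx K'x; have [->//|KK'] := eqVneq K K'.
have [_ _ _ _ /(_ K K' KT K'T KK') h] := cT.
have : face K [set i | [exists j, row i K.1 == row j K'.1]]%SET x by rewrite -h.
move/(faceP (ndT KT)) => hx.
have common k : bary K x k != 0 -> exists j, row k K.1 = row j K'.1.
  move=> tk; have : k \in [set i | [exists j, row i K.1 == row j K'.1]]%SET.
    by apply: contraT => hk; case: (hx k) => _ /(_ hk) /eqP; rewrite (negbTE tk).
  by rewrite inE => /existsP[j /eqP E]; exists j.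
rewrite /nodal; have K'j j : bary K' x j = \sum_i bary K x i * bary K' (row i K.1) j.
  by rewrite -(bary_comb_sum _ _ (ndT K'T) (bary_sum (ndT KT) x)) (bary_comb (ndT KT)).
under [RHS]eq_bigr do rewrite K'j mulr_suml.
rewrite exchange_big/=; apply: eq_bigr => k _.
have [->|/common[j kj]] := eqVneq (bary K x k) 0.
  by rewrite mul0r big1// => j _; rewrite !mul0r.
rewrite (bigD1 j)//= kj (bary_vertex (ndT K'T)) eqxx mulr1 big1 ?addr0// => j' jj'.
by rewrite (bary_vertex (ndT K'T)) eq_sym (negbTE jj') mulr0 mul0r.
Qed.

(** The condition on [W] makes the nodal sums vanish at points outside [Omega], which is what
    [P1_VT] requires besides affinity on the elements. *)
Lemma interpolant : exists2 chi, VT Omega T chi & forall K x, K \in T -> simplex K x ->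
  chi x = \sum_i bary K x i * W (row i K.1).
Proof.
pose Kof x := xget (0, 0%N) [set K : tsimplex R d | K \in T /\ simplex K x].
pose chi x := if `[< closure Omega x >] then nodal (Kof x) x else 0.
have chiE K x : K \in T -> simplex K x -> chi x = nodal K x.
  move=> KT Kx; rewrite /chi asboolT; last exact: mesh_closure cT _ _ KT Kx.
  have [|K'T K'x] := @xgetPex _ (0, 0%N) [set K : tsimplex R d | K \in T /\ simplex K x]; first by exists K.
  exact: nodal_consistent.
exists chi => //; apply: (P1_VT lipO d0 cT) => [x nO|K KT].
  have [cx|ncx] := pselect (closure Omega x); last by rewrite /chi asboolF.
  have [K KT Kx] := mesh_cover cT cx; rewrite (chiE K)// /nodal big1// => i _.
  have [->|bi] := eqVneq (bary K x i) 0; first by rewrite mul0r.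
  by rewrite (W0 KT Kx nO bi) mulr0.
exists (\sum_i bary K 0 i * W (row i K.1)), (\sum_i W (row i K.1) *: bgrad K i) => x Kx.
rewrite (chiE K)// dotpC (big_morph (dotp x) (fun a b => dotpDr a b _) (dotp0r _)) -big_split/=.
by apply: eq_bigr => i _; rewrite (bary_dotp K) mulrDl dotpZr dotpC [W _ * _]mulrC.
Qed.

End interpolant.

Lemma convex_sqr_le (n : nat) (t a : 'I_n -> R) : (forall i, 0 <= t i) -> (forall i, t i <= 1) -> \sum_i t i = 1 ->
  (\sum_i t i * a i) ^+ 2 <= \sum_i a i ^+ 2.
Proof.
move=> t0 t1 ts; set m := \sum_i t i * a i.
have h : 0 <= \sum_i t i * (a i - m) ^+ 2 by apply: sumr_ge0 => i _; rewrite mulr_ge0 ?sqr_ge0.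
have E : \sum_i t i * (a i - m) ^+ 2 = \sum_i t i * a i ^+ 2 - m ^+ 2.
  have -> : \sum_i t i * (a i - m) ^+ 2 = \sum_i (t i * a i ^+ 2 + (- (2 * m)) * (t i * a i) + m ^+ 2 * t i).
    by apply: eq_bigr => i _; ring.
  by rewrite !big_split/= -!mulr_sumr ts -/m; ring.
rewrite E subr_ge0 in h; apply: (le_trans h); apply: ler_sum => i _.
by rewrite ler_piMl ?sqr_ge0.
Qed.

Lemma quasi_interpolation : exists2 Cq : R, 0 < Cq & forall T : mesh R d, conforming_mesh Omega T ->
  (forall K, K \in T -> shape_bounded C K) ->
  (forall K K' i i', K \in T -> K' \in T -> row i K.1 = row i' K'.1 -> hK K <= M * hK K') ->
  forall w, L2 setT w -> {ae mu, forall x, ~ closure Omega x -> w x = 0} ->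
  exists2 chi, VT Omega T chi & exists W : 'rV[R]_d -> R, forall K, K \in T ->
    (forall x, simplex K x -> (w x - chi x) ^+ 2 <= \sum_i (w x - W (row i K.1)) ^+ 2) /\
    forall i, (\int[mu]_(x in simplex K) ((w x - W (row i K.1)) ^+ 2)%:E <=
      (Cq * hK K `^ alpha)%:E * seminorm_from alpha (simplex K) w)%E.
Proof.
have [Cq Cq0 hq] := vertex_average; exists Cq => // T cT sT comp w Lw w0.
pose good z W := (forall K i x, K \in T -> row i K.1 = z -> simplex K x -> ~ Omega x -> bary K x i != 0 -> W = 0) /\
    forall K i, K \in T -> row i K.1 = z ->
      (\int[mu]_(x in simplex K) ((w x - W) ^+ 2)%:E <= (Cq * hK K `^ alpha)%:E * seminorm_from alpha (simplex K) w)%E.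
have /choice[W hW] : forall z, exists W, (exists K i, K \in T /\ row i K.1 = z) -> good z W.
  move=> z; have [[K0 [i0 [K0T <-]]]|n] := pselect (exists K i, K \in T /\ row i K.1 = z).
    by have [W HW] := hq T cT sT comp w Lw w0 K0 i0 K0T; exists W.
  by exists 0.
have {hW}gW K i : K \in T -> good (row i K.1) (W (row i K.1)) by move=> KT; apply: hW; exists K, i.
have [|chi Vchi hchi] := @interpolant T cT W.
  by move=> K i x KT Kx nO; have [h _] := gW K i KT; exact: h.
exists chi => //; exists W => K KT; have [ndK _ _ _] := sT K KT; split=> [x Kx|i]; last first.
  by have [_ h] := gW K i KT; exact: (h K i).
rewrite (hchi K)//; have -> : w x - \sum_i bary K x i * W (row i K.1) = \sum_i bary K x i * (w x - W (row i K.1)).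
  under [RHS]eq_bigr do rewrite mulrBr.
  by rewrite sumrB -mulr_suml bary_sum// mul1r.
have t0 := iffLR (simplexP ndK x) Kx.
by apply: convex_sqr_le => [i|i|]; [exact: t0|exact: bary_le1|exact: bary_sum].
Qed.

End quasi_interpolation.

(** * Hardy inequality at the faces of a simplex *)

Section hardy_step.
Context {R : realType} {d : nat} (alpha : R).
Hypothesis d0 : (0 < d)%N.
Hypothesis alpha0 : 0 < alpha.
Local Notation mu := (@lebesgue_rV R d).

Lemma ge0_integral_affine (a : R) (v : 'rV[R]_d) (f : 'rV[R]_d -> \bar R) : a != 0 -> measurable_fun setT f ->
  (forall x, 0 <= f x)%E -> (\int[mu]_x f (a *: x + v)%R = (`|a| ^- d)%:E * \int[mu]_x f x)%E.
Proof.
move=> a0 mf f0; rewrite -(ge0_integral_shift v mf f0).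
rewrite -(ge0_integral_scale a0)//.
by apply: (measurableT_comp mf); apply: measurable_addrV => //; exact: measurable_cst.
Qed.

Variables (C : R) (K : tsimplex R d).
Hypothesis C0 : 0 < C.
Hypothesis sK : shape_bounded C K.
Local Notation h := (hK K).

Let ndK : nondegenerate_simplex K. Proof. by case: sK. Qed.
Let h0 : 0 < h. Proof. by case: sK. Qed.
Let mK : measurable (simplex K). Proof. exact: measurable_simplex. Qed.

Definition layer i (t : R) := simplex K `&` [set x | bary K x i <= t].

Lemma measurable_layer i t : measurable (layer i t).
Proof.
apply: measurableI => //; rewrite (_ : mkset _ = (fun x => bary K x i) @^-1` `]-oo, t]); last first.
  by apply/seteqP; split=> x; rewrite /preimage/= in_itv.
by apply: measurable_preimageT => //; exact: measurable_bary.
Qed.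

Lemma slab_measure i (a b : R) A : a < b -> measurable A -> A `<=` simplex K -> (forall x, A x -> a <= bary K x i <= b) ->
  (mu A <= ((6 * C) ^+ d * (4 * d%:R) * (b - a) * h ^+ d)%:E)%E.
Proof.
move=> ab mA AK hA; have [_ _ _ diam] := sK.
have [j hj] := bgrad_ge d0 ndK (D := C * h) i diam.
have D0 : 0 < C * h by rewrite mulr_gt0.
have gj : bgrad K i 0 j != 0.
  by apply: contraTneq hj => ->; rewrite normr0 mulr0 -ltNge.
have := @layer_measure R d A (row ord0 K.1) (bgrad K i) (a - bary K 0 i) (b - bary K 0 i) (C * h) j mA D0.
have -> : b - bary K 0 i - (a - bary K 0 i) = b - a by ring.
move=> H; apply: le_trans (H _ gj _ _) _; first by rewrite ltrD2r.
- by move=> x Ax; apply: diam; [exact: AK|exact: simplex_row].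
- by move=> x Ax; have := hA x Ax; rewrite (bary_dotp K x); lra.
have gj0 : 0 < `|bgrad K i 0 j| by rewrite normr_gt0.
rewrite lee_fin (_ : 6 * (C * h) = 6 * C * h); last by ring.
rewrite [(6 * C * h) ^+ d]exprMn.
have -> : (6 * C) ^+ d * (4 * d%:R) * (b - a) * h ^+ d = (6 * C) ^+ d * h ^+ d * (4 * (b - a) * d%:R) by ring.
rewrite ler_wpM2l ?mulr_ge0 ?exprn_ge0 ?mulr_ge0 ?(ltW C0) ?(ltW h0)//.
rewrite ler_wpM2l ?mulr_ge0 ?subr_ge0 ?(ltW ab)//.
by rewrite -[_^-1]mul1r ler_pdivrMr ?mulr_gt0// [_ * (C * h)]mulrC mulrA.
Qed.

Variable g : 'rV[R]_d -> R.
Hypothesis mg : measurable_fun setT g.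

Let B i t := (\int[mu]_(x in layer i t) ((g x) ^+ 2)%:E)%E.

Lemma indic_mul_integral (A : set 'rV[R]_d) (f : 'rV[R]_d -> R) : measurable A ->
  (\int[mu]_(x in A) (f x)%:E = \int[mu]_x (\1_A x * f x)%:E)%E.
Proof.
move=> mA; rewrite integral_mkcond; apply: eq_integral => x _; rewrite patchE indicE.
by case: ifP => _; rewrite ?mul1r ?mul0r.
Qed.

Let mu_indic (A : set 'rV[R]_d) : measurable A -> (mu A = \int[mu]_x (\1_A x)%:E)%E.
Proof. by move=> mA; rewrite integral_indic// setIT. Qed.

Let ind_ge0 (A : set 'rV[R]_d) x : 0 <= \1_A x :> R.
Proof. by rewrite indicE. Qed.

Let pos1 (A : set 'rV[R]_d) x (z : R) : 0 <= \1_A x * z ^+ 2.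
Proof. exact: mulr_ge0 (ind_ge0 _ _) (sqr_ge0 _). Qed.

Let pos2 (A A' : set 'rV[R]_d) x y (z : R) : 0 <= \1_A x * (\1_A' y * z ^+ 2).
Proof. exact: mulr_ge0 (ind_ge0 _ _) (pos1 _ _ _). Qed.

Local Notation moved i t s x p := (\1_(layer i t) x * (\1_(simplex K) p * (g ((1 - s) *: x + s *: p)) ^+ 2)).
Local Notation jump i t s x p := (\1_(layer i t) x * (\1_(simplex K) p * (g x - g ((1 - s) *: x + s *: p)) ^+ 2)).

Let mcomb (a b : R) : measurable_fun setT (fun p : 'rV[R]_d * 'rV[R]_d => a *: p.1 + b *: p.2).
Proof. by apply: measurable_addrV; apply: measurable_scalerV; [exact: measurable_fst|exact: measurable_snd]. Qed.

Let mcombC (a b : R) : measurable_fun setT (fun p : 'rV[R]_d * 'rV[R]_d => a *: p.2 + b *: p.1).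
Proof. by apply: measurable_addrV; apply: measurable_scalerV; [exact: measurable_snd|exact: measurable_fst]. Qed.

Let mind (A : set 'rV[R]_d) dd (T : measurableType dd) (f : T -> 'rV[R]_d) : measurable A -> measurable_fun setT f ->
  measurable_fun setT (fun x => \1_A (f x) : R).
Proof. by move=> mA mf; apply: (measurableT_comp _ mf); exact: measurable_indic. Qed.

(** Substitute y = (1 - s) x + s p for [x]. Then y lies in the layer of height [t + s], and 2^d
    bounds the Jacobian (1 - s)^(-d). *)
Let averages_le i (t s : R) : 0 < t -> 0 < s <= 2^-1 ->
  (\int[mu]_x \int[mu]_p (moved i t s x p)%:E <=
   (2 ^+ d * ((6 * C) ^+ d * (4 * d%:R) * (t / s) * h ^+ d))%:E * B i (t + s))%E.
Proof.
move=> t0 /andP[s0 s1]; have mL := measurable_layer i.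
have r0 : 0 < 1 - s by lra.
rewrite (ge0_fubini_indic (h := fun x p => moved i t s x p)); first last.
- by move=> x y; exact: pos2.
- apply: measurable_funM; first by apply: mind => //; exact: measurable_fst.
  apply: measurable_funM; first by apply: mind => //; exact: measurable_snd.
  by apply: measurable_funX; apply: (measurableT_comp mg); exact: mcomb.
pose F p y := \1_(layer i t) ((1 - s)^-1 *: y + (- (s / (1 - s))) *: p) * (\1_(simplex K) p * (g y) ^+ 2) : R.
have mF2 : measurable_fun setT (fun z : 'rV[R]_d * 'rV[R]_d => F z.2 z.1).
  apply: measurable_funM; first by apply: mind => //; exact: mcomb.
  apply: measurable_funM; first by apply: mind => //; exact: measurable_snd.
  by apply: measurable_funX; apply: (measurableT_comp mg); exact: measurable_fst.
have mF1 : measurable_fun setT (fun z : 'rV[R]_d * 'rV[R]_d => F z.1 z.2).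
  apply: measurable_funM; first by apply: mind => //; exact: mcombC.
  apply: measurable_funM; first by apply: mind => //; exact: measurable_fst.
  by apply: measurable_funX; apply: (measurableT_comp mg); exact: measurable_snd.
have F0 p y : 0 <= F p y by exact: pos2.
have E p : (\int[mu]_x (moved i t s x p)%:E =
    (`|1 - s| ^- d)%:E * \int[mu]_y (F p y)%:E)%E.
  rewrite -(ge0_integral_affine (s *: p) (lt0r_neq0 r0)); last 2 first.
  - by apply/measurable_EFinP; exact: (measurableT_comp mF2 (pair2_measurable p)).
  - by move=> y; rewrite lee_fin.
  apply: eq_integral => x _; rewrite /F; congr ((\1_(layer i t) _ * _)%:E).
  by rewrite scalerDr !scalerA mulVf ?lt0r_neq0// scale1r -addrA -scalerDl [(1 - s)^-1 * s]mulrC subrr scale0r addr0.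
under eq_integral do rewrite E.
rewrite ge0_integralZl//; last 2 first.
- exact: measurable_integral_snd mF1 F0.
- by move=> p _; apply: integral_ge0 => y _; rewrite lee_fin.
rewrite (ge0_fubini_indic mF1 F0).
set G := (6 * C) ^+ d * (4 * d%:R) * (t / s) * h ^+ d.
have G0 : 0 <= G by rewrite !mulr_ge0 ?exprn_ge0 ?invr_ge0 ?mulr_ge0// ltW.
have inner y : (\int[mu]_p (F p y)%:E <= (\1_(layer i (t + s)) y * g y ^+ 2 * G)%:E)%E.
  pose A := simplex K `&` [set p | layer i t ((1 - s)^-1 *: y + (- (s / (1 - s))) *: p)].
  have mA : measurable A.
    apply: measurableI => //.
    rewrite (_ : mkset _ = (fun p => (1 - s)^-1 *: y + (- (s / (1 - s))) *: p) @^-1` layer i t)//.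
    apply: measurable_preimageT => //; apply: measurable_addrV; first exact: measurable_cst.
    exact: measurable_scalerV.
  have -> : (\int[mu]_p (F p y)%:E = (g y ^+ 2)%:E * mu A)%E.
    rewrite mu_indic// -ge0_integralZl//; first last.
    - by rewrite lee_fin sqr_ge0.
    - by apply/measurable_EFinP; exact: measurable_indic.
    apply: eq_integral => p _; rewrite -EFinM; congr EFin; rewrite /F mulrA mulrC; congr (_ * _).
    by rewrite /A indicI /= mulrC.
  have yK p : A p -> layer i (t + s) y /\ (bary K y i - t) / s <= bary K p i <= (bary K y i - t) / s + t / s.
    move=> [Kp [Kx xt]]; set x := _ + _ in Kx xt.
    have yE : y = (1 - s) *: x + s *: p.
      rewrite /x scalerDr !scalerA divff ?lt0r_neq0// scale1r -addrA -scalerDl.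
      by rewrite mulrN mulrCA divff ?lt0r_neq0// mulr1 addNr scale0r addr0.
    have s01 : 0 <= s <= 1 by lra.
    have Ky : simplex K y by rewrite yE; exact: simplex_convex.
    have bE : bary K y i = (1 - s) * bary K x i + s * bary K p i by rewrite {1}yE baryC.
    have x0 := iffLR (simplexP ndK x) Kx i; have p1 := bary_le1 ndK i Kp; have p0 := iffLR (simplexP ndK p) Kp i.
    rewrite /= in xt; split; first by split=> //=; rewrite bE; nra.
    rewrite -mulrDl subrK ler_pdivrMr// ler_pdivlMr// bE; apply/andP; split; nra.
  rewrite [\1_(layer i (t + s)) y]indicE; case: (boolP (y \in layer i (t + s))) => [yL|/negP yL].
    rewrite mul1r (EFinM (g y ^+ 2) G); apply: lee_wpmul2l; first by rewrite lee_fin sqr_ge0.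
    have := @slab_measure i ((bary K y i - t) / s) ((bary K y i - t) / s + t / s) A.
    rewrite [_ + t / s - _]addrAC subrr add0r; apply => //.
    + by rewrite ltrDl divr_gt0.
    + by move=> p [].
    + by move=> p /yK[].
  rewrite !mul0r (_ : A = set0) ?measure0 ?mule0// -subset0 => p /yK[yL' _]; apply: yL.
  by rewrite inE.
apply: (@le_trans _ _ ((`|1 - s| ^- d)%:E * (G%:E * B i (t + s)))%E); last first.
  rewrite muleA -EFinM; apply: lee_wpmul2r; first by apply: integral_ge0 => x _; rewrite lee_fin sqr_ge0.
  rewrite lee_fin ler_wpM2r// gtr0_norm// -exprVn; apply: lerXn2r; rewrite ?nnegrE ?invr_ge0 ?(ltW r0)//.
  by rewrite -[leLHS]mul1r ler_pdivrMr//; lra.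
apply: lee_wpmul2l; first by rewrite lee_fin invr_ge0 exprn_ge0.
rewrite /B indic_mul_integral// -ge0_integralZl//; last 2 first.
- by apply/measurable_EFinP; apply: measurable_funM; [exact: mind|exact: measurable_funX].
- by move=> y _; rewrite lee_fin; exact: pos1.
apply: nonneg_le_integral => //.
- by move=> y _; apply: integral_ge0 => p _; rewrite lee_fin.
- by move=> y _; rewrite -EFinM mulrC; exact: inner.
Qed.

(** Substituting y = (1 - s) x + s p for [p] costs s^(-d). As |x - y| <= s C h, the kernel
    contributes (s C h)^(d + alpha), which leaves the gain s^alpha. *)
Let differences_le i (t s : R) : 0 < s ->
  (\int[mu]_x \int[mu]_p (jump i t s x p)%:E <=
   (C `^ (d%:R + alpha) * s `^ alpha * h `^ alpha * h ^+ d)%:E * seminorm_from alpha (simplex K) g)%E.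
Proof.
move=> s0; have mL := measurable_layer i; have [_ _ _ diam] := sK.
set c := _ * h ^+ d.
have c0 : 0 <= c by rewrite !mulr_ge0 ?powR_ge0 ?exprn_ge0 ?(ltW h0).
have mk := measurable_integral_snd (measurable_pair_increment alpha mg) (@pair_increment_ge0 R d alpha g).
rewrite /seminorm_from -ge0_integralZl//; last 2 first.
- exact: measurable_funTS.
- by move=> x _; exact: slice_increment_ge0.
rewrite [leRHS]integral_mkcond.
apply: nonneg_le_integral => //.
- by move=> x _; apply: integral_ge0 => y _; rewrite lee_fin; exact: pos2.
move=> x _; rewrite patchE; case: (boolP (x \in simplex K)) => [|xK]; last first.
  rewrite integral0_eq// => p _; rewrite indicE (_ : (x \in layer i t) = false) ?mul0r//.
  by apply: contraNF xK; rewrite !inE => -[].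
rewrite inE => Kx.
pose F y := \1_(simplex K) (s^-1 *: y + (- ((1 - s) / s)) *: x) * (g x - g y) ^+ 2 : R.
have mF : measurable_fun setT F.
  apply: measurable_funM; last by apply: measurable_funX; exact: measurable_funB.
  apply: mind => //; apply: measurable_addrV; [exact: measurable_scalerV|exact: measurable_cst].
apply: (@le_trans _ _ (\int[mu]_p (F (s *: p + (1 - s) *: x))%:E)%E).
  apply: nonneg_le_integral => //.
  - by move=> p _; rewrite lee_fin; exact: pos2.
  move=> p _; rewrite lee_fin /F.
  have -> : s^-1 *: (s *: p + (1 - s) *: x) + (- ((1 - s) / s)) *: x = p.
    by rewrite scalerDr !scalerA mulVf ?lt0r_neq0// scale1r -addrA -scalerDl [s^-1 * _]mulrC subrr scale0r addr0.
  rewrite [s *: p + _]addrC ler_piMl ?pos1// indicE; by case: (_ \in _).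
rewrite (ge0_integral_affine (f := fun y => (F y)%:E) ((1 - s) *: x) (lt0r_neq0 s0)); last 2 first.
- exact/measurable_EFinP.
- by move=> y; rewrite lee_fin; exact: pos1.
rewrite gtr0_norm// -ge0_integralZl//; last 3 first.
- exact/measurable_EFinP.
- by move=> y _; rewrite lee_fin; exact: pos1.
- by rewrite lee_fin invr_ge0 exprn_ge0// ltW.
rewrite -ge0_integralZl//; last 2 first.
- by apply/measurable_EFinP; exact: measurable_slice_increment.
- by move=> y _; rewrite lee_fin pair_increment_ge0.
apply: nonneg_le_integral => //.
- by move=> y _; rewrite -EFinM lee_fin mulr_ge0 ?pos1// invr_ge0 exprn_ge0// ltW.
move=> y _; rewrite -!EFinM lee_fin /F indicE; case: (boolP (_ \in _)) => [|_]; last first.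
  by rewrite mul0r mulr0 mulr_ge0 ?pair_increment_ge0.
rewrite inE; set p := _ + _ => Kp.
have [->|xy] := eqVneq x y; first by rewrite subrr expr0n /= !(mulr0, mul0r).
have e0 : 0 < enorm (x - y) by rewrite enorm_gt0// subr_eq0.
have xyE : enorm (x - y) <= s * C * h.
  have -> : x - y = s *: (x - p).
    rewrite /p scalerBr scalerDr !scalerA divff ?lt0r_neq0// scale1r mulrN mulrCA divff ?lt0r_neq0// mulr1.
    by apply/rowP => j; rewrite !mxE; ring.
  by rewrite enormZ gtr0_norm// -mulrA ler_wpM2l ?(ltW s0)//; exact: diam.
have k0 : 0 < frac_kernel alpha x y by rewrite powR_gt0.
have kle : frac_kernel alpha x y <= s ^+ d * c.
  apply: le_trans (_ : (s * C * h) `^ (d%:R + alpha) <= _).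
    by rewrite ge0_ler_powR// ?nnegrE ?enorm_ge0 ?addr_ge0 ?(ltW alpha0)// (le_trans (ltW e0)).
  rewrite !powRM ?mulr_ge0 ?(ltW s0) ?(ltW C0) ?(ltW h0)//.
  rewrite [s `^ (_ + _)]powRD ?(lt0r_neq0 s0) ?implybT// [h `^ (_ + _)]powRD ?(lt0r_neq0 h0) ?implybT//.
  rewrite !powR_mulrn ?(ltW s0) ?(ltW h0)// /c; apply: eq_lew; ring.
have := sqr_ge0 (g x - g y); rewrite mul1r; move: (_ ^+ 2) kle; clearbody c; move: (frac_kernel _ _ _) k0 => k k0 q kle q0.
rewrite ler_pdivrMl ?exprn_gt0// !mulrA ler_pdivlMr// mulrC ler_wpM2r//.
Qed.

(* The mass of [g] near a face is compared with its mean over the points [(1-s) x + s p], [p] in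
   the simplex; a given point arises only from [p] in a slab of width [t/s]. *)
Lemma hardy_step i (t s : R) : 0 < t -> 0 < s <= 2^-1 ->
  (B i t <= (2 * 2 ^+ d * ((6 * C) ^+ d * (4 * d%:R)) * (t / s))%:E * B i (t + s) +
     (2 * C `^ (d%:R + alpha) * s `^ alpha)%:E * ((h `^ alpha)%:E * seminorm_from alpha (simplex K) g))%E.
Proof.
move=> t0 s01; have s0 : 0 < s by case/andP: s01.
have mL := measurable_layer i; have [_ _ mE _] := sK.
have hd : 0 < h ^+ d by rewrite exprn_gt0.
pose I1 := (\int[mu]_x \int[mu]_p (moved i t s x p)%:E)%E.
pose I2 := (\int[mu]_x \int[mu]_p (jump i t s x p)%:E)%E.
have a1 : (I1 <= _)%E := averages_le i t0 s01.
have a2 : (I2 <= _)%E := differences_le i t s0.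
have key : ((h ^+ d)%:E * B i t <= 2%:E * I1 + 2%:E * I2)%E.
  have F1 : measurable_fun setT (fun z : 'rV[R]_d * 'rV[R]_d => \1_(layer i t) z.1 * (\1_(simplex K) z.2 * (g ((1 - s) *: z.1 + s *: z.2)) ^+ 2)).
    apply: measurable_funM; first by apply: mind => //; exact: measurable_fst.
    apply: measurable_funM; first by apply: mind => //; exact: measurable_snd.
    by apply: measurable_funX; apply: (measurableT_comp mg); exact: mcomb.
  have F2 : measurable_fun setT (fun z : 'rV[R]_d * 'rV[R]_d => \1_(layer i t) z.1 * (\1_(simplex K) z.2 * (g z.1 - g ((1 - s) *: z.1 + s *: z.2)) ^+ 2)).
    apply: measurable_funM; first by apply: mind => //; exact: measurable_fst.
    apply: measurable_funM; first by apply: mind => //; exact: measurable_snd.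
    apply: measurable_funX; apply: measurable_funB; apply: (measurableT_comp mg); [exact: measurable_fst|exact: mcomb].
  have F10 x y : 0 <= moved i t s x y by exact: pos2.
  have F20 x y : 0 <= jump i t s x y by exact: pos2.
  have m1 := measurable_integral_snd F1 F10; have m2 := measurable_integral_snd F2 F20.
  have p1 x : (0 <= \int[mu]_p (moved i t s x p)%:E)%E.
    by apply: integral_ge0 => p _; rewrite lee_fin.
  have p2 x : (0 <= \int[mu]_p (jump i t s x p)%:E)%E.
    by apply: integral_ge0 => p _; rewrite lee_fin.
  have -> : (2%:E * I1 = \int[mu]_x (2%:E * \int[mu]_p (moved i t s x p)%:E))%E.
    by rewrite ge0_integralZl.
  have -> : (2%:E * I2 = \int[mu]_x (2%:E * \int[mu]_p (jump i t s x p)%:E))%E.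
    by rewrite ge0_integralZl.
  rewrite -ge0_integralD//; last 4 first.
  - by move=> x _; rewrite mule_ge0.
  - exact: measurable_funeM.
  - by move=> x _; rewrite mule_ge0.
  - exact: measurable_funeM.
  rewrite /B indic_mul_integral// -ge0_integralZl//; last 3 first.
  - by apply/measurable_EFinP; apply: measurable_funM; [exact: mind|exact: measurable_funX].
  - by move=> y _; rewrite lee_fin; exact: pos1.
  - by rewrite lee_fin ltW.
  apply: nonneg_le_integral => //.
  - by move=> y _; rewrite -EFinM lee_fin mulr_ge0 ?pos1// ltW.
  move=> x _; rewrite -!ge0_integralZl//; last 4 first.
  - by apply/measurable_EFinP; exact: (measurableT_comp F2 (pair1_measurable x)).
  - by move=> y _; rewrite lee_fin.
  - by apply/measurable_EFinP; exact: (measurableT_comp F1 (pair1_measurable x)).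
  - by move=> y _; rewrite lee_fin.
  rewrite -ge0_integralD//; last 4 first.
  - by move=> y _; rewrite -EFinM lee_fin mulr_ge0.
  - by apply: measurable_funeM; apply/measurable_EFinP; exact: (measurableT_comp F1 (pair1_measurable x)).
  - by move=> y _; rewrite -EFinM lee_fin mulr_ge0.
  - by apply: measurable_funeM; apply/measurable_EFinP; exact: (measurableT_comp F2 (pair1_measurable x)).
  rewrite -mE muleC mu_indic// -ge0_integralZl//; last 2 first.
  - by apply/measurable_EFinP; exact: measurable_indic.
  - by rewrite lee_fin; exact: pos1.
  apply: nonneg_le_integral => //.
  - by move=> p _; rewrite -EFinM lee_fin mulr_ge0 ?pos1.
  move=> p _; rewrite -!EFinM -EFinD lee_fin; move: (g _ in X in _ <= X) => y.
  have -> : 2 * (\1_(layer i t) x * (\1_(simplex K) p * y ^+ 2)) + 2 * (\1_(layer i t) x * (\1_(simplex K) p * (g x - y) ^+ 2))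
    = \1_(layer i t) x * \1_(simplex K) p * (2 * y ^+ 2 + 2 * (g x - y) ^+ 2) :> R by ring.
  rewrite mulrAC ler_wpM2l ?mulr_ge0//.
  by have := sqr_ge0 (g x - 2 * y); nra.
clearbody I1 I2.
have B0 u : (0 <= B i u)%E by apply: integral_ge0 => x _; rewrite lee_fin sqr_ge0.
have S0 : (0 <= seminorm_from alpha (simplex K) g)%E.
  exact: seminorm_from_ge0.
have G0 : 0 <= 2 * 2 ^+ d * ((6 * C) ^+ d * (4 * d%:R)) * (t / s).
  by rewrite !mulr_ge0 ?exprn_ge0 ?mulr_ge0 ?invr_ge0 ?(ltW C0) ?(ltW t0) ?(ltW s0).
rewrite -(@lee_pmul2l _ (h ^+ d)%:E)//; apply: (le_trans key).
rewrite [leRHS]ge0_muleDr; last 2 first.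
- by rewrite mule_ge0 ?lee_fin.
- by rewrite mule_ge0 ?lee_fin ?mulr_ge0 ?powR_ge0// mule_ge0 ?lee_fin ?powR_ge0.
apply: leeD.
  apply: le_trans (lee_wpmul2l _ a1) _; rewrite // !muleA -!EFinM.
  apply: lee_wpmul2r => //.
  by rewrite lee_fin; apply: eq_lew; ring.
apply: le_trans (lee_wpmul2l _ a2) _; rewrite // !muleA -!EFinM.
apply: lee_wpmul2r => //.
by rewrite lee_fin; apply: eq_lew; ring.
Qed.

End hardy_step.

Section hardy.
Context {R : realType} {d : nat} (alpha : R).
Hypothesis d0 : (0 < d)%N.
Hypothesis alpha0 : 0 < alpha.
Local Notation mu := (@lebesgue_rV R d).

(** Iterating [hardy_step] on layers of geometrically decreasing height t_n, the mass of g^2 in a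
    layer decays like t_n to the power [th']. Between consecutive layers the weight is at most
    t_(n+1)^(-theta), and the series converges because [theta < th']. *)
Lemma hardy_simplex (C theta : R) : 0 < C -> 0 <= theta < 1 -> theta < alpha ->
  exists2 CH : R, 0 < CH & forall K, shape_bounded C K -> forall i (g : 'rV[R]_d -> R), measurable_fun setT g ->
    (\int[mu]_(x in simplex K) (bary K x i `^ (- theta) * g x ^+ 2)%:E <=
     CH%:E * (\int[mu]_(x in simplex K) (g x ^+ 2)%:E +
              (hK K `^ alpha)%:E * seminorm_from alpha (simplex K) g))%E.
Proof.
move=> C0 /andP[th0 th1] tha.
(* Strictly between [theta] and the minimum of 1 and [alpha]: at most [alpha] so that the difference
   terms decay fast enough, below 1 so that a large ratio [N] of heights beats the factor [G]. *)
pose th' := (theta + Num.min 1 alpha) / 2.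
have [tt t1 ta] : [/\ theta < th', th' < 1 & th' <= alpha].
  have m1 : Num.min 1 alpha <= 1 by rewrite ge_min lexx.
  have m2 : Num.min 1 alpha <= alpha by rewrite ge_min lexx orbT.
  have m3 : theta < Num.min 1 alpha by rewrite lt_min th1.
  by rewrite /th'; split; lra.
pose G := 2 * 2 ^+ d * ((6 * C) ^+ d * (4 * d%:R)).
have G0 : 0 <= G by rewrite !mulr_ge0 ?exprn_ge0 ?mulr_ge0// ltW.
pose Z := 4 * G + 2; have Z2 : 2 <= Z by rewrite lerDr mulr_ge0.
have Z0 : 0 < Z by exact: lt_le_trans Z2.
(* Chosen so that N^(1 - th') = Z, which makes the coefficient G / (N - 1) of the preceding layer at
   most half of the decay rate [rho]. *)
pose N := Z `^ (1 - th')^-1.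
have e1 : 0 < 1 - th' by rewrite subr_gt0.
have N2 : 2 <= N.
  apply: (le_trans Z2); rewrite -[leLHS]powRr1 ?(ltW Z0)//; apply: ler_powR; first by apply: le_trans Z2; rewrite ler1n.
  by rewrite -[leLHS]invr1 lef_pV2 ?posrE//; lra.
have N0 : 0 < N by exact: lt_le_trans N2.
have N1 : 1 <= N by rewrite (le_trans _ N2)// ler1n.
have N10 : 0 < N - 1 by rewrite subr_gt0 (lt_le_trans _ N2)// ltr1n.
have NZ : N `^ (1 - th') = Z by rewrite /N -powRrM mulVf ?lt0r_neq0// powRr1// ltW.
clearbody N.
pose rho := N `^ (- th'); have rho0 : 0 < rho by exact: powR_gt0.
have GM : G / (N - 1) <= rho / 2.
  rewrite ler_pdivrMr//; have : rho * N = Z.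
    by rewrite /rho -[X in _ * X](powRr1 (ltW N0)) -powRD ?(lt0r_neq0 N0) ?implybT// addrC NZ.
  have : rho * 2 <= rho * N by rewrite ler_wpM2l// ltW.
  rewrite /Z; nra.
pose C2 := 2 * C `^ (d%:R + alpha); have C20 : 0 < C2 by rewrite mulr_gt0// powR_gt0.
pose A0 := 1 + 2 * C2 / rho; have A00 : 1 <= A0 by rewrite lerDl; exact: divr_ge0 (mulr_ge0 (ler0n _ 2) (ltW C20)) (ltW rho0).
pose t n : R := 2^-1 / N ^+ n.
have t0 n : 0 < t n by rewrite divr_gt0// exprn_gt0.
have tS n : t n.+1 * N = t n by rewrite /t exprS; field; rewrite ?expf_neq0 ?lt0r_neq0.
pose z := N `^ (theta - th').
have pow1 (u : R) : 1 `^ u = 1 by rewrite powR1.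
have z01 : 0 <= z < 1.
  rewrite powR_ge0 /= /z -(opprB th' theta) powRN invf_lt1 ?powR_gt0// -[ltLHS](pow1 (th' - theta)).
  by apply: gt0_ltr_powR; rewrite ?subr_gt0// ?nnegrE ?(ltW N0)//; lra.
have z1 : 0 < 1 - z by case/andP: z01; rewrite subr_gt0.
pose Bz := (2 * N) `^ theta * A0.
exists (2 `^ theta + Bz / (1 - z)).
  have : 0 < 2 `^ theta :> R by rewrite powR_gt0.
  have : 0 <= Bz / (1 - z).
    by rewrite divr_ge0 ?mulr_ge0 ?powR_ge0 ?(le_trans ler01 A00)// ltW.
  lra.
move=> K sK i g mg; have [ndK h0 _ _] := sK.
set X := (_ + _)%E.
have mK : measurable (simplex K) by exact: measurable_simplex.
have S0 : (0 <= seminorm_from alpha (simplex K) g)%E.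
  exact: seminorm_from_ge0.
have hS0 : (0 <= (hK K `^ alpha)%:E * seminorm_from alpha (simplex K) g)%E by rewrite mule_ge0// lee_fin powR_ge0.
have g0 : (0 <= \int[mu]_(x in simplex K) (g x ^+ 2)%:E)%E by apply: integral_ge0 => x _; rewrite lee_fin sqr_ge0.
have X0 : (0 <= X)%E by rewrite adde_ge0.
have gX : (\int[mu]_(x in simplex K) (g x ^+ 2)%:E <= X)%E by rewrite leeDl.
have hX : ((hK K `^ alpha)%:E * seminorm_from alpha (simplex K) g <= X)%E by rewrite leeDr.
clearbody X.
pose B u := (\int[mu]_(x in layer K i u) ((g x) ^+ 2)%:E)%E.
have mL u : measurable (layer K i u) by exact: (measurable_layer sK).
have BX u : (B u <= X)%E.
  apply: le_trans gX; apply: ge0_subset_integral => //.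
  - by apply: measurable_funTS; apply/measurable_EFinP; exact: measurable_funX.
  - by move=> x _; rewrite lee_fin sqr_ge0.
  - by move=> x [].
have B0 u : (0 <= B u)%E by apply: integral_ge0 => x _; rewrite lee_fin sqr_ge0.
have key n : (B (t n) <= (A0 * rho ^+ n)%:E * X)%E.
  elim: n => [|n IH].
    by rewrite expr0 mulr1; apply: le_trans (BX _) _; rewrite -[leLHS]mul1e; apply: lee_wpmul2r.
  pose s := t n - t n.+1.
  have sE : s = t n.+1 * (N - 1) by rewrite /s -tS; ring.
  have s0 : 0 < s by rewrite sE mulr_gt0.
  have tn : t n <= 2^-1.
    by rewrite /t ler_pdivrMr ?exprn_gt0// ler_peMr// exprn_ege1.
  have s1 : 0 < s <= 2^-1 by rewrite s0 /=; have := t0 n.+1; rewrite /s; lra.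
  have := hardy_step d0 alpha0 C0 sK mg i (t0 n.+1) s1.
  have -> : t n.+1 + s = t n by rewrite /s addrC subrK.
  move=> /le_trans; apply.
  have ts : t n.+1 / s = (N - 1)^-1.
    by rewrite sE; field; rewrite ?lt0r_neq0.
  rewrite -/G ts.
  have sa : s `^ alpha <= rho ^+ n.
    apply: le_trans (_ : (N ^- n) `^ alpha <= _).
      rewrite ge0_ler_powR// ?nnegrE ?invr_ge0 ?exprn_ge0 ?(ltW s0) ?(ltW alpha0) ?(ltW N0)//.
      have p : 0 <= N ^- n by rewrite invr_ge0 exprn_ge0// ltW.
      have tE : t n = 2^-1 * N ^- n by [].
      by have := t0 n.+1; rewrite /s tE; clearbody t; lra.
    rewrite /rho -powR_nat ?(ltW N0)// -powR_inv1 ?exprn_ge0 ?(ltW N0)// -!powRrM mulN1r.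
    apply: ler_powR; last by rewrite lerN2.
    by rewrite exprn_ege1.
  apply: (@le_trans _ _ ((rho / 2 * (A0 * rho ^+ n))%:E * X + (C2 * rho ^+ n)%:E * X)%E).
    apply: leeD.
      rewrite (EFinM (rho / 2)) -muleA.
      by apply: lee_pmul; [rewrite lee_fin divr_ge0// ltW|exact: B0|rewrite lee_fin|exact: IH].
    apply: lee_pmul => //; rewrite lee_fin.
      by rewrite !mulr_ge0 ?powR_ge0.
    by rewrite ler_wpM2l// ltW.
  have rn0 : 0 <= rho ^+ n by rewrite exprn_ge0// ltW.
  have p1 : (0 <= (rho / 2 * (A0 * rho ^+ n))%:E)%E.
    by rewrite lee_fin; apply: mulr_ge0; [rewrite divr_ge0// ltW|apply: mulr_ge0 rn0; exact: le_trans A00].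
  have p2 : (0 <= (C2 * rho ^+ n)%:E)%E by rewrite lee_fin; exact: mulr_ge0 (ltW C20) rn0.
  rewrite -(ge0_muleDl _ p1 p2) -EFinD.
  apply: lee_wpmul2r => //; rewrite lee_fin exprS.
  have -> : rho / 2 * (A0 * rho ^+ n) + C2 * rho ^+ n = (rho / 2 * A0 + C2) * rho ^+ n by ring.
  rewrite mulrA ler_wpM2r ?exprn_ge0 ?(ltW rho0)//.
  have : rho / 2 * A0 = rho / 2 + C2 by rewrite /A0; field; exact: lt0r_neq0.
  have : A0 * rho = rho + 2 * C2 by rewrite /A0; field; exact: lt0r_neq0.
  by lra.
have mb : measurable_fun setT (fun x => bary K x i `^ (- theta)).
  by apply: (measurableT_comp (measurable_powR _)); exact: measurable_bary.
pose U n x := (t n.+1 `^ (- theta) * (\1_(layer K i (t n)) x * g x ^+ 2))%:E.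
have u0 n x : (0 <= U n x)%E.
  by rewrite lee_fin mulr_ge0 ?powR_ge0// mulr_ge0 ?sqr_ge0// indicE.
have pw x : simplex K x -> ((bary K x i `^ (- theta) * g x ^+ 2)%:E <= (2 `^ theta * g x ^+ 2)%:E +
    \sum_(0 <= n <oo) U n x)%E.
  move=> Kx; have b0 := iffLR (simplexP ndK x) Kx i.
  have s0 : (0 <= \sum_(0 <= n <oo) U n x)%E.
    by apply: nneseries_ge0 => n _ _.
  have [b1|b1] := leP (bary K x i) 2^-1; last first.
    rewrite -[leLHS]adde0; apply: leeD => //; rewrite lee_fin ler_wpM2r ?sqr_ge0//.
    have -> : 2 `^ theta = (2^-1) `^ (- theta) :> R by rewrite -powR_inv1// -powRrM mulN1r opprK.
    by apply: ler_powR_neg; rewrite ?oppr_le0 ?(ltW b1).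
  suff [n bn bn'] : exists2 n, bary K x i <= t n & bary K x i `^ (- theta) <= t n.+1 `^ (- theta).
    rewrite -[leLHS]add0e; apply: leeD; first by rewrite lee_fin mulr_ge0 ?sqr_ge0 ?powR_ge0.
    apply: le_trans (_ : U n x <= _)%E.
      rewrite lee_fin indicE (_ : x \in layer K i (t n)) ?mul1r ?ler_wpM2r ?sqr_ge0//.
      by rewrite inE; split.
    by rewrite (nneseriesD1 (n := n))// leeDl// nneseries_ge0.
  (* On the face itself the power is 0 by convention, or 1 if theta = 0; the layer of largest height
     serves. *)
  have [bz|bz] := eqVneq (bary K x i) 0.
    exists 0%N; first by rewrite bz ltW.
    apply: (@le_trans _ _ 1).
      by rewrite bz; have [->|tz] := eqVneq theta 0; [rewrite oppr0 powRr0|rewrite powR0// oppr_eq0].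
    rewrite -(pow1 (- theta)); apply: ler_powR_neg; rewrite ?oppr_le0//.
    by rewrite /t expr1 ler_pdivrMr//; lra.
  have bp : 0 < bary K x i by rewrite lt_neqAle eq_sym bz.
  have [m hm] := exists_pow2_gt (bary K x i)^-1.
  have ex : exists n, t n.+1 < bary K x i.
    exists m; rewrite /t ltr_pdivrMr ?exprn_gt0//.
    have : 1 < bary K x i * 2 ^+ m by rewrite -ltr_pdivrMl// mulr1.
    have : bary K x i * 2 ^+ m <= bary K x i * N ^+ m.+1.
      rewrite ler_wpM2l//; apply: le_trans (_ : N ^+ m <= _); first by apply: lerXn2r; rewrite ?nnegrE ?(ltW N0).
      by rewrite ler_weXn2l.
    lra.
  pose n := ex_minn ex; exists n; last first.
    by apply: ler_powR_neg; rewrite ?oppr_le0//; rewrite /n; case: ex_minnP => k /ltW.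
  rewrite /n; case: ex_minnP => -[_ _|k _ hk]; first by rewrite /t expr0 divr1.
  by rewrite leNgt; apply/negP => /hk; rewrite ltnn.
have mun n : measurable_fun (simplex K) (fun x => U n x).
  apply: measurable_funTS; apply/measurable_EFinP; apply: measurable_funM => //; apply: measurable_funM; last exact: measurable_funX.
  exact: measurable_indic.
have mg2 : measurable_fun (simplex K) (fun x => (2 `^ theta * g x ^+ 2)%:E).
  by apply: measurable_funTS; apply/measurable_EFinP; apply: measurable_funM => //; exact: measurable_funX.
have ms : measurable_fun (simplex K) (fun x => (\sum_(0 <= n <oo) U n x)%E).
  by apply: ge0_emeasurable_sum => [n x _ _|n _]; [exact: u0|exact: mun].
apply: (@le_trans _ _ (\int[mu]_(x in simplex K) ((2 `^ theta * g x ^+ 2)%:E +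
    \sum_(0 <= n <oo) U n x))%E).
  apply: nonneg_le_integral => //.
  - by move=> x _; rewrite lee_fin mulr_ge0 ?powR_ge0 ?sqr_ge0.
rewrite ge0_integralD//; last 2 first.
- by move=> x _; rewrite lee_fin mulr_ge0 ?powR_ge0 ?sqr_ge0.
- by move=> x _; apply: nneseries_ge0 => n _ _; exact: u0.
rewrite integral_nneseries// EFinD ge0_muleDl ?lee_fin ?powR_ge0//; last first.
  by rewrite divr_ge0 ?mulr_ge0 ?powR_ge0 ?(le_trans ler01 A00)// ltW.
apply: leeD.
  under eq_integral do rewrite EFinM.
  rewrite ge0_integralZl//; last 2 first.
  - by apply: measurable_funTS; apply/measurable_EFinP; exact: measurable_funX.
  - by move=> x _; rewrite lee_fin sqr_ge0.
  by apply: lee_wpmul2l.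
have un n : (\int[mu]_(x in simplex K) U n x <= (Bz * z ^+ n)%:E * X)%E.
  rewrite /U; under eq_integral do rewrite EFinM.
  rewrite ge0_integralZl//; last 3 first.
  - apply: measurable_funTS; apply/measurable_EFinP; apply: measurable_funM; [exact: measurable_indic|exact: measurable_funX].
  - by move=> x _; rewrite lee_fin mulr_ge0 ?sqr_ge0// indicE.
  - by rewrite lee_fin powR_ge0.
  have -> : (\int[mu]_(x in simplex K) (\1_(layer K i (t n)) x * g x ^+ 2)%:E = B (t n))%E.
    rewrite integral_mkcond /B [RHS]integral_mkcond; apply: eq_integral => x _; rewrite !patchE indicE.
    case: (boolP (x \in layer K i (t n))) => [|_].
      by rewrite inE => -[Kx _]; rewrite mem_set// mul1r.
    by rewrite mul0r; case: ifP.
  apply: le_trans (lee_wpmul2l _ (key n)) _; first by rewrite lee_fin powR_ge0.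
  rewrite muleA -EFinM; apply: lee_wpmul2r => //; rewrite lee_fin; apply: eq_lew.
  have -> : t n.+1 = (2 * N) ^-1 * N ^- n by rewrite /t exprS; field; rewrite ?expf_neq0 ?lt0r_neq0.
  rewrite powRM ?invr_ge0 ?mulr_ge0 ?exprn_ge0 ?(ltW N0)//.
  rewrite -powR_inv1 ?mulr_ge0 ?(ltW N0)// -powRrM mulN1r opprK.
  rewrite -powR_inv1 ?exprn_ge0 ?(ltW N0)// -powRrM mulN1r opprK powR_nat ?(ltW N0)//.
  rewrite /Bz /z powRD ?(lt0r_neq0 N0) ?implybT// exprMn -/rho; ring.
case EX : X un X0 => [x||] un X0; last by [].
- have x0 : 0 <= x by rewrite -lee_fin.
  have Bx : 0 <= Bz * x by rewrite !mulr_ge0 ?powR_ge0// (le_trans ler01 A00).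
  apply: le_trans (nneseries_geometric_le Bx z01 _) _; last by rewrite -EFinM mulrAC.
  move=> n; apply/andP; split; last by apply: le_trans (un n) _; rewrite -EFinM mulrAC.
  by apply: integral_ge0 => y _; exact: u0.
- rewrite gt0_muley ?leey// lte_fin divr_gt0 ?subr_gt0//; last by case/andP: z01.
  by rewrite mulr_gt0 ?powR_gt0 ?mulr_gt0// (lt_le_trans ltr01 A00).
Qed.

End hardy.

(** * The truncated fractional Laplacian of a discrete function *)

Section truncated_laplacian.
Context {R : realType} {d : nat} (alpha : R).
Hypothesis alpha02 : 0 < alpha < 2.
Local Notation mu := (@lebesgue_rV R d).
Variables (v : 'rV[R]_d -> R) (L M : R).
Hypothesis vL : forall x y, `|v x - v y| <= L * enorm (x - y).
Hypothesis vM : forall x, `|v x| <= M.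

Let quot x y := (v x - v y) / frac_kernel alpha x y.

Definition trunc_lap (eps : R) (x : 'rV[R]_d) : R :=
  \int[mu]_(w in [set w | eps < enorm (x - w)]) ((v x - v w) / frac_kernel alpha x w).

Let mv : measurable_fun setT v.
Proof. exact: continuous_measurable_rV (lipschitz_continuous vL). Qed.

Let M0 : 0 <= M. Proof. exact: le_trans (vM 0). Qed.

Lemma measurable_outside (eps : R) x : measurable [set w : 'rV[R]_d | eps < enorm (x - w)].
Proof.
rewrite (_ : mkset _ = (fun w => enorm (x - w)) @^-1` `]eps, +oo[); last first.
  by apply/seteqP; split=> w; rewrite /preimage/= in_itv/= andbT.
by apply: measurable_preimageT => //; apply: measurable_enormB => //; exact: measurable_cst.
Qed.

Lemma measurable_quot : measurable_fun setT (fun p : 'rV[R]_d * 'rV[R]_d => (v p.1 - v p.2) / frac_kernel alpha p.1 p.2).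
Proof.
apply: (measurable_div_kernel alpha).
by apply: measurable_funB; [exact: (measurableT_comp mv measurable_fst)|exact: (measurableT_comp mv measurable_snd)].
Qed.

Let mquot x : measurable_fun setT (quot x).
Proof. exact: (measurableT_comp measurable_quot (pair1_measurable x)). Qed.

(** The Lipschitz bound at distances up to 1 and boundedness beyond both imply a bound of the
    increment by the distance to the power alpha / 2, as alpha / 2 < 1. Truncated integrals then
    grow only like eps^(-alpha/2), an exponent below 1 and below alpha in absolute value, which
    Hardy's inequality can handle. *)
Let quot_le x y : `|quot x y| <= (`|L| + 2 * M) * enorm (x - y) `^ (- (d%:R + alpha / 2)).
Proof.
have /andP[a0 a2] := alpha02; rewrite /quot normrM normfV [`|frac_kernel _ _ _|]ger0_norm ?frac_kernel_ge0//.
have [->|xy] := eqVneq x y; first by rewrite subrr normr0 mul0r mulr_ge0 ?powR_ge0// addr_ge0// mulr_ge0.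
have e0 : 0 < enorm (x - y) by rewrite enorm_gt0// subr_eq0.
rewrite /frac_kernel; move: (vL x y) (ler_norm L); move: (enorm (x - y)) e0 => e e0 hL hl.
have h2 : `|v x - v y| <= 2 * M by have := ler_normB (v x) (v y); have := vM x; have := vM y; lra.
have -> : - (d%:R + alpha / 2) = alpha / 2 - (d%:R + alpha) by lra.
rewrite powRB ?(lt0r_neq0 e0) ?implybT// mulrA ler_wpM2r ?invr_ge0 ?powR_ge0//.
have [e1|e1] := leP e 1.
  apply: (@le_trans _ _ (`|L| * e `^ (alpha / 2))); last by rewrite ler_wpM2r ?powR_ge0// lerDl mulr_ge0.
  apply: (le_trans hL); apply: (@le_trans _ _ (`|L| * e)); first by rewrite ler_wpM2r// ltW.
  by rewrite ler_wpM2l//; apply: ger1_powR; rewrite ?e0//; lra.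
apply: (le_trans h2); apply: (@le_trans _ _ (2 * M * e `^ (alpha / 2))); last by rewrite ler_wpM2r ?powR_ge0// lerDr.
rewrite -[leLHS]mulr1 ler_wpM2l ?mulr_ge0//; apply: le_trans (_ : e `^ 0 <= _); first by rewrite powRr0.
by apply: ler_powR; lra.
Qed.

Lemma trunc_lap_bound : exists2 C : R, 0 < C & forall x eps, 0 < eps ->
  mu.-integrable [set w | eps < enorm (x - w)] (fun w => ((v x - v w) / frac_kernel alpha x w)%:E) /\
  (\int[mu]_(w in [set w | (eps < enorm (x - w))%R]) `|((v x - v w) / frac_kernel alpha x w)%:E| <= (C * eps `^ (- (alpha / 2)))%:E)%E.
Proof.
have /andP[a0 a2] := alpha02; have a20 : 0 < alpha / 2 by lra.
have [C C0 hC] := @far_kernel_integral R d _ a20.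
pose c := `|L| + 2 * M + 1; have c0 : 0 < c by rewrite ltr_wpDl// addr_ge0// mulr_ge0.
exists (c * C) => [|x eps e0]; first exact: mulr_gt0.
have mA := measurable_outside eps x.
have mB : measurable [set w : 'rV[R]_d | eps <= enorm (x - w)].
  rewrite (_ : mkset _ = (fun w => enorm (x - w)) @^-1` `[eps, +oo[); last first.
    by apply/seteqP; split=> w; rewrite /preimage/= in_itv/= andbT.
  by apply: measurable_preimageT => //; apply: measurable_enormB => //; exact: measurable_cst.
have mp : measurable_fun setT (fun w : 'rV[R]_d => enorm (x - w) `^ (- (d%:R + alpha / 2))).
  by apply: (measurableT_comp (measurable_powR _)); apply: measurable_enormB => //; exact: measurable_cst.
have bound : (\int[mu]_(w in [set w | (eps < enorm (x - w))%R]) `|(quot x w)%:E| <= (c * C * eps `^ (- (alpha / 2)))%:E)%E.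
  apply: (@le_trans _ _ (\int[mu]_(w in [set w | (eps <= enorm (x - w))%R]) (c%:E * (enorm (x - w) `^ (- (d%:R + alpha / 2)))%:E))%E).
    apply: (@le_trans _ _ (\int[mu]_(w in [set w | (eps < enorm (x - w))%R]) (c%:E * (enorm (x - w) `^ (- (d%:R + alpha / 2)))%:E))%E).
      apply: nonneg_le_integral => //.
      - by move=> w _; rewrite -EFinM abse_EFin lee_fin (le_trans (quot_le _ _))// ler_wpM2r ?powR_ge0// lerDl.
    apply: ge0_subset_integral => //; first by apply: measurable_funTS; apply: measurable_funeM; exact/measurable_EFinP.
      by move=> w _; rewrite -EFinM lee_fin mulr_ge0 ?powR_ge0// ltW.
    by move=> w /= /ltW.
  rewrite ge0_integralZl//; last 3 first.
  - by apply: measurable_funTS; exact/measurable_EFinP.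
  - by move=> w _; rewrite lee_fin powR_ge0.
  - by rewrite lee_fin ltW.
  by rewrite -mulrA (EFinM c); apply: lee_wpmul2l; [rewrite lee_fin ltW|exact: hC].
split=> //; apply/integrableP; split; last by apply: le_lt_trans bound _; exact: ltry.
by apply: measurable_funTS; apply/measurable_EFinP; exact: mquot.
Qed.

Lemma trunc_lap_le : exists2 C : R, 0 < C & forall x eps, 0 < eps -> `|trunc_lap eps x| <= C * eps `^ (- (alpha / 2)).
Proof.
have [C C0 h] := trunc_lap_bound; exists C => // x eps e0; have [iq bq] := h x eps e0.
have mA := measurable_outside eps x.
rewrite -lee_fin -abse_EFin /trunc_lap /Rintegral fineK; last exact: integrable_fin_num.
apply: le_trans (le_abse_integral _ mA _) bq.
by case/integrableP: iq.
Qed.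

(** Tonelli's theorem is applied to the positive and the negative part of the truncated
    integrand. *)
Lemma measurable_trunc_lap eps : measurable_fun setT (trunc_lap eps).
Proof.
pose h (s : R) x w := Num.max (s * (\1_[set r : R | eps < r] (enorm (x - w)) * quot x w)) 0.
have h0 s x w : 0 <= h s x w by rewrite le_max lexx orbT.
have mh s : measurable_fun setT (fun p : 'rV[R]_d * 'rV[R]_d => h s p.1 p.2).
  apply: measurable_maxr => //; apply: measurable_funM => //; apply: measurable_funM; last exact: measurable_quot.
  apply: (measurableT_comp (f := (\1_[set r : R | eps < r] : R -> R))).
    apply: measurable_indic; rewrite (_ : mkset _ = `]eps, +oo[%classic); first exact: measurable_itv.
    by apply/seteqP; split=> w /=; rewrite in_itv/= andbT.
  by apply: measurable_enormB; [exact: measurable_fst|exact: measurable_snd].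
have m1 := measurable_integral_snd (mh 1) (h0 1); have m2 := measurable_integral_snd (mh (- 1)) (h0 (- 1)).
apply: (eq_measurable_fun (fun x => fine (\int[mu]_w (h 1 x w)%:E - \int[mu]_w (h (- 1) x w)%:E)%E)); last first.
  by apply: (measurableT_comp (fine_measurable measurableT)) => //; exact: emeasurable_funB.
move=> x _; rewrite /trunc_lap /Rintegral integral_mkcond integralE; congr (fine (_ - _)%E);
  apply: eq_integral => w _; rewrite ?funeposE ?funenegE /h patchE indicE.
- rewrite mul1r EFin_max; congr maxe; case: (boolP (eps < enorm (x - w))) => ew.
    by rewrite !mem_set// mul1r.
  by rewrite !memNset ?mul0r//=; exact/negP.
- rewrite mulN1r EFin_max; congr maxe; case: (boolP (eps < enorm (x - w))) => ew.
    by rewrite !mem_set// mul1r.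
  by rewrite !memNset ?mul0r ?oppr0 ?oppe0//=; exact/negP.
Qed.

(** The point reflection in [x] exchanges the positive and the negative part. *)
Lemma odd_integral0 (h : 'rV[R]_d -> R) (x : 'rV[R]_d) A : measurable A -> (forall w, A (x - w + x) <-> A w) ->
  mu.-integrable A (EFin \o h) -> (forall w, A w -> h (x - w + x) = - h w) -> \int[mu]_(w in A) h w = 0.
Proof.
move=> mA sA ih oh; rewrite /Rintegral.
have fin := integrable_pos_fin_num mA ih.
rewrite integralE (_ : (\int[mu]_(w in A) (EFin \o h)^\- w = \int[mu]_(w in A) (EFin \o h)^\+ w)%E) ?subee//.
have [mh _] := integrableP _ _ _ ih.
rewrite [RHS]integral_mkcond -[RHS]mul1e [LHS]integral_mkcond.
have -> : 1%E = (`|(-1)| ^- d)%:E :> \bar R by rewrite normrN1 expr1n invr1.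
rewrite -(ge0_integral_affine (x + x)); last 3 first.
- by rewrite oppr_eq0 oner_eq0.
- by apply/(measurable_restrictT _ mA); exact: measurable_funepos.
- by move=> w; rewrite patchE; case: ifP.
apply: eq_integral => w _; rewrite !patchE scaleN1r addrA [- w + x]addrC.
case: ifPn => [|/negP] wA; [rewrite inE in wA|].
  have wA' := iffRL (sA w) wA; rewrite mem_set// funeposE funenegE /= oh// EFinN//.
rewrite memNset// => /sA wA'; apply: wA; by rewrite inE.
Qed.

(** Between the two radii [v] is affine, so the integrand is odd about [x] and integrates to 0: the
    principal value is already attained at the radius [del]. *)
Lemma trunc_lap_stable (x : 'rV[R]_d) (del c : R) g : (forall w, enorm (x - w) <= del -> v w = c + dotp g w) ->
  forall eps, 0 < eps < del -> trunc_lap eps x = trunc_lap del x.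
Proof.
move=> aff eps /andP[e0 ed]; have [C _ h] := trunc_lap_bound; have [iq _] := h x eps e0.
have mA := measurable_outside eps x; have mD := measurable_outside del x.
have E : [set w | eps < enorm (x - w)] = [set w | eps < enorm (x - w) <= del] `|` [set w | del < enorm (x - w)].
  apply/seteqP; split=> [w /= ew|w /= [/andP[]//|]]; last exact: lt_trans.
  by have [wd|dw] := leP (enorm (x - w)) del; [left; rewrite ew|right].
have mB : measurable [set w | eps < enorm (x - w) <= del].
  rewrite (_ : mkset _ = [set w | eps < enorm (x - w)] `\` [set w | del < enorm (x - w)]); first exact: measurableD.
  apply/seteqP; split=> w /=; first by move=> /andP[a b]; split=> //; apply/negP; rewrite -leNgt.
  by move=> [-> /negP]; rewrite -leNgt.
rewrite {1}/trunc_lap E Rintegral_setU//; last 2 first.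
- by rewrite -E.
- by apply/disj_setPS => w /= [/andP[_ a]]; rewrite ltNge a.
rewrite (@odd_integral0 _ x) ?add0r//.
- move=> w /=; have -> : x - (x - w + x) = - (x - w) by apply/rowP => j; rewrite !mxE; ring.
  by rewrite enormN.
- by apply: integrableS iq => // w /= /andP[].
move=> w /= /andP[ew wd]; have xw : x - (x - w + x) = - (x - w) by apply/rowP => j; rewrite !mxE; ring.
rewrite /frac_kernel xw enormN -mulNr; congr (_ / _).
rewrite !aff ?xw ?enormN ?subrr ?enorm0 ?(le_trans (ltW e0) (ltW ed))//.
by rewrite !dotpDr !dotpNr; ring.
Qed.

Lemma fraclap_trunc (x : 'rV[R]_d) (del c : R) g : 0 < del -> (forall w, enorm (x - w) <= del -> v w = c + dotp g w) ->
  fraclap alpha v x = @Cda R d alpha * trunc_lap del x /\ trunc_lap n.+1%:R^-1 x @[n --> \oo] --> trunc_lap del x.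
Proof.
move=> d0 aff; have st := trunc_lap_stable aff; split.
  rewrite /fraclap; congr (_ * _); apply: lim_near_cst => //.
  near=> eps; apply: st; apply/andP; split; near: eps; [exact: nbhs_right_gt|exact: nbhs_right_lt].
apply: cvg_near_cst; near=> n; apply: st; rewrite invr_gt0 ltr0n/=.
by near: n; exact: near_infty_natSinv_lt (PosNum d0).
Unshelve. all: by end_near. Qed.

Lemma trunc_lap_affine_le : exists2 C : R, 0 < C & forall (x : 'rV[R]_d) (del c : R) g, 0 < del ->
  (forall w, enorm (x - w) <= del -> v w = c + dotp g w) ->
  forall eps, 0 < eps -> `|trunc_lap eps x| <= C * del `^ (- (alpha / 2)).
Proof.
have /andP[a0 _] := alpha02; have [C C0 hC] := trunc_lap_le; exists C => // x del c g d0 aff eps e0.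
have [ed|de] := ltP eps del; first by rewrite (trunc_lap_stable aff) ?e0//; exact: hC.
apply: le_trans (hC x eps e0) _; rewrite ler_pM2l//; apply: ler_powR_neg => //; lra.
Qed.

End truncated_laplacian.

Lemma cvg_sum_seq (R : realType) (I : eqType) (s : seq I) (u : I -> nat -> R) (l : I -> R) :
  (forall i, i \in s -> u i n @[n --> \oo] --> l i) -> \sum_(i <- s) u i n @[n --> \oo] --> \sum_(i <- s) l i.
Proof.
elim: s => [_|i s IH h]; first by under eq_fun do rewrite big_nil; rewrite big_nil; exact: cvg_cst.
under eq_fun do rewrite big_cons; rewrite big_cons; apply: cvgD; first by apply: h; exact: mem_head.
by apply: IH => j js; apply: h; rewrite in_cons js orbT.
Qed.

Lemma nondegenerate_shape_bounded (R : realType) (d : nat) (K : tsimplex R d) : (0 < d)%N -> nondegenerate_simplex K ->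
  exists2 C, 0 < C & shape_bounded C K.
Proof.
move=> d0 ndK; have [m m0 mE] := simplex_measure ndK; have [h0 hd] := hK_pow d0 mE m0.
have [D [_ hD]] := simplex_bounded K.
pose B := (d%:R + 1) * (2 * (`|D| + 1)) : R.
have B0 : 0 < B by rewrite !mulr_gt0// ltr_wpDl.
exists (B / hK K); first exact: divr_gt0.
split=> // [|x z Kx Kz]; first by rewrite mE hd.
rewrite divfK ?lt0r_neq0//; apply: le_trans (enorm_le_norm _) _; rewrite ler_wpM2l ?addr_ge0//.
have DD : D < `|D| + 1 by apply: le_lt_trans (ler_norm D) _; rewrite ltrDl.
have := ler_normB x z; have := hD _ DD x Kx; have := hD _ DD z Kz; rewrite /=; lra.
Qed.

(** * Green's formula element by element *)

Section green_formula.
Context {R : realType} {d : nat} (alpha : R) (Omega : set 'rV[R]_d).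
Hypothesis lipO : bounded_lipschitz_domain Omega.
Hypothesis d0 : (0 < d)%N.
Hypothesis alpha02 : 0 < alpha < 2.
Variable T : mesh R d.
Hypothesis cT : conforming_mesh Omega T.
Local Notation mu := (@lebesgue_rV R d).
Local Notation mu2 := (mu \x mu)%E.

Let a0 : 0 < alpha. Proof. by case/andP: alpha02. Qed.
Let ndT K : K \in T -> nondegenerate_simplex K.
Proof. by case: cT => _ h _ _ _ /h[]. Qed.
Let mC : measurable (closure Omega). Proof. by apply: closed_measurable_rV; exact: closed_closure. Qed.

Lemma mesh_trivIset : trivIset [set` T] (fun K : tsimplex R d => (simplex K)°).
Proof.
apply/trivIsetP => K K' /= KT K'T /eqP KK'; apply/seteqP; split=> // x [Kx K'x].
exact: (KK' (mesh_interior_disjoint cT KT K'T Kx (interior_subset K'x))).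
Qed.

Lemma mesh_Rintegral (f : 'rV[R]_d -> R) : mu.-integrable setT (EFin \o f) ->
  {ae mu, forall x, ~ closure Omega x -> f x = 0} ->
  \int[mu]_x f x = \sum_(K <- T) \int[mu]_(x in (simplex K)°) f x.
Proof.
move=> If f0; pose U := \big[setU/set0]_(K <- T) (simplex K)°.
have mi (K : tsimplex R d) : measurable (simplex K)° by exact: measurable_simplex_interior.
have mU : measurable U by apply: bigsetU_measurable => K _.
have [mf _] := integrableP _ _ _ If.
have uT : uniq T by case: cT.
rewrite /Rintegral sum_fine => [|K _]; last by apply: integrable_fin_num => //; exact: integrableS If.
rewrite -(integral_bigsetU_EFin mu mi uT mesh_trivIset); last exact: measurable_funTS.
congr fine; rewrite [RHS]integral_mkcond; apply: ae_eq_integral => //; first by apply/(measurable_restrictT _ mU); exact: measurable_funTS.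
apply: filterS (filterI f0 (mesh_conull d0 cT)) => x [fx hx] _; rewrite patchE.
case: ifPn => // /negP; rewrite inE -/U => nU; rewrite fx// => /hx[K KT Kx]; apply: nU.
by rewrite /U -bigcup_seq; exists K.
Qed.

Variable v : 'rV[R]_d -> R.
Hypothesis Vv : VT Omega T v.

Lemma VT_bounded : exists M : R, forall x, `|v x| <= M.
Proof.
have [L L0 vL] := VT_lipschitz lipO cT Vv.
have [B B0 hB] := bounded_set_closure_norm (let: And5 _ _ _ b _ := lipO in b).
exists (`|v 0| + L * ((d%:R + 1) * B)) => x.
have L' : 0 <= L * ((d%:R + 1) * B) by rewrite !mulr_ge0 ?addr_ge0// ltW.
have [Ox|nO] := pselect (Omega x); last by rewrite (VT_boundary0 lipO Vv nO) normr0 addr_ge0.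
have := vL x 0; rewrite subr0 => h; have := ler_normD (v x - v 0) (v 0); rewrite subrK => /le_trans; apply.
rewrite addrC lerD2l; apply: (le_trans h); rewrite ler_wpM2l//; apply: le_trans (enorm_le_norm _) _.
by rewrite ler_wpM2l ?addr_ge0//; apply: hB; exact: subset_closure.
Qed.

(** The singularity is governed by the smallest barycentric coordinate; the sum over all coordinates
    dominates its power and fits Hardy's inequality face by face. *)
Lemma trunc_lap_simplex_le : exists2 C : R, 0 < C & forall K, K \in T -> exists2 G : R, 0 < G & forall x, (simplex K)° x ->
  (forall eps, 0 < eps -> `|trunc_lap alpha v eps x| <= C * G * \sum_i bary K x i `^ (- (alpha / 2))) /\
  exists2 l, fraclap alpha v x = @Cda R d alpha * l & trunc_lap alpha v n.+1%:R^-1 x @[n --> \oo] --> l.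
Proof.
have [L L0 vL] := VT_lipschitz lipO cT Vv; have [M vM] := VT_bounded.
have [C C0 hC] := trunc_lap_affine_le alpha02 vL vM; exists C => // K KT; have ndK := ndT KT.
pose H := \sum_i enorm (bgrad K i) + 1.
have H0 : 0 < H by rewrite ltr_wpDl// sumr_ge0// => i _; exact: enorm_ge0.
have HE i : enorm (bgrad K i) <= H.
  rewrite /H (bigD1 i)//= -addrA lerDl addr_ge0// sumr_ge0// => j _; exact: enorm_ge0.
exists ((2 * H)^-1 `^ (- (alpha / 2))) => [|x Kx]; first by rewrite powR_gt0// invr_gt0 mulr_gt0.
have b0 := iffLR (simplex_interiorP ndK x) Kx.
have [i0 hi0] : exists i0, forall i, bary K x i0 <= bary K x i.
  have [i _ hi] := @arg_minP _ _ _ ord0 xpredT (fun i => bary K x i) isT.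
  by exists i => j; exact: hi.
(* Within this distance every coordinate stays at least half of the smallest one at [x], so the ball
   lies in [K], where [v] is affine. *)
pose del := (2 * H)^-1 * bary K x i0.
have del0 : 0 < del by rewrite mulr_gt0 ?invr_gt0 ?mulr_gt0.
have [c [g vK]] : P1_on (simplex K) v by case: Vv => _ _ h _; exact: h.
have aff w : enorm (x - w) <= del -> v w = c + dotp g w.
  move=> xw; apply: vK; apply/(simplexP ndK) => i.
  have h1 := baryB K x w i; have h2 := dotp_le (bgrad K i) (x - w).
  have h3 : enorm (bgrad K i) * enorm (x - w) <= H * del by rewrite ler_pM ?enorm_ge0.
  have h4 : H * del = bary K x i0 / 2 by rewrite /del; field; exact: lt0r_neq0.
  have := hi0 i; have := b0 i0; have := ler_norm (dotp (bgrad K i) (x - w)); lra.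
split; last by have [-> h] := fraclap_trunc alpha02 vL vM del0 aff; exists (trunc_lap alpha v del x).
move=> eps e0; apply: le_trans (hC x del c g del0 aff eps e0) _.
rewrite /del powRM ?invr_ge0 ?mulr_ge0 ?(ltW H0) ?(ltW (b0 _))// mulrA ler_wpM2l ?mulr_ge0 ?powR_ge0 ?(ltW C0)//.
by rewrite (bigD1 i0)//= lerDl sumr_ge0// => j _; exact: powR_ge0.
Qed.

Lemma measurable_fraclap K : K \in T -> measurable_fun (simplex K)° (fraclap alpha v).
Proof.
move=> KT; have [C C0 h] := trunc_lap_simplex_le; have [G G0 hG] := h K KT.
have [L L0 vL] := VT_lipschitz lipO cT Vv.
apply: (@measurable_fun_cvg _ _ _ _ (fun n x => @Cda R d alpha * trunc_lap alpha v n.+1%:R^-1 x)) => [n|x Kx].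
  by apply: measurable_funTS; apply: measurable_funM => //; exact: (measurable_trunc_lap alpha vL).
have [_ [l -> hl]] := hG x Kx; apply: cvgM => //; exact: cvg_cst.
Qed.

Variable w : 'rV[R]_d -> R.
Hypothesis Hw : Htilde alpha Omega w.

Let Lw : L2 setT w. Proof. by case: Hw => /HspaceP[]. Qed.
Let mw : measurable_fun setT w. Proof. by case: Lw. Qed.
Let w0 : {ae mu, forall x, ~ closure Omega x -> w x = 0}. Proof. by case: Hw. Qed.

Lemma seminorm_le : (\int[mu]_x \int[mu]_y ((w x - w y) ^+ 2 / frac_kernel alpha x y)%:E < +oo)%E.
Proof.
have [_ fin] : Hspace alpha w by case: Hw.
move: fin; rewrite (fubini_tonelli1 (fun z => ((w z.1 - w z.2) ^+ 2 / frac_kernel alpha z.1 z.2)%:E))//.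
  by apply/measurable_EFinP; exact: measurable_pair_increment.
by move=> z; rewrite lee_fin pair_increment_ge0.
Qed.

Let sqw : (\int[mu]_x ((w x) ^+ 2)%:E < +oo)%E. Proof. by case: Lw. Qed.

(** As |w| <= w^2 + 1, integrands linear in [w] are covered by Hardy's inequality for [w] and for
    the constant 1. *)
Lemma weight_integrable K (theta : R) i : K \in T -> 0 <= theta < 1 -> theta < alpha ->
  mu.-integrable (simplex K) (fun x => ((w x ^+ 2 + 1) * bary K x i `^ (- theta))%:E).
Proof.
move=> KT th01 tha; have ndK := ndT KT; have [C C0 sK] := nondegenerate_shape_bounded d0 ndK.
have [CH CH0 hardy] := hardy_simplex d0 a0 C0 th01 tha.
have mK := measurable_simplex ndK; have [_ h0 mE _] := sK.
have mb : measurable_fun setT (fun x => bary K x i `^ (- theta)).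
  by apply: (measurableT_comp (measurable_powR _)); exact: measurable_bary.
have key (g : 'rV[R]_d -> R) : measurable_fun setT g -> (\int[mu]_(x in simplex K) (g x ^+ 2)%:E < +oo)%E ->
    (seminorm_from alpha (simplex K) g < +oo)%E ->
    mu.-integrable (simplex K) (fun x => (bary K x i `^ (- theta) * g x ^+ 2)%:E).
  move=> mg f1 f2; apply/integrableP; split.
    by apply: measurable_funTS; apply/measurable_EFinP; apply: measurable_funM => //; exact: measurable_funX.
  under eq_integral => x _ do rewrite gee0_abs ?lee_fin ?(mulr_ge0 (powR_ge0 _ _) (sqr_ge0 _))//.
  apply: le_lt_trans (hardy K sK i g mg) _; rewrite lte_mul_pinfty ?lee_fin ?(ltW CH0)// lte_add_pinfty//.
  by rewrite lte_mul_pinfty ?lee_fin ?powR_ge0.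
have i1 := key w mw; have i2 := key (fun=> 1) (measurable_cst _).
rewrite (_ : (fun x => _) = (fun x => (bary K x i `^ (- theta) * w x ^+ 2)%:E + (bary K x i `^ (- theta) * 1 ^+ 2)%:E)%E); last first.
  by apply/funext => x; rewrite -EFinD; congr EFin; ring.
apply: integrableD => //.
- apply: i1; first by apply: le_lt_trans sqw; apply: ge0_subset_integral => //;
    [apply/measurable_EFinP; exact: measurable_funX|move=> x _; rewrite lee_fin sqr_ge0].
  apply: le_lt_trans seminorm_le; apply: ge0_subset_integral => //.
    exact: measurable_integral_snd (measurable_pair_increment alpha mw) (@pair_increment_ge0 R d alpha w).
  by move=> x _; exact: slice_increment_ge0.
- apply: i2; first by under eq_integral do rewrite expr1n; rewrite integral_cst// mul1e (_ : _ (simplex K) = (hK K ^+ d)%:E) ?ltry.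
  rewrite /seminorm_from integral0_eq ?ltry// => x _; rewrite integral0_eq// => y _.
  by rewrite subrr expr0n mul0r.
Qed.

(* The truncated integrals are dominated by the distance to the element boundary to the power
   [-alpha/2], which is integrable against [w] by Hardy's inequality. *)
Lemma trunc_lap_cvg K : K \in T -> 0 < @Cda R d alpha ->
  mu.-integrable (simplex K)° (fun x => (w x * fraclap alpha v x)%:E) /\
  \int[mu]_(x in (simplex K)°) (w x * trunc_lap alpha v n.+1%:R^-1 x) @[n --> \oo] -->
  \int[mu]_(x in (simplex K)°) (w x * fraclap alpha v x) / @Cda R d alpha.
Proof.
move=> KT c0; have [C C0 h] := trunc_lap_simplex_le; have [G G0 hG] := h K KT.
have [L L0 vL] := VT_lipschitz lipO cT Vv.
have mi := measurable_simplex_interior K; have mK := measurable_simplex (ndT KT).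
have mf := measurable_fraclap KT.
pose f x := w x * (fraclap alpha v x / @Cda R d alpha).
have mff : measurable_fun (simplex K)° (EFin \o f).
  by apply/measurable_EFinP; apply: measurable_funM; [exact: measurable_funTS|exact: measurable_funM].
pose g x := (\sum_i (C * G * ((w x ^+ 2 + 1) * bary K x i `^ (- (alpha / 2))))%:E)%E.
have ig : mu.-integrable (simplex K)° g.
  apply: integrable_sum => // i _; under eq_fun do rewrite EFinM.
  apply: integrableZl => //; apply: (integrableS mK mi (@interior_subset _ _)).
  by apply: weight_integrable => //; have /andP[b0 b2] := alpha02; [apply/andP; split; lra|lra].
have gle n x : (simplex K)° x -> (`|(w x * trunc_lap alpha v n.+1%:R^-1 x)%:E| <= g x)%E.
  move=> Kx; have [hb _] := hG x Kx; rewrite abse_EFin /g sumEFin lee_fin normrM.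
  have -> : \sum_i C * G * ((w x ^+ 2 + 1) * bary K x i `^ (- (alpha / 2))) = (w x ^+ 2 + 1) * (C * G * \sum_i bary K x i `^ (- (alpha / 2))).
    by rewrite !mulr_sumr; apply: eq_bigr => i _; ring.
  apply: ler_pM => //; last by apply: hb; rewrite invr_gt0.
  by rewrite -real_normK ?num_real//; have := sqr_ge0 (`|w x| - 1); have := normr_ge0 (w x); nra.
have [|||if_ _ cf] := @dominated_convergence _ _ R mu (simplex K)° mi (fun n x => (w x * trunc_lap alpha v n.+1%:R^-1 x)%:E) (EFin \o f) g _ mff _ ig.
- by move=> n; apply: measurable_funTS; apply/measurable_EFinP; apply: measurable_funM => //; exact: (measurable_trunc_lap alpha vL).
- apply/aeW => x Kx; have [_ [l fl hl]] := hG x Kx; apply: cvg_EFin; first exact: nearW.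
  rewrite /f fl mulrAC divff ?lt0r_neq0// mul1r; apply: cvgM => //; exact: cvg_cst.
- by apply/aeW => x n; exact: gle.
have fE x : (w x * fraclap alpha v x)%:E = ((@Cda R d alpha)%:E * (f x)%:E)%E.
  by rewrite -EFinM; congr EFin; rewrite /f; field; exact: lt0r_neq0.
have iwf : mu.-integrable (simplex K)° (fun x => (w x * fraclap alpha v x)%:E).
  by under eq_fun do rewrite fE; exact: integrableZl.
split=> //; apply: fine_cvg; apply: cvg_trans cf _ => //=.
suff -> : (\int[mu]_(x in (simplex K)°) (w x * fraclap alpha v x) / @Cda R d alpha)%:E = (\int[mu]_(x in (simplex K)°) (f x)%:E)%E by [].
rewrite /Rintegral; under eq_integral do rewrite fE.
rewrite integralZl// fineM//=; last exact: integrable_fin_num.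
by rewrite mulrAC divff ?lt0r_neq0// mul1r fineK//; exact: integrable_fin_num.
Qed.

Let w_integrable : mu.-integrable setT (EFin \o w).
Proof.
have [B B0 hB] := bounded_set_closure_norm (let: And5 _ _ _ b _ := lipO in b).
have fC := lebesgue_rV_lty mC hB.
have LC : sqint mu (closure Omega) w by apply: (@L2_subset R d _ setT).
have L1 : sqint mu (closure Omega) (fun=> 1).
  by split; [exact: measurable_cst|under eq_integral do rewrite expr1n; rewrite integral_cst// mul1e].
have /integrableP[_ i1] := sqint_mul mC LC L1.
apply/integrableP; split; first exact/measurable_EFinP.
rewrite (ae_eq_integral ((fun x => `|(w x * 1)%:E|%E) \_ (closure Omega)))//; first by rewrite -integral_mkcond.
- by apply: measurableT_comp => //; exact/measurable_EFinP.
- apply/(measurable_restrictT _ mC); apply: measurable_funTS; apply: measurableT_comp => //; apply/measurable_EFinP.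
  exact: measurable_funM.
- apply: filterS w0 => x hx _; rewrite patchE; case: ifPn => [_|/negP nC]; first by rewrite mulr1.
  by rewrite /= hx ?normr0// => Cx; apply: nC; rewrite inE.
Qed.

Section truncation.
Variable eps : R.
Hypothesis eps0 : 0 < eps.

Let chi (z : 'rV[R]_d * 'rV[R]_d) : R := \1_[set r : R | eps < r] (enorm (z.1 - z.2)).
Let G z := chi z * (w z.1 * ((v z.1 - v z.2) / frac_kernel alpha z.1 z.2)).
Let F z := (v z.1 - v z.2) * (w z.1 - w z.2) / frac_kernel alpha z.1 z.2.

Let vv : exists L M : R, (forall x y, `|v x - v y| <= L * enorm (x - y)) /\ forall x, `|v x| <= M.
Proof. by have [L _ vL] := VT_lipschitz lipO cT Vv; have [M vM] := VT_bounded; exists L, M. Qed.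

Let mchi : measurable_fun setT chi.
Proof.
apply: (measurableT_comp (f := (\1_[set r : R | eps < r] : R -> R))).
  apply: measurable_indic; rewrite (_ : mkset _ = `]eps, +oo[%classic); first exact: measurable_itv.
  by apply/seteqP; split=> u /=; rewrite in_itv/= andbT.
by apply: measurable_enormB; [exact: measurable_fst|exact: measurable_snd].
Qed.

Let mG : measurable_fun setT G.
Proof.
have [L [M [vL vM]]] := vv; apply: measurable_funM => //; apply: measurable_funM; last exact: (measurable_quot alpha vL).
exact: (measurableT_comp mw measurable_fst).
Qed.

Let inner_integral x : (fun y => (G (x, y))%:E) =
  (fun y => (w x)%:E * (((fun y => ((v x - v y) / frac_kernel alpha x y)%:E) \_ [set y | (eps < enorm (x - y))%R]) y))%E.
Proof.
apply/funext => y; rewrite /G /chi /= indicE patchE; case: (boolP (eps < enorm (x - y))) => ew.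
  by rewrite !mem_set// mul1r EFinM.
by rewrite !memNset ?mul0r ?mule0//=; exact/negP.
Qed.

Let iG : mu2.-integrable setT (EFin \o G).
Proof.
have [L [M [vL vM]]] := vv; have [C C0 hC] := trunc_lap_bound alpha02 vL vM.
apply/integrableP; split; first exact/measurable_EFinP.
rewrite (fubini_tonelli1 (fun z => `|(EFin \o G) z|%E))//; last by apply: measurableT_comp => //; exact/measurable_EFinP.
have [_ iw] := integrableP _ _ _ w_integrable.
have c0 : 0 <= C * eps `^ (- (alpha / 2)) by rewrite mulr_ge0 ?powR_ge0// ltW.
apply: (@le_lt_trans _ _ (\int[mu]_x ((C * eps `^ (- (alpha / 2)))%:E * `|(EFin \o w) x|))%E); last first.
  rewrite ge0_integralZl//; first by rewrite lte_mul_pinfty.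
  by apply: measurableT_comp => //; exact/measurable_EFinP.
apply: nonneg_le_integral => //.
- by move=> x _; exact: integral_ge0.
move=> x _; have [iq bq] := hC x eps eps0; have mA := measurable_outside eps x.
rewrite /fubini_F /= (_ : (fun y => _) = (fun y => (`|(w x)%:E| * ((fun y => `|((v x - v y) / frac_kernel alpha x y)%:E|) \_ [set y | (eps < enorm (x - y))%R]) y)%E)); last first.
  apply/funext => y; have /= -> := congr1 (fun f => `|f y|%E) (inner_integral x); rewrite abseM; congr (_ * _)%E.
  by rewrite !patchE; case: ifP => _; rewrite ?abse0.
have mq : measurable_fun [set y | eps < enorm (x - y)] (fun y => `|((v x - v y) / frac_kernel alpha x y)%:E|%E).
  by apply: measurableT_comp => //; case/integrableP: iq.
rewrite ge0_integralZl//; last 2 first.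
- exact/(measurable_restrictT _ mA).
- by move=> y _; rewrite patchE; case: ifP.
by rewrite muleC -integral_mkcond; apply: lee_wpmul2r.
Qed.

(** Away from the diagonal the symmetric integrand splits into two integrable halves exchanged by
    swapping the variables; Fubini turns each into [w] times the truncated integral of [v]. *)
Lemma truncated_form : mu2.-integrable setT (EFin \o F) ->
  \int[mu2]_z (chi z * F z) = 2 * \sum_(K <- T) \int[mu]_(x in (simplex K)°) (w x * trunc_lap alpha v eps x).
Proof.
move=> iF; have [L [M [vL vM]]] := vv; have [C C0 hC] := trunc_lap_bound alpha02 vL vM.
have wt0 : {ae mu, forall x, ~ closure Omega x -> w x * trunc_lap alpha v eps x = 0}.
  by apply: filterS w0 => x hx nC; rewrite (hx nC) mul0r.
have mcF : measurable_fun setT (fun z => chi z * F z).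
  by apply: measurable_funM => //; apply/measurable_EFinP; case/integrableP: iF.
have chi01 z : 0 <= chi z <= 1 by rewrite /chi indicE; case: (_ \in _); rewrite ?lexx ?ler01.
have icF : mu2.-integrable setT (EFin \o (fun z => chi z * F z)).
  apply: le_integrable iF => //; first exact/measurable_EFinP.
  move=> z _; rewrite /= lee_fin normrM ler_piMl// ger0_norm; by case/andP: (chi01 z).
have FE z : chi z * F z = G z + G (z.2, z.1).
  have kC : frac_kernel alpha z.2 z.1 = frac_kernel alpha z.1 z.2 by rewrite /frac_kernel enormB.
  by rewrite /G /F /chi /= kC [enorm (z.2 - z.1)]enormB; ring.
have iG' : mu2.-integrable setT (EFin \o (fun z => G (z.2, z.1))).
  rewrite (_ : EFin \o _ = ((EFin \o (fun z => (chi z * F z)%R)) \- (EFin \o G))%E); first exact: integrableB.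
  by apply/funext => z /=; rewrite FE -EFinB [G z + _]addrC addrK.
have innE x : (\int[mu]_y (G (x, y))%:E = (w x * trunc_lap alpha v eps x)%:E)%E.
  have [iq _] := hC x eps eps0; have mA := measurable_outside eps x.
  rewrite inner_integral integralZl//; last exact/(integrable_mkcond _ mA).
  by rewrite -integral_mkcond EFinM /trunc_lap /Rintegral fineK//; exact: integrable_fin_num.
have E1 := integral12_prod_meas1 iG; have E2 := integral12_prod_meas1 iG'.
have E3 := integral21_prod_meas1 iG.
have iwt : mu.-integrable setT (EFin \o (fun x => w x * trunc_lap alpha v eps x)).
  have := integrable_fubini_F iG; rewrite (_ : fubini_F _ _ = EFin \o (fun x => w x * trunc_lap alpha v eps x))//.
  by apply/funext => x; rewrite /fubini_F /= innE.
under eq_Rintegral do rewrite FE.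
rewrite (RintegralD measurableT iG iG').
have S1 : \int[mu2]_z G z = \int[mu]_x (w x * trunc_lap alpha v eps x).
  rewrite /Rintegral -E1; congr fine; apply: eq_integral => x _; exact: innE.
have S2 : \int[mu2]_z G (z.2, z.1) = \int[mu2]_z G z.
  by rewrite /Rintegral -[in LHS]E2 -[in RHS]E3.
apply: etrans (congr2 +%R S1 (etrans S2 S1)) _.
rewrite -mulr2n -[LHS]mulr_natl; congr (2 * _); exact: (mesh_Rintegral iwt wt0).
Qed.

End truncation.

(** Limit of [truncated_form] along the radii 1 / (n + 1): the left side is dominated by the full
    integrand, the right side converges on each element by [trunc_lap_cvg]. The factor 2 of the
    symmetrisation cancels the 1/2 in the form. *)
Lemma green_formula : 0 < @Cda R d alpha ->
  aform alpha v w = \sum_(K <- T) \int[mu]_(x in (simplex K)°) (w x * fraclap alpha v x).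
Proof.
move=> c0; pose F z := (v z.1 - v z.2) * (w z.1 - w z.2) / frac_kernel alpha z.1 z.2.
have Hv : Hspace alpha v by have [] := VT_Htilde lipO alpha02 cT Vv.
have Hw' : Hspace alpha w by case: Hw.
have iF : mu2.-integrable setT (EFin \o F).
  rewrite (_ : EFin \o F = fun z => (increment alpha v z * increment alpha w z)%:E); last first.
    by apply/funext => z; rewrite incrementM.
  by apply: sqint_mul; [exact: measurableT|exact: Hspace_sqint|exact: Hspace_sqint].
pose chi n (z : 'rV[R]_d * 'rV[R]_d) : R := \1_[set r : R | n.+1%:R^-1 < r] (enorm (z.1 - z.2)).
have mF : measurable_fun setT F by apply/measurable_EFinP; case/integrableP: iF.
have mchi n : measurable_fun setT (chi n).
  apply: (measurableT_comp (f := (\1_[set r : R | n.+1%:R^-1 < r] : R -> R))).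
    apply: measurable_indic; rewrite (_ : mkset _ = `]n.+1%:R^-1, +oo[%classic); first exact: measurable_itv.
    by apply/seteqP; split=> u /=; rewrite in_itv/= andbT.
  by apply: measurable_enormB; [exact: measurable_fst|exact: measurable_snd].
have [||||_ _ cF] := @dominated_convergence _ _ R mu2 setT measurableT (fun n z => (chi n z * F z)%:E) (EFin \o F) (fun z => `|(EFin \o F) z|%E) _ _ _ (integrable_abse iF).
- by move=> n; apply/measurable_EFinP; exact: measurable_funM.
- exact/measurable_EFinP.
- apply/aeW => z _; have [zE|zN] := eqVneq z.1 z.2.
    have F0 : F z = 0 by rewrite /F zE subrr !mul0r.
    by rewrite /= F0; under eq_fun do rewrite mulr0; exact: cvg_cst.
  apply: cvg_near_cst; near=> n.
  rewrite /chi indicE mem_set ?mul1r//=.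
  by near: n; apply: (near_infty_natSinv_lt (PosNum _)); rewrite enorm_gt0// subr_eq0.
- apply/aeW => z n _; rewrite /= lee_fin normrM ler_piMl// /chi indicE; by case: (_ \in _); rewrite ?normr1 ?normr0.
have cT' : 2 * \sum_(K <- T) \int[mu]_(x in (simplex K)°) (w x * trunc_lap alpha v n.+1%:R^-1 x) @[n --> \oo] -->
    2 * \sum_(K <- T) (\int[mu]_(x in (simplex K)°) (w x * fraclap alpha v x) / @Cda R d alpha).
  apply: cvgM; first exact: cvg_cst.
  by apply: cvg_sum_seq => K KT; have [_] := trunc_lap_cvg KT c0.
have cF' : \int[mu2]_z (chi n z * F z) @[n --> \oo] --> \int[mu2]_z F z.
  apply: fine_cvg; rewrite fineK; last exact: integrable_fin_num.
  exact: cF.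
rewrite /aform -/(F _) (_ : \int[mu2]_z _ = \int[mu2]_z F z)//.
have <- : 2 * \sum_(K <- T) (\int[mu]_(x in (simplex K)°) (w x * fraclap alpha v x) / @Cda R d alpha) = \int[mu2]_z F z.
  apply: (cvg_unique (@norm_hausdorff _ R) cT').
  apply: cvg_trans cF'; apply: near_eq_cvg; near=> n.
  by rewrite /= (truncated_form _ iF)// invr_gt0.
rewrite -mulr_suml; field; exact: lt0r_neq0.
Unshelve. all: by end_near. Qed.

End green_formula.

Lemma powR_sqr (R : realType) (x a : R) : (x `^ a) ^+ 2 = x `^ (a * 2).
Proof. by rewrite -powR_mulrn ?powR_ge0// -powRrM. Qed.

(** * Reliability of the estimator *)

Section local_efficiency.
Context {R : realType} {d : nat} (alpha : R) (Omega : set 'rV[R]_d).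
Hypothesis lipO : bounded_lipschitz_domain Omega.
Hypothesis d0 : (0 < d)%N.
Hypothesis alpha02 : 0 < alpha < 2.
Local Notation mu := (@lebesgue_rV R d).
Variables (C L M : R).
Hypothesis C1 : 1 <= C.
Hypothesis L1 : 1 <= L.
Hypothesis M1 : 1 <= M.

Let a0 : 0 < alpha. Proof. by case/andP: alpha02. Qed.

(** Twice the exponent sigma of the weight, or 0 for alpha <= 1, so that the squared weight is
    h^(alpha - theta) times omega^theta. *)
Let theta : R := if alpha <= 1 then 0 else alpha - 1.

Let theta_bounds : 0 <= theta < 1 /\ theta < alpha.
Proof.
have /andP[b0 b2] := alpha02; rewrite /theta; case: (leP alpha 1) => h; split; try apply/andP; try split; lra.
Qed.

(** Up to a factor d + 1, the smallest barycentric coordinate to the power - theta, written as a sum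
    so that Hardy's inequality applies to each face. *)
Definition bary_weight K x : R := \sum_(i < d.+1) bary K x i `^ (- theta).

(** A point of the skeleton is not interior to [K], so some coordinate is nonpositive there. By the
    Lipschitz bound on the coordinates its distance to [x] is at least h / L times the smallest
    coordinate of [x]. *)
Lemma htilde_ge (T : mesh R d) K x : conforming_mesh Omega T -> K \in T -> shape_bounded C K ->
  (forall i x y, `|bary K x i - bary K y i| <= L / hK K * enorm (x - y)) -> (simplex K)° x ->
  L `^ (- theta) * hK K `^ alpha / bary_weight K x <= htilde alpha T K x ^+ 2.
Proof.
move=> cT KT [ndK h0 _ _] baryL Kx; have L0 : 0 < L by exact: lt_le_trans ltr01 L1.
have b0 := iffLR (simplex_interiorP ndK x) Kx.
have [i0 hi0] : exists i0, forall i, bary K x i0 <= bary K x i.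
  have [i _ hi] := @arg_minP _ _ _ ord0 xpredT (fun i => bary K x i) isT.
  by exists i => j; exact: hi.
have S0 : bary K x i0 `^ (- theta) <= bary_weight K x.
  by rewrite /bary_weight (bigD1 i0)//= lerDl sumr_ge0// => j _; exact: powR_ge0.
have p0 : 0 < bary K x i0 `^ (- theta) by exact: powR_gt0.
have Sp : 0 < bary_weight K x by exact: lt_le_trans S0.
apply: (@le_trans _ _ (L `^ (- theta) * hK K `^ alpha * bary K x i0 `^ theta)).
  rewrite ler_wpM2l ?mulr_ge0 ?powR_ge0//.
  have -> : bary K x i0 `^ theta = (bary K x i0 `^ (- theta))^-1 by rewrite powRN invrK.
  by rewrite lef_pV2 ?posrE.
rewrite /htilde; move: theta_bounds; rewrite /theta; case: (leP alpha 1) => a1 _.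
  by rewrite oppr0 !powRr0 mul1r mulr1 powR_sqr divfK.
have om : hK K / L * bary K x i0 <= omegaT T x.
  apply: lb_le_inf.
    by exists (inf [set enorm (x - z) | z in boundary (simplex K)]); exists K.
  move=> _ [K' K'T <-]; have ndK' : nondegenerate_simplex K' by case: cT => _ /(_ K' K'T)[].
  apply: lb_le_inf.
    have [j ji] : exists j : 'I_d.+1, j != ord0 by exists ord_max; rewrite -val_eqE/= -lt0n.
    exists (enorm (x - row ord0 K'.1)); exists (row ord0 K'.1) => //; apply/(simplex_boundaryP ndK'); split; first exact: simplex_row.
    by exists j; rewrite bary_vertex// eq_sym (negbTE ji).
  move=> _ [z /(simplex_boundaryP ndK')[K'z [j zj]] <-].
  have [i zi] : exists i, bary K z i <= 0.
    apply: contrapT => n; have Kz : (simplex K)° z.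
      by apply/(simplex_interiorP ndK) => i; rewrite ltNge; apply/negP => zi; apply: n; exists i.
    have KK' := mesh_interior_disjoint cT KT K'T Kz K'z.
    by have := iffLR (simplex_interiorP ndK z) Kz j; rewrite KK' zj ltxx.
  have := baryL i x z; have := ler_norm (bary K x i - bary K z i); have := hi0 i => h1 h2 h3.
  have h4 : bary K x i0 <= L / hK K * enorm (x - z) by lra.
  rewrite -(ler_pM2l (_ : 0 < L / hK K)) ?divr_gt0//; apply: le_trans h4.
  by rewrite mulrA; apply: eq_lew; field; rewrite !lt0r_neq0.
rewrite exprMn !powR_sqr.
have -> : (alpha / 2 - (alpha / 2 - 2^-1)) * 2 = 1 by field.
have -> : (alpha / 2 - 2^-1) * 2 = alpha - 1 by field.
rewrite powRr1 ?(ltW h0)//.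
apply: (@le_trans _ _ (hK K * (hK K / L * bary K x i0) `^ (alpha - 1))); last first.
  rewrite ler_pM2l//; apply: ge0_ler_powR; rewrite ?nnegrE ?subr_ge0 ?(ltW a1)//.
    by rewrite mulr_ge0 ?divr_ge0 ?(ltW h0) ?(ltW L0) ?(ltW (b0 _)).
  by apply: le_trans om; rewrite mulr_ge0 ?divr_ge0 ?(ltW h0) ?(ltW L0) ?(ltW (b0 _)).
rewrite !powRM ?invr_ge0 ?mulr_ge0 ?(ltW h0) ?(ltW L0) ?(ltW (b0 _)) ?divr_ge0 ?(ltW h0) ?(ltW L0)//.
rewrite -(powR_inv1 (ltW L0)) -powRrM mulN1r.
have -> : hK K `^ alpha = hK K * hK K `^ (alpha - 1).
  by rewrite -{2}(powRr1 (ltW h0)) -powRD ?(lt0r_neq0 h0) ?implybT// addrC subrK.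
  by apply: eq_lew; ring.
by rewrite invr_ge0 ltW.
Qed.

Lemma seminorm_from_shift K (w : 'rV[R]_d -> R) c : seminorm_from alpha K (fun x => w x - c) = seminorm_from alpha K w.
Proof. by apply: eq_integral => x _; apply: eq_integral => y _; rewrite opprB addrA subrK. Qed.

(** The reciprocal weight is a sum over faces, the interpolation error is bounded by a sum over
    vertices; each of the (d + 1)^2 products is an instance of Hardy's inequality for [w - W j]. *)
Lemma weighted_interpolation_error (Cq : R) : 0 < Cq -> exists2 CB : R, 0 < CB & forall K, shape_bounded C K ->
  forall (w chi : 'rV[R]_d -> R) (W : 'I_d.+1 -> R), measurable_fun setT w -> measurable_fun setT chi ->
  (forall x, simplex K x -> (w x - chi x) ^+ 2 <= \sum_i (w x - W i) ^+ 2) ->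
  (forall i, (\int[mu]_(x in simplex K) ((w x - W i) ^+ 2)%:E <= (Cq * hK K `^ alpha)%:E * seminorm_from alpha (simplex K) w)%E) ->
  (\int[mu]_(x in simplex K) ((L `^ (- theta) * hK K `^ alpha / bary_weight K x)^-1 * (w x - chi x) ^+ 2)%:E <=
    CB%:E * seminorm_from alpha (simplex K) w)%E.
Proof.
move=> Cq0; have C0 : 0 < C by exact: lt_le_trans ltr01 C1.
have [th01 tha] := theta_bounds; have [CH CH0 hardy] := hardy_simplex d0 a0 C0 th01 tha.
have Lt : 0 < L `^ (- theta) by rewrite powR_gt0// (lt_le_trans ltr01).
exists ((L `^ (- theta))^-1 * (d.+1%:R * (d.+1%:R * (CH * (Cq + 1))))).
  by rewrite !mulr_gt0 ?invr_gt0 ?ltr0n// addr_gt0.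
move=> K sK w chi W mw mchi hW1 hW2; have [ndK h0 _ _] := sK.
have mK : measurable (simplex K) by exact: measurable_simplex.
have ha : 0 < hK K `^ alpha by rewrite powR_gt0.
have S0 : (0 <= seminorm_from alpha (simplex K) w)%E.
  exact: seminorm_from_ge0.
have mb i : measurable_fun setT (fun x => bary K x i `^ (- theta)).
  by apply: (measurableT_comp (measurable_powR _)); exact: measurable_bary.
have mwW j : measurable_fun setT (fun x => w x - W j) by apply: measurable_funB => //.
pose c := (L `^ (- theta) * hK K `^ alpha)^-1; have c0 : 0 <= c by rewrite invr_ge0 mulr_ge0 ?powR_ge0.
pose f i j x := c * (bary K x i `^ (- theta) * (w x - W j) ^+ 2).
have f0 i j x : 0 <= f i j x by apply: mulr_ge0 c0 (mulr_ge0 (powR_ge0 _ _) (sqr_ge0 _)).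
have mf i j : measurable_fun (simplex K) (fun x => (f i j x)%:E).
  apply: measurable_funTS; apply/measurable_EFinP; apply: measurable_funM => //; apply: measurable_funM => //.
  exact: measurable_funX.
apply: (@le_trans _ _ (\int[mu]_(x in simplex K) (\sum_i \sum_j (f i j x)%:E))%E).
  apply: nonneg_le_integral => x Kx.
    rewrite lee_fin mulr_ge0 ?sqr_ge0// invr_ge0 divr_ge0 ?mulr_ge0 ?powR_ge0//.
    by apply: sumr_ge0 => i _; exact: powR_ge0.
  under eq_bigr do rewrite sumEFin.
  rewrite sumEFin lee_fin invfM invrK -/c -mulrA; under eq_bigr do rewrite -mulr_sumr -mulr_sumr.
  rewrite -mulr_sumr ler_wpM2l// -mulr_suml ler_wpM2l ?hW1//.
  by apply: sumr_ge0 => i _; exact: powR_ge0.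
rewrite ge0_integral_sum//; last 2 first.
- by move=> i; apply: emeasurable_sum.
- by move=> i x _; apply: sume_ge0 => j _; rewrite lee_fin.
have hij i j : (\int[mu]_(x in simplex K) (f i j x)%:E <= ((L `^ (- theta))^-1 * (CH * (Cq + 1)))%:E * seminorm_from alpha (simplex K) w)%E.
  under eq_integral do rewrite EFinM.
  rewrite ge0_integralZl//; last 2 first.
  - apply: measurable_funTS; apply/measurable_EFinP; apply: measurable_funM => //; exact: measurable_funX.
  - by move=> x _; rewrite lee_fin; apply: mulr_ge0 (powR_ge0 _ _) (sqr_ge0 _).
  apply: le_trans (lee_wpmul2l _ (hardy K sK i _ (mwW j))) _; first by rewrite lee_fin.
  rewrite seminorm_from_shift muleA -EFinM.
  apply: le_trans (lee_wpmul2l _ (leeD2r _ (hW2 j))) _; first by rewrite lee_fin mulr_ge0 ?(ltW CH0).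
  rewrite -ge0_muleDl ?lee_fin ?(ltW ha) ?mulr_ge0 ?(ltW Cq0) ?powR_ge0// -EFinD muleA -EFinM.
  apply: lee_wpmul2r => //; rewrite lee_fin /c; apply: eq_lew.
  by field; rewrite !lt0r_neq0.
apply: (@le_trans _ _ (\sum_(i < d.+1) \sum_(j < d.+1) ((L `^ (- theta))^-1 * (CH * (Cq + 1)))%:E * seminorm_from alpha (simplex K) w)%E).
  apply: lee_sum => i _; rewrite ge0_integral_sum//; last by move=> j x _; rewrite lee_fin.
  by apply: lee_sum => j _; exact: hij.
rewrite !sumr_const !card_ord.
have nm (n : nat) (a : R) (X : \bar R) : 0 <= a -> ((a%:E * X)%E *+ n)%R = ((n%:R * a)%:E * X)%E.
  move=> a1; elim: n => [|n IH]; first by rewrite mulr0n mul0r mul0e.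
  by rewrite mulrS IH -natr1 mulrDl mul1r addrC EFinD ge0_muleDl ?lee_fin ?mulr_ge0.
have cc : 0 <= (L `^ (- theta))^-1 * (CH * (Cq + 1)) by rewrite mulr_ge0 ?invr_ge0 ?powR_ge0 ?mulr_ge0 ?addr_ge0 ?ltW.
rewrite !nm ?(mulr_ge0 _ cc)//; apply: lee_wpmul2r => //; rewrite lee_fin; apply: eq_lew; ring.
Qed.

End local_efficiency.

Section reliability.
Context {R : realType} {d : nat} (alpha : R) (Omega : set 'rV[R]_d).
Hypothesis lipO : bounded_lipschitz_domain Omega.
Hypothesis d0 : (0 < d)%N.
Hypothesis alpha02 : 0 < alpha < 2.
Local Notation mu := (@lebesgue_rV R d).
Local Notation mu2 := (mu \x mu)%E.

Let a0 : 0 < alpha. Proof. by case/andP: alpha02. Qed.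

(** A quadratic inequality in [t], hence a discriminant condition. Young's inequality can thus be
    summed over the elements with one common parameter, which is optimised only afterwards. *)
Lemma young_optimal (X E B : R) : 0 <= E -> 0 <= B -> (forall t : R, 0 < t -> X <= t / 2 * E + (2 * t)^-1 * B) ->
  X <= Num.sqrt E * Num.sqrt B.
Proof.
move=> E0 B0 h; have [X0|X0] := leP X 0; first by rewrite (le_trans X0)// mulr_ge0 ?sqrtr_ge0.
rewrite -sqrtrM// -[leLHS](ger0_norm (ltW X0)) -sqrtr_sqr; apply: ler_wsqrtr.
rewrite -sqrrN mulrC; apply: quad_form_CS => // t; have [t0|t0] := leP t 0.
  by have := mulr_ge0 (sqr_ge0 t) E0; nra.
have := h t t0; rewrite -(ler_pM2l (_ : 0 < 2 * t)) ?mulr_gt0// mulrDr mulrA mulVKf ?lt0r_neq0 ?mulr_gt0//.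
have -> : 2 * t * (t / 2) = t ^+ 2 by field.
lra.
Qed.

(** For [d >= 2] comparability of the sizes at a vertex is [star_comparable]; in dimension 1, where
    neighbouring intervals share just a point, it is the ratio bound contained in [mesh_class]. *)
Lemma mesh_constants (kappa : R) : exists C L M : R, [/\ 1 <= C, 1 <= L, 1 <= M & forall T0 T : mesh R d,
  conforming_mesh Omega T0 -> mesh_class Omega kappa T0 T ->
  [/\ forall K, K \in T -> shape_bounded C K,
      forall K, K \in T -> forall i x y, `|bary K x i - bary K y i| <= L / hK K * enorm (x - y) &
      forall K K' i i', K \in T -> K' \in T -> row i K.1 = row i' K'.1 -> hK K <= M * hK K']].
Proof.
have [C0 C00 hC] := @refinement_shape_regular R d d0 kappa.
pose C := C0 + 1; have C1 : 1 <= C by rewrite lerDr ltW.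
have Cp : 0 < C by exact: lt_le_trans C1.
have [L0 L00 hL] := bary_lipschitz d0 Cp.
pose L := L0 + 1; have L1 : 1 <= L by rewrite lerDr ltW.
have Lp : 0 < L by exact: lt_le_trans L1.
pose N := Num.bound ((4 * C) ^+ d).
have hN : (4 * C) ^+ d < N%:R.
  by have := archi_boundP (exprn_ge0 d (mulr_ge0 (ler0n R 4) (ltW Cp))).
have LC1 : 1 <= L * C by apply: le_trans L1 _; rewrite ler_peMr// ltW.
exists C, L, ((L * C) ^+ N + `|kappa|); split=> //.
  by apply: le_trans (exprn_ege1 N LC1) _; rewrite lerDl.
move=> T0 T cT0 [cT sr ref qu].
have sT K : K \in T -> shape_bounded C K.
  move=> KT; have [//|n h m di] := hC T0 T _ sr ref K KT; first by case: cT0.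
  split=> // x z Kx Kz; apply: le_trans (di x z Kx Kz) _.
  by rewrite ler_wpM2r ?(ltW h)// lerDl.
have bL K : K \in T -> forall i x y, `|bary K x i - bary K y i| <= L / hK K * enorm (x - y).
  move=> KT i x y; have [_ h _ _] := sT K KT; apply: le_trans (hL K (sT K KT) i x y) _.
  by rewrite ler_wpM2r ?enorm_ge0// ler_wpM2r ?invr_ge0 ?(ltW h)// lerDl.
split=> // K K' i i' KT K'T zE; have [_ h' _ _] := sT K' K'T.
have [d2|d1] := ltnP 1 d.
  apply: le_trans (star_comparable lipO d0 cT C1 sT Lp bL d2 LC1 hN KT K'T zE) _.
  by rewrite ler_wpM2r ?(ltW h')// lerDl.
have dE : d = 1%N by apply/eqP; rewrite eqn_leq d1 d0.
apply: le_trans (qu dE K K' KT K'T _) _.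
  by exists (row i K.1); split; [exact: simplex_row|rewrite zE; exact: simplex_row].
rewrite ler_wpM2r ?(ltW h')// (le_trans (ler_norm _))// lerDr exprn_ge0// mulr_ge0 ?ltW//.
Qed.

Lemma sum_seminorm_le (T : mesh R d) (w : 'rV[R]_d -> R) : conforming_mesh Omega T -> measurable_fun setT w ->
  (\sum_(K <- T) seminorm_from alpha (simplex K) w <= \int[mu2]_z ((increment alpha w z) ^+ 2)%:E)%E.
Proof.
move=> cT mw; pose f x := (\int[mu]_y ((w x - w y) ^+ 2 / frac_kernel alpha x y)%:E)%E.
have f0 x : (0 <= f x)%E by exact: slice_increment_ge0.
have mf : measurable_fun setT f := measurable_integral_snd (measurable_pair_increment alpha mw) (@pair_increment_ge0 R d alpha w).
have uT : uniq T by case: cT.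
have mi (K : tsimplex R d) : measurable (simplex K)° by exact: measurable_simplex_interior.
have -> : (\int[mu2]_z ((increment alpha w z) ^+ 2)%:E = \int[mu]_x f x)%E.
  rewrite fubini_tonelli1.
  - by apply: eq_integral => x _; apply: eq_integral => y _; rewrite expr2 incrementM expr2.
  - by apply/measurable_EFinP; apply: measurable_funX; exact: measurable_increment.
  - by move=> z; rewrite lee_fin sqr_ge0.
apply: (@le_trans _ _ (\sum_(K <- T) \int[mu]_(x in (simplex K)°) f x)%E).
  rewrite big_seq [leRHS]big_seq; apply: lee_sum => K KT.
  have ndK : nondegenerate_simplex K by case: cT => _ /(_ K KT)[].
  have mD : measurable (simplex K `\` (simplex K)°) by apply: measurableD; [exact: measurable_simplex|exact: mi].
  rewrite /seminorm_from -/f -{1}(setDUK (@interior_subset _ (simplex K))).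
  apply: (@le_trans _ _ (\int[mu]_(x in (simplex K)°) f x + \int[mu]_(x in simplex K `\` (simplex K)°) f x)%E).
    apply: (@ge0_integral_setU_le _ _ R mu _ _ f (mi K) mD) => [|x _]; [exact: measurable_funTS|exact: f0].
  rewrite [X in (_ + X)%E](_ : _ = 0%E) ?adde0//.
  by apply: null_set_integral => //; [exact: measurable_funTS|exact: simplex_interior_conull].
rewrite -(ge0_integral_bigsetU mu mi uT (mesh_trivIset cT)) => [|//|//].
  by apply: ge0_subset_integral => //; apply: bigsetU_measurable => K _.
exact: measurable_funTS.
Qed.

Lemma Hnorm_increment (w : 'rV[R]_d -> R) : Htilde alpha Omega w -> 0 < @Cda R d alpha ->
  (\int[mu2]_z ((increment alpha w z) ^+ 2)%:E = (2 / @Cda R d alpha * Hnorm alpha w ^+ 2)%:E)%E.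
Proof.
move=> [Hw _] c0; rewrite (Hnorm_sqr a0) aform_ip -(EFin_ip (Hspace_sqint Hw)).
by congr EFin; field; exact: lt0r_neq0.
Qed.

Lemma reliability_estimate (kappa : R) : exists CI : R, 0 < CI /\ (0 < @Cda R d alpha -> forall (T0 T : mesh R d),
  conforming_mesh Omega T0 -> mesh_class Omega kappa T0 T -> forall g v w, L2 Omega g -> VT Omega T v ->
  (forall chi, VT Omega T chi -> aform alpha v chi = inner Omega g chi) -> Htilde alpha Omega w ->
  forall E : R, 0 <= E ->
  (\sum_(K <- T) weighted_residual alpha T K (fun x => g x - fraclap alpha v x)%R <= E%:E)%E ->
  inner Omega g w - aform alpha v w <= CI * Num.sqrt E * Hnorm alpha w).
Proof.
have [C [L [M [C1 L1 M1 hT]]]] := mesh_constants kappa.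
have [Cq Cq0 hq] := quasi_interpolation a0 lipO d0 C1 M1.
have [CB CB0 hB] := weighted_interpolation_error d0 alpha02 C1 L1 Cq0.
(* The absolute value lets the constant be named before [Cda > 0] is assumed; adding 1 makes it
   positive. *)
exists (Num.sqrt (CB * (2 / `|@Cda R d alpha|)) + 1); split; first by rewrite ltr_wpDl// sqrtr_ge0.
move=> c0 T0 T cT0 mT g v w Lg Vv gal Hw E E0 hE.
have cT : conforming_mesh Omega T by case: mT.
have [sT bL comp] := hT T0 T cT0 mT.
have mO := domain_measurable lipO.
have Lw : L2 setT w by case: Hw => /HspaceP[].
have w0 : {ae mu, forall x, ~ closure Omega x -> w x = 0} by case: Hw.
have mw : measurable_fun setT w by case: Lw.
have [chi Vchi [W hW]] := hq T cT sT comp w Lw w0.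
have Hchi := VT_Htilde lipO alpha02 cT Vchi; have Hv := VT_Htilde lipO alpha02 cT Vv.
have mchi : measurable_fun setT chi by case: Hchi => /HspaceP[[]].
pose e := w \- chi.
have He : Htilde alpha Omega e by exact: HtildeB.
have Le : L2 setT e by case: He => /HspaceP[].
have me : measurable_fun setT e by case: Le.
have e0 : {ae mu, forall x, ~ closure Omega x -> e x = 0} by case: He.
have LO f : L2 setT f -> sqint mu Omega f by move=> Lf; apply: (@L2_subset R d Omega setT).
have Lchi : L2 setT chi by case: Hchi => /HspaceP[].
have -> : inner Omega g w - aform alpha v w = inner Omega g e - aform alpha v e.
  rewrite (aformBr (proj1 Hw) (proj1 Hchi) (proj1 Hv)) (gal chi Vchi).
  have -> : inner Omega g e = inner Omega g w - inner Omega g chi.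
    by rewrite -![inner Omega g _]/(ip mu Omega g _) ipC ipBl ?[ip _ _ _ g]ipC//; exact: LO.
  by ring.
pose r x := g x - fraclap alpha v x.
have igO : mu.-integrable Omega (fun x => (g x * e x)%:E) by apply: sqint_mul => //; exact: LO.
have KO K x : K \in T -> (simplex K)° x -> Omega x by exact: mesh_interior_sub.
have mi (K : tsimplex R d) : measurable (simplex K)° by exact: measurable_simplex_interior.
have igK K : K \in T -> mu.-integrable (simplex K)° (EFin \o (fun x => g x * e x)).
  by move=> KT; apply: (integrableS mO (mi K) _ igO) => x; exact: KO.
have ifK K : K \in T -> mu.-integrable (simplex K)° (EFin \o (fun x => e x * fraclap alpha v x)).
  by move=> KT; have [] := trunc_lap_cvg lipO d0 alpha02 cT Vv He KT c0.
have E1 : inner Omega g e = \sum_(K <- T) \int[mu]_(x in (simplex K)°) (g x * e x).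
  rewrite /inner Rintegral_mkcond (mesh_Rintegral d0 cT).
  - rewrite big_seq [RHS]big_seq; apply: eq_bigr => K KT; apply: eq_Rintegral => x; rewrite inE => Kx.
    by rewrite patchE mem_set//; exact: KO KT Kx.
  - have := iffLR (integrable_mkcond _ mO) igO; congr (integrable _ _ _).
    by apply/funext => x; rewrite /= !patchE; case: ifP.
  - by apply: filterS e0 => x hx nC; rewrite patchE; case: ifP => // _; rewrite hx// mulr0.
have E2 := green_formula lipO d0 alpha02 cT Vv He c0.
have E3 : inner Omega g e - aform alpha v e = \sum_(K <- T) \int[mu]_(x in (simplex K)°) (r x * e x).
  rewrite E1 E2 -sumrB big_seq [RHS]big_seq; apply: eq_bigr => K KT.
  rewrite -(RintegralB (mi K) (igK K KT) (ifK K KT)); apply: eq_Rintegral => x _.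
  by rewrite /r; ring.
pose S := 2 / @Cda R d alpha * Hnorm alpha w ^+ 2.
have S0 : 0 <= S by rewrite mulr_ge0 ?sqr_ge0// divr_ge0// ltW.
have semS : (\sum_(K <- T) seminorm_from alpha (simplex K) w <= S%:E)%E.
  by rewrite -(Hnorm_increment Hw c0); exact: sum_seminorm_le.
pose P (K : tsimplex R d) x := L `^ (- (if alpha <= 1 then 0 else alpha - 1)) * hK K `^ alpha / bary_weight alpha K x.
have CBS : 0 <= CB * S by rewrite mulr_ge0// ltW.
have key : inner Omega g e - aform alpha v e <= Num.sqrt E * Num.sqrt (CB * S).
  (* On each element r e <= (t / 2) P r^2 + (2 t)^(-1) P^(-1) e^2, with [P] the lower bound of the
     squared weight. The first term is controlled by the estimator, the second by
     [weighted_interpolation_error]. *)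
  apply: young_optimal => // t t0; rewrite E3 -lee_fin.
  have t20 : 0 <= (2 * t)^-1 by rewrite invr_ge0 mulr_ge0// ltW.
  apply: (@le_trans _ _ (\sum_(K <- T) ((t / 2)%:E * weighted_residual alpha T K r + ((2 * t)^-1)%:E * (CB%:E * seminorm_from alpha (simplex K) w)))%E).
    rewrite -sumEFin big_seq [leRHS]big_seq; apply: lee_sum => K KT.
    have [hW1 hW2] := hW K KT; have sK := sT K KT; have [ndK h0 _ _] := sK.
    have mg : measurable_fun (simplex K)° g.
      by case: Lg => mg _; apply: (measurable_funS mO) mg => x; exact: KO.
    have mr : measurable_fun (simplex K)° r.
      by apply: measurable_funB => //; exact: (measurable_fraclap lipO alpha02 cT Vv KT).
    have mP : measurable_fun setT (bary_weight alpha K).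
      by apply: measurable_sum => i; apply: (measurableT_comp (measurable_powR _)); exact: measurable_bary.
    have Pp x : (simplex K)° x -> 0 < P K x.
      move=> Kx; have b0 := iffLR (simplex_interiorP ndK x) Kx.
      have wp : 0 < bary_weight alpha K x.
        by rewrite /bary_weight big_ord_recl ltr_wpDr ?powR_gt0// sumr_ge0// => i _; exact: powR_ge0.
      exact: divr_gt0 (mulr_gt0 (powR_gt0 _ (lt_le_trans ltr01 L1)) (powR_gt0 _ h0)) wp.
    have mPK : measurable_fun (simplex K)° (P K).
      apply: measurable_funTS; apply: measurable_funM => //.
      apply: (eq_measurable_fun (fun x => bary_weight alpha K x `^ (-1))) => [x _|].
        by rewrite powR_inv1// sumr_ge0// => i _; exact: powR_ge0.
      exact: (measurableT_comp (measurable_powR _) mP).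
    have mre : measurable_fun (simplex K)° (fun x => (r x * e x)%:E).
      by apply/measurable_EFinP; apply: measurable_funM => //; exact: measurable_funTS.
    have ire : mu.-integrable (simplex K)° (fun x => (r x * e x)%:E).
      have := integrableB (mi K) (igK K KT) (ifK K KT); congr (integrable _ _ _).
      by apply/funext => x; rewrite /= -EFinB /r; congr EFin; ring.
    have n1 x : (simplex K)° x -> 0 <= P K x * r x ^+ 2 by move=> Kx; exact: mulr_ge0 (ltW (Pp x Kx)) (sqr_ge0 _).
    have n2 x : (simplex K)° x -> 0 <= (P K x)^-1 * e x ^+ 2.
      by move=> Kx; apply: mulr_ge0 (sqr_ge0 _); rewrite invr_ge0 ltW// Pp.
    have m1 : measurable_fun (simplex K)° (fun x => (P K x * r x ^+ 2)%:E).
      by apply/measurable_EFinP; apply: measurable_funM => //; exact: measurable_funX.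
    have mPi : measurable_fun setT (fun x => (P K x)^-1).
      rewrite (_ : (fun x => _) = (fun x => (L `^ (- (if alpha <= 1 then 0 else alpha - 1)) * hK K `^ alpha)^-1 * bary_weight alpha K x)).
        exact: measurable_funM.
      by apply/funext => x; rewrite /P invfM invrK.
    have m2 : measurable_fun setT (fun x => ((P K x)^-1 * e x ^+ 2)%:E).
      by apply/measurable_EFinP; apply: measurable_funM => //; exact: measurable_funX.
    rewrite [leLHS]fineK; last by apply: integrable_fin_num.
    apply: (@le_trans _ _ (\int[mu]_(x in (simplex K)°) ((t / 2)%:E * (P K x * r x ^+ 2)%:E + ((2 * t)^-1)%:E * ((P K x)^-1 * e x ^+ 2)%:E))%E).
      apply: le_trans (lee_abs _) _; apply: le_trans (le_abse_integral _ (mi K) mre) _.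
      apply: nonneg_le_integral => // x Kx; rewrite -!EFinM -EFinD abse_EFin lee_fin.
      have := Pp x Kx; move: (P K x) (r x) (e x) => p a b p0.
      have tp : 0 < t * p by rewrite mulr_gt0.
      have -> : t / 2 * (p * a ^+ 2) + (2 * t)^-1 * (p^-1 * b ^+ 2) = (2 * (t * p))^-1 * ((t * p * `|a|) ^+ 2 + `|b| ^+ 2).
        by rewrite exprMn !real_normK ?num_real//; field; rewrite !lt0r_neq0.
      rewrite normrM ler_pdivlMl ?mulr_gt0//.
      have := sqr_ge0 (t * p * `|a| - `|b|); nra.
    rewrite ge0_integralD//; last 4 first.
    - by move=> x Kx; rewrite -EFinM lee_fin mulr_ge0 ?n1// divr_ge0// ltW.
    - exact: measurable_funeM.
    - by move=> x Kx; rewrite -EFinM lee_fin mulr_ge0 ?n2.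
    - by apply: measurable_funTS; exact: measurable_funeM.
    apply: leeD; rewrite ge0_integralZl//; try by rewrite lee_fin// divr_ge0// ltW.
    - apply: lee_wpmul2l; first by rewrite lee_fin divr_ge0// ltW.
      apply: nonneg_le_integral => x Kx; first by rewrite lee_fin n1.
      rewrite lee_fin exprMn; apply: ler_wpM2r; first exact: sqr_ge0.
      exact: (htilde_ge d0 alpha02 L1 cT KT sK (bL K KT) Kx).
    - apply: lee_wpmul2l; first by rewrite lee_fin.
      apply: le_trans (hB K sK w chi (fun i => W (row i K.1)) mw mchi hW1 hW2).
      apply: ge0_subset_integral => //; [exact: measurable_simplex|exact: measurable_funTS| |exact: interior_subset].
      move=> x Kx; rewrite lee_fin; apply: mulr_ge0 (sqr_ge0 _).
      rewrite invr_ge0 divr_ge0 ?mulr_ge0 ?powR_ge0//; apply: sumr_ge0 => i _; exact: powR_ge0.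
    - exact: measurable_funTS.
  have sem0 K : (0 <= seminorm_from alpha (simplex K) w)%E.
    exact: seminorm_from_ge0.
  have wr0 K : (0 <= weighted_residual alpha T K r)%E by exact: weighted_residual_ge0.
  rewrite big_split/= -!ge0_sume_distrr//; last by move=> K _; rewrite mule_ge0// lee_fin ltW.
  rewrite EFinD (EFinM (t / 2)) (EFinM (2 * t)^-1) (EFinM CB); apply: leeD.
    by apply: lee_wpmul2l; [rewrite lee_fin divr_ge0// ltW|exact: hE].
  apply: lee_wpmul2l; first by rewrite lee_fin.
  by apply: lee_wpmul2l; [rewrite lee_fin ltW|exact: semS].
apply: (le_trans key).
have q0 : 0 <= CB * (2 / `|@Cda R d alpha|) by exact: mulr_ge0 (ltW CB0) (divr_ge0 (ler0n _ 2) (normr_ge0 _)).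
have -> : Num.sqrt (CB * S) = Num.sqrt (CB * (2 / `|@Cda R d alpha|)) * Hnorm alpha w.
  have -> : CB * S = CB * (2 / `|@Cda R d alpha|) * Hnorm alpha w ^+ 2 by rewrite /S (gtr0_norm c0) !mulrA.
  by rewrite (sqrtrM _ q0) sqrtr_sqr (ger0_norm (Hnorm_ge0 _ _)).
move: (Num.sqrt (CB * (2 / `|@Cda R d alpha|))) (sqrtr_ge0 E) (Hnorm_ge0 alpha w) => s.
move: (Num.sqrt E) (Hnorm alpha w) => t h t0 h0.
rewrite mulrCA mulrA -subr_ge0 (_ : _ - _ = t * h); last by ring.
exact: mulr_ge0.
Qed.

End reliability.

(** * Quasi-orthogonality *)

Theorem theorem5p4 (R : realType) (d : nat) (Omega : set 'rV[R]_d)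
    (alpha Cst Cad : R) :
  (0 < d)%N -> bounded_lipschitz_domain Omega ->
  0 < alpha < 2 -> 0 < Cst -> 0 < Cad ->
  (* Corth is a function of the shape regularity of the initial mesh *)
  exists Corth : R -> R, (forall kappa, 0 < Corth kappa) /\
  forall (gamma beta ua ub : R) (f yd : 'rV[R]_d -> R),
  0 < gamma -> 0 < beta -> ua < 0 -> 0 < ub -> L2 Omega f -> L2 Omega yd ->
  exists C : R, 0 < C /\
  forall kappa : R,
  exists hmax : R, 0 < hmax /\
  forall T : nat -> mesh R d,
  meshsize (T 0%N) <= hmax ->
  (forall k, mesh_class Omega kappa (T 0%N) (T k)) ->
  (forall k, refinement (T k) (T k.+1)) ->
  forall y p u lambda : 'rV[R]_d -> R,
  optimality_system alpha Omega gamma beta ua ub f yd (Htilde alpha Omega)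
    y p u lambda ->
  forall yT pT uT lambdaT : nat -> 'rV[R]_d -> R,
  (forall k, optimality_system alpha Omega gamma beta ua ub f yd
               (VT Omega (T k)) (yT k) (pT k) (uT k) (lambdaT k)) ->
  forall l N : nat,
  ((\sum_(l <= k < N.+1)
      (Hnorm alpha (yT k \- yT k.+1) ^+ 2 + Hnorm alpha (pT k \- pT k.+1) ^+ 2
       - 2 * C * Theta alpha Omega (T 0%N) ^+ 2
         * (Hnorm alpha (y \- yT k) ^+ 2 + Hnorm alpha (p \- pT k) ^+ 2)))%:E
   <= (Corth kappa)%:E *
      estimator_sq alpha Cst Cad f yd (uT l) (yT l) (pT l) (T l))%E.
Proof.
move=> d0 lipO alpha02 Cst0 Cad0; have /andP[alpha0 _] := alpha02.
have bO : bounded_set Omega by case: lipO.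
have mO : measurable Omega by exact: domain_measurable.
have VT_zero (T : mesh R d) : conforming_mesh Omega T -> VT Omega T (fun=> 0).
  move=> cT; apply: (P1_VT lipO d0 cT) => // K _; exists 0, 0 => x _.
  by rewrite dotpC dotp0r addr0.
have [CI hCI] := choice (reliability_estimate lipO d0 alpha02).
have CI0 kappa : 0 < CI kappa by case: (hCI kappa).
have rel kappa := (hCI kappa).2.
pose mC := Num.min Cst Cad.
have mC0 : 0 < mC by rewrite lt_min Cst0.
(* The sum is at most [2 * e l], the error [e l] at most 4 CI^2 times the two unweighted residual
   sums, and these together at most the estimator divided by [mC]. *)
exists (fun k => 8 * CI k ^+ 2 / mC); split.
  by move=> k; rewrite divr_gt0// mulr_gt0// exprn_gt0.
move=> gamma beta ua ub f yd g0 b0 ua0 ub0 Lf Lyd.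
(* If [Cda] were 0, all energy norms would vanish and the claim would say that the estimator is
   nonnegative. *)
have := Cda_ge0 (d := d) alpha0; rewrite le_eqVlt => /orP[/eqP Cz|C0].
  exists 1; split=> // kappa; exists 1; split=> // T _ _ _ y p u la _ yT pT uT laT _ l N.
  have z (v : 'rV[R]_d -> R) : Hnorm alpha v = 0 by rewrite /Hnorm aform_ip -Cz !mul0r sqrtr0.
  rewrite big1 => [|k _]; last by rewrite !z expr0n/= addr0 mulr0 subrr.
  by rewrite mule_ge0 ?estimator_ge0 ?(ltW Cst0) ?(ltW Cad0)// lee_fin divr_ge0 ?mulr_ge0 ?sqr_ge0// ltW.
have [P P0 PP] := normL2_poincare d0 alpha0 bO mO C0.
pose A := 2 * P ^+ 2 * L2_const gamma P.
have Lc : 0 < L2_const gamma P.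
  rewrite /L2_const mulr_gt0//; first by rewrite exprn_gt0// addr_gt0// invr_gt0.
  by rewrite !ltr_wpDr// mulr_ge0// ?sqr_ge0// exprn_ge0// ltW.
have A0 : 0 < A by rewrite /A mulr_gt0// mulr_gt0// exprn_gt0.
pose Q := quasi_const gamma P.
have Q0 : 0 <= Q.
  rewrite /Q /quasi_const.
  have P2 := sqr_ge0 P; have G0 : 0 <= gamma^-1 by rewrite invr_ge0 ltW.
  have P4 : 0 <= P ^+ 4 by rewrite exprn_ge0// ltW.
  have PG := mulr_ge0 P2 G0.
  have u1 : 0 <= 2 * P ^+ 2 / gamma + 3 * P ^+ 2 by rewrite -mulrA; lra.
  have u2 : 0 <= 4 * P ^+ 2 / gamma + 6 * P ^+ 2 + 2 by rewrite -mulrA; lra.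
  by have := mulr_ge0 u1 u2; lra.
pose C := A * (2 + 2 * Q).
have C1 : A <= C by rewrite /C ler_peMr ?ltW//; lra.
exists C; split; first exact: lt_le_trans C1.
move=> kappa; exists 1; split=> // T _ Tcl Tref y p u la sol yT pT uT laT solT l N.
pose e k := Hnorm alpha (y \- yT k) ^+ 2 + Hnorm alpha (p \- pT k) ^+ 2.
pose r k := Hnorm alpha (yT k \- yT k.+1) ^+ 2 + Hnorm alpha (pT k \- pT k.+1) ^+ 2.
pose Th := Theta alpha Omega (T 0%N).
have e0 k : 0 <= e k by rewrite addr_ge0// sqr_ge0.
have Tconf k : conforming_mesh Omega (T k) by case: (Tcl k).
have VH k := VT_Htilde lipO alpha02 (Tconf k).
have Vsub k : VT Omega (T k) `<=` VT Omega (T k.+1) by exact: VT_refinement.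
have V0k k : VT Omega (T 0%N) `<=` VT Omega (T k).
  by elim: k => // k IH v /IH; exact: Vsub.
have Vy k : VT Omega (T k) (yT k) by case: (solT k) => -[].
have Vp k : VT Omega (T k) (pT k) by case: (solT k) => -[].
have Th0 : 0 <= Th by apply: sup_nonneg => _ [g [_ _ ->]]; apply: inf_nonneg => _ [chi _ <-]; exact: sqrtr_ge0.
have dual k (w : 'rV[R]_d -> R) : Htilde alpha Omega w -> (forall chi, VT Omega (T k) chi -> aform alpha w chi = 0) -> normL2 Omega w <= Th * Hnorm alpha w.
  move=> Hw wV; apply: (sup_inf_duality d0 alpha0 bO mO C0 P0 PP (VH 0%N) (VT_zero _ (Tconf 0%N)) erefl Hw).
  by move=> chi Vc; apply: wV; exact: V0k.
have L2e k : normL2 Omega (u \- uT k) ^+ 2 + normL2 Omega (y \- yT k) ^+ 2 <= L2_const gamma P * Th ^+ 2 * e k.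
  exact: (L2_error_le d0 alpha0 bO mO C0 P0 PP g0 b0 Lf Lyd sol (VH k) (solT k) Th0 (dual k)).
have step k : r k <= 2 * (e k - e k.+1) + 2 * A * Th ^+ 2 * e k.+1.
  have := level_step alpha0 mO PP Lf Lyd sol (VH k.+1) (solT k.+1) (VT_sub lipO (Vsub k _ (Vy k)) (Vy k.+1)) (VT_sub lipO (Vsub k _ (Vp k)) (Vp k.+1)) (VH k _ (Vy k)) (VH k _ (Vp k)).
  move=> /le_trans; apply; rewrite lerD2l /A.
  have -> : 2 * (2 * P ^+ 2 * L2_const gamma P) * Th ^+ 2 * e k.+1 = 4 * P ^+ 2 * (L2_const gamma P * Th ^+ 2 * e k.+1) by ring.
  by apply: ler_wpM2l; [rewrite mulr_ge0 ?sqr_ge0|exact: L2e].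
have quasi k : e k.+1 <= Q * e k.
  exact: (quasi_optimal alpha0 mO P0 PP g0 b0 Lf Lyd sol (VH k.+1) (solT k.+1) (VT_sub lipO (Vy k.+1) (Vsub k _ (Vy k))) (VT_sub lipO (Vp k.+1) (Vsub k _ (Vp k))) (VH k _ (Vy k)) (VH k _ (Vp k))).
have Th2 := sqr_ge0 Th.
have rhs0 : (0 <= (8 * CI kappa ^+ 2 / mC)%:E * estimator_sq alpha Cst Cad f yd (uT l) (yT l) (pT l) (T l))%E.
  by rewrite mule_ge0 ?estimator_ge0 ?(ltW Cst0) ?(ltW Cad0)// lee_fin divr_ge0 ?mulr_ge0 ?sqr_ge0// ltW.
rewrite (eq_bigr (fun k => r k - 2 * C * Th ^+ 2 * e k)); last by [].
have [Abig|Asmall] := ltP 1 (2 * A * Th ^+ 2).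
  apply: le_trans rhs0; rewrite lee_fin; apply: sumr_le0 => k _.
  have := step k; have := quasi k; have := e0 k; have := e0 k.+1.
  set x := e k; set x' := e k.+1; set t := 2 * A * Th ^+ 2 in Abig *.
  have -> : 2 * C * Th ^+ 2 * x = t * ((2 + 2 * Q) * x) by rewrite /C /t; ring.
  move=> x'0 x0 qx st.
  have : t * x' <= t * (Q * x) by apply: ler_wpM2l => //; lra.
  have tx : x <= t * x by rewrite ler_peMl// ltW.
  have -> : t * ((2 + 2 * Q) * x) = 2 * (t * x) + 2 * (t * (Q * x)) by ring.
  have t0 : 0 <= t by rewrite ltW// (lt_trans _ Abig).
  have tq : 0 <= t * (Q * x) by apply: mulr_ge0 => //; apply: mulr_ge0.
  by move: x0 x'0 qx st tx tq; clear; lra.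
have esum : \sum_(l <= k < N.+1) (r k - 2 * C * Th ^+ 2 * e k) <= 2 * e l.
  have [lN|Nl] := leqP N.+1 l; first by rewrite big_geq// mulr_ge0.
  (* Since [C >= A], the term subtracted at level [k] compensates the perturbation at level [k.+1]
     up to a difference that telescopes. *)
  have tel : \sum_(l <= k < N.+1) (r k - 2 * C * Th ^+ 2 * e k) <=
      \sum_(l <= k < N.+1) ((- (2 - 2 * A * Th ^+ 2)) * (e k.+1 - e k)).
    apply: ler_sum => k _; have := step k; have := e0 k; have := e0 k.+1.
    move=> x'0 x0 st.
    have : 2 * A * Th ^+ 2 * e k <= 2 * C * Th ^+ 2 * e k.
      by rewrite ler_wpM2r// ler_wpM2r// ler_wpM2l.
    by move: st; clear; lra.
  apply: (le_trans tel); rewrite -mulr_sumr telescope_sumr; last exact: ltnW.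
  have := e0 l; have := e0 N.+1; have : 0 <= 2 * A * Th ^+ 2 by apply: mulr_ge0 => //; apply: mulr_ge0 => //; exact: ltW.
  move: Asmall; set t := 2 * A * _ => t1 t0 x x'.
  have : 0 <= t * e l by rewrite mulr_ge0.
  have : 0 <= (2 - t) * e N.+1 by rewrite mulr_ge0// subr_ge0 (le_trans t1)// ler1n.
  by clear; lra.
apply: le_trans (_ : (2 * e l)%:E <= _)%E; first by rewrite lee_fin.
move: rhs0; rewrite /estimator_sq.
have [Ey EyE] := exists_eq (fun K : tsimplex R d => weighted_residual alpha (T l) K (fun x => f x + uT l x - fraclap alpha (yT l) x)%R).
have [Ep EpE] := exists_eq (fun K : tsimplex R d => weighted_residual alpha (T l) K (fun x => yT l x - yd x - fraclap alpha (pT l) x)%R).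
rewrite (eq_bigr (fun K => Cst%:E * Ey K + Cad%:E * Ep K)%E); last by move=> K _; rewrite EyE EpE.
set S := (\sum_(K <- T l) _)%E => rhs0.
have Ey0 K : (0 <= Ey K)%E by rewrite EyE; exact: weighted_residual_ge0.
have Ep0 K : (0 <= Ep K)%E by rewrite EpE; exact: weighted_residual_ge0.
have S1 : (mC%:E * (\sum_(K <- T l) Ey K + \sum_(K <- T l) Ep K) <= S)%E.
  exact: (@min_weight_sum_le R _ (T l) Ey Ep Cst Cad Cst0 Cad0 Ey0 Ep0).
have CC0 : 0 < 8 * CI kappa ^+ 2 / mC by rewrite divr_gt0// mulr_gt0// exprn_gt0.
(* An infinite estimator makes the bound trivial; otherwise both residual sums are real numbers [a]
   and [b], as [reliability_estimate] requires. *)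
have [Soo|Sfin] := eqVneq S +oo%E; first by rewrite Soo gt0_muley ?leey// lte_fin.
have Y0 : (0 <= \sum_(K <- T l) Ey K)%E by apply: sume_ge0.
have Z0 : (0 <= \sum_(K <- T l) Ep K)%E by apply: sume_ge0.
have [SY ESY] := exists_eq (\sum_(K <- T l) Ey K)%E.
have [SZ ESZ] := exists_eq (\sum_(K <- T l) Ep K)%E.
rewrite -ESY -ESZ in S1; rewrite -ESY in Y0; rewrite -ESZ in Z0.
have SYZ : (mC%:E * (SY + SZ) < +oo)%E by apply: le_lt_trans S1 _; rewrite ltey.
have [a Ea] : exists a, SY = a%:E.
  move: Y0 SYZ; case: (SY) => [a _ _||]//; first by exists a.
  by move: Z0; case: (SZ) => [b||]//= _ _; rewrite ?addye// gt0_muley ?lte_fin// ltxx.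
have [b Eb] : exists b, SZ = b%:E.
  move: Z0 SYZ; case: (SZ) => [b _ _||]//; first by exists b.
  by rewrite Ea /= => _; rewrite gt0_muley ?lte_fin// ltxx.
rewrite Ea in Y0; rewrite Eb in Z0; rewrite !lee_fin in Y0 Z0.
rewrite Ea Eb in S1.
have [hy hp hyh hph] := discrete_Ht sol (VH l) (solT l).
have [Lu Luh _ _] := discrete_L2 sol (solT l).
have Hdy := HtildeB hy hyh; have Hdp := HtildeB hp hph.
have Hs v : Htilde alpha Omega v -> Hspace alpha v by case.
have hl v : Htilde alpha Omega v -> L2 Omega v by exact: Htilde_L2.
have r1 := rel kappa C0 (T 0%N) (T l) (Tconf 0%N) (Tcl l) (f \+ uT l) (yT l) (y \- yT l) (sqintD mO Lf Luh) (Vy l).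
have {}r1 : inner Omega (f \+ uT l) (y \- yT l) - aform alpha (yT l) (y \- yT l) <= CI kappa * Num.sqrt a * Hnorm alpha (y \- yT l).
  apply: r1 => //; last by rewrite -Ea ESY EyE.
  by move=> chi Vc; case: (solT l) => _ _ E _ _; exact: E.
have r2 := rel kappa C0 (T 0%N) (T l) (Tconf 0%N) (Tcl l) (yT l \- yd) (pT l) (p \- pT l) (sqintB mO (hl _ hyh) Lyd) (Vp l).
have {}r2 : inner Omega (yT l \- yd) (p \- pT l) - aform alpha (pT l) (p \- pT l) <= CI kappa * Num.sqrt b * Hnorm alpha (p \- pT l).
  apply: r2 => //; last by rewrite -Eb ESZ EpE.
  by move=> chi Vc; case: (solT l) => _ _ _ E _; rewrite aformC; exact: E.
have k1 : aform alpha (y \- yT l) (y \- yT l) <= inner Omega (u \- uT l) (y \- yT l) + CI kappa * Num.sqrt a * Hnorm alpha (y \- yT l).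
  rewrite (aformBl (Hs _ hy) (Hs _ hyh) (Hs _ Hdy)).
  case: sol => _ _ E _ _; rewrite (E _ Hdy).
  have -> : inner Omega (u \- uT l) (y \- yT l) = inner Omega (f \+ u) (y \- yT l) - inner Omega (f \+ uT l) (y \- yT l).
    have Ld := hl _ Hdy.
    have E1 : inner Omega (u \- uT l) (y \- yT l) = inner Omega u (y \- yT l) - inner Omega (uT l) (y \- yT l) by exact: ipBl.
    have E2 : inner Omega (f \+ u) (y \- yT l) = inner Omega f (y \- yT l) + inner Omega u (y \- yT l) by exact: ipDl.
    have E3 : inner Omega (f \+ uT l) (y \- yT l) = inner Omega f (y \- yT l) + inner Omega (uT l) (y \- yT l) by exact: ipDl.
    by rewrite E1 E2 E3; ring.
  by move: r1; clear; lra.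
have k2 : aform alpha (p \- pT l) (p \- pT l) <= inner Omega (y \- yT l) (p \- pT l) + CI kappa * Num.sqrt b * Hnorm alpha (p \- pT l).
  rewrite (aformBl (Hs _ hp) (Hs _ hph) (Hs _ Hdp)).
  case: sol => _ _ _ E _; rewrite (aformC _ p) (E _ Hdp).
  have -> : inner Omega (y \- yT l) (p \- pT l) = inner Omega (y \- yd) (p \- pT l) - inner Omega (yT l \- yd) (p \- pT l).
    have Ld := hl _ Hdp; have Ly := hl _ hy; have Lyh := hl _ hyh.
    have E1 : inner Omega (y \- yT l) (p \- pT l) = inner Omega y (p \- pT l) - inner Omega (yT l) (p \- pT l) by exact: ipBl.
    have E2 : inner Omega (y \- yd) (p \- pT l) = inner Omega y (p \- pT l) - inner Omega yd (p \- pT l) by exact: ipBl.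
    have E3 : inner Omega (yT l \- yd) (p \- pT l) = inner Omega (yT l) (p \- pT l) - inner Omega yd (p \- pT l) by exact: ipBl.
    by rewrite E1 E2 E3; ring.
  by move: r2; clear; lra.
have el : e l <= 2 * P ^+ 2 * (normL2 Omega (u \- uT l) ^+ 2 + normL2 Omega (y \- yT l) ^+ 2) + 2 * ((CI kappa * Num.sqrt a) ^+ 2 + (CI kappa * Num.sqrt b) ^+ 2).
  apply: (reliability_step alpha0 mO P0 PP sol (VH l) (solT l) k1 k2); by rewrite mulr_ge0 ?sqrtr_ge0// ltW.
(* As [2 * A * Th ^+ 2 <= 1], the L^2 terms are at most half of [e l] and are absorbed; no constant
   depending on [gamma] survives. *)
have el2 : e l <= 4 * CI kappa ^+ 2 * (a + b).
  have Ea2 : (CI kappa * Num.sqrt a) ^+ 2 = CI kappa ^+ 2 * a by rewrite exprMn sqr_sqrtr.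
  have Eb2 : (CI kappa * Num.sqrt b) ^+ 2 = CI kappa ^+ 2 * b by rewrite exprMn sqr_sqrtr.
  have := L2e l; rewrite Ea2 Eb2 in el => h.
  have t1 : 2 * P ^+ 2 * (normL2 Omega (u \- uT l) ^+ 2 + normL2 Omega (y \- yT l) ^+ 2) <= A * Th ^+ 2 * e l.
    have -> : A * Th ^+ 2 * e l = 2 * P ^+ 2 * (L2_const gamma P * Th ^+ 2 * e l) by rewrite /A; ring.
    by apply: ler_wpM2l => //; rewrite mulr_ge0 ?sqr_ge0.
  have t2 : 2 * A * Th ^+ 2 * e l <= e l by rewrite ler_piMl.
  have t3 : A * Th ^+ 2 * e l + A * Th ^+ 2 * e l = 2 * A * Th ^+ 2 * e l by ring.
  by move: el t1 t2 t3; clear; lra.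
apply: le_trans (_ : ((8 * CI kappa ^+ 2 / mC)%:E * (mC%:E * (a%:E + b%:E)) <= _)%E); last first.
  by apply: lee_wpmul2l; [rewrite lee_fin ltW|exact: S1].
rewrite -EFinD -!EFinM lee_fin.
have -> : 8 * CI kappa ^+ 2 / mC * (mC * (a + b)) = 8 * CI kappa ^+ 2 * (a + b) by field; rewrite gt_eqF.
by move: el2; clear; lra.
Qed.
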